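(* Let $\mathcal A$ be an essential real hyperplane arrangement in $V_{\mathbb R}=\mathbb R^\ell$, $F\subset V_{\mathbb R}$ a generic affine hyperplane, $C\in\mathsf{ch}_\ell^F(\mathcal A)$ a chamber with $C\cap F_{\mathbb R}=\emptyset$, and $p\in C$ a fixed point. The following explicit construction yields a continuous map $$\sigma_C:(\mathrm D^\ell,\partial\mathrm D^\ell)\to(\mathsf M(\mathcal A),\mathsf M(\mathcal A)\cap F_{\mathbb C}),$$ differentiable in a neighborhood of $0\in\mathrm D^\ell$, such that (i) $\sigma_C(0)=p$, $\sigma_C(\mathrm D^\ell)\cap C=\{p\}$ and $\sigma_C(\mathrm D^\ell)$ intersects $C$ transversally; (ii) $\sigma_C(\partial\mathrm D^\ell)\subset\mathsf M(\mathcal A)\cap F_{\mathbb C}$; (iii) if $C'\in\mathsf{ch}_\ell^F(\mathcal A)$ is another chamber, then $\sigma_C(\mathrm D^\ell)\cap C'=\emptyset$. **Construction.** Choose coordinates $(x_1,\dots,x_\ell)$ with $F=\{x_\ell=0\}$ and $p=(0,\dots,0,1)$; write $x'=(x_1,\dots,x_{\ell-1})$. *Cylinder and flow.* Let $R=2\sup\{\|x'\|: (x',x_\ell)\in X,\ 0\le x_\ell\le1,\ X \text{ a one-dimensional intersection of members of }\mathcal A\}$, which is finite, and $\mathrm{Cyl}(R)=\{\|x'\|=R,\ 0\le x_\ell\le 1\}$. There is a vector field $\tilde V=\partial_{x_\ell}+\sum_{i<\ell}f_i\partial_{x_i}$ on $\mathrm{Cyl}(R)$ tangent to $\mathrm{Cyl}(R)\cap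 H$ for every $H\in\mathcal A$. Its flow gives diffeomorphisms $\eta_t$ ($0\le t\le1$) of the unit sphere $S^{\ell-2}\subset\mathbb R^{\ell-1}$ with $\eta_0=\mathrm{id}$ and $\frac{d}{dt}(R\,\eta_t(x'),t)=\tilde V_{(R\eta_t(x'),t)}$. On $T=\{x'\in\mathbb R^{\ell-1}:1/2\le\|x'\|\le1\}$ put $\eta_t(x')=\|x'\|\,\eta_t(x'/\|x'\|)$ and $I(x')=\eta_1^{-1}(-\eta_1(x'))$. *Decomposition of the disk.* Write $v\in\mathrm D^\ell$ as $v=(x'\cos\theta,\|x'\|\sin\theta)$ with $\theta$ the latitude (so $\|v\|=\|x'\|$), and fix $0<\theta_0<\pi/2$ with $\tan\theta_0=1/R$. Let $A_1=\{\|v\|\le\frac12\}$, and within $\{\frac12\le\|v\|\le1\}$ let $A_2=\{\theta\ge\theta_0\}$, $A_3=\{\theta\le-\theta_0\}$, $A_4=\{-\theta_0\le\theta\le\theta_0\}$. For $\frac12\le\|x'\|\le1$ and $\theta\ne0$ put $$\xi(v)=\Big((2\|x'\|-1)\frac{\cos\theta}{\sin\theta}\cdot\frac{-x'}{\|x'\|},\ 2-2\|x'\|\Big)\in V_{\mathbb R};$$ it divides the segment from $p$ to the point $q$ where the line $p+\mathbb R v$ meets $F_{\mathbb R}$ in the ratio $(\|x'\|-\frac12):(1-\|x'\|)$. *Pieces.* Write $(x,w)_{\mathbb C}=x+\sqrt{-1}\,w$. Define - $\sigma_1(v)=(p,v)_{\mathbb C}$ on $A_1$; - $\sigma_2(v)=(\xi(v),v)_{\mathbb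 C}$ on $A_2$; - $\sigma_3(v)=(\xi(v),v)_{\mathbb C}$ on $A_3$; - on $A_4$, using the diffeomorphism $\gamma:T\times[0,1]\to A_4$, $\gamma(x',t)=\big(-\eta_t^{-1}(-\eta_t(x'))\cos(2t-1)\theta_0,\ \|x'\|\sin(2t-1)\theta_0\big)$, $$\sigma_4(\gamma(x',t))=\big((1-t)\,\xi(\gamma(x',0))+t\,\xi(\gamma(x',1)),\ x'-I(x')\big)_{\mathbb C},$$ where $x'-I(x')$ is regarded as a horizontal vector. All four maps take values in $\mathsf M(\mathcal A)$, and for $\|x'\|=1$ the point $\sigma_4(\gamma(x',t))$ lies in $F_{\mathbb C}$ but not in $F_{\mathbb R}$. *Gluing.* $\sigma_1,\sigma_2$ agree on $A_1\cap A_2$ and $\sigma_1,\sigma_3$ agree on $A_1\cap A_3$, giving $\sigma_{123}$ on $A_1\cup A_2\cup A_3$. The maps $\sigma_{123}$ and $\sigma_4$ do not coincide on their common boundary, but are pasted together: for $v\in A_2\cap A_4$, $\sigma_2(v)$ and $\sigma_4(v)$ are tangent vectors at the same point $\xi(v)$ which lie on the same side of every $H\in\mathcal A$ through $\xi(v)$, and they are connected inside $\mathsf M(\mathcal A)$ by the vectors $\sigma_2(v)\cos\rho+\sigma_4(v)\sin\rho$, $0\le\rho\le\pi/2$, at $\xi(v)$. This gives a continuous map $\sigma=\sigma_{1234}:\mathrm D^\ell\to\mathsf M(\mathcal A)$ satisfying (i) and (iii). *Pushing the boundary into $F_{\mathbb C}$.* For small $\varepsilon>0$ put $\mathrm{Cyl}_{R,\varepsilon}=\{\|x'\|\le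 R,\ |x_\ell|\le\varepsilon\}$ and $\mathrm{Cyl}_{R,0}=\{\|x'\|\le R,\ x_\ell=0\}$. There is a diffeomorphism of $(\mathrm{Cyl}_{R,\varepsilon},\mathrm{Cyl}_{R,\varepsilon}\cap\mathcal A)$ with $(\mathrm{Cyl}_{R,0},\mathrm{Cyl}_{R,0}\cap\mathcal A)\times[-\varepsilon,\varepsilon]$; let $\mathrm{Pr}_1:\mathrm{Cyl}_{R,\varepsilon}\to\mathrm{Cyl}_{R,0}$ be the composite with the first projection. For $v\in\partial\mathrm D^\ell$, the vectors $\sigma(v)\cos\rho+\mathrm{Pr}_1(\sigma(v))\sin\rho$, $0\le\rho\le\pi/2$ (with $\mathrm{Pr}_1$ acting on tangent vectors by its differential), connect $\sigma(v)$ to a vector tangent to $F_{\mathbb R}$, i.e. to a point of $F_{\mathbb C}$. Attaching this homotopy along $\partial\mathrm D^\ell$ gives $\sigma_C$, which satisfies (i), (ii) and (iii).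
   Context: $\mathcal A$ is a finite set of affine hyperplanes in $\mathbb R^\ell$; essential means some intersection of members of $\mathcal A$ is a point. $F=F_{\mathbb R}$ is generic if $\dim(F\cap X)=\ell-1-\operatorname{codim}X$ for every nonempty intersection $X$ of members of $\mathcal A$ (with $F\cap X=\emptyset$ when this number is negative). $F_{\mathbb C}$ and $H_{\mathbb C}$ denote complexifications, and $\mathsf M(\mathcal A)=\mathbb C^\ell\setminus\bigcup_{H\in\mathcal A}H_{\mathbb C}$. Chambers are the connected components of $\mathbb R^\ell\setminus\bigcup_{H\in\mathcal A}H$, regarded as subsets of $\mathsf M(\mathcal A)$ via $\mathbb R^\ell\subset\mathbb C^\ell$; $\mathsf{ch}_\ell^F(\mathcal A)$ is the set of chambers not meeting $F_{\mathbb R}$. $\mathrm D^\ell$ is the closed unit disk in $\mathbb R^\ell$. A point $x+\sqrt{-1}\,w\in\mathbb C^\ell$ ($x,w\in\mathbb R^\ell$) is identified with the tangent vector $w$ at $x\in\mathbb R^\ell$; it lies in $\mathsf M(\mathcal A)$ if and only if $w$ is not tangent to any $H\in\mathcal A$ containing $x$. *)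

(* Defs.v *)
(* The dimension is ell = n.+1; x' = (x_1, ..., x_(ell-1)) lives in 'rV[R]_n. *)
From HB Require Import structures.
From mathcomp Require Import all_boot all_order all_algebra.
From mathcomp Require Import all_classical all_reals all_analysis.
From mathcomp Require Import complex.
Set Implicit Arguments.
Unset Strict Implicit.
Unset Printing Implicit Defensive.
Import Order.TTheory GRing.Theory Num.Theory.
Import numFieldNormedType.Exports.
Local Open Scope classical_set_scope.
Local Open Scope ring_scope.

Section Smooth.
Variables (R : realType) (V W : normedModType R).

Fixpoint Ck (k : nat) (U : set V) (f : V -> W) : Prop :=
  match k with
  | 0%N => forall x, U x -> {for x, continuous f}
  | k'.+1 => (forall x, U x -> differentiable f x) /\
             (forall v, Ck k' U (fun x => 'd f x v))
  end.

(* A map on an arbitrary subset S is smooth when it extends smoothly to a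
   neighborhood of S; our maps being total, f itself is such an extension. *)
Definition smooth_on (S : set V) (f : V -> W) : Prop :=
  exists U : set V, [/\ open U, S `<=` U & forall k, Ck k U f].

End Smooth.

Definition diffeo_between (R : realType) (V W : normedModType R)
    (S : set V) (S' : set W) (f : V -> W) (g : W -> V) : Prop :=
  [/\ smooth_on S f, smooth_on S' g,
      (forall x, S x -> S' (f x) /\ g (f x) = x) &
      (forall y, S' y -> S (g y) /\ f (g y) = y)].

Section EuclideanSpace.
Variable R : realType.

Definition dot (m : nat) (a x : 'rV[R]_m) : R := \sum_j a 0 j * x 0 j.

(* The norm `|x| of 'rV[R]_m is the sup norm. *)
Definition enorm (m : nat) (x : 'rV[R]_m) : R := Num.sqrt (dot x x).

Definition hyperplane (m : nat) (H : set 'rV[R]_m) : Prop :=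
  exists a b, a != 0 /\ H = [set x | dot a x = b].

Definition has_dim (m : nat) (X : set 'rV[R]_m) (k : nat) : Prop :=
  exists (x0 : 'rV[R]_m) (U : {vspace 'rV[R]_m}),
    X = [set x | x - x0 \in U] /\ \dim U = k.

End EuclideanSpace.

Section Arrangements.
Variables (R : realType) (n : nat).
Local Notation E := 'rV[R]_n.+1.
Implicit Types (A : set (set E)) (F H X C : set E) (sigma : E -> E * E).

Definition arrangement A : Prop :=
  finite_set A /\ forall H, A H -> hyperplane H.

Definition intersection A X : Prop :=
  exists2 B : set (set E), B `<=` A & X = \bigcap_(H in B) H.

Definition essential A : Prop := exists x : E, intersection A [set x].

(* If dim X = k then codim X = ell - k, and ell - 1 - codim X >= 0 means
   codim X <= n. *)
Definition generic A F : Prop :=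
  forall X k, intersection A X -> has_dim X k ->
    if (n.+1 - k <= n)%N then has_dim (F `&` X) (n - (n.+1 - k))
    else F `&` X = set0.

Definition complement A : set E := ~` \bigcup_(H in A) H.

Definition chamber A C : Prop :=
  exists2 x, complement A x & C = connected_component (complement A) x.

Definition chamber_off A F C : Prop := chamber A C /\ C `&` F = set0.

(* A pair (x, w) : E * E stands for the point x + sqrt(-1) w of C^ell, i.e. for
   the tangent vector w at x. *)
Definition cpoint (z : E * E) : 'rV[R[i]]_n.+1 :=
  \row_j (z.1 0 j +i* z.2 0 j)%C.

(* Common complex zeros of the real affine functions vanishing on X. *)
Definition complexification X : set 'rV[R[i]]_n.+1 :=
  [set z | forall (a : E) (b : R), (forall x, X x -> dot a x = b) ->
     \sum_j (a 0 j)%:C%C * z 0 j = b%:C%C].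

Definition cplx X : set (E * E) := cpoint @^-1` complexification X.

Definition Mcompl A : set (E * E) := ~` \bigcup_(H in A) cplx H.

(* X as a subset of C^ell via R^ell in C^ell. *)
Definition realpts X : set (E * E) := [set z | X z.1 /\ z.2 = 0].

Definition disk : set E := [set v | enorm v <= 1].
Definition bdisk : set E := [set v | enorm v = 1].

(* C being open in R^ell, its tangent space is R^ell inside C^ell. *)
Definition transverse C sigma : Prop :=
  forall v, disk v -> realpts C (sigma v) ->
    differentiable sigma v /\
    forall z : E * E, exists u c : E, z = 'd sigma v u + (c, 0).

Definition meets_only_at C (p : E) sigma : Prop :=
  [/\ sigma 0 = (p, 0),
      (sigma @` disk) `&` realpts C = [set (p, 0)] &
      transverse C sigma].

Definition avoids_others A F C sigma : Prop :=
  forall C', chamber_off A F C' -> C' <> C ->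
    (sigma @` disk) `&` realpts C' = set0.

Definition lefschetz_disk A F C (p : E) sigma : Prop :=
  [/\ {within disk, continuous sigma} /\ sigma @` disk `<=` Mcompl A,
      (\forall v \near (0 : E), differentiable sigma v),
      meets_only_at C p sigma,
      sigma @` bdisk `<=` Mcompl A `&` cplx F &
      avoids_others A F C sigma].

(* Affine coordinates y = x M + b. *)
Definition chart (M : 'M[R]_n.+1) (b : E) (x : E) : E := x *m M + b.

Definition chart_inv (M : 'M[R]_n.+1) (b : E) (z : E * E) : E * E :=
  ((z.1 - b) *m invmx M, z.2 *m invmx M).

End Arrangements.

Section Construction.
Variables (R : realType) (n : nat).
Local Notation E := 'rV[R]_n.+1.
Local Notation E' := 'rV[R]_n.
Implicit Types (A : set (set E)) (v w : E) (t rho : R).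

Definition hor (x : E) : E' := \row_i x 0 (lift ord_max i).
Definition hgt (x : E) : R := x 0 ord_max.
Definition vec (x' : E') t : E :=
  \row_j (if unlift ord_max j is Some i then x' 0 i else t).

Definition F0 : set E := [set x | hgt x = 0].
Definition p0 : E := vec 0 1.

Definition adapted (F : set E) (p : E) (M : 'M[R]_n.+1) (b : E) : Prop :=
  [/\ M \in unitmx, chart M b @` F = F0 & chart M b p = p0].

Definition unit_interval : set R := [set t | 0 <= t <= 1].
Definition usphere : set E' := [set x' | enorm x' = 1].

Definition line_radii A : set R :=
  [set r | exists X x, [/\ intersection A X, has_dim X 1, X x,
     0 <= hgt x <= 1 & r = enorm (hor x)]].
Definition cyl_radius A : R := 2 * sup (line_radii A).

Definition Cyl A : set E :=
  [set x | enorm (hor x) = cyl_radius A /\ 0 <= hgt x <= 1].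

(* For x in H, the vector w is tangent to H at x iff x + w is in H. *)
Definition tangent_field A (V : E -> E) : Prop :=
  [/\ smooth_on (Cyl A) V,
      (forall x, Cyl A x -> hgt (V x) = 1 /\ dot (hor x) (hor (V x)) = 0) &
      (forall H x, A H -> Cyl A x -> H x -> H (x + V x))].

(* etai t is the inverse of the diffeomorphism eta t of the unit sphere. *)
Definition is_flow A (V : E -> E) (eta etai : R -> E' -> E') : Prop :=
  [/\ smooth_on (usphere `*` unit_interval) (fun z => eta z.2 z.1),
      smooth_on (usphere `*` unit_interval) (fun z => etai z.2 z.1),
      (forall t, unit_interval t ->
         diffeo_between usphere usphere (eta t) (etai t)),
      (forall x', usphere x' -> eta 0 x' = x') &
      (forall x' t, usphere x' -> unit_interval t ->
         is_derive t 1 (fun s => vec (cyl_radius A *: eta s x') s)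
                   (V (vec (cyl_radius A *: eta t x') t)))].

Section Pieces.
Variables (A : set (set E)) (eta etai : R -> E' -> E').

Definition Tshell : set E' := [set x' | 2^-1 <= enorm x' <= 1].

Definition ext (f : E' -> E') (x' : E') : E' :=
  enorm x' *: f ((enorm x')^-1 *: x').

Definition Imap (x' : E') : E' := ext (etai 1) (- ext (eta 1) x').

Definition theta0 : R := atan (cyl_radius A)^-1.

Definition latitude v : R := asin (hgt v / enorm v).

Definition A1 : set E := [set v | enorm v <= 2^-1].
Definition A2 : set E :=
  [set v | 2^-1 <= enorm v <= 1 /\ theta0 <= latitude v].
Definition A3 : set E :=
  [set v | 2^-1 <= enorm v <= 1 /\ latitude v <= - theta0].
Definition A4 : set E :=
  [set v | 2^-1 <= enorm v <= 1 /\ - theta0 <= latitude v <= theta0].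

(* For v = (x' cos theta, |x'| sin theta), the quotient hor v / hgt v is
   (cos theta / sin theta) (x' / |x'|), and |v| = |x'|; thus
   xi v = p0 + (2 |v| - 1) (q - p0) with q = p0 - v / hgt v in F0. *)
Definition xi v : E :=
  vec (- ((2 * enorm v - 1) / hgt v) *: hor v) (2 - 2 * enorm v).

Definition gamma (x' : E') t : E :=
  vec (cos ((2 * t - 1) * theta0) *: - ext (etai t) (- ext (eta t) x'))
      (enorm x' * sin ((2 * t - 1) * theta0)).

Definition sigma1 v : E * E := (p0, v).
Definition sigma23 v : E * E := (xi v, v).

(* base4 and vec4 are the base point and the vector of sigma_4 o gamma. *)
Definition base4 (x' : E') t : E :=
  (1 - t) *: xi (gamma x' 0) + t *: xi (gamma x' 1).
Definition vec4 (x' : E') : E := vec (x' - Imap x') 0.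
Definition sigma4gamma (x' : E') t : E * E := (base4 x' t, vec4 x').

Definition rotate rho v w : E := cos rho *: v + sin rho *: w.

Definition quarter : set R := [set rho | 0 <= rho <= pi / 2].

(* w and w' are on the same side of every hyperplane of A through x. *)
Definition same_side (x : E) w w' : Prop :=
  forall H, A H -> H x -> forall a b, H = [set y | dot a y = b] ->
    0 < dot a w * dot a w'.

Definition pieces_valid : Prop :=
  (exists gammai : E -> E' * R,
     diffeo_between (Tshell `*` unit_interval) A4
       (fun z => gamma z.1 z.2) gammai) /\
  [/\ (forall v, A1 v -> Mcompl A (sigma1 v)),
      (forall v, A2 v \/ A3 v -> Mcompl A (sigma23 v)) &
      (forall x' t, Tshell x' -> unit_interval t ->
         Mcompl A (sigma4gamma x' t) /\
         (enorm x' = 1 -> cplx F0 (sigma4gamma x' t) /\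
                          ~ realpts F0 (sigma4gamma x' t)))] /\
  (forall v, A1 v -> A2 v \/ A3 v -> sigma1 v = sigma23 v) /\
  (forall x' t, Tshell x' -> unit_interval t ->
     let v := gamma x' t in
     A2 v \/ A3 v ->
     [/\ base4 x' t = xi v, same_side (xi v) v (vec4 x') &
         forall rho, quarter rho -> Mcompl A (xi v, rotate rho v (vec4 x'))]).

(* Parameters (x', t) of the common boundary of A_4 and A_1 u A_2 u A_3. *)
Definition seam (x' : E') t : Prop :=
  [/\ Tshell x', unit_interval t & [\/ enorm x' = 2^-1, t = 0 | t = 1]].

(* Over A_4 n (A_2 u A_3) the vectors are joined by rotation.  Over A_4 n A_1
   the base point is p0, which is on no hyperplane, and any homotopy through
   nonzero vectors is allowed; the rotation may vanish there, which would make
   the disk pass through p0 again. *)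
Definition pasting (h : E' -> R -> R -> E) : Prop :=
  {within [set z : E' * R * R | seam z.1.1 z.1.2 /\ quarter z.2],
     continuous (fun z => h z.1.1 z.1.2 z.2)} /\
  forall x' t, seam x' t ->
    [/\ h x' t 0 = gamma x' t, h x' t (pi / 2) = vec4 x',
        (t = 0 \/ t = 1 -> forall rho, quarter rho ->
           h x' t rho = rotate rho (gamma x' t) (vec4 x')) &
        (enorm x' = 2^-1 -> forall rho, quarter rho -> h x' t rho != 0)].

(* The parameter square {(|x'|, t)} of A_4 is contracted towards (1, 1/2): its
   inner half, where g <= 1/2, carries sigma_4 and the remaining collar of the
   seam carries the homotopy h, from g = 1 (rho = 0) to g = 1/2 (rho = pi/2). *)
Definition glued (h : E' -> R -> R -> E) (sigma : E -> E * E) : Prop :=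
  [/\ (forall v, A1 v -> sigma v = sigma1 v),
      (forall v, A2 v \/ A3 v -> sigma v = sigma23 v) &
      (forall x' t, Tshell x' -> unit_interval t ->
         let r := enorm x' in
         let g := Num.max (2 * (1 - r)) `|2 * t - 1| in
         (g <= 2^-1 ->
            sigma (gamma x' t) =
              sigma4gamma (((2 * r - 1) / r) *: x') (2 * t - 2^-1)) /\
         (2^-1 <= g ->
            let y' := ((1 + (r - 1) / g) / r) *: x' in
            let s := 2^-1 + (t - 2^-1) / g in
            sigma (gamma x' t) = (base4 y' s, h y' s (pi * (1 - g)))))].

End Pieces.

Definition Cyl_eps A (eps : R) : set E :=
  [set x | enorm (hor x) <= cyl_radius A /\ `|hgt x| <= eps].
Definition Cyl_0 A : set E :=
  [set x | enorm (hor x) <= cyl_radius A /\ hgt x = 0].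

(* Normalized to be the identity on Cyl_0, so that the differential of Pr_1
   maps a tangent vector at a point of Cyl_0 to one at the same point. *)
Definition trivialization A (eps : R) (Phi : E -> E * R) (Psi : E * R -> E) :
    Prop :=
  let J : set R := [set s | - eps <= s <= eps] in
  [/\ diffeo_between (Cyl_eps A eps) (Cyl_0 A `*` J) Phi Psi,
      (forall H, A H ->
         Phi @` (Cyl_eps A eps `&` H) = (Cyl_0 A `&` H) `*` J) &
      (forall x, Cyl_0 A x -> Phi x = (x, 0))].

Definition Pr1 (Phi : E -> E * R) (x : E) : E := (Phi x).1.

(* The disk of radius 1/2 carries sigma and the collar 1/2 <= |v| <= 1 carries
   the homotopy, with |v| = (1 + 2 rho / pi) / 2. *)
Definition pushed (sigma : E -> E * E) (Phi : E -> E * R)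
    (sigmaC : E -> E * E) : Prop :=
  (forall v, enorm v <= 2^-1 -> sigmaC v = sigma (2 *: v)) /\
  (forall v rho, bdisk v -> quarter rho ->
     let: (x, w) := sigma v in
     sigmaC (((1 + 2 * rho / pi) / 2) *: v) =
       (x, rotate rho w ('d (Pr1 Phi) x w))).

End Construction.

(* Main.v *)
(* Flows of bounded smooth fields are limits of Euler polygons; they are smooth in the
   initial point because the polygons of the tangent field (x, v) |-> (W x, DW x v) are
   the derivatives of those of W.

   By genericity, the hyperplanes through any given point of F or of Cyl(R) contain a
   common one-dimensional stratum L, and L meets every height exactly once.  Averaging the
   directions of these lines with the weights prod_(H not containing L) alpha_H^2 gives a
   smooth field along which each alpha_H satisfies a linear equation alpha_H' = k alpha_H;
   a multiple of the averaged displacement from the lines is added to make it tangent to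
   the boundary of the cylinder.  This yields both the field on Cyl(R) and the
   trivialization near F.

   The sign of alpha_H is constant along trajectories on Cyl(R).  Antipodal points of the
   sphere at height 1 have midpoint p, so alpha_H has the sign of alpha_H(p) at one of
   them, hence also at the corresponding point of the sphere at height 0.  The base point
   of sigma_4 is a convex combination of p and two such corresponding points U and U', and
   the vector of sigma_4 is a multiple of U - U': if it is tangent to H, then alpha_H has
   the sign of alpha_H(p) at both U and U', so the base point is not on H.

   For the final push, let H contain a point x of the base of the cylinder.  The
   differential of Pr_1 at x preserves the kernel of d alpha_H and fixes horizontal
   vectors, so it preserves d alpha_H, and the rotation stays in the complement. *)
From HB Require Import structures.
Require Import Defs.
From mathcomp Require Import all_boot all_order all_algebra.
From mathcomp Require Import all_classical all_reals all_analysis.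
From mathcomp Require Import complex ring lra.
Set Implicit Arguments.
Unset Strict Implicit.
Unset Printing Implicit Defensive.
Import Order.TTheory GRing.Theory Num.Theory.
Import numFieldNormedType.Exports.
Local Open Scope classical_set_scope.
Local Open Scope ring_scope.

(** * Calculus of continuously differentiable maps *)

Section Calculus.
Variable R : realType.

(** The theorem quantifies over every tangent field, flow, pasting and trivialization, so the sign
    arguments cannot rely on the fields built for the existence claims. For an arbitrary tangent
    field, the component normal to H merely vanishes on H; a Lipschitz bound, combined with a bound
    by a multiple of [|alpha_H|] for the distance to H within Cyl(R), turns this into a differential
    inequality, and Gronwall takes the place of the linear equation. For an arbitrary trivialization
    nothing is known outside the cylinder, so the differential at points of the rim is read off from
    rays entering the cylinder. Fields that are controlled only near a compact set are multiplied by
    cutoffs, which makes them bounded and their flows complete. The factor 2 in R is a margin: lines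
    stay within R/2 of the axis, so every hyperplane crosses the sphere of radius R transversally
    and the displacement from a line points outward there. For ell = 1 the sphere is empty, and the
    disk is placed over the segment from p to F. *)

Lemma coord_le_norm n (x : 'rV[R]_n) j : `|x 0 j| <= `|x|.
Proof.
rewrite -[leRHS]/(mx_norm x) mx_normrE.
exact: (le_bigmax _ (fun i : 'I_1 * 'I_n => `|x i.1 i.2|) (0, j)).
Qed.

Implicit Types (V W X Y Z : normedModType R).

(** The form in which Euler limits and the bump function at zero are differentiated: an explicit
    candidate for the differential and an estimate. *)
Lemma is_diff_eps V W (f : V -> W) (df : {linear V -> W}) x :
  continuous df ->
  (forall e : R, 0 < e ->
     \forall h \near (0 : V), `|f (h + x) - f x - df h| <= e * `|h|) ->
  is_diff x f df.
Proof.
move=> dfc H.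
have E : f \o shift x = cst (f x) + df +o_ (0 : V) id.
  apply/eqaddoP => e e0; apply: filterS (H _ e0) => h.
  by rewrite !fctE /= opprD addrA.
have D := diff_unique dfc E.
by split=> //; apply/diff_locallyP; rewrite D.
Qed.

Lemma differentiable_eps V W (f : V -> W) x (e : R) : differentiable f x -> 0 < e ->
  \forall h \near (0 : V), `|f (h + x) - f x - 'd f x h| <= e * `|h|.
Proof.
move=> /diff_locally /eqaddoP /(_ e) H e0.
have {H} := H e0; apply: filterS => h /=.
by rewrite !fctE /= opprD addrA.
Qed.

Lemma near_eq_is_diff V W (f g : V -> W) x :
  (\forall y \near x, f y = g y) -> differentiable f x -> is_diff x g ('d f x).
Proof.
move=> fg df; apply: is_diff_eps; first exact: diff_continuous.
move=> e e0; have fgx : f x = g x by exact: nbhs_singleton fg.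
have N : \forall h \near (0 : V), f (h + x) = g (h + x).
  move: fg; rewrite (near_shift (0 : V) x); apply: filterS => h /=.
  by rewrite subr0.
apply: filterS2 (differentiable_eps df e0) N => h + <-.
by rewrite -fgx.
Qed.

Lemma CkSP V W k (U : set V) (f : V -> W) : Ck k.+1 U f ->
  (forall x, U x -> differentiable f x) /\ (forall v, Ck k U (fun x => 'd f x v)).
Proof. by []. Qed.

Lemma CkW V W k (U : set V) (f : V -> W) : Ck k.+1 U f -> Ck k U f.
Proof.
elim: k f => [|k IH] f [df H] /=.
  by move=> x Ux; apply: differentiable_continuous; exact: df.
by split=> // v; apply: IH.
Qed.

Lemma Ck_le V W k k' (U : set V) (f : V -> W) : (k <= k')%N -> Ck k' U f -> Ck k U f.
Proof.
move=> /subnK <-; elim: (_ - _)%N => // d IH H.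
by apply: IH; apply: CkW.
Qed.

Lemma Ck_sub V W k (U U' : set V) (f : V -> W) : U `<=` U' -> Ck k U' f -> Ck k U f.
Proof.
move=> UU; elim: k f => [|k IH] f /=; first by move=> H x /UU; exact: H.
by move=> [df H]; split=> [x /UU /df //|v]; apply: IH.
Qed.

Lemma Ck_cont V W k (U : set V) (f : V -> W) x : Ck k U f -> U x -> {for x, continuous f}.
Proof. by move=> /(@Ck_le _ _ 0 k) - /(_ isT); apply. Qed.

Lemma Ck_diff V W k (U : set V) (f : V -> W) x : Ck k.+1 U f -> U x -> differentiable f x.
Proof. by case=> H _; apply: H. Qed.

(** Openness of [U] turns equality on [U] into equality near each point, hence into equality of the
    differentials. *)
Lemma Ck_ext V W k (U : set V) (f g : V -> W) : open U ->
  (forall x, U x -> f x = g x) -> Ck k U f -> Ck k U g.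
Proof.
move=> oU; elim: k f g => [|k IH] f g fg /=.
  move=> H x Ux; rewrite /prop_for /continuous_at -(fg x Ux).
  apply: cvg_trans (H x Ux); apply: near_eq_cvg.
  by near=> y; apply: fg; near: y; exact: open_nbhs_nbhs.
move=> [df H].
have D x : U x -> is_diff x g ('d f x).
  move=> Ux; apply: near_eq_is_diff; last exact: df.
  by near=> y; apply: fg; near: y; exact: open_nbhs_nbhs.
split=> [x Ux|v]; first exact: (@ex_diff _ _ _ _ _ _ _ (D x Ux)).
apply: IH (H v) => x Ux /=.
by rewrite (@diff_val _ _ _ _ _ _ _ (D x Ux)).
Unshelve. all: by end_near. Qed.

(** The induction step of the smoothness proofs: an explicit formula for the derivative stands in
    for ['d]. *)
Lemma CkS_of V W k (U : set V) (f : V -> W) (df : V -> V -> W) : open U ->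
  (forall x, U x -> is_diff x f (df x)) ->
  (forall v, Ck k U (fun x => df x v)) -> Ck k.+1 U f.
Proof.
move=> oU D H; split=> [x Ux|v]; first exact: (@ex_diff _ _ _ _ _ _ _ (D x Ux)).
by apply: Ck_ext (H v) => // x Ux; rewrite (@diff_val _ _ _ _ _ _ _ (D x Ux)).
Qed.

Lemma Ck_cst V W k (U : set V) (c : W) : open U -> Ck k U (fun=> c).
Proof.
move=> oU; elim: k c => [|k IH] c; first by move=> x _; exact: cst_continuous.
by apply: (@CkS_of _ _ _ _ _ (fun _ _ => 0)) => // x _; exact: is_diff_cst.
Qed.

Lemma pairDE V W (a c : V) (b d : W) : (a, b) + (c, d) = (a + c, b + d).
Proof. by []. Qed.

Lemma pairZE V W (k : R) (a : V) (b : W) : k *: (a, b) = (k *: a, k *: b).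
Proof. by []. Qed.

Lemma is_diff_linear V W (L : {linear V -> W}) x : continuous L -> is_diff x L L.
Proof. by move=> Lc; split; [exact: linear_differentiable|rewrite diff_lin]. Qed.

Lemma is_diff_fst V W (x : V * W) : is_diff x (@fst V W) fst.
Proof. by apply: is_diff_linear => y; exact: cvg_fst. Qed.

Lemma is_diff_snd V W (x : V * W) : is_diff x (@snd V W) snd.
Proof. by apply: is_diff_linear => y; exact: cvg_snd. Qed.

Lemma Ck_lin V W k (U : set V) (L : {linear V -> W}) : open U ->
  continuous L -> Ck k U L.
Proof.
move=> oU Lc; case: k => [|k]; first by move=> x _; exact: Lc.
apply: (@CkS_of _ _ _ _ _ (fun _ v => L v)) => // [x _|v]; last exact: Ck_cst.
by split; [exact: linear_differentiable|rewrite diff_lin].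
Qed.

Lemma Ck_id V k (U : set V) : open U -> Ck k U (@id V).
Proof. by move=> oU; apply: (@Ck_lin _ _ _ _ idfun) => // x; exact: cvg_id. Qed.

Lemma Ck_fst V W k (U : set (V * W)) : open U -> Ck k U (@fst V W).
Proof. by move=> oU; apply: Ck_lin => // x; exact: cvg_fst. Qed.

Lemma Ck_snd V W k (U : set (V * W)) : open U -> Ck k U (@snd V W).
Proof. by move=> oU; apply: Ck_lin => // x; exact: cvg_snd. Qed.

Lemma Ck_add V W k (U : set V) (f g : V -> W) : open U ->
  Ck k U f -> Ck k U g -> Ck k U (fun x => f x + g x).
Proof.
move=> oU; elim: k f g => [|k IH] f g.
  by move=> Hf Hg x Ux; apply: cvgD; [exact: Hf|exact: Hg].
move=> /CkSP[df Hf] /CkSP[dg Hg].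
apply: (@CkS_of _ _ _ _ _ (fun x v => 'd f x v + 'd g x v)) => // [x Ux|v].
  have := df x Ux; have := dg x Ux => /differentiableP ? /differentiableP ?.
  exact: is_diffD.
exact: IH.
Qed.

Lemma Ck_linpost V W W' k (U : set V) (f : V -> W) (L : {linear W -> W'}) : open U ->
  continuous L -> Ck k U f -> Ck k U (fun x => L (f x)).
Proof.
move=> oU Lc; elim: k f => [|k IH] f.
  by move=> Hf x Ux; apply: continuous_comp; [exact: Hf|exact: Lc].
move=> /CkSP[df Hf].
apply: (@CkS_of _ _ _ _ _ (fun x v => L ('d f x v))) => // [x Ux|v].
  have /differentiableP ? := df x Ux.
  have ? : is_diff (f x) L L.
    exact: is_diff_linear.
  exact: is_diff_comp.
exact: IH.
Qed.

Lemma Ck_opp V W k (U : set V) (f : V -> W) : open U -> Ck k U f ->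
  Ck k U (fun x => - f x).
Proof. by move=> oU; apply: Ck_linpost => // x; exact: opp_continuous. Qed.

Lemma Ck_cscale V W k (U : set V) (f : V -> W) (c : R) : open U -> Ck k U f ->
  Ck k U (fun x => c *: f x).
Proof. by move=> oU; apply: (@Ck_linpost _ _ _ _ _ _ ( *:%R c)) => // x; exact: scaler_continuous. Qed.

Lemma Ck_sum V W k (U : set V) m (f : 'I_m -> V -> W) : open U ->
  (forall i, Ck k U (f i)) -> Ck k U (fun x => \sum_i f i x).
Proof.
move=> oU; elim: m f => [|m IH] f H.
  by apply: Ck_ext (@Ck_cst V W k U 0 oU) => // x _; rewrite big_ord0.
apply: (@Ck_ext _ _ _ _ (fun x => \sum_i f (widen_ord (leqnSn m) i) x + f ord_max x)) => //.
  by move=> x _; rewrite big_ord_recr.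
by apply: Ck_add => //; apply: IH.
Qed.

Lemma is_diff_fun_scale V W (a da : V -> R) (g dg : V -> W) x :
  is_diff x a da -> is_diff x g dg ->
  is_diff x (fun y => a y *: g y) (fun h => a x *: dg h + da h *: g x).
Proof.
move=> Da Dg.
have ? := @ex_diff _ _ _ _ _ _ _ Da; have ? := @ex_diff _ _ _ _ _ _ _ Dg.
have bil : bilinear_for (GRing.Scale.Law.clone _ _ *:%R _)
    (GRing.Scale.Law.clone _ _ *:%R _) (@GRing.scale R W).
  split=> [u'|u] c y z /=; first by rewrite scalerDl scalerA.
  by rewrite scalerDr !scalerA mulrC.
pose BM := bilinear_isBilinear.Build R R W W _ _ (@GRing.scale R W) bil.
pose B : {bilinear R -> W -> W} := HB.pack (@GRing.scale R W) BM.
have Bc : continuous (fun p : R * W => B p.1 p.2) by exact: scale_continuous.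
have D : is_diff (a x, g x) (fun p : R * W => p.1 *: p.2)
    (fun q : R * W => a x *: q.2 + q.1 *: g x).
  split; first exact: (@differentiable_bilin _ _ _ _ B).
  exact: (@diff_bilin _ _ _ _ B (a x, g x)).
exact: (is_diff_comp (is_diff_pair Da Dg) D).
Qed.

Lemma Ck_scale V W k (U : set V) (a : V -> R) (g : V -> W) : open U ->
  Ck k U a -> Ck k U g -> Ck k U (fun x => a x *: g x).
Proof.
move=> oU; elim: k a g => [|k IH] a g Ha Hg.
  by move=> x Ux; apply: cvgZ; [exact: Ha|exact: Hg].
have Ha' := CkW Ha; have Hg' := CkW Hg.
move: Ha Hg => /CkSP[da Ha] /CkSP[dg Hg].
apply: (@CkS_of _ _ _ _ _ (fun x v => a x *: 'd g x v + 'd a x v *: g x)) => // [x Ux|v].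
  by apply: is_diff_fun_scale; apply/differentiableP; [exact: da|exact: dg].
by apply: Ck_add => //; apply: IH.
Qed.

Lemma Ck_mul V k (U : set V) (a b : V -> R) : open U ->
  Ck k U a -> Ck k U b -> Ck k U (fun x => a x * b x).
Proof. exact: Ck_scale. Qed.

Lemma Ck_exp V k (U : set V) (a : V -> R) m : open U ->
  Ck k U a -> Ck k U (fun x => a x ^+ m).
Proof.
move=> oU Ha; elim: m => [|m IH]; first exact: Ck_cst.
apply: (@Ck_ext _ _ _ _ (fun x => a x * a x ^+ m)) => //; last exact: Ck_mul.
by move=> x _; rewrite exprS.
Qed.

Lemma Ck_pair V W W' k (U : set V) (f : V -> W) (g : V -> W') : open U ->
  Ck k U f -> Ck k U g -> Ck k U (fun x => (f x, g x)).
Proof.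
move=> oU; elim: k f g => [|k IH] f g.
  by move=> Hf Hg x Ux; apply: cvg_pair; [exact: Hf|exact: Hg].
move=> /CkSP[df Hf] /CkSP[dg Hg].
apply: (@CkS_of _ _ _ _ _ (fun x v => ('d f x v, 'd g x v))) => // [x Ux|v].
  have /differentiableP ? := df x Ux; have /differentiableP ? := dg x Ux.
  exact: is_diff_pair.
exact: IH.
Qed.

(* The Lipschitz and chain-rule arguments only need coordinates and compact balls,
   which products inherit. *)
Class findim X : Prop := FinDim {
  findim_coord : exists (m : nat) (e : 'I_m -> X) (c : 'I_m -> {linear X -> R}),
    (forall i, continuous (c i)) /\ (forall x, x = \sum_i c i x *: e i);
  findim_compact : forall r : R, compact [set x : X | `|x| <= r] }.

Lemma Ck_comp X Y Z k (U : set X) (V : set Y) (f : X -> Y) (g : Y -> Z) :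
  findim Y -> open U -> (forall x, U x -> V (f x)) ->
  Ck k U f -> Ck k V g -> Ck k U (fun x => g (f x)).
Proof.
move=> fY oU UV; have [m [e [c [cc ce]]]] := @findim_coord _ fY.
elim: k f g UV => [|k IH] f g UV.
  by move=> Hf Hg x Ux; apply: continuous_comp; [exact: Hf|apply: Hg; exact: UV].
move=> Hf Hg; have Hf' := CkW Hf; move: Hf Hg => /CkSP[df Hf] /CkSP[dg Hg].
apply: (@CkS_of _ _ _ _ _ (fun x v => 'd g (f x) ('d f x v))) => // [x Ux|v].
  have /differentiableP ? := df x Ux; have /differentiableP ? := dg _ (UV _ Ux).
  exact: is_diff_comp.
(* [Ck] controls ['d g] at fixed vectors only, so the moving vector ['d f x v] is expanded in
   coordinates. *)
apply: (@Ck_ext _ _ _ _ (fun x => \sum_i c i ('d f x v) *: 'd g (f x) (e i))) => //.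
  move=> x _; rewrite [in RHS](ce ('d f x v)) linear_sum; apply: eq_bigr => i _.
  by rewrite linearZ.
apply: Ck_sum => // i; apply: Ck_scale => //.
  by apply: Ck_linpost => //.
exact: (IH _ (fun y => 'd g y (e i))).
Qed.

Lemma is_diff_real W (h : R -> W) x dh : is_derive x (1 : R) h dh -> is_diff x h (fun v : R => v *: dh).
Proof.
move=> D; have D1 : derivable h x 1 by exact: ex_derive.
split; first exact/derivable1_diffP.
rewrite deriv1E // derive1E; apply/funext => v.
by rewrite (@derive_val _ _ _ _ _ _ _ D).
Qed.

Lemma Ck_real W k (U : set R) (h h' : R -> W) : open U ->
  (forall x, U x -> is_derive x (1 : R) h (h' x)) -> Ck k U h' -> Ck k.+1 U h.
Proof.
move=> oU D H; apply: (@CkS_of R _ _ _ _ (fun x v : R => v *: h' x)) => // [x Ux|v].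
  exact/is_diff_real/D.
exact: Ck_cscale.
Qed.

Lemma open_neq0 : open [set x : R | x != 0].
Proof.
rewrite (_ : mkset _ = ~` [set 0 : R]); last by apply/seteqP; split => x /=; move/eqP.
by apply: closed_openC; exact: closed_eq.
Qed.

Lemma Ck_inv k : Ck k [set x : R | x != 0] (@GRing.inv R).
Proof.
elim: k => [|k IH]; first by move=> x /= x0; exact: inv_continuous.
apply: (@CkS_of _ _ _ _ _ (fun x h : R => - x ^- 2 *: h)); first exact: open_neq0.
  by move=> x x0; split; [exact: differentiable_Rinv|exact: diff_Rinv].
move=> v; apply: (@Ck_ext R R _ _ (fun x : R => - (x^-1 * x^-1 * v))); first exact: open_neq0.
  by move=> x _; rewrite -invfM -expr2 /GRing.scale /= mulNr.
by apply: Ck_opp; [exact: open_neq0|do ?apply: Ck_mul => //; try exact: Ck_cst; exact: open_neq0].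
Qed.

#[global] Instance findim_R : findim R.
Proof.
split.
  exists 1%N, (fun=> 1), (fun=> idfun); split=> [i|x]; first by move=> x; exact: cvg_id.
  by rewrite big_ord1 /GRing.scale /= mulr1.
move=> r; rewrite (_ : mkset _ = [set` `[- r, r]]); first exact: segment_compact.
by apply/seteqP; split=> x /=; rewrite in_itv /= ler_norml.
Qed.

#[global] Instance findim_rV n : findim 'rV[R]_n.
Proof.
split.
  have Lin (i : 'I_n) : linear (fun x : 'rV[R]_n => x 0 i) by move=> a x y; rewrite !mxE.
  pose L i : {linear 'rV[R]_n -> R} := HB.pack (fun x : 'rV[R]_n => x 0 i)
     (GRing.isLinear.Build _ _ _ _ _ (Lin i)).
  exists n, (fun i => delta_mx 0 i), L; split=> [i|x]; last exact: row_sum_delta.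
  by move=> x; exact: coord_continuous.
move=> r; apply: bounded_closed_compact.
  by exists r; split=> [|M rM x /= xr]; [exact: num_real|apply: le_trans xr (ltW rM)].
rewrite (_ : mkset _ = (fun x : 'rV[R]_n => `|x|) @^-1` [set y | y <= r]) //.
by apply: closed_comp => [x _|]; [exact: norm_continuous|exact: closed_le].
Qed.

#[global] Instance findim_prod X Y : findim X -> findim Y -> findim (X * Y)%type.
Proof.
move=> fX fY; split.
  have [m1 [e1 [c1 [cc1 ce1]]]] := @findim_coord _ fX.
  have [m2 [e2 [c2 [cc2 ce2]]]] := @findim_coord _ fY.
  pose e (i : 'I_(m1 + m2)) : X * Y :=
    match fintype.split i with inl j => (e1 j, 0) | inr j => (0, e2 j) end.
  pose c (i : 'I_(m1 + m2)) : {linear (X * Y)%type -> R} :=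
    match fintype.split i with
    | inl j => (c1 j \o fst : {linear _ -> _})
    | inr j => (c2 j \o snd : {linear _ -> _}) end.
  exists (m1 + m2)%N, e, c; split=> [i|[x y]].
    rewrite /c; case: (fintype.split i) => j /= z.
      by apply: (@continuous_comp _ _ _ fst (c1 j)); [exact: cvg_fst|exact: cc1].
    by apply: (@continuous_comp _ _ _ snd (c2 j)); [exact: cvg_snd|exact: cc2].
  rewrite big_split_ord /=.
  have E1 i : c (lshift m2 i) (x, y) *: e (lshift m2 i) = (c1 i x *: e1 i, 0).
    by rewrite /c /e (unsplitK (inl i)) /= pairZE scaler0.
  have E2 i : c (rshift m1 i) (x, y) *: e (rshift m1 i) = (0, c2 i y *: e2 i).
    by rewrite /c /e (unsplitK (inr i)) /= pairZE scaler0.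
  rewrite (eq_bigr _ (fun i _ => E1 i)) (eq_bigr _ (fun i _ => E2 i)).
  have P1 (G : 'I_m1 -> X) : \sum_i (G i, 0 : Y) = (\sum_i G i, 0).
    by elim/big_rec2: _ => // i a b _ ->; rewrite pairDE addr0.
  have P2 (G : 'I_m2 -> Y) : \sum_i (0 : X, G i) = (0, \sum_i G i).
    by elim/big_rec2: _ => // i a b _ ->; rewrite pairDE addr0.
  by rewrite P1 P2 -ce1 -ce2 pairDE addr0 add0r.
move=> r; rewrite (_ : mkset _ = [set x : X | `|x| <= r] `*` [set y : Y | `|y| <= r]).
  by apply: compact_setX; exact: findim_compact.
by apply/seteqP; split=> -[x y] /=; rewrite prod_normE /= ge_max => /andP.
Qed.

End Calculus.

(** * Euler polygons *)

Section Bounds.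
Variable R : realType.
Implicit Types (X Y : normedModType R).

Lemma ball_bound X Y (f : X -> Y) (r : R) : findim X -> continuous f ->
  exists2 M : R, 0 <= M & forall x, `|x| <= r -> `|f x| <= M.
Proof.
move=> fX fc.
have cK : compact (f @` [set x : X | `|x| <= r]).
  apply: continuous_compact; last exact: findim_compact.
  by apply: continuous_subspaceT.
have [M [_ HM]] := compact_bounded cK.
exists (`|M| + 1); first by rewrite addr_ge0.
move=> x xr; apply: (HM (`|M| + 1)); last by exists x.
by rewrite (le_lt_trans (ler_norm M)) // ltrDl.
Qed.

Lemma dbound X Y (W : X -> Y) (r : R) : findim X -> Ck 1 setT W ->
  exists2 K : R, 0 <= K & forall x v, `|x| <= r -> `|'d W x v| <= K * `|v|.
Proof.
move=> fX /CkSP[dW cW]; have [m [e [c [cc ce]]]] := @findim_coord _ _ fX.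
have /fin_all_exists2[M M0 HM] : forall i, exists2 M : R, 0 <= M &
    forall x, `|x| <= r -> `|'d W x (e i)| <= M.
  by move=> i; apply: ball_bound => // x; apply: (cW (e i)).
have /fin_all_exists2[K K0 HK] : forall i, exists2 K : R, 0 < K & forall v, `|c i v| <= K * `|v|.
  by move=> i; apply: linear_lipschitz.
exists (\sum_i K i * M i); first by apply: sumr_ge0 => i _; rewrite mulr_ge0 // ltW.
move=> x v xr; rewrite [in 'd W x v](ce v) linear_sum mulr_suml.
apply: le_trans (ler_norm_sum _ _ _) _; apply: ler_sum => i _.
rewrite linearZ normrZ mulrAC ler_pM //; exact: HM.
Qed.

(* The constant accounts for reading the values in coordinates, where the
   one-dimensional mean value theorem applies. *)
Lemma mean_value_bound Y : findim Y -> exists2 K : R, 0 <= K &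
  forall X (f : X -> Y) x v (B : R), 0 <= B ->
    (forall s : R, 0 <= s <= 1 -> differentiable f (x + s *: v)) ->
    (forall s : R, 0 <= s <= 1 -> `|'d f (x + s *: v) v| <= B) ->
  `|f (x + v) - f x| <= K * B.
Proof.
move=> fY; have [m [e [c [cc ce]]]] := @findim_coord _ _ fY.
have /fin_all_exists2[K K0 HK] : forall i, exists2 K : R, 0 < K & forall v, `|c i v| <= K * `|v|.
  by move=> i; apply: linear_lipschitz.
exists (\sum_i K i * `|e i|); first by apply: sumr_ge0 => i _; rewrite mulr_ge0 // ltW.
move=> X f x v B B0 df Bf.
have D i (s : R) : 0 <= s <= 1 ->
    is_derive s (1 : R) (fun s : R => c i (f (x + s *: v))) (c i ('d f (x + s *: v) v)).
  move=> s01.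
  have /differentiableP Df := df s s01.
  have Da : is_diff s (fun s : R => x + s *: v) (fun h : R => h *: v).
    have := is_diffD (is_diff_cst x s) (is_diff_scalel s v) => H.
    by apply: (is_diff_eq H); apply/funext => h; rewrite !fctE add0r.
  have Dc : is_diff (f (x + s *: v)) (c i) (c i).
    exact: is_diff_linear.
  have D3 := is_diff_comp (is_diff_comp Da Df) Dc.
  apply: DeriveDef; first exact/derivable1_diffP/(@ex_diff _ _ _ _ _ _ _ D3).
  rewrite deriveE; last exact: (@ex_diff _ _ _ _ _ _ _ D3).
  by rewrite (@diff_val _ _ _ _ _ _ _ D3) /= scale1r.
have C i : `|c i (f (x + v) - f x)| <= K i * B.
  rewrite linearB /=.
  have [|s||s /[!in_itv]/= s01 E] := @MVT R (fun s : R => c i (f (x + s *: v)))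
    (fun s => c i ('d f (x + s *: v) v)) 0 1 => //.
  - by rewrite in_itv /= => /andP[s0 s1]; apply: D; rewrite !ltW.
  - apply: derivable_within_continuous => s; rewrite in_itv /= => s01.
    exact: (@ex_derive _ _ _ _ _ _ _ (D i s s01)).
  - move: E; rewrite scale1r scale0r addr0 subr0 mulr1 => ->.
    apply: le_trans (HK _ _) _; rewrite ler_wpM2l ?(ltW (K0 i)) //; apply: Bf.
    by case/andP: s01 => s0 s1; rewrite !ltW.
rewrite [X in `|X|]ce; apply: le_trans (ler_norm_sum _ _ _) _.
rewrite mulr_suml; apply: ler_sum => i _; rewrite normrZ.
by rewrite mulrAC ler_wpM2r.
Qed.

Lemma lip_ball X Y (W : X -> Y) (r : R) : findim X -> findim Y -> Ck 1 setT W ->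
  exists2 L : R, 0 <= L & forall x y, `|x| <= r -> `|y| <= r -> `|W x - W y| <= L * `|x - y|.
Proof.
move=> fX fY CW; have [K K0 HK] := mean_value_bound fY.
have [M M0 HM] := dbound r fX CW.
exists (K * M); first exact: mulr_ge0.
move=> x y xr yr; have := HK X W y (x - y) (M * `|x - y|); rewrite (addrC y) subrK -mulrA; apply.
- exact: mulr_ge0.
- move=> s _; exact: (Ck_diff CW).
- move=> s s01; apply: HM.
  (* The ball is convex, so the bound on the derivative applies along the whole segment. *)
  have -> : y + s *: (x - y) = s *: x + (1 - s) *: y.
    by rewrite scalerBr scalerBl scale1r addrCA addrA.
  apply: le_trans (ler_normD _ _) _; rewrite !normrZ.
  case/andP: s01 => s0 s1; rewrite !ger0_norm ?subr_ge0 //.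
  have : s * `|x| <= s * r by rewrite ler_wpM2l.
  have : (1 - s) * `|y| <= (1 - s) * r by rewrite ler_wpM2l // subr_ge0.
  by lra.
Qed.

(** Lets the number of Euler steps go to infinity in an estimate whose remaining terms are fixed. *)
Lemma le_of_le_inv (a b C : R) : (forall N : nat, a <= b + C / N.+1%:R) -> a <= b.
Proof.
move=> H; apply/ler_addgt0Pr => e e0.
have [C0|C0] := leP C 0.
  apply: le_trans (H 0%N) _; rewrite lerD2l invr1 mulr1; lra.
pose N := Num.truncn (C / e).
apply: le_trans (H N) _; rewrite lerD2l ler_pdivrMr ?ltr0n //.
rewrite mulrC -ler_pdivrMr //; apply/ltW.
by have /andP[_] := truncn_itv (ltW (divr_gt0 C0 e0)).
Qed.

End Bounds.

Section Euler.
Variables (R : realType).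
Implicit Types X : normedModType R.

Definition euler_step X (W : X -> X) (h : R) (x : X) : X := x + h *: W x.

(** The step is [1/N], so [euler W N N] approximates the time-one map; for [N = 0] the step is
    zero. *)
Definition euler X (W : X -> X) (N k : nat) : X -> X :=
  iter k (euler_step W N%:R^-1).

(* Explicit Euler polygons issued from a bounded set stay bounded, uniformly in the
   mesh; this replaces completeness of the field and passes to tangent fields. *)
Definition stable X (W : X -> X) : Prop :=
  forall r : R, exists r' : R, forall N k x, (k <= N)%N -> `|x| <= r -> `|euler W N k x| <= r'.

Lemma stable_pos X (W : X -> X) : stable W -> forall r : R, exists2 r' : R, 0 <= r' &
  forall N k x, (k <= N)%N -> `|x| <= r -> `|euler W N k x| <= r'.
Proof.
move=> S r; have [r' H] := S r; exists `|r'| => // N k x kN xr.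
by apply: le_trans (H N k x kN xr) _; exact: ler_norm.
Qed.

Lemma eulerS X (W : X -> X) N k x :
  euler W N k.+1 x = euler W N k x + N%:R^-1 *: W (euler W N k x).
Proof. by []. Qed.

Lemma exprD1_le (a : R) k : 0 <= a -> (1 + a) ^+ k <= expR (k%:R * a).
Proof.
move=> a0; rewrite expRM_natl.
by apply: lerXn2r; rewrite ?nnegrE ?addr_ge0 ?expR_ge0 //; exact: expR_ge1Dx.
Qed.

(** With [m] substeps per coarse step of length [h], the fine polygon drifts by at most [h M] during
    that step, so the local error is [L M h^2]; a discrete Gronwall argument sums [N] such errors to
    order [1/N]. Comparing a mesh with its refinements is enough, because any two meshes have a
    common refinement. *)
Lemma euler_refine X (W : X -> X) (r : R) : findim X -> stable W -> Ck 1 setT W ->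
  exists2 C : R, 0 <= C & forall N m x, (0 < N)%N -> (0 < m)%N -> `|x| <= r ->
    `|euler W N N x - euler W (N * m) (N * m) x| <= C / N%:R.
Proof.
move=> fX S C1; have [r' r'0 Hr] := stable_pos S r.
have [L L0 HL] := lip_ball r' fX fX C1.
have Wc : continuous W by move=> x; apply: (Ck_cont C1).
have [M M0 HM] := ball_bound r' fX Wc.
exists (L * M * expR L); first by rewrite !mulr_ge0 // expR_ge0.
move=> N m x N0 m0 xr.
have NR : (0 : R) < N%:R by rewrite ltr0n.
have mR : (0 : R) < m%:R by rewrite ltr0n.
set h : R := N%:R^-1.
have h0 : 0 < h by rewrite invr_gt0.
have hm : (N * m)%:R^-1 = h / m%:R :> R by rewrite natrM invfM.
pose b k := euler W (N * m) (k * m) x.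
have bB k j : (k < N)%N -> (j <= m)%N -> `|euler W (N * m) (k * m + j) x| <= r'.
  move=> kN jm; apply: Hr => //; apply: leq_trans (_ : k * m + m <= _)%N.
    by rewrite leq_add2l.
  by rewrite -mulSnr leq_mul2r kN orbT.
have drift k j : (k < N)%N -> (j <= m)%N ->
    `|euler W (N * m) (k * m + j) x - b k| <= j%:R * (h / m%:R * M).
  move=> kN; elim: j => [_|j IH jm]; first by rewrite addn0 subrr normr0 mul0r.
  rewrite addnS eulerS addrAC; apply: le_trans (ler_normD _ _) _.
  rewrite -natr1 mulrDl mul1r lerD ?IH 1?ltnW // hm normrZ ger0_norm; last by rewrite divr_ge0 // ltW.
  by rewrite ler_wpM2l ?divr_ge0 ?(ltW h0) ?(ltW mR) //; apply: HM; apply: bB => //; exact: ltnW.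
(* Local error: during one coarse step the field is evaluated within [h M] of [b k]. *)
have step k j : (k < N)%N -> (j <= m)%N ->
    `|euler W (N * m) (k * m + j) x - b k - (j%:R * (h / m%:R)) *: W (b k)| <=
    j%:R * (h / m%:R * (L * (h * M))).
  move=> kN; elim: j => [_|j IH jm]; first by rewrite addn0 subrr !mul0r scale0r subr0 normr0.
  rewrite addnS eulerS hm -natr1 !mulrDl !mul1r scalerDl.
  set e := euler _ _ _ _.
  have -> : e + (h / m%:R) *: W e - b k - ((j%:R * (h / m%:R)) *: W (b k) + (h / m%:R) *: W (b k)) =
      (e - b k - (j%:R * (h / m%:R)) *: W (b k)) + (h / m%:R) *: (W e - W (b k)).
    by rewrite scalerBr [RHS]addrACA -opprD [e - _ + _]addrAC.
  apply: le_trans (ler_normD _ _) _; apply: lerD; first by apply: IH; exact: ltnW.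
  rewrite normrZ ger0_norm; last by rewrite divr_ge0 // ltW.
  rewrite ler_wpM2l ?divr_ge0 ?(ltW h0) ?(ltW mR) //.
  have eB : `|e| <= r' by apply: bB => //; exact: ltnW.
  have bB' : `|b k| <= r' by rewrite /b -[(k * m)%N]addn0; apply: bB.
  apply: le_trans (HL _ _ eB bB') _; rewrite ler_wpM2l //.
  apply: le_trans (drift _ _ kN (ltnW jm)) _.
  have -> : h * M = m%:R * (h / m%:R * M) by field; rewrite gt_eqF.
  by rewrite ler_wpM2r ?ler_nat ?mulr_ge0 ?divr_ge0 ?(ltW mR) ?(ltW h0) // ltnW.
(* Each coarse step multiplies the accumulated error by at most [1 + h L] and adds one local
   error. *)
have main k : (k <= N)%N ->
    `|euler W N k x - b k| <= k%:R * (h * (L * (h * M))) * (1 + h * L) ^+ k.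
  elim: k => [_|k IH kN]; first by rewrite /b mul0n subrr normr0 !mul0r.
  have {}IH := IH (ltnW kN).
  have := step k m kN (leqnn _); rewrite -mulSnr -/(b k.+1).
  have -> : m%:R * (h / m%:R) = h by field; rewrite gt_eqF.
  have -> : m%:R * (h / m%:R * (L * (h * M))) = h * (L * (h * M)) by field; rewrite gt_eqF.
  move=> Hs; rewrite eulerS -/h.
  set a := euler W N k x in IH *.
  have -> : a + h *: W a - b k.+1 = (a - b k) + h *: (W a - W (b k)) - (b k.+1 - b k - h *: W (b k)).
    rewrite scalerBr [X in _ = X - _]addrACA -opprD -[b k.+1 - _ - _]addrA -opprD.
    by rewrite opprB addrA subrK.
  apply: le_trans (ler_normB _ _) _.
  apply: le_trans (lerD (ler_normD _ _) Hs) _.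
  have aB : `|a| <= r' by apply: Hr => //; exact: ltnW.
  have bB' : `|b k| <= r' by rewrite /b -[(k * m)%N]addn0; apply: bB.
  rewrite normrZ (ger0_norm (ltW h0)).
  set D := `|a - b k| in IH *.
  have {}HL : h * `|W a - W (b k)| <= h * (L * D) by rewrite ler_wpM2l ?(ltW h0) //; exact: HL.
  set q := h * (L * (h * M)) in IH *.
  have q0 : 0 <= q by rewrite !mulr_ge0 ?(ltW h0).
  have hL1 : 1 <= 1 + h * L by rewrite lerDl mulr_ge0 // ltW.
  have hL0 : 0 <= 1 + h * L by rewrite (le_trans ler01).
  apply: le_trans (_ : D * (1 + h * L) + q <= _).
    by rewrite lerD2r mulrDr mulr1 lerD2l (le_trans HL) // mulrA mulrC.
  apply: le_trans (_ : k%:R * q * (1 + h * L) ^+ k * (1 + h * L) + q * (1 + h * L) ^+ k.+1 <= _).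
    rewrite lerD //; first by rewrite ler_wpM2r.
    by rewrite ler_peMr // exprn_ege1.
  by rewrite -mulrA -exprSr -mulrDl -[X in _ + X]mul1r -mulrDl natr1.
apply: le_trans (main N (leqnn _)) _; rewrite -/h.
have -> : N%:R * (h * (L * (h * M))) = L * M * h by rewrite /h; field; rewrite gt_eqF.
rewrite -!mulrA [h * _]mulrC !mulrA ler_wpM2r ?(ltW h0) // ler_wpM2l ?mulr_ge0 //.
apply: le_trans (exprD1_le _ _) _; first by rewrite mulr_ge0 // ltW.
by rewrite mulrA divff ?mul1r // gt_eqF.
Qed.

End Euler.

Section EulerLimit.
Variable R : realType.
Implicit Types X Y : normedModType R.

Definition tangent_map X Y (W : X -> Y) (p : X * X) : Y * Y := (W p.1, 'd W (p.1) (p.2)).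

Lemma Ck_d X Y (W : X -> Y) k : findim X -> Ck k.+1 setT W ->
  Ck k setT (fun p : X * X => 'd W (p.1) (p.2)).
Proof.
move=> fX /CkSP[dW cW]; have [m [e [c [cc ce]]]] := @findim_coord _ _ fX.
apply: (@Ck_ext _ _ _ _ _ (fun p : X * X => \sum_i c i p.2 *: 'd W (p.1) (e i))); first exact: openT.
  move=> p _; rewrite [in RHS](ce p.2) linear_sum; apply: eq_bigr => i _.
  by rewrite linearZ.
apply: Ck_sum => [|i]; first exact: openT.
apply: Ck_scale; first exact: openT.
  by apply: Ck_linpost => //; [exact: openT|apply: Ck_snd; exact: openT].
apply: (Ck_comp fX (V := setT) (g := fun x => 'd W x (e i))) => //; first exact: openT.
by apply: Ck_fst; exact: openT.
Qed.

Lemma Ck_tangent_map X Y (W : X -> Y) k : findim X -> Ck k.+1 setT W ->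
  Ck k setT (tangent_map W).
Proof.
move=> fX CW; apply: Ck_pair; [exact: openT| |exact: Ck_d].
apply: (Ck_comp fX (V := setT) (g := W)) => //; first exact: openT.
  by apply: Ck_fst; exact: openT.
exact: CkW.
Qed.

Lemma euler_tangent1 X (W : X -> X) N k x v :
  (euler (tangent_map W) N k (x, v)).1 = euler W N k x.
Proof. by elim: k => // k IH; rewrite !eulerS /= IH. Qed.

Lemma euler_tangentS X (W : X -> X) N k x v :
  (euler (tangent_map W) N k.+1 (x, v)).2 = (euler (tangent_map W) N k (x, v)).2 +
    N%:R^-1 *: 'd W (euler W N k x) (euler (tangent_map W) N k (x, v)).2.
Proof. by rewrite eulerS /= euler_tangent1. Qed.

(** The base points stay in a ball by stability of [W]; there the differential is bounded by some
    [K], so the vector grows by at most [(1 + K/N)^k], which is below [exp K] uniformly in the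
    mesh. *)
Lemma stable_tangent X (W : X -> X) : findim X -> stable W -> Ck 1 setT W ->
  stable (tangent_map W).
Proof.
move=> fX S C1 r; have [r' r'0 Hr] := stable_pos S r.
have [K K0 HK] := dbound r' fX C1.
exists (Num.max r' (expR K * r)) => N k [x v] kN.
rewrite prod_normE /= ge_max => /andP[xr vr].
rewrite prod_normE /= euler_tangent1 ge_max !le_max Hr //=; apply/orP; right.
have r0 : 0 <= r := le_trans (normr_ge0 _) vr.
have [N0|N0] := posnP N.
  move: kN; rewrite N0 leqn0 => /eqP -> /=; apply: le_trans vr _.
  rewrite ler_peMl //.
  by apply: le_trans (expR_ge1Dx K); rewrite lerDl.
have NR : (0 : R) < N%:R by rewrite ltr0n.
have H : `|(euler (tangent_map W) N k (x, v)).2| <= (1 + K / N%:R) ^+ k * r.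
  elim: k kN => [_|k IH kN]; first by rewrite expr0 mul1r.
  rewrite euler_tangentS; set z := (euler _ _ _ _).2 in IH *.
  have {}IH := IH (ltnW kN).
  apply: le_trans (ler_normD _ _) _; rewrite normrZ ger0_norm ?invr_ge0 ?(ltW NR) //.
  have Hd : `|'d W (euler W N k x) z| <= K * `|z| by apply: HK; apply: Hr => //; exact: ltnW.
  apply: le_trans (_ : (1 + K / N%:R) * `|z| <= _).
    rewrite mulrDl mul1r lerD2l [K / _]mulrC -mulrA ler_wpM2l // invr_ge0 ltW //.
  by rewrite exprS -mulrA ler_wpM2l // addr_ge0 // divr_ge0 // ltW.
apply: le_trans H _; rewrite ler_wpM2r //.
apply: le_trans (exprD1_le _ _) _; first by rewrite divr_ge0 // ltW.
rewrite ler_expR mulrCA -[leRHS]mulr1 ler_wpM2l //.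
by rewrite ler_pdivrMr // mul1r ler_nat.
Qed.

Lemma is_diff_euler X (W : X -> X) N k x : Ck 1 setT W ->
  is_diff x (euler W N k) (fun v => (euler (tangent_map W) N k (x, v)).2).
Proof.
move=> /CkSP[dW _]; elim: k => [|k IH]; first exact: is_diff_id.
have DW : is_diff (euler W N k x) W ('d W (euler W N k x)) by apply/differentiableP; exact: dW.
have := is_diffD IH (is_diffZ N%:R^-1 (is_diff_comp IH DW)).
rewrite (_ : euler W N k + _ = euler W N k.+1) => [H|]; last by [].
apply: (is_diff_eq H); apply/funext => v.
by rewrite euler_tangentS.
Qed.

Lemma continuous_euler X (W : X -> X) N k : Ck 1 setT W -> continuous (euler W N k).
Proof.
move=> C1 x; apply: differentiable_continuous.
exact: (@ex_diff _ _ _ _ _ _ _ (is_diff_euler N k x C1)).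
Qed.

Definition euler_lim X (W : X -> X) (x : X) : X :=
  lim (euler W N.+1 N.+1 x @[N --> \oo]).

Lemma euler_limP X (W : X -> X) (r : R) : findim X -> stable W -> Ck 1 setT W ->
  exists2 C : R, 0 <= C & forall N x, `|x| <= r ->
    `|euler W N.+1 N.+1 x - euler_lim W x| <= C / N.+1%:R.
Proof.
move=> fX S C1; have [C C0 HC] := euler_refine r fX S C1.
have [r' r'0 Hr] := stable_pos S r.
exists C => // N x xr.
have HNM n m : `|euler W n.+1 n.+1 x - euler W m.+1 m.+1 x| <= C / n.+1%:R + C / m.+1%:R.
  rewrite -(subrKA (euler W (n.+1 * m.+1) (n.+1 * m.+1) x)).
  apply: le_trans (ler_normD _ _) _; apply: lerD; first exact: HC.
  by rewrite distrC mulnC; apply: HC.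
have cC n : C / n.+1%:R + C / m.+1%:R @[m --> \oo] --> C / n.+1%:R.
  rewrite -[X in _ --> X]addr0; apply: cvgD; first exact: cvg_cst.
  rewrite -(mulr0 C); apply: cvgM; first exact: cvg_cst.
  by apply: (cvg_trans _ (@cvg_harmonic R)).
(* [X] is not assumed complete; the polygons stay in a compact ball, where Cauchy sequences
   converge. *)
have cE : cvg (euler W N.+1 N.+1 x @[N --> \oo]).
  apply: (compact_cauchy_cvg (U := [set x : X | `|x| <= r'])).
  - apply/cauchyP => e e0; pose n0 := Num.truncn (2 * C / e).
    exists (euler W n0.+1 n0.+1 x).
    have : \forall m \near \oo, ball (euler W n0.+1 n0.+1 x) e (euler W m.+1 m.+1 x).
      near=> m; have mn : (n0 <= m)%N by near: m; exact: nbhs_infty_ge.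
      rewrite -ball_normE /=; apply: le_lt_trans (HNM _ _) _.
      apply: (@le_lt_trans _ _ (2 * C / n0.+1%:R)).
        rewrite -mulrA mulr_natl mulr2n lerD2l.
        by rewrite ler_wpM2l // lef_pV2 ?posrE ?ltr0n // ler_nat.
      rewrite ltr_pdivrMr ?ltr0n // [ltRHS]mulrC -ltr_pdivrMr //.
      have := @truncn_itv _ (2 * C / e); rewrite -/n0 => /(_ _)/andP[|_ //].
      by rewrite divr_ge0 ?mulr_ge0 // ltW.
    by [].
  - have : \forall n \near \oo, `|euler W n.+1 n.+1 x| <= r' by near=> n; apply: Hr.
    by [].
  - exact: findim_compact.
have dC : `|euler W N.+1 N.+1 x - euler W m.+1 m.+1 x| @[m --> \oo] --> `|euler W N.+1 N.+1 x - euler_lim W x|.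
  apply: cvg_norm; apply: cvgB; first exact: cvg_cst.
  exact: cE.
apply: (ler_cvg_to dC (cC N)).
by near=> m; exact: HNM.
Unshelve. all: by end_near. Qed.

Lemma cvg_of_inv_bound X (u : nat -> X) (l : X) (C : R) :
  (forall N, `|u N - l| <= C / N.+1%:R) -> u @ \oo --> l.
Proof.
move=> H; apply/cvgrPdist_le => e e0; near=> N; rewrite distrC.
apply: le_trans (H N) _.
rewrite ler_pdivrMr ?ltr0n // mulrC -ler_pdivrMr //.
near: N; apply: filterS (nbhs_infty_ger (C / e)) => N /= HN.
by apply: le_trans HN _; rewrite ler_nat.
Unshelve. all: by end_near. Qed.

Lemma euler_lim_cvg X (W : X -> X) x : findim X -> stable W -> Ck 1 setT W ->
  euler W N.+1 N.+1 x @[N --> \oo] --> euler_lim W x.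
Proof.
move=> fX S C1; have [C C0 HC] := euler_limP (`|x|) fX S C1.
by apply: (@cvg_of_inv_bound _ _ _ C) => N; exact: HC.
Qed.

Lemma continuous_euler_lim X (W : X -> X) : findim X -> stable W -> Ck 1 setT W ->
  continuous (euler_lim W).
Proof.
move=> fX S C1 x; have [C C0 HC] := euler_limP (`|x| + 1) fX S C1.
apply/cvgrPdist_le => e e0.
have [N HN] : exists N : nat, C / N.+1%:R <= e / 3.
  exists (Num.truncn (C / (e / 3))); rewrite ler_pdivrMr ?ltr0n // mulrC -ler_pdivrMr; last by rewrite divr_gt0.
  by have /andP[_ /ltW] := truncn_itv (divr_ge0 C0 (divr_ge0 (ltW e0) (ler0n _ 3))).
have e3 : 0 < e / 3 by rewrite divr_gt0.
have xN : `|x| <= `|x| + 1 by rewrite lerDl.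
have := @continuous_euler X W N.+1 N.+1 C1 x => /cvgrPdist_le /(_ _ e3) cN.
near=> y.
have yN : `|y| <= `|x| + 1.
  rewrite -lerBlDl; apply: le_trans (lerB_dist _ _) _; rewrite distrC; near: y.
  by apply: cvgr_dist_le => //; exact: cvg_id.
have -> : euler_lim W x - euler_lim W y = (euler_lim W x - euler W N.+1 N.+1 x) +
    (euler W N.+1 N.+1 x - euler W N.+1 N.+1 y) + (euler W N.+1 N.+1 y - euler_lim W y).
  by rewrite !subrKA.
apply: le_trans (ler_normD _ _) _; apply: le_trans (lerD (ler_normD _ _) (lexx _)) _.
have := HC N x xN; have := HC N y yN; rewrite [in X in _ -> X -> _]distrC => H1 H2.
have H3 : `|euler W N.+1 N.+1 x - euler W N.+1 N.+1 y| <= e / 3 by near: y.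
move: HN H1 H2; move: (C / _) => u HN H1 H2; lra.
Unshelve. all: by end_near. Qed.

(** The mean value bound is applied to a polygon map minus its differential at [x]. The
    differentials of the polygons are uniformly close to their limit [D], and [D] is continuous, so
    the bound is [eps |h|] up to terms of order [1/N], which disappear at fixed [h]. *)
Theorem is_diff_euler_lim X (W : X -> X) x : findim X -> stable W -> Ck 2 setT W ->
  is_diff x (euler_lim W) (fun v => (euler_lim (tangent_map W) (x, v)).2).
Proof.
move=> fX S C2; have C1 := CkW C2.
have fXX := findim_prod fX fX.
have ST := stable_tangent fX S C1.
have CT := Ck_tangent_map fX C2.
pose D y v := (euler_lim (tangent_map W) (y, v)).2.
pose DN N y v := (euler (tangent_map W) N.+1 N.+1 (y, v)).2.
have DNE N y v : DN N y v = 'd (euler W N.+1 N.+1) y v.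
  by rewrite (@diff_val _ _ _ _ _ _ _ (is_diff_euler N.+1 N.+1 y C1)).
have Dcvg y v : DN N y v @[N --> \oo] --> D y v.
  apply: (@cvg_comp _ _ _ _ snd _ _ _ (@euler_lim_cvg _ _ (y, v) fXX ST CT)).
  exact: cvg_snd.
have Dlin y : linear (D y).
  move=> a u v; apply: (cvg_unique (@norm_hausdorff _ X) (Dcvg y (a *: u + v))).
  rewrite (_ : (fun N => DN N y (a *: u + v)) = (fun N => a *: DN N y u + DN N y v)); last first.
    by apply/funext => N; rewrite !DNE linearD linearZ.
  by apply: cvgD; [apply: cvgZ => //; exact: cvg_cst|].
pose DL y : {linear X -> X} := HB.pack (D y) (GRing.isLinear.Build _ _ _ _ _ (Dlin y)).
have D0 y : D y 0 = 0 := linear0 (DL y).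
have DZ y a v : D y (a *: v) = a *: D y v := linearZ_LR (DL y) a v.
have Djc : continuous (fun p : X * X => D p.1 p.2).
  have Ec := continuous_euler_lim fXX ST CT.
  rewrite (_ : (fun _ => _) = snd \o euler_lim (tangent_map W)); last by apply/funext => -[].
  by move=> p; apply: continuous_comp; [exact: Ec|exact: cvg_snd].
have Dc y : continuous (DL y).
  move=> v; apply: (@continuous_comp _ _ _ (fun v => (y, v)) (fun p : X * X => D p.1 p.2)); last exact: Djc.
  by apply: cvg_pair; [exact: cvg_cst|exact: cvg_id].
have [K K0 HK] := mean_value_bound fX.
have [C C0 HC] := euler_limP (`|x| + 1) fX S C1.
have [CT' CT0 HCT] := euler_limP (`|x| + 1) fXX ST CT.
(* [euler_limP] is uniform on bounded pairs only; linearity in [v] reduces to unit vectors and makes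
   the error proportional to [|v|]. *)
have HD N y v : `|y| <= `|x| + 1 -> `|DN N y v - D y v| <= CT' / N.+1%:R * `|v|.
  move=> yr; have [->|v0] := eqVneq v 0.
    by rewrite DNE linear0 D0 subr0 normr0 mulr0.
  have vn : 0 < `|v| by rewrite normr_gt0.
  have -> : v = `|v| *: (`|v|^-1 *: v) by rewrite scalerA divff ?scale1r // gt_eqF.
  rewrite DNE linearZ -DNE DZ /= -scalerBr normrZ normr_id.
  rewrite [X in _ <= _ * `|X|]scalerA divff ?gt_eqF // scale1r mulrC ler_wpM2r //.
  have := HCT N (y, `|v|^-1 *: v); rewrite prod_normE /= ge_max yr normrZ normfV normr_id mulVf ?gt_eqF //.
  rewrite lerDr normr_ge0 => /(_ isT); apply: le_trans.
  by rewrite prod_normE /= le_max lexx orbT.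
have [m [e [c [cc ce]]]] := @findim_coord _ _ fX.
have /fin_all_exists2[B B0 HB] : forall i, exists2 B : R, 0 < B & forall v, `|c i v| <= B * `|v|.
  by move=> i; apply: linear_lipschitz.
apply: (is_diff_eps (df := DL x)) => // eps eps0.
pose S0 := \sum_i B i + 1.
have S00 : 0 < S0 by rewrite ltr_wpDl // sumr_ge0 // => i _; exact: ltW.
(* [S0] pays for the passage to the coordinates of a vector, and [K + 1] for the constant of the
   mean value bound. *)
pose d := eps / (K + 1) / S0.
have d0 : 0 < d by rewrite !divr_gt0 // ltr_wpDl.
have Dnear : \forall y \near x, forall i, `|D y (e i) - D x (e i)| <= d.
  apply: filter_forall => i.
  have /cvgrPdist_le /(_ _ d0) : {for x, continuous (fun y => D y (e i))}.
    apply: (@continuous_comp _ _ _ (fun y => (y, e i)) (fun p : X * X => D p.1 p.2)); last exact: Djc.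
    by apply: cvg_pair; [exact: cvg_id|exact: cvg_cst].
  by apply: filterS => y; rewrite distrC.
have [del /= del0 Hdel] := (nbhs_ballP _ _).1 Dnear.
near=> h.
have hdel : `|h| < del.
  by near: h; apply: cvgr0_norm_lt => //; exact: cvg_id.
have h1 : `|h| <= 1.
  by near: h; apply: cvgr0_norm_le => //; exact: cvg_id.
have seg (s : R) : 0 <= s <= 1 -> `|s *: h| <= `|h|.
  by move=> /andP[s0 s1]; rewrite normrZ ger0_norm // ler_piMl.
have Dxh y : `|y - x| < del -> forall v, `|D y v - D x v| <= eps / (K + 1) * `|v|.
  move=> yx v.
  have Hy : forall i, `|D y (e i) - D x (e i)| <= d by apply: Hdel; rewrite -ball_normE /= distrC.
  have DS z : D z v = \sum_i c i v *: D z (e i).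
    rewrite [in LHS](ce v) -[LHS]/(DL z _) linear_sum; apply: eq_bigr => i _.
    by rewrite linearZ.
  have -> : D y v - D x v = \sum_i c i v *: (D y (e i) - D x (e i)).
    by rewrite !DS -sumrB; apply: eq_bigr => i _; rewrite scalerBr.
  apply: le_trans (ler_norm_sum _ _ _) _.
  apply: (@le_trans _ _ (\sum_i B i * `|v| * d)).
    by apply: ler_sum => i _; rewrite normrZ ler_pM //; exact: HB.
  rewrite -mulr_suml -mulr_suml mulrAC ler_wpM2r //.
  rewrite /d [leLHS]mulrC -[leRHS]mulr1 -[leLHS]mulrA ler_wpM2l ?divr_ge0 ?(ltW eps0) ?addr_ge0 //.
  by rewrite mulrC ler_pdivrMr // mul1r lerDl.
(* The constant collects the terms carrying [1/N]: two errors of the polygons at the end points, the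
   errors of their differentials inside the mean value bound, and the one at [x]. *)
apply: (@le_of_le_inv _ _ _ (2 * C + K * (2 * CT') * `|h| + CT' * `|h|)) => N.
set NR := N.+1%:R; have NR0 : 0 < NR by rewrite ltr0n.
have xr : `|x| <= `|x| + 1 by rewrite lerDl.
have xhr : `|x + h| <= `|x| + 1 by apply: le_trans (ler_normD _ _) _; rewrite lerD2l.
have : `|euler W N.+1 N.+1 (x + h) - 'd (euler W N.+1 N.+1) x (x + h) -
        (euler W N.+1 N.+1 x - 'd (euler W N.+1 N.+1) x x)| <= K * (2 * CT' / NR * `|h| + eps / (K + 1) * `|h|).
  set dd := 'd (euler W N.+1 N.+1) x.
  have Df y : is_diff y (fun z => euler W N.+1 N.+1 z - dd z) (fun v => DN N y v - dd v).
    have D1 := is_diff_euler N.+1 N.+1 y C1.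
    have D2 : is_diff y dd dd.
      have ddc : continuous dd by apply: diff_continuous; exact: (@ex_diff _ _ _ _ _ _ _ (is_diff_euler N.+1 N.+1 x C1)).
      by split; [exact: linear_differentiable|rewrite diff_lin].
    exact: (is_diffB D1 D2).
  apply: (HK X (fun z => euler W N.+1 N.+1 z - dd z) x h).
  - by rewrite addr_ge0 // mulr_ge0 // divr_ge0 // ?mulr_ge0 ?addr_ge0 // ltW.
  - by move=> s _; exact: (@ex_diff _ _ _ _ _ _ _ (Df _)).
  - move=> s s01; rewrite (@diff_val _ _ _ _ _ _ _ (Df _)) -DNE.
    set y := x + s *: h.
    have yr : `|y| <= `|x| + 1.
      by apply: le_trans (ler_normD _ _) _; rewrite lerD2l (le_trans (seg _ s01)).
    have yx : `|y - x| < del by rewrite /y addrC addKr (le_lt_trans (seg _ s01)).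
    have -> : DN N y h - DN N x h = (DN N y h - D y h) + (D y h - D x h) + (D x h - DN N x h).
      by rewrite !subrKA.
    apply: le_trans (ler_normD _ _) _; apply: le_trans (lerD (ler_normD _ _) (lexx _)) _.
    have H1 := HD N y h yr; have H2 := Dxh y yx h; have := HD N x h xr; rewrite distrC => H3.
    apply: le_trans (lerD (lerD H1 H2) H3) _.
    by rewrite -/NR; move: (NR) => Q; lra.
have -> : euler W N.+1 N.+1 (x + h) - 'd (euler W N.+1 N.+1) x (x + h) -
        (euler W N.+1 N.+1 x - 'd (euler W N.+1 N.+1) x x) =
   euler W N.+1 N.+1 (x + h) - euler W N.+1 N.+1 x - DN N x h.
  rewrite linearD DNE -addrA -opprD [_ + _ + (_ - _)]addrC subrKA opprD addrA //.
move=> Hm.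
have H1 := HC N x xr; have := HC N _ xhr; rewrite distrC => H2; have := HD N x h xr => H3.
have -> : euler_lim W (h + x) - euler_lim W x - DL x h =
    (euler_lim W (x + h) - euler W N.+1 N.+1 (x + h)) +
    (euler W N.+1 N.+1 (x + h) - euler W N.+1 N.+1 x - DN N x h) +
    ((euler W N.+1 N.+1 x - euler_lim W x) + (DN N x h - D x h)).
  rewrite [X in _ = _ + X]addrACA -opprD -[_ - _ - DN N x h]addrA -opprD !subrKA.
  by rewrite opprD addrA (addrC h).
apply: le_trans (ler_normD _ _) _.
apply: le_trans (lerD (ler_normD _ _) (ler_normD _ _)) _.
have Hk : K * (eps / (K + 1) * `|h|) <= eps * `|h|.
  rewrite mulrA ler_wpM2r // mulrCA ler_piMr ?(ltW eps0) //.
  by rewrite ler_pdivrMr ?mul1r ?lerDl // ltr_wpDl.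
move: H1 H2 H3 Hm; rewrite -/NR; move: (NR) => Q H1 H2 H3 Hm; lra.
Unshelve. all: by end_near. Qed.

(** The derivative is a component of the Euler limit of the tangent field, which is again stable and
    smooth but lives on [X * X]; hence the induction is over all spaces at once. *)
Theorem Ck_euler_lim X (W : X -> X) k : findim X -> stable W ->
  (forall k, Ck k setT W) -> Ck k setT (euler_lim W).
Proof.
elim: k X W => [|k IH] X W fX S C; first by move=> x _; exact: continuous_euler_lim.
apply: (@CkS_of _ _ _ _ _ _ (fun x v => (euler_lim (tangent_map W) (x, v)).2)).
- exact: openT.
- by move=> x _; apply: is_diff_euler_lim.
- move=> v; apply: (@Ck_linpost _ _ _ _ _ _ (fun x => euler_lim (tangent_map W) (x, v)) snd).
  + exact: openT.
  + by move=> ?; exact: cvg_snd.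
  + apply: (Ck_comp (V := setT) (g := euler_lim (tangent_map W)) (findim_prod fX fX)) => //.
    * exact: openT.
    * by apply: Ck_pair; [exact: openT|apply: Ck_id; exact: openT|apply: Ck_cst; exact: openT].
    * by apply: IH => [|k']; [exact: stable_tangent|exact: Ck_tangent_map].
Qed.

End EulerLimit.

(** * Flows *)

Lemma derive_seq (R : realType) (X : normedModType R) (f : R -> X) (s : R) (c : nat -> R) :
  derivable f s 1 -> c @ \oo --> (0 : R) -> (forall m, c m != 0) ->
  (c m)^-1 *: (f (c m + s) - f s) @[m --> \oo] --> 'D_1 f s.
Proof.
move=> df c0 cn0.
have hc : c @ \oo --> (0 : R)^'.
  move=> P HP; have HQ : \forall m \near \oo, c m != 0 -> P (c m) := c0 _ HP.
  have : \forall m \near \oo, P (c m) by apply: filterS HQ => m; apply; exact: cn0.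
  exact.
have := cvg_comp _ _ hc df; apply: cvg_trans; apply: near_eq_cvg; near=> m.
by rewrite /=; congr (_ *: (f (_ + _) - _)); exact: mulr1.
Unshelve. all: by end_near. Qed.

(** A derivative known to exist is determined by one null sequence of increments; this lets a law of
    the flow at special times suffice. *)
Lemma derive_seq_eq (R : realType) (X : normedModType R) (f g : R -> X) (s r : R) (c : nat -> R) :
  c @ \oo --> (0 : R) -> (forall m, c m != 0) ->
  derivable f s 1 -> derivable g r 1 ->
  (forall m, f (c m + s) - f s = g (c m + r) - g r) -> 'D_1 f s = 'D_1 g r.
Proof.
move=> c0 cn0 df dg E; have Hf := derive_seq df c0 cn0.
have Hg := derive_seq dg c0 cn0.
have EE : (fun m => (c m)^-1 *: (f (c m + s) - f s)) = (fun m => (c m)^-1 *: (g (c m + r) - g r)).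
  by apply/funext => m; rewrite E.
by rewrite EE in Hf; exact: (cvg_unique (@norm_hausdorff _ X) Hf Hg).
Qed.

Lemma is_derive_comp_shift (R : realType) (X : normedModType R) (f : R -> X) (s c : R) (df : X) :
  is_derive (s + c) (1 : R) f df -> is_derive s (1 : R) (fun r => f (r + c)) df.
Proof.
move=> D; have Ds : is_derive s (1 : R) (fun r : R => r + c) 1.
  by have := is_deriveD (is_derive_id s (1 : R)) (is_derive_cst c s (1 : R)); rewrite addr0.
have C := is_diff_comp (is_diff_real Ds) (is_diff_real D).
apply: DeriveDef; first exact/derivable1_diffP/(@ex_diff _ _ _ _ _ _ _ C).
rewrite deriveE; last exact: (@ex_diff _ _ _ _ _ _ _ C).
apply: (etrans (congr1 (fun g : R -> X => g 1) (@diff_val _ _ _ _ _ _ _ C))).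
by rewrite /= [X in X *: _](mulr1 1) scale1r.
Qed.

Section Flow.
Variables (R : realType) (X : normedModType R) (fX : findim X) (V : X -> X).
Hypothesis CV : forall k, Ck k setT V.
Variable M : R.
Hypothesis VM : forall x, `|V x| <= M.

(* The time-1 map of this autonomous field on X * R packages the whole flow of V,
   so smoothness in the state gives joint smoothness in position and time. *)
Definition time_field (p : X * R) : X * R := (p.2 *: V p.1, 0).

Lemma Ck_time_field k : Ck k setT time_field.
Proof.
apply: Ck_pair; [exact: openT| |apply: Ck_cst; exact: openT].
apply: Ck_scale; [exact: openT|apply: Ck_snd; exact: openT|].
apply: (Ck_comp fX (V := setT)) => //; [exact: openT|apply: Ck_fst; exact: openT].
Qed.

Lemma euler_time_field N k x t :
  euler time_field N k (x, t) = (iter k (euler_step V (t / N%:R)) x, t).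
Proof.
elim: k => // k IH; rewrite eulerS IH /time_field /=.
rewrite pairZE pairDE scaler0 addr0.
by rewrite /euler_step scalerA [t / _]mulrC.
Qed.

Lemma stable_time_field : stable time_field.
Proof.
move=> r; exists (`|r| + `|r| * M) => N k [x t] kN.
have M0 : 0 <= M by apply: le_trans (normr_ge0 _) (VM x).
rewrite prod_normE /= ge_max => /andP[xr tr].
rewrite euler_time_field prod_normE /= ge_max.
have rr := ler_norm r.
apply/andP; split; last by apply: le_trans tr _; rewrite (le_trans rr) // lerDl mulr_ge0.
have [N0|N0] := posnP N.
  move: kN; rewrite N0 leqn0 => /eqP -> /=; apply: le_trans xr _.
  by rewrite (le_trans rr) // lerDl mulr_ge0.
have NR : (0 : R) < N%:R by rewrite ltr0n.
have H : `|iter k (euler_step V (t / N%:R)) x| <= `|r| + k%:R * (`|r| / N%:R * M).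
  elim: k {kN} => [|k IH]; first by rewrite mul0r addr0 (le_trans xr).
  rewrite iterS {1}/euler_step; apply: le_trans (ler_normD _ _) _.
  rewrite -natr1 mulrDl mul1r addrA lerD // normrZ ler_pM // normrM normfV (ger0_norm (ltW NR)).
  by rewrite ler_wpM2r ?invr_ge0 ?(ltW NR) // (le_trans tr).
apply: le_trans H _; rewrite lerD2l.
rewrite [leLHS](_ : _ = k%:R / N%:R * (`|r| * M)); last by ring.
by rewrite ler_piMl ?mulr_ge0 // ler_pdivrMr // mul1r ler_nat.
Qed.

Definition flow (t : R) (x : X) : X := (euler_lim time_field (x, t)).1.

Lemma Ck_flow k : Ck k setT (fun z : X * R => flow z.2 z.1).
Proof.
apply: (@Ck_ext _ _ _ _ _ (fun z => (euler_lim time_field z).1)); first exact: openT.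
  by move=> [x t].
apply: (@Ck_linpost _ _ _ _ _ _ _ fst) => //; first exact: openT.
  by move=> ?; exact: cvg_fst.
apply: Ck_euler_lim => [|k']; [exact: stable_time_field|exact: Ck_time_field].
Qed.

Lemma continuous_flow t : continuous (flow t).
Proof.
move=> x; apply: (@continuous_comp _ _ _ (fun y => (y, t)) (fun z : X * R => flow z.2 z.1)).
  exact: (Ck_cont (Ck_pair openT (Ck_id 0 openT) (Ck_cst 0 t openT)) I).
exact: (Ck_cont (Ck_flow 0)).
Qed.

Lemma flow_approx (r : R) : exists2 C : R, 0 <= C & forall N x t, `|x| <= r -> `|t| <= r ->
  `|iter N.+1 (euler_step V (t / N.+1%:R)) x - flow t x| <= C / N.+1%:R.
Proof.
have [C C0 HC] := euler_limP r (findim_prod fX (findim_R R)) stable_time_field (Ck_time_field 1).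
exists C => // N x t xr tr; have := HC N (x, t).
rewrite prod_normE ge_max xr tr => /(_ isT) H; apply: le_trans H.
by rewrite euler_time_field prod_normE le_max; apply/orP; left; exact: lexx.
Qed.

(** The same polygon, made of [m+1] blocks of [N+1] steps of size [t/(N+1)], approximates both
    sides. *)
Lemma flow_iter m t x : flow (m.+1%:R * t) x = iter m.+1 (flow t) x.
Proof.
have cvg1 k : iter (k * N.+1) (euler_step V (t / N.+1%:R)) x @[N --> \oo] --> iter k (flow t) x.
  elim: k => [|k IH]; first exact: cvg_cst.
  set y := iter k (flow t) x in IH *.
  have [C C0 HC] := flow_approx (Num.max (`|y| + 1) `|t|).
  under eq_fun do rewrite mulSn iterD.
  pose z N := iter (k * N.+1) (euler_step V (t / N.+1%:R)) x.
  have E : iter N.+1 (euler_step V (t / N.+1%:R)) (z N) - flow t (z N) @[N --> \oo] --> (0 : X).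
    apply/cvgr0Pnorm_le => e e0; near=> N.
    apply: le_trans (HC N _ _ _ _) _.
    - rewrite le_max; apply/orP; left.
      rewrite -lerBlDl; apply: le_trans (lerB_dist _ _) _; rewrite distrC.
      by near: N; apply: cvgr_dist_le.
    - by rewrite le_max lexx orbT.
    rewrite ler_pdivrMr ?ltr0n // mulrC -ler_pdivrMr //.
    near: N; apply: filterS (nbhs_infty_ger (C / e)) => N /= HN.
    by apply: le_trans HN _; rewrite ler_nat.
  have F : flow t (z N) @[N --> \oo] --> flow t y.
    by apply: (cvg_comp _ _ IH); exact: continuous_flow.
  suff : iter N.+1 (euler_step V (t / N.+1%:R)) (z N) @[N --> \oo] --> flow t y by [].
  rewrite -[flow t y]add0r; apply: cvg_trans (cvgD E F).
  by apply: near_eq_cvg; near=> N; rewrite !fctE subrK.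
have cvg2 : iter (m.+1 * N.+1) (euler_step V (t / N.+1%:R)) x @[N --> \oo] --> flow (m.+1%:R * t) x.
  have [C C0 HC] := flow_approx (Num.max (`|x|) `|m.+1%:R * t|).
  apply: (@cvg_of_inv_bound _ _ _ _ C) => N.
  have := HC (m.+1 * N.+1).-1 x (m.+1%:R * t).
  rewrite !le_max !lexx orbT => /(_ isT isT).
  rewrite prednK ?muln_gt0 // natrM invfM mulrACA divff ?pnatr_eq0 // mul1r.
  move=> H; apply: le_trans H _; rewrite ler_wpM2l //.
  by rewrite ler_piMl ?invr_ge0 // invf_le1 ?ltr0n // ler1n.
exact: (cvg_unique (@norm_hausdorff _ X) cvg2 (cvg1 m.+1)).
Unshelve. all: by end_near. Qed.

Lemma flow0 x : flow 0 x = x.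
Proof.
apply: (cvg_unique (@norm_hausdorff _ X) (F := x @[N --> \oo])); last exact: cvg_cst.
have [C C0 HC] := flow_approx (`|x|).
apply: (@cvg_of_inv_bound _ _ _ _ C) => N; have := HC N x 0 (lexx _).
rewrite normr0 normr_ge0 mul0r => /(_ isT); congr (`|_ - _| <= _).
by elim: (N.+1) => //= k ->; rewrite /euler_step scale0r addr0.
Qed.

Lemma is_diff_time_field p : is_diff p time_field
  (fun q : X * R => (p.2 *: 'd V (p.1) (q.1) + q.2 *: V p.1, 0)).
Proof.
apply: is_diff_pair.
apply: is_diff_fun_scale.
  exact: is_diff_snd.
have D1 := is_diff_fst p.
have D2 : is_diff (p.1) V ('d V (p.1)).
  by apply/differentiableP; exact: (Ck_diff (CV 1)).
exact: (is_diff_comp D1 D2).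
Qed.

Lemma derivable_flow (t : R) (x : X) : derivable (fun s => flow s x) t 1.
Proof.
apply/derivable1_diffP.
have C := Ck_comp (findim_prod fX (findim_R R)) (f := fun s : R => (x, s)) (V := setT)
  (U := setT) (g := fun z : X * R => flow z.2 z.1) (k := 1) openT.
apply: (Ck_diff (C _ _ (Ck_flow 1))) => //.
by apply: Ck_pair; [exact: openT|apply: Ck_cst; exact: openT|apply: Ck_id; exact: openT].
Qed.

Lemma is_derive_flow0 x : is_derive 0 (1 : R) (fun s => flow s x) (V x).
Proof.
have fXR := findim_prod fX (findim_R R).
apply: DeriveDef; first exact: derivable_flow.
have D := is_diff_euler_lim (x, 0 : R) fXR stable_time_field (Ck_time_field 2).
have Di : is_diff (0 : R) (fun s : R => (x, s)) (fun s : R => (0 : X, s)).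
  by apply: is_diff_pair; exact: is_diff_cst.
have D1 := is_diff_fst (euler_lim time_field (x, 0 : R)).
have D3 := is_diff_comp (is_diff_comp Di D) D1.
rewrite deriveE; last exact: (@ex_diff _ _ _ _ _ _ _ D3).
rewrite (@diff_val _ _ _ _ _ _ _ D3) /=.
have ST := stable_tangent fXR stable_time_field (Ck_time_field 1).
have CT := Ck_tangent_map fXR (Ck_time_field 2).
have := @euler_lim_cvg _ _ _ ((x, 0 : R), (0 : X, 1 : R)) (findim_prod fXR fXR) ST CT.
(* The tangent polygon in the time direction: the field vanishes at [(x, 0)], so the base point does
   not move and the vector grows linearly up to [V x]. *)
have E N k : euler (tangent_map time_field) N k ((x, 0), (0, 1)) = ((x, 0), ((k%:R / N%:R) *: V x, 1)).
  elim: k => [|k IH]; first by rewrite mul0r scale0r.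
  rewrite eulerS IH /tangent_map (@diff_val _ _ _ _ _ _ _ (is_diff_time_field _)) /time_field /=.
  rewrite !pairZE !pairDE.
  by rewrite !scale0r !scaler0 !addr0 add0r scale1r -scalerDl -natr1 mulrDl mul1r.
under eq_fun do rewrite E divff ?pnatr_eq0 // scale1r.
move=> H; by rewrite (cvg_unique (@norm_hausdorff _ _) H (cvg_cst _)).
Qed.

(** With the increments [t/(m+1)], both [t] and [t + t/(m+1)] are integer multiples of the same
    time, so [flow_iter] compares the curve near [t] with the trajectory of [y] near time zero. *)
Lemma is_derive_flow t x : is_derive t (1 : R) (fun s => flow s x) (V (flow t x)).
Proof.
have [->|t0] := eqVneq t 0; first by rewrite flow0; exact: is_derive_flow0.
apply: DeriveDef; first exact: derivable_flow.
set y := flow t x.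
have h0 m : t / m.+1%:R != 0 by rewrite mulf_neq0 // invr_eq0 pnatr_eq0.
have hc0 : t / m.+1%:R @[m --> \oo] --> (0 : R).
  apply: (@cvg_of_inv_bound _ _ _ _ `|t|) => m.
  by rewrite subr0 normrM normfV (ger0_norm (ler0n _ _)).
rewrite -(@derive_val _ _ _ _ _ _ _ (is_derive_flow0 y)).
apply: (@derive_seq_eq R X (fun s => flow s x) (fun s => flow s y) t 0 (fun m => t / m.+1%:R)
  hc0 h0 (@derivable_flow t x) (@derivable_flow 0 y)) => m.
have tE : m.+1%:R * (t / m.+1%:R) = t by rewrite mulrC divfK // pnatr_eq0.
rewrite addr0 flow0 -/y -[in LHS](_ : m.+2%:R * (t / m.+1%:R) = t / m.+1%:R + t); last first.
  by rewrite -[m.+2%:R]natr1 mulrDl mul1r addrC; congr (_ + _).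
by rewrite flow_iter iterS -flow_iter tE.
Qed.

End Flow.

(** * Gronwall arguments: propagation of zeros and signs, uniqueness of solutions *)

Section Gronwall.
Variable R : realType.

Lemma is_derive_coord n (y : R -> 'rV[R]_n) dy t j :
  is_derive t (1 : R) y dy -> is_derive t (1 : R) (fun s => y s 0 j) (dy 0 j).
Proof.
move=> /is_diff_real D.
have Lin : linear (fun x : 'rV[R]_n => x 0 j) by move=> k x z; rewrite !mxE.
pose L : {linear 'rV[R]_n -> R} := HB.pack (fun x : 'rV[R]_n => x 0 j)
   (GRing.isLinear.Build _ _ _ _ _ Lin).
have Lc : continuous L by move=> x; exact: coord_continuous.
have D3 := is_diff_comp D (is_diff_linear _ Lc).
apply: DeriveDef; first exact/derivable1_diffP/(@ex_diff _ _ _ _ _ _ _ D3).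
rewrite deriveE; last exact: (@ex_diff _ _ _ _ _ _ _ D3).
by rewrite (@diff_val _ _ _ _ _ _ _ D3) /= scale1r.
Qed.

(** The function [u^2 exp(-2Ks)] is nonincreasing and [u^2 exp(2Ks)] is nondecreasing; being
    nonnegative, they carry a zero at [c] to the right and to the left respectively. *)
Lemma gronwall_zero (u du : R -> R) (K a b c : R) :
  (forall t, a <= t <= b -> is_derive t (1 : R) u (du t)) ->
  (forall t, a <= t <= b -> `|du t| <= K * `|u t|) ->
  a <= c <= b -> u c = 0 -> forall t, a <= t <= b -> u t = 0.
Proof.
move=> Du Hu cab uc t tab.
pose f (k s : R) := u s * u s * expR (k * s).
have Df k s : a <= s <= b -> is_derive s (1 : R) (f k)
    (expR (k * s) * (2 * (u s * du s) + k * u s ^+ 2)).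
  move=> sab; have D1 := Du s sab.
  have D2 : is_derive s (1 : R) (fun s : R => expR (k * s)) (expR (k * s) * k).
    have Dk : is_derive s (1 : R) (fun s : R => k * s) k.
      have := is_deriveZ k (is_derive_id s (1 : R)); rewrite /GRing.scale /= mulr1.
      exact.
    exact: (is_derive1_comp (is_derive_expR _) Dk).
  have := is_deriveM (is_deriveM D1 D1) D2.
  move=> D; apply: (is_derive_eq D).
  by rewrite /GRing.scale /= !fctE; ring.
have sgn s : a <= s <= b -> `|u s * du s| <= K * u s ^+ 2.
  move=> sab; rewrite normrM -real_normK ?num_real // expr2 mulrCA.
  by rewrite ler_wpM2l //; exact: Hu.
have dle s : a <= s <= b -> derive1 (f (- (2 * K))) s <= 0.
  move=> sab; rewrite derive1E (@derive_val _ _ _ _ _ _ _ (Df _ _ sab)).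
  rewrite pmulr_rle0 ?expR_gt0 //; have := sgn s sab; rewrite ler_norml => /andP[]; lra.
have dge s : a <= s <= b -> 0 <= derive1 (f (2 * K)) s.
  move=> sab; rewrite derive1E (@derive_val _ _ _ _ _ _ _ (Df _ _ sab)).
  rewrite pmulr_rge0 ?expR_gt0 //; have := sgn s sab; rewrite ler_norml => /andP[]; lra.
have f0 k s : f k s <= 0 -> u s = 0.
  rewrite /f pmulr_lle0 ?expR_gt0 // -expr2 => H; apply/eqP.
  by rewrite -sqrf_eq0 eq_le H sqr_ge0.
have fc k : f k c = 0 by rewrite /f uc !mul0r.
have ab s : s \in `]a, b[ -> a <= s <= b.
  by rewrite in_itv /= => /andP[x y]; rewrite !ltW.
have cf k : {within `[a, b], continuous (f k)}.
  apply: derivable_within_continuous => s; rewrite in_itv /= => sab.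
  exact: (@ex_derive _ _ _ _ _ _ _ (Df k s sab)).
have /andP[ac cb] := cab; have /andP[at_ tb] := tab.
have [ct|tc] := leP c t.
  apply: (f0 (- (2 * K))); rewrite -(fc (- (2 * K))).
  apply: (@ler0_derive1_nincr _ _ a b) => // [s /ab sab|s /ab]; last exact: dle.
  exact: (@ex_derive _ _ _ _ _ _ _ (Df _ s sab)).
apply: (f0 (2 * K)); rewrite -(fc (2 * K)).
apply: (@ger0_derive1_ndecr _ _ a b) => // [s /ab sab|s /ab|]; [|exact: dge|exact: ltW].
exact: (@ex_derive _ _ _ _ _ _ _ (Df _ s sab)).
Qed.

Lemma bounded_itv (X : normedModType R) (f : R -> X) (a b : R) :
  {within `[a, b], continuous f} -> exists2 r : R, 0 <= r & forall t, a <= t <= b -> `|f t| <= r.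
Proof.
move=> fc; have cK : compact (f @` `[a, b]).
  by apply: continuous_compact => //; exact: segment_compact.
have [M [_ HM]] := compact_bounded cK.
exists (`|M| + 1); first by rewrite addr_ge0.
move=> t tab; apply: (HM (`|M| + 1)); last by exists t => //=; rewrite in_itv.
by rewrite (le_lt_trans (ler_norm M)) // ltrDl.
Qed.

Lemma sg_constant (u : R -> R) (a b : R) : {within `[a, b], continuous u} ->
  (forall c, a <= c <= b -> u c = 0 -> forall t, a <= t <= b -> u t = 0) ->
  forall s t, a <= s <= b -> a <= t <= b -> Num.sg (u s) = Num.sg (u t).
Proof.
move=> uc Z.
suff H s t : a <= s <= b -> a <= t <= b -> s <= t -> Num.sg (u s) = Num.sg (u t).
  move=> s t sab tab; have [st|/ltW ts] := leP s t; first exact: H.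
  by rewrite (H t s).
move=> sab tab st.
have [us|us] := eqVneq (u s) 0; first by rewrite us (Z s).
have [ut|ut] := eqVneq (u t) 0; first by rewrite ut (Z t).
have [//|neq] := eqVneq (Num.sg (u s)) (Num.sg (u t)).
have stab w : s <= w <= t -> a <= w <= b.
  move=> /andP[sw wt]; have /andP[as_ _] := sab; have /andP[_ tb] := tab.
  by rewrite (le_trans as_) // (le_trans wt).
have [w] : exists2 w, w \in `[s, t] & u w = 0.
  apply: IVT => //.
    by apply: continuous_subspaceW uc => w /=; rewrite !in_itv /=; exact: stab.
  rewrite ge_min le_max.
  move: neq; rewrite neq_lt in us; rewrite neq_lt in ut.
  case/orP: us => us; case/orP: ut => ut.
  - by rewrite (ltr0_sg us) (ltr0_sg ut) eqxx.
  - by move=> _; rewrite (ltW us) (ltW ut) ?orbT.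
  - by move=> _; rewrite (ltW us) (ltW ut) ?orbT.
  - by rewrite (gtr0_sg us) (gtr0_sg ut) eqxx.
rewrite in_itv /= => /stab wab uw0.
by move: us; rewrite (Z w wab uw0 s sab) eqxx.
Qed.

Lemma linear_ode_sign (u k : R -> R) (a b : R) :
  (forall t, a <= t <= b -> is_derive t (1 : R) u (k t * u t)) ->
  {within `[a, b], continuous k} ->
  forall s t, a <= s <= b -> a <= t <= b -> Num.sg (u s) = Num.sg (u t).
Proof.
move=> Du kc; have [K K0 HK] := bounded_itv kc.
apply: sg_constant => [|c cab uc].
  apply: derivable_within_continuous => s; rewrite in_itv /= => sab.
  exact: (@ex_derive _ _ _ _ _ _ _ (Du s sab)).
apply: (@gronwall_zero u (fun t => k t * u t) K a b c) => // t tab.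
by rewrite normrM ler_wpM2r //; exact: HK.
Qed.

(** Gronwall for the sum of the squared coordinates of the difference. The Lipschitz bound is in the
    sup norm, whence the factor [n] in the constant. *)
Lemma ode_unique n (V : 'rV[R]_n -> 'rV[R]_n) (y1 y2 : R -> 'rV[R]_n) (a b c : R) :
  Ck 1 setT V ->
  (forall t, a <= t <= b -> is_derive t (1 : R) y1 (V (y1 t))) ->
  (forall t, a <= t <= b -> is_derive t (1 : R) y2 (V (y2 t))) ->
  a <= c <= b -> y1 c = y2 c -> forall t, a <= t <= b -> y1 t = y2 t.
Proof.
move=> CV D1 D2 cab y12 t tab.
have cD (y : R -> 'rV[R]_n) : (forall t, a <= t <= b -> is_derive t (1 : R) y (V (y t))) ->
    {within `[a, b], continuous y}.
  move=> D; apply: derivable_within_continuous => s; rewrite in_itv /= => sab.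
  exact: (@ex_derive _ _ _ _ _ _ _ (D s sab)).
have [r1 r10 H1] := bounded_itv (cD _ D1); have [r2 r20 H2] := bounded_itv (cD _ D2).
have [L L0 HL] := lip_ball (r1 + r2) (findim_rV R n) (findim_rV R n) CV.
pose d s := y1 s - y2 s; pose dd s := V (y1 s) - V (y2 s).
pose u s := \sum_j d s 0 j * d s 0 j.
pose du s := \sum_j 2 * (d s 0 j * dd s 0 j).
have Dc (i : 'I_n) s : a <= s <= b -> is_derive s (1 : R) (fun s => d s 0 i) (dd s 0 i).
  by move=> sab; exact: (is_derive_coord i (is_deriveB (D1 s sab) (D2 s sab))).
have Du s : a <= s <= b -> is_derive s (1 : R) u (du s).
  move=> sab; have Dj j : is_derive s (1 : R) (fun s => d s 0 j * d s 0 j) (2 * (d s 0 j * dd s 0 j)).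
    have := is_deriveM (Dc j s sab) (Dc j s sab) => D; apply: (is_derive_eq D).
    by rewrite /GRing.scale /=; ring.
  have := is_derive_sum Dj.
  by rewrite (_ : \sum_(i < n) _ = u) //; apply/funext => w; rewrite fct_sumE.
have uz : u t = 0.
  apply: (@gronwall_zero u du (2 * n%:R * L) a b c) => // [s sab|]; last first.
    by rewrite /u /d y12 subrr big1 // => j _; rewrite mxE mul0r.
  have sq j : 0 <= d s 0 j * d s 0 j by rewrite -expr2 sqr_ge0.
  have dn : `|d s| ^+ 2 <= `|u s|.
    rewrite ger0_norm; last by exact: sumr_ge0.
    have [->|/mx_norm_neq0] := eqVneq `|d s| 0.
      by rewrite expr0n; exact: sumr_ge0.
    move=> [[i j]]; rewrite ord1 => E; rewrite -[`|d s|]/(mx_norm (d s)) E /=.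
    by rewrite real_normK ?num_real // /u (bigD1 j) //= expr2 lerDl; exact: sumr_ge0.
  have Hy : `|dd s| <= L * `|d s|.
    apply: HL; first by rewrite (le_trans (H1 s sab)) // lerDl.
    by rewrite (le_trans (H2 s sab)) // lerDr.
  apply: le_trans (ler_norm_sum _ _ _) _.
  apply: (@le_trans _ _ (\sum_(j < n) 2 * (L * `|d s| ^+ 2))).
    apply: ler_sum => j _; rewrite !normrM ger0_norm // ler_wpM2l //.
    apply: (@le_trans _ _ (`|d s| * (L * `|d s|))); last by rewrite expr2 mulrCA.
    apply: ler_pM => //; first exact: coord_le_norm.
    exact: le_trans (coord_le_norm _ _) Hy.
  rewrite sumr_const card_ord -[leLHS]mulr_natl.
  have -> : n%:R * (2 * (L * `|d s| ^+ 2)) = 2 * n%:R * L * `|d s| ^+ 2 by ring.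
  by rewrite ler_wpM2l ?mulr_ge0.
apply/eqP; rewrite -subr_eq0; apply/eqP/rowP => j; rewrite [RHS]mxE.
apply/eqP; rewrite -sqrf_eq0; move/eqP: uz; rewrite /u psumr_eq0 => [|k _]; last by rewrite -expr2 sqr_ge0.
by move=> /allP /(_ j (mem_index_enum _)); rewrite -expr2.
Qed.

Section FlowRV.
Variables (n : nat) (V : 'rV[R]_n -> 'rV[R]_n).
Hypothesis CV : forall k, Ck k setT V.
Variable M : R.
Hypothesis VM : forall x, `|V x| <= M.

Lemma flow_unique (y : R -> 'rV[R]_n) (a b c : R) :
  (forall t, a <= t <= b -> is_derive t (1 : R) y (V (y t))) ->
  a <= c <= b -> forall t, a <= t <= b -> y t = flow V (t - c) (y c).
Proof.
move=> Dy cab; apply: (ode_unique (CV 1) Dy _ cab); last first.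
  by rewrite subrr (flow0 (findim_rV R n) CV VM).
move=> t _; have D := is_derive_flow (findim_rV R n) CV VM (t - c) (y c).
exact: is_derive_comp_shift D.
Qed.

(** [flow_iter] covers integer multiples only; the general law comes from uniqueness of
    solutions. *)
Lemma flowD s t x : flow V (s + t) x = flow V s (flow V t x).
Proof.
have fx := findim_rV R n.
have := @flow_unique (fun s => flow V (s + t) x) (- `|s|) `|s| 0.
move=> H; rewrite (H _ _ s).
- by rewrite subr0 add0r.
- move=> r _; have D := is_derive_flow fx CV VM (r + t) x.
  exact: is_derive_comp_shift D.
- by rewrite oppr_le0 normr_ge0.
- by rewrite lerNl -normrN ler_norm normrN ler_norm.
Qed.

End FlowRV.
End Gronwall.

(** * Horizontal and vertical coordinates *)

Section Rows.
Variable R : realType.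
Implicit Types n m : nat.

Lemma dotC n (x y : 'rV[R]_n) : dot x y = dot y x.
Proof. by apply: eq_bigr => i _; rewrite mulrC. Qed.

Lemma dotDr n (a x y : 'rV[R]_n) : dot a (x + y) = dot a x + dot a y.
Proof. by rewrite -big_split; apply: eq_bigr => i _; rewrite mxE mulrDr. Qed.

Lemma dotZr n k (a x : 'rV[R]_n) : dot a (k *: x) = k * dot a x.
Proof. by rewrite mulr_sumr; apply: eq_bigr => i _; rewrite mxE mulrCA. Qed.

Lemma dotNr n (a x : 'rV[R]_n) : dot a (- x) = - dot a x.
Proof. by rewrite -scaleN1r dotZr mulN1r. Qed.

Lemma dotBr n (a x y : 'rV[R]_n) : dot a (x - y) = dot a x - dot a y.
Proof. by rewrite dotDr dotNr. Qed.

Lemma dotDl n (a x y : 'rV[R]_n) : dot (x + y) a = dot x a + dot y a.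
Proof. by rewrite ![dot _ a]dotC dotDr. Qed.

Lemma dotZl n k (a x : 'rV[R]_n) : dot (k *: x) a = k * dot x a.
Proof. by rewrite ![dot _ a]dotC dotZr. Qed.

Lemma dotNl n (a x : 'rV[R]_n) : dot (- x) a = - dot x a.
Proof. by rewrite ![dot _ a]dotC dotNr. Qed.

Lemma dotBl n (a x y : 'rV[R]_n) : dot (x - y) a = dot x a - dot y a.
Proof. by rewrite dotDl dotNl. Qed.

Lemma dot0r n (a : 'rV[R]_n) : dot a 0 = 0.
Proof. by rewrite -(scale0r 0) dotZr mul0r. Qed.

Lemma dot0l n (a : 'rV[R]_n) : dot 0 a = 0.
Proof. by rewrite dotC dot0r. Qed.

Lemma dot_sumr n (I : Type) (r : seq I) (P : pred I) (F : I -> 'rV[R]_n) a :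
  dot a (\sum_(i <- r | P i) F i) = \sum_(i <- r | P i) dot a (F i).
Proof. by elim/big_rec2: _ => [|i x y _ <-]; rewrite ?dot0r // dotDr. Qed.

Lemma dot_ge0 n (x : 'rV[R]_n) : 0 <= dot x x.
Proof. by apply: sumr_ge0 => i _; rewrite -expr2 sqr_ge0. Qed.

Lemma dot_eq0 n (x : 'rV[R]_n) : dot x x = 0 -> x = 0.
Proof.
move=> /eqP; rewrite psumr_eq0 => [/allP H|i _]; last by rewrite -expr2 sqr_ge0.
apply/rowP => j; rewrite mxE; apply/eqP; rewrite -sqrf_eq0 expr2.
exact: (H j (mem_index_enum _)).
Qed.

Lemma dot_gt0 n (x : 'rV[R]_n) : x != 0 -> 0 < dot x x.
Proof.
by move=> x0; rewrite lt_neqAle dot_ge0 andbT eq_sym; apply: contra_neq x0 => /dot_eq0.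
Qed.

Lemma enorm_sqr n (x : 'rV[R]_n) : enorm x ^+ 2 = dot x x.
Proof. by rewrite sqr_sqrtr // dot_ge0. Qed.

Lemma enorm_ge0 n (x : 'rV[R]_n) : 0 <= enorm x.
Proof. exact: sqrtr_ge0. Qed.

Lemma enorm0 n : enorm (0 : 'rV[R]_n) = 0.
Proof. by rewrite /enorm dot0r sqrtr0. Qed.

Lemma enorm_eq0 n (x : 'rV[R]_n) : enorm x = 0 -> x = 0.
Proof. by move=> x0; apply: dot_eq0; rewrite -enorm_sqr x0 expr0n. Qed.

Lemma enorm_gt0 n (x : 'rV[R]_n) : x != 0 -> 0 < enorm x.
Proof. by move=> /dot_gt0; rewrite sqrtr_gt0. Qed.

Lemma enorm_neq0 n (x : 'rV[R]_n) : 0 < enorm x -> x != 0.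
Proof. by apply: contraTneq => ->; rewrite enorm0 ltxx. Qed.

Lemma enormZ n k (x : 'rV[R]_n) : enorm (k *: x) = `|k| * enorm x.
Proof. by rewrite /enorm dotZl dotZr mulrA -expr2 sqrtrM ?sqr_ge0 // sqrtr_sqr. Qed.

Lemma enormN n (x : 'rV[R]_n) : enorm (- x) = enorm x.
Proof. by rewrite -scaleN1r enormZ normrN1 mul1r. Qed.

Lemma enorm_normalize n (x : 'rV[R]_n) : x != 0 -> enorm ((enorm x)^-1 *: x) = 1.
Proof.
move=> /enorm_gt0 x0; rewrite enormZ ger0_norm ?invr_ge0 ?enorm_ge0 //.
by rewrite mulVf // gt_eqF.
Qed.

Lemma dot_cauchy n (x y : 'rV[R]_n) : `|dot x y| <= enorm x * enorm y.
Proof.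
have [->|y0] := eqVneq y 0; first by rewrite dot0r normr0 mulr_ge0 ?enorm_ge0.
rewrite -[enorm x * _]ger0_norm ?mulr_ge0 ?enorm_ge0 // -ler_sqr ?nnegrE //.
rewrite !real_normK ?num_real // exprMn !enorm_sqr.
have Y := dot_gt0 y0.
have := dot_ge0 (dot y y *: x - dot x y *: y).
rewrite !(dotBl, dotBr, dotZl, dotZr) [dot y x]dotC.
rewrite (_ : _ - _ = dot y y * (dot x x * dot y y - dot x y ^+ 2)); last by ring.
by rewrite pmulr_rge0 // subr_ge0.
Qed.

Lemma dot_cauchy_le n (x y : 'rV[R]_n) : dot x y <= enorm x * enorm y.
Proof. exact: le_trans (ler_norm _) (dot_cauchy _ _). Qed.

Lemma enormD n (x y : 'rV[R]_n) : enorm (x + y) <= enorm x + enorm y.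
Proof.
have H := dot_cauchy_le x y.
rewrite -ler_sqr ?nnegrE ?addr_ge0 ?enorm_ge0 // sqrrD !enorm_sqr.
rewrite !(dotDl, dotDr) [dot y x]dotC; lra.
Qed.

Lemma coord_le_enorm n (x : 'rV[R]_n) j : `|x 0 j| <= enorm x.
Proof.
rewrite -sqrtr_sqr ler_sqrt ?dot_ge0 // /dot (bigD1 j) //= expr2 lerDl.
by apply: sumr_ge0 => i _; rewrite -expr2 sqr_ge0.
Qed.

Lemma norm_le_enorm n (x : 'rV[R]_n) : `|x| <= enorm x.
Proof.
rewrite -[leLHS]/(mx_norm x) mx_normrE; apply: bigmax_le; first exact: enorm_ge0.
by move=> [i j] _ /=; rewrite ord1; exact: coord_le_enorm.
Qed.

Lemma enorm_le_norm n (x : 'rV[R]_n) : enorm x <= n%:R * `|x|.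
Proof.
rewrite -ler_sqr ?nnegrE ?mulr_ge0 ?enorm_ge0 // enorm_sqr exprMn.
apply: (@le_trans _ _ (\sum_(j < n) `|x| ^+ 2)).
  apply: ler_sum => j _; rewrite -expr2 -real_normK ?num_real //.
  by rewrite ler_sqr ?nnegrE //; exact: coord_le_norm.
rewrite sumr_const card_ord -[leLHS]mulr_natl ler_wpM2r ?sqr_ge0 //.
by rewrite -natrX ler_nat; case: n {x} => // n; rewrite expnS expn1 leq_pmulr.
Qed.

Lemma horD n (x y : 'rV[R]_n.+1) : hor (x + y) = hor x + hor y.
Proof. by apply/rowP => i; rewrite !mxE. Qed.

Lemma horZ n k (x : 'rV[R]_n.+1) : hor (k *: x) = k *: hor x.
Proof. by apply/rowP => i; rewrite !mxE. Qed.

Lemma horN n (x : 'rV[R]_n.+1) : hor (- x) = - hor x.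
Proof. by apply/rowP => i; rewrite !mxE. Qed.

Lemma horB n (x y : 'rV[R]_n.+1) : hor (x - y) = hor x - hor y.
Proof. by rewrite horD horN. Qed.

Lemma hgtD n (x y : 'rV[R]_n.+1) : hgt (x + y) = hgt x + hgt y.
Proof. by rewrite /hgt !mxE. Qed.

Lemma hgtZ n k (x : 'rV[R]_n.+1) : hgt (k *: x) = k * hgt x.
Proof. by rewrite /hgt !mxE. Qed.

Lemma hgtN n (x : 'rV[R]_n.+1) : hgt (- x) = - hgt x.
Proof. by rewrite /hgt !mxE. Qed.

Lemma hgtB n (x y : 'rV[R]_n.+1) : hgt (x - y) = hgt x - hgt y.
Proof. by rewrite hgtD hgtN. Qed.

Lemma hor_vec n (x' : 'rV[R]_n) t : hor (vec x' t) = x'.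
Proof. by apply/rowP => i; rewrite !mxE liftK. Qed.

Lemma hgt_vec n (x' : 'rV[R]_n) t : hgt (vec x' t) = t.
Proof. by rewrite /hgt mxE unlift_none. Qed.

Lemma vec_eta n (x : 'rV[R]_n.+1) : vec (hor x) (hgt x) = x.
Proof. by apply/rowP => j; rewrite mxE; case: unliftP => [i ->|->]; rewrite ?mxE. Qed.

Lemma vec_inj n (x y : 'rV[R]_n.+1) : hor x = hor y -> hgt x = hgt y -> x = y.
Proof. by move=> h1 h2; rewrite -(vec_eta x) -(vec_eta y) h1 h2. Qed.

Lemma vecD n (x y : 'rV[R]_n) s t : vec x s + vec y t = vec (x + y) (s + t).
Proof. by apply: vec_inj; rewrite ?horD ?hgtD !(hor_vec, hgt_vec). Qed.

Lemma vecZ n k (x : 'rV[R]_n) s : k *: vec x s = vec (k *: x) (k * s).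
Proof. by apply: vec_inj; rewrite ?horZ ?hgtZ !(hor_vec, hgt_vec). Qed.

Lemma vecN n (x : 'rV[R]_n) s : - vec x s = vec (- x) (- s).
Proof. by apply: vec_inj; rewrite ?horN ?hgtN !(hor_vec, hgt_vec). Qed.

Lemma vecB n (x y : 'rV[R]_n) s t : vec x s - vec y t = vec (x - y) (s - t).
Proof. by rewrite vecN vecD. Qed.

Lemma hor0 n : hor (0 : 'rV[R]_n.+1) = 0.
Proof. by apply/rowP => i; rewrite !mxE. Qed.

Lemma hgt0 n : hgt (0 : 'rV[R]_n.+1) = 0.
Proof. by rewrite /hgt mxE. Qed.

Lemma dot_hor n (a x : 'rV[R]_n.+1) : dot a x = dot (hor a) (hor x) + hgt a * hgt x.
Proof.
rewrite /dot (bigD1_ord ord_max) //= addrC; congr (_ + _).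
by apply: eq_bigr => i _; rewrite !mxE.
Qed.

Lemma enorm_hor n (x : 'rV[R]_n.+1) : enorm x ^+ 2 = enorm (hor x) ^+ 2 + hgt x ^+ 2.
Proof. by rewrite !enorm_sqr dot_hor expr2. Qed.

Lemma hgt_le_enorm n (x : 'rV[R]_n.+1) : `|hgt x| <= enorm x.
Proof. exact: coord_le_enorm. Qed.

End Rows.

Section SmoothRows.
Variable R : realType.
Implicit Types (n : nat) (X : normedModType R).

Lemma Ck_row X n k (U : set X) (f : X -> 'rV[R]_n) : open U ->
  (forall j, Ck k U (fun x => f x 0 j)) -> Ck k U f.
Proof.
move=> oU H.
apply: (@Ck_ext _ _ _ _ _ (fun x => \sum_j f x 0 j *: delta_mx 0 j)) => //.
  by move=> x _; rewrite -row_sum_delta.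
by apply: Ck_sum => // j; apply: Ck_scale => //; exact: Ck_cst.
Qed.

Lemma Ck_coord X n k (U : set X) (f : X -> 'rV[R]_n) j : open U ->
  Ck k U f -> Ck k U (fun x => f x 0 j).
Proof.
move=> oU; have Lin : linear (fun x : 'rV[R]_n => x 0 j) by move=> a x y; rewrite !mxE.
pose L : {linear 'rV[R]_n -> R} := HB.pack (fun x : 'rV[R]_n => x 0 j)
  (GRing.isLinear.Build _ _ _ _ _ Lin).
by apply: (@Ck_linpost _ _ _ _ _ _ _ L) => // x; exact: coord_continuous.
Qed.

Lemma Ck_hor X n k (U : set X) (f : X -> 'rV[R]_n.+1) : open U ->
  Ck k U f -> Ck k U (fun x => hor (f x)).
Proof.
move=> oU H; apply: Ck_row => // j.
by apply: (@Ck_ext _ _ _ _ _ _ _ oU _ (Ck_coord (lift ord_max j) oU H)) => x _; rewrite mxE.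
Qed.

Lemma Ck_hgt X n k (U : set X) (f : X -> 'rV[R]_n.+1) : open U ->
  Ck k U f -> Ck k U (fun x => hgt (f x)).
Proof. exact: Ck_coord. Qed.

Lemma Ck_vec X n k (U : set X) (f : X -> 'rV[R]_n) (g : X -> R) : open U ->
  Ck k U f -> Ck k U g -> Ck k U (fun x => vec (f x) (g x)).
Proof.
move=> oU Hf Hg; apply: Ck_row => // j; case: (unliftP ord_max j) => [i ->|->].
  by apply: Ck_ext (Ck_coord i oU Hf) => // x _; rewrite mxE liftK.
by apply: Ck_ext Hg => // x _; rewrite mxE unlift_none.
Qed.

Lemma Ck_sumI X (W : normedModType R) k (U : set X) (I : Type) (r : seq I) (P : pred I)
    (f : I -> X -> W) : open U ->
  (forall i, P i -> Ck k U (f i)) -> Ck k U (fun x => \sum_(i <- r | P i) f i x).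
Proof.
move=> oU H; elim: r => [|i r IH].
  by apply: Ck_ext (Ck_cst k 0 oU) => // x _; rewrite big_nil.
have [Pi|Pi] := boolP (P i).
  by apply: Ck_ext (Ck_add oU (H i Pi) IH) => // x _; rewrite big_cons Pi.
by apply: Ck_ext IH => // x _; rewrite big_cons (negbTE Pi).
Qed.

Lemma Ck_prodI X k (U : set X) (I : Type) (r : seq I) (P : pred I)
    (f : I -> X -> R) : open U ->
  (forall i, P i -> Ck k U (f i)) -> Ck k U (fun x => \prod_(i <- r | P i) f i x).
Proof.
move=> oU H; elim: r => [|i r IH].
  by apply: Ck_ext (Ck_cst k (1 : R) oU) => // x _; rewrite big_nil.
have [Pi|Pi] := boolP (P i).
  by apply: Ck_ext (Ck_mul oU (H i Pi) IH) => // x _; rewrite big_cons Pi.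
by apply: Ck_ext IH => // x _; rewrite big_cons (negbTE Pi).
Qed.

Lemma Ck_dot X n k (U : set X) (f g : X -> 'rV[R]_n) : open U ->
  Ck k U f -> Ck k U g -> Ck k U (fun x => dot (f x) (g x)).
Proof.
by move=> oU Hf Hg; apply: Ck_sumI => // i _; apply: Ck_mul => //; exact: Ck_coord.
Qed.

Lemma Ck_invf X k (U : set X) (f : X -> R) : open U -> (forall x, U x -> f x != 0) ->
  Ck k U f -> Ck k U (fun x => (f x)^-1).
Proof. by move=> oU f0 Hf; apply: (Ck_comp (findim_R R) oU f0 Hf); exact: Ck_inv. Qed.

Lemma open_gt0 : open [set x : R | 0 < x].
Proof. exact: open_gt. Qed.

Lemma Ck_sqrt k : Ck k [set x : R | 0 < x] Num.sqrt.
Proof.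
elim: k => [|k IH]; first by move=> x _; exact: sqrt_continuous.
apply: (@Ck_real _ _ _ _ _ (fun x => (2 * Num.sqrt x)^-1)).
- exact: open_gt0.
apply: Ck_invf; first exact: open_gt0.
  by move=> x /= x0; rewrite mulf_neq0 // gt_eqF // sqrtr_gt0.
by apply: Ck_mul => //; apply: Ck_cst; exact: open_gt0.
Qed.

Lemma Ck_enorm X n k (U : set X) (f : X -> 'rV[R]_n) : open U ->
  (forall x, U x -> f x != 0) -> Ck k U f -> Ck k U (fun x => enorm (f x)).
Proof.
move=> oU f0 Hf; apply: (Ck_comp (findim_R R) oU (V := [set x : R | 0 < x]) (f := fun x => dot (f x) (f x))).
- by move=> x /f0 /dot_gt0.
- exact: Ck_dot.
- exact: Ck_sqrt.
Qed.

Lemma Ck_cos_sin k (U : set R) : open U -> Ck k U cos /\ Ck k U sin.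
Proof.
move=> oU; elim: k => [|k [IHc IHs]].
  by split=> x _; [exact: continuous_cos|exact: continuous_sin].
split; last by apply: (@Ck_real _ _ _ _ _ cos).
by apply: (@Ck_real _ _ _ _ _ (fun x => - sin x)) => //; apply: Ck_opp.
Qed.

Lemma open_unit_interval : open [set x : R | -1 < x < 1].
Proof.
rewrite (_ : mkset _ = [set` `]-1, 1[]); first exact: interval_open.
by apply/seteqP; split=> x /=; rewrite in_itv.
Qed.

Lemma Ck_asin k : Ck k [set x : R | -1 < x < 1] (@asin R).
Proof.
apply: (@CkW _ _ _ k).
apply: (@Ck_real _ _ _ _ _ (fun x => (Num.sqrt (1 - x ^+ 2))^-1)).
- exact: open_unit_interval.
have pos (x : R) : -1 < x < 1 -> 0 < 1 - x ^+ 2 by move=> /andP[]; nra.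
have oI := open_unit_interval.
apply: Ck_invf => //; first by move=> x /= x1; rewrite gt_eqF // sqrtr_gt0 pos.
apply: (Ck_comp (findim_R R) oI (V := [set x : R | 0 < x]) (f := fun x : R => 1 - x ^+ 2) (g := @Num.sqrt R)).
- exact: pos.
- apply: Ck_add => //; first exact: Ck_cst.
  by apply: Ck_opp => //; apply: Ck_exp => //; exact: Ck_id.
- exact: Ck_sqrt.
Qed.

Lemma continuous_Ck0 X (W : normedModType R) (f : X -> W) : Ck 0 setT f -> continuous f.
Proof. by move=> H x; exact: H. Qed.

Lemma continuous_hgt n : continuous (@hgt R n).
Proof. exact: coord_continuous. Qed.

Lemma continuous_enorm n : continuous (@enorm R n).
Proof.
move=> x; apply: (@continuous_comp _ _ _ (fun x => dot x x) Num.sqrt); last exact: sqrt_continuous.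
by apply: (@Ck_dot _ _ 0 setT id id) => //; try apply: Ck_id; exact: openT.
Qed.

Lemma near_enorm_lt n (c : R) : 0 < c -> \forall v \near (0 : 'rV[R]_n), enorm v < c.
Proof.
move=> c0; have H : @enorm R n v @[v --> (0 : 'rV[R]_n)] --> enorm (0 : 'rV[R]_n).
  exact: continuous_enorm.
rewrite enorm0 in H; apply: (H [set s | s < c]); apply: open_nbhs_nbhs.
by split; [exact: open_lt|].
Qed.

End SmoothRows.

(** * Cutoff functions *)

Section Bump.
Variable R : realType.

Lemma Ck_local (X Y : normedModType R) k (U : set X) (f : X -> Y) :
  (forall x, U x -> exists2 D : set X, D x & Ck k D f) -> Ck k U f.
Proof.
elim: k f => [|k IH] f H; first by move=> x /H[D Dx HD]; exact: HD.
split=> [x /H[D Dx HD]|v]; first exact: Ck_diff HD Dx.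
by apply: IH => x /H[D Dx /CkSP[_ HD]]; exists D.
Qed.

Lemma expR_dominates (d : nat) (y : R) : 0 <= y -> y ^+ d <= d`!%:R * expR y.
Proof.
case: d => [|d] y0; first by rewrite expr0 fact0 mul1r -expR0 ler_expR.
rewrite mulrC -ler_pdivrMr ?ltr0n ?fact_gt0 //.
by apply: le_trans (expR_ge1Dxn d y0); rewrite lerDr.
Qed.

Lemma horner_bound (p : {poly R}) (y : R) : 1 <= y ->
  `|p.[y]| <= (\sum_(i < size p) `|p`_i|) * y ^+ size p.
Proof.
move=> y1; rewrite horner_coef mulr_suml; apply: le_trans (ler_norm_sum _ _ _) _.
apply: ler_sum => i _; rewrite normrM ler_wpM2l // ger0_norm ?exprn_ge0 ?(le_trans ler01) //.
by apply: ler_weXn2l => //; exact: ltnW.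
Qed.

(* The family is closed under differentiation, which gives smoothness of the case
   [p = 1] at the origin. *)
Definition poly_bump (p : {poly R}) (s : R) : R :=
  if 0 < s then p.[s^-1] * expR (- s^-1) else 0.

(** In the variable [y = 1/s], a polynomial times [y^2] is dominated by [exp y]. The quadratic bound
    gives derivative zero at the origin. *)
Lemma poly_bump_small (p : {poly R}) : exists2 C : R, 0 <= C &
  forall s, `|s| <= 1 -> `|poly_bump p s| <= C * s ^+ 2.
Proof.
pose q := p * 'X^2.
pose C0 := (\sum_(i < size q) `|q`_i|) * (size q)`!%:R.
exists C0; first by rewrite mulr_ge0 // sumr_ge0.
move=> s s1; rewrite /poly_bump; case: ifP => s0; last first.
  by rewrite normr0 mulr_ge0 ?sqr_ge0 // mulr_ge0 // sumr_ge0.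
have y1 : 1 <= s^-1 by rewrite invf_ge1 //; move: s1; rewrite ger0_norm // ltW.
have y0 : 0 <= s^-1 by rewrite invr_ge0 ltW.
have := horner_bound q y1; rewrite /q hornerM hornerXn normrM -/q => H.
rewrite normrM (ger0_norm (expR_ge0 _)) expRN ler_pdivrMr ?expR_gt0 //.
have E : `|s^-1 ^+ 2| = (s ^+ 2)^-1 by rewrite exprVn ger0_norm // invr_ge0 sqr_ge0.
have s20 : 0 < s ^+ 2 by rewrite exprn_gt0.
move: H; rewrite E ler_pdivrMr // => H.
apply: le_trans H _; rewrite [leRHS]mulrAC ler_wpM2r ?(ltW s20) //.
rewrite /C0 -mulrA ler_wpM2l ?sumr_ge0 //.
exact: expR_dominates.
Qed.

Lemma is_derive_poly_bump (p : {poly R}) (s : R) :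
  is_derive s (1 : R) (poly_bump p) (poly_bump ('X^2 * (p - p^`())) s).
Proof.
have [s0|s0|->] := ltgtP s 0.
- rewrite [X in is_derive _ _ _ X]/poly_bump ltNge (ltW s0) /=.
  apply: (near_eq_is_derive (f := cst (0 : R))).
  near=> t; rewrite /poly_bump ltNge; suff -> : t <= 0 by [].
  by apply: ltW; near: t; exact: lt_nbhsl.
- rewrite [X in is_derive _ _ _ X]/poly_bump s0.
  have Dv : is_derive s (1 : R) (fun t : R => t^-1) (- s ^- 2).
    have sn : s != 0 by rewrite gt_eqF.
    apply: DeriveDef; first exact/derivable1_diffP/differentiable_Rinv.
    rewrite deriveE; last exact: differentiable_Rinv.
    by rewrite diff_Rinv // /GRing.scale /= mulr1.
  have Dp : is_derive s (1 : R) (fun t : R => p.[t^-1]) (p^`().[s^-1] * - s ^- 2).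
    exact: (is_derive1_comp (is_derive_poly p s^-1) Dv).
  have De : is_derive s (1 : R) (fun t : R => expR (- t^-1)) (expR (- s^-1) * s ^- 2).
    have Dn : is_derive s (1 : R) (fun t : R => - t^-1) (s ^- 2).
      by have := is_deriveN Dv; rewrite opprK.
    exact: (is_derive1_comp (is_derive_expR _) Dn).
  apply: (near_eq_is_derive (f := (fun t : R => p.[t^-1]) * (fun t : R => expR (- t^-1)))).
    near=> t; rewrite /poly_bump; suff -> : 0 < t by [].
    by near: t; exact: lt_nbhsr.
  apply: (is_derive_eq (is_deriveM Dp De)).
  by rewrite hornerM hornerXn hornerD hornerN exprVn /GRing.scale /=; ring.
rewrite [X in is_derive _ _ _ X]/poly_bump ltxx.
have [C C0 HC] := poly_bump_small p.
have D : is_diff (0 : R) (poly_bump p) (\0 : {linear R -> R}).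
  apply: is_diff_eps; first exact: cst_continuous.
  move=> e e0; near=> h.
  have h1 : `|h| <= 1 by near: h; apply: cvgr0_norm_le => //; exact: cvg_id.
  have he : `|h| <= e / (C + 1).
    by near: h; apply: cvgr0_norm_le; [exact: cvg_id|rewrite divr_gt0 // ltr_wpDl].
  rewrite addr0 /= subr0 {2}/poly_bump ltxx subr0; apply: le_trans (HC h h1) _.
  rewrite -real_normK ?num_real // expr2 mulrA ler_wpM2r //.
  apply: (@le_trans _ _ (C * (e / (C + 1)))); first exact: ler_wpM2l.
  by rewrite mulrCA ler_piMr ?(ltW e0) // ler_pdivrMr ?mul1r ?lerDl // ltr_wpDl.
apply: DeriveDef; first exact/derivable1_diffP/(@ex_diff _ _ _ _ _ _ _ D).
rewrite deriveE; last exact: (@ex_diff _ _ _ _ _ _ _ D).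
by rewrite (@diff_val _ _ _ _ _ _ _ D).
Unshelve. all: by end_near. Qed.

Lemma Ck_poly_bump p k : Ck k setT (poly_bump p).
Proof.
elim: k p => [|k IH] p.
  move=> x _; apply: differentiable_continuous; apply/derivable1_diffP.
  exact: (@ex_derive _ _ _ _ _ _ _ (is_derive_poly_bump p x)).
apply: (@Ck_real _ _ _ _ _ (poly_bump ('X^2 * (p - p^`())))) => //; first exact: openT.
by move=> x _; exact: is_derive_poly_bump.
Qed.

Definition bump : R -> R := poly_bump 1.

Lemma Ck_bump k : Ck k setT bump.
Proof. exact: Ck_poly_bump. Qed.

Lemma bump_gt0 s : 0 < s -> 0 < bump s.
Proof. by move=> s0; rewrite /bump /poly_bump s0 hornerC mul1r expR_gt0. Qed.

Lemma bump_le0 s : s <= 0 -> bump s = 0.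
Proof. by rewrite /bump /poly_bump leNgt => /negbTE ->. Qed.

Lemma bump_ge0 s : 0 <= bump s.
Proof. by have [/bump_le0 ->|/bump_gt0/ltW] := leP s 0. Qed.

Lemma bump_eq0 s : bump s <= 0 -> s <= 0.
Proof. by move=> H; rewrite leNgt; apply/negP => /bump_gt0; rewrite ltNge H. Qed.

(** Solves [exp(-1/s) <= c] for [s]. As [bump] stays below 1, this makes the sublevel sets at [1/2]
    of the gauges built from it bounded. *)
Lemma bump_bounded s (c : R) : 0 < c -> c < 1 -> bump s <= c -> s <= - (ln c)^-1.
Proof.
move=> c0 c1; have l0 : ln c < 0 by rewrite ln_lt0 // c0.
rewrite /bump /poly_bump; case: ifP => [s0|/negbT]; last first.
  by rewrite -leNgt => s0 _; apply: le_trans s0 _; rewrite -invrN invr_ge0 oppr_ge0 ltW.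
rewrite hornerC mul1r -{1}(lnK (c0 : c \is Num.pos)) ler_expR => H.
rewrite -invrN -[leLHS]invrK lef_pV2 ?posrE ?oppr_gt0 ?invr_gt0 //.
by rewrite lerNl.
Qed.

Section Cutoff.
Variables (X : normedModType R) (fX : findim X).

(** [G] is a smooth gauge of the compact set where it vanishes. The part of the sublevel set at
    [1/2] outside [U] is compact, so [G] has a positive minimum [m] there, and any level below [m]
    confines the support of the cutoff to [U]. *)
Lemma cutoff_exists (G : X -> R) (U : set X) (r0 : R) :
  (forall k, Ck k setT G) -> (forall x, 0 <= G x) -> (forall x, G x <= 2^-1 -> `|x| <= r0) ->
  open U -> (forall x, G x <= 0 -> U x) ->
  exists chi : X -> R, [/\ forall k, Ck k setT chi, forall x, 0 <= chi x,
    forall x, G x <= 0 -> chi x = 1 &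
    exists2 c : R, 0 < c <= 2^-1 & (forall x, c <= G x -> chi x = 0) /\ (forall x, G x <= c -> U x)].
Proof.
move=> CG G0 Gr oU GU.
have Gc : continuous G by apply: continuous_Ck0.
pose K1 := [set x | G x <= 2^-1] `&` ~` U.
have cK : compact K1.
  apply: (@subclosed_compact _ _ [set x : X | `|x| <= r0]).
  - apply: closedI; last exact: open_closedC.
    rewrite (_ : mkset _ = G @^-1` [set y | y <= 2^-1]) //.
    by apply: closed_comp => [x _|]; [exact: Gc|exact: closed_le].
  - exact: findim_compact.
  - by move=> x [/Gr].
have [m m0 Hm] : exists2 m : R, 0 < m & forall x, K1 x -> m <= G x.
  have [[x0 Kx0]|nK] := pselect (K1 !=set0); last first.
    by exists 1 => // x Kx; case: nK; exists x.
  have [|x Kx Hx] := @compact_EVT_min X R G K1 _ cK (continuous_subspaceT Gc).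
    by exists x0.
  exists (G x); last by move=> y Ky; apply: Hx; rewrite inE.
  rewrite ltNge; apply/negP => /GU Ux; move: Kx; rewrite inE => -[_]; exact.
(* Half of [m], so that [G <= c] is incompatible with [m <= G]. *)
pose c := Num.min 2^-1 (m / 2).
have c0 : 0 < c by rewrite lt_min invr_gt0 ltr0n divr_gt0.
have b1 : 0 < bump 1 by exact: bump_gt0.
exists (fun x => bump (1 - G x / c) / bump 1); split.
- move=> k; apply: Ck_mul; [exact: openT| |apply: Ck_cst; exact: openT].
  apply: (Ck_comp (findim_R R) openT (V := setT)) => //; last exact: Ck_bump.
  apply: Ck_add; [exact: openT|apply: Ck_cst; exact: openT|].
  apply: Ck_opp; first exact: openT.
  by apply: Ck_mul; [exact: openT| |apply: Ck_cst; exact: openT].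
- by move=> x; rewrite divr_ge0 ?bump_ge0.
- move=> x Gx; have -> : G x = 0 by apply/eqP; rewrite eq_le Gx G0.
  by rewrite mul0r subr0 divff // gt_eqF.
- exists c; first by rewrite c0 ge_min lexx.
  split=> x Gx.
    by rewrite bump_le0 ?mul0r // subr_le0 ler_pdivlMr // mul1r.
  have [//|nU] := pselect (U x).
  have : m <= G x by apply: Hm; split=> //; apply: le_trans Gx _; rewrite ge_min lexx.
  have : G x <= m / 2 by apply: le_trans Gx _; rewrite ge_min lexx orbT.
  lra.
Qed.

(** A point with [G <= c] lies in [U], where both factors are smooth; beyond level [c] the product
    is identically zero. The support is bounded, hence so is the field. *)
Lemma cutoff_field (Y : normedModType R) (G chi : X -> R) (U : set X) (r0 c : R) (W : X -> Y) :
  continuous G -> (forall k, Ck k setT chi) -> (forall x, G x <= 2^-1 -> `|x| <= r0) ->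
  open U -> (forall x, c <= G x -> chi x = 0) -> (forall x, G x <= c -> U x) ->
  c <= 2^-1 -> (forall k, Ck k U W) ->
  (forall k, Ck k setT (fun x => chi x *: W x)) /\
  exists M : R, forall x, `|chi x *: W x| <= M.
Proof.
move=> Gc Cchi Gr oU chi0 GU c2 CW.
have C k : Ck k setT (fun x => chi x *: W x).
  apply: Ck_local => x _; have [Gx|Gx] := leP (G x) c.
    exists U; first exact: GU.
    by apply: Ck_scale => //; exact: Ck_sub (Cchi k).
  exists [set x | c < G x] => //.
  have oG : open [set x | c < G x].
    rewrite (_ : mkset _ = G @^-1` [set y | c < y]) //.
    by apply: open_comp => [y _|]; [exact: Gc|exact: open_gt].
  by apply: Ck_ext (Ck_cst k 0 oG) => // y /= /ltW /chi0 ->; rewrite scale0r.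
split=> //; have [M M0 HM] := ball_bound r0 fX (continuous_Ck0 (C 0%N)).
exists M => x; have [Gx|Gx] := leP (G x) 2^-1; first exact/HM/Gr.
by rewrite chi0 ?scale0r ?normr0 // (le_trans c2) // ltW.
Qed.

End Cutoff.
End Bump.

(** * Lines of an arrangement *)

Section Flats.
Variables (R : realType) (n N : nat) (a : 'I_N -> 'rV[R]_n.+1) (b : 'I_N -> R).
Local Notation E := 'rV[R]_n.+1.
Implicit Types (S T : {set 'I_N}) (x y w u z : E) (s : R).

Definition hyp i : set E := [set x | dot (a i) x = b i].
Definition alpha i x : R := dot (a i) x - b i.
Definition flat S : set E := [set x | forall i, i \in S -> dot (a i) x = b i].
Definition dirs S : set E := [set w | forall i, i \in S -> dot (a i) w = 0].
Definition line z u : set E := [set z + s *: u | s in [set: R]].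
Definition through x : {set 'I_N} := [set i | alpha i x == 0]%SET.

Lemma alphaE i x : alpha i x = dot (a i) x - b i.
Proof. by []. Qed.

Lemma alpha_eq0 i x : (alpha i x == 0) = (dot (a i) x == b i).
Proof. by rewrite subr_eq0. Qed.

Lemma flat_through x : flat (through x) x.
Proof. by move=> i; rewrite inE alpha_eq0 => /eqP. Qed.

Lemma flat_add S x w : flat S x -> dirs S w -> flat S (x + w).
Proof. by move=> Sx Sw i iS; rewrite dotDr Sx // Sw // addr0. Qed.

Lemma flat_dirs S x y : flat S x -> flat S y -> dirs S (y - x).
Proof. by move=> Sx Sy i iS; rewrite dotBr Sx // Sy // subrr. Qed.

Lemma dirs_scale S w s : dirs S w -> dirs S (s *: w).
Proof. by move=> Sw i iS; rewrite dotZr Sw // mulr0. Qed.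

Lemma flatS S T : S \subset T -> flat T `<=` flat S.
Proof. by move=> /fintype.subsetP ST x Tx i /ST; exact: Tx. Qed.

Lemma flat_line S x w i : flat S x -> dirs S w -> dot (a i) w != 0 ->
  (forall v, dirs S v -> dot (a i) v = 0 -> v = 0) -> flat S = line x w.
Proof.
move=> Sx Sw iw H; apply/seteqP; split=> [y Sy|_ [s _ <-]]; last first.
  by apply: flat_add => //; exact: dirs_scale.
have Sv := flat_dirs Sx Sy.
exists (dot (a i) (y - x) / dot (a i) w) => //; apply/eqP; rewrite eq_sym -subr_eq0 opprD addrA; apply/eqP.
set v := y - x in Sv *.
apply: H; last by rewrite dotBr dotZr divfK // subrr.
by move=> j jS; rewrite [LHS]dotBr dotZr (Sw _ jS) (Sv _ jS) mulr0 subrr.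
Qed.

Hypothesis a0 : forall i, a i != 0.
Hypothesis ess : forall w, (forall i, dot (a i) w = 0) -> w = 0.

Lemma ess_neq w : w != 0 -> exists i, dot (a i) w != 0.
Proof.
move=> w0; apply: contrapT => H; move/eqP: w0; apply; apply: ess => i.
by apply/eqP; apply: contrapT => /negP Hi; apply: H; exists i.
Qed.

(** Take the largest [T] containing [S] whose flat is nonempty and has a nonzero direction [u].
    Essentiality gives a normal [a i] not orthogonal to [u]; a second direction orthogonal to [a i]
    would allow adding [i] to [T]. *)
Lemma line_in_flat S x w : flat S x -> dirs S w -> w != 0 ->
  exists T z u, [/\ S \subset T, u != 0 & flat T = line z u].
Proof.
move=> Sx Sw w0.
pose P (T : {set 'I_N}) := (S \subset T) && `[< exists x w, [/\ flat T x, dirs T w & w != 0] >].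
have PS : P S by rewrite /P subxx; apply/asboolP; exists x, w.
case: (@arg_maxnP _ S P (fun T => #|T|) PS) => T /andP[ST /asboolP[z [u [Tz Tu u0]]]] max.
have [i iu] := ess_neq u0.
have iT : i \notin T by apply/negP => /Tu /eqP; rewrite (negbTE iu).
exists T, z, u; split=> //; apply: (flat_line Tz Tu iu) => v Tv iv.
apply/eqP; apply: contrapT => /negP v0.
have : P (i |: T).
  rewrite /P (fintype.subset_trans ST) ?finset.subsetU1 //=; apply/asboolP.
  (* The point of the flat moved along [u] onto the hyperplane of index [i], which keeps the larger
     flat nonempty. *)
  exists (z + ((b i - dot (a i) z) / dot (a i) u) *: u), v; split=> //.
    move=> j; rewrite !inE => /orP[/eqP ->|jT]; last by apply: (flat_add Tz) => //; exact: dirs_scale.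
    by rewrite dotDr dotZr divfK // addrC subrK.
  by move=> j; rewrite !inE => /orP[/eqP ->|] //; exact: Tv.
by move/max => /=; rewrite cardsU1 iT /= add1n ltnn.
Qed.

(** Dual to the previous argument: hyperplanes through the vertex are discarded, keeping a largest
    family that still has a nonzero common direction. All its members contain [x], so the flat
    remains nonempty. *)
Lemma line_through_point S x : flat S x -> (forall w, dirs S w -> w = 0) ->
  exists T z u, [/\ flat T x, u != 0 & flat T = line z u].
Proof.
move=> Sx S0.
pose P (T : {set 'I_N}) := (T \subset S) && `[< exists w, dirs T w /\ w != 0 >].
have P0 : P finset.set0.
  rewrite /P finset.sub0set; apply/asboolP; exists (delta_mx 0 0); split; first by move=> i; rewrite inE.
  apply/negP => /eqP /rowP /(_ 0); rewrite !mxE !eqxx => /eqP.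
  by rewrite oner_eq0.
case: (@arg_maxnP _ finset.set0 P (fun T => #|T|) P0) => T /andP[TS /asboolP[u [Tu u0]]] max.
have [i iS iT] : exists2 i, i \in S & i \notin T.
  apply/fintype.subsetPn; apply/negP => ST; move/eqP: u0; apply; apply: S0.
  by move=> j jS; apply: Tu; apply: (fintype.subsetP ST).
have H v : dirs T v -> dot (a i) v = 0 -> v = 0.
  move=> Tv iv; apply/eqP; apply: contrapT => /negP v0.
  have : P (i |: T).
    rewrite /P finset.subUset finset.sub1set iS TS /=; apply/asboolP; exists v; split=> //.
    by move=> j; rewrite !inE => /orP[/eqP ->|] //; exact: Tv.
  by move/max => /=; rewrite cardsU1 iT /= add1n ltnn.
have Tx : flat T x by exact: flatS TS x Sx.
exists T, x, u; split=> //; apply: (flat_line Tx Tu _ H).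
by apply: contra_neq u0; exact: H.
Qed.

(** Genericity in adapted coordinates: no vertex lies on F, and no one-dimensional stratum is
    parallel to F. *)
Hypothesis gen0 : forall S x, flat S = [set x] -> hgt x != 0.
Hypothesis gen1 : forall S z u, u != 0 -> flat S = line z u -> hgt u != 0.

(* A line meets every height exactly once; it is parametrized by the height. *)
Definition hline T z u : Prop := [/\ hgt z = 0, hgt u = 1 & flat T = line z u].
Definition is_line T : Prop := exists zu : E * E, hline T zu.1 zu.2.
(** The two conditions in [hline] on the heights make the pair unique; for a [T] whose flat is not a
    line the value is the default [(0, 0)]. *)
Definition line_par T : E * E := xget (0, 0) [set zu | hline T zu.1 zu.2].
Definition line_pt T s : E := (line_par T).1 + s *: (line_par T).2.

Lemma is_lineP T z u : u != 0 -> flat T = line z u -> is_line T.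
Proof.
move=> u0 Tzu; have hu := gen1 u0 Tzu.
exists (z - (hgt z / hgt u) *: u, (hgt u)^-1 *: u); split=> /=.
- by rewrite hgtB hgtZ divfK // subrr.
- by rewrite hgtZ mulVf.
rewrite Tzu; apply/seteqP; split=> _ [s _ <-].
  exists (s * hgt u + hgt z) => //; rewrite scalerA mulrDl mulfK // scalerDl [s *: u + _]addrC addrA subrK //.
exists (s / hgt u - hgt z / hgt u) => //.
by rewrite scalerBl scalerA addrA addrAC.
Qed.

Section OneLine.
Variable T : {set 'I_N}.
Hypothesis lT : is_line T.

Lemma line_parP : hline T (line_par T).1 (line_par T).2.
Proof. by have [zu Hzu] := lT; apply: (@xgetPex _ (0, 0) [set zu : E * E | hline T zu.1 zu.2]); exists zu. Qed.

Lemma hgt_line_pt s : hgt (line_pt T s) = s.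
Proof. by have [z0 u1 _] := line_parP; rewrite hgtD hgtZ z0 u1 add0r mulr1. Qed.

Lemma flat_line_pt s : flat T (line_pt T s).
Proof. by have [_ _ ->] := line_parP; exists s. Qed.

Lemma line_ptE y : flat T y -> y = line_pt T (hgt y).
Proof.
have [z0 u1 ->] := line_parP => -[s _ <-].
by rewrite hgtD hgtZ z0 u1 add0r mulr1.
Qed.

Lemma dirs_line : dirs T (line_par T).2.
Proof.
have H0 := flat_line_pt 0; have H1 := flat_line_pt 1.
have := flat_dirs H0 H1; rewrite /line_pt scale0r scale1r addr0.
by rewrite addrAC subrr add0r.
Qed.
End OneLine.

Lemma exists_line S x w : flat S x -> dirs S w -> w != 0 ->
  exists2 T : {set 'I_N}, S \subset T & is_line T.
Proof.
move=> Sx Sw w0; have [T [z [u [ST u0 Tzu]]]] := line_in_flat Sx Sw w0.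
by exists T => //; exact: is_lineP u0 Tzu.
Qed.

Variable A : set (set E).
Hypothesis HA : A = [set hyp i | i in [set: 'I_N]].

Lemma intersectionP X : intersection A X <-> exists S, X = flat S.
Proof.
split=> [[B BA ->]|[S ->]].
  exists [set i | `[< B (hyp i) >]]%SET; apply/seteqP; split=> x Hx.
    by move=> i; rewrite inE => /asboolP /Hx.
  move=> H BH; have := BA H BH; rewrite HA => -[i _ Hi]; rewrite -Hi.
  by apply: Hx; rewrite inE; apply/asboolP; rewrite Hi.
exists [set hyp i | i in [set i | i \in S]].
  by move=> _ [i _ <-]; rewrite HA; exists i.
apply/seteqP; split=> x Hx; first by move=> _ [i /= iS <-]; exact: Hx.
by move=> i iS; apply: (Hx (hyp i)); exists i.
Qed.

Lemma has_dim1P (X : set E) : has_dim X 1 <-> exists z u, u != 0 /\ X = line z u.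
Proof.
split=> [[z [U [-> U1]]]|[z [u [u0 ->]]]].
  have U0 : U != 0%VS by rewrite -dimv_eq0 U1.
  exists z, (vpick U); split; first by rewrite vpick0.
  have EU : U = <[vpick U]>%VS.
    apply/eqP; rewrite eq_sym eqEdim -memvE memv_pick U1 dim_vline vpick0 U0 //.
  apply/seteqP; split=> [x /=|_ [s _ <-] /=].
    rewrite {1}EU => /vlineP[s Hs]; by exists s => //; rewrite -Hs addrC subrK.
  by rewrite addrC addKr memvZ // memv_pick.
exists z, <[u]>%VS; split; last by rewrite dim_vline u0.
apply/seteqP; split=> [_ [s _ <-] /=|x /= /vlineP[s Hs]].
  by rewrite addrC addKr memvZ // memv_line.
by exists s => //; rewrite -Hs addrC subrK.
Qed.

Lemma line_radiiP r : line_radii A r <->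
  exists T s, [/\ is_line T, 0 <= s <= 1 & r = enorm (hor (line_pt T s))].
Proof.
split=> [[X [x [/intersectionP[T ->] /has_dim1P[z [u [u0 Tzu]]] Tx xs ->]]]|[T [s [lT s01 ->]]]].
  have lT := is_lineP u0 Tzu; exists T, (hgt x); split=> //.
  by rewrite -line_ptE.
exists (flat T), (line_pt T s); split.
- by apply/intersectionP; exists T.
- have [z0 u1 ->] := line_parP lT; apply/has_dim1P.
  exists (line_par T).1, (line_par T).2; split=> //; apply/eqP => E0.
  by move: u1; rewrite E0 hgt0 => /eqP; rewrite eq_sym oner_eq0.
- exact: flat_line_pt.
- by rewrite hgt_line_pt.
- by [].
Qed.

Hypothesis n0 : (0 < n)%N.
Hypothesis p0C : forall i, dot (a i) (@p0 R n) != b i.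

Lemma exists_horizontal : exists2 w : E, w != 0 & hgt w = 0.
Proof.
exists (vec (const_mx 1) 0); last by rewrite hgt_vec.
apply/eqP => /(congr1 (@hor R n)); rewrite hor_vec hor0 => /rowP /(_ (Ordinal n0)).
by rewrite !mxE => /eqP; rewrite oner_eq0.
Qed.

Lemma has_sup_line_radii : has_sup (line_radii A).
Proof.
split.
  have [w w0 _] := exists_horizontal.
  have [||T _ lT] := @exists_line finset.set0 0 w _ _ w0; try by move=> i; rewrite inE.
  by exists (enorm (hor (line_pt T 0))); apply/line_radiiP; exists T, 0; rewrite lexx ler01.
exists (\sum_(T : {set 'I_N}) (enorm (hor (line_par T).1) + enorm (hor (line_par T).2))).
move=> r /line_radiiP[T [s [lT /andP[s0 s1] ->]]].
rewrite (bigD1 T) //= -[leLHS]addr0 lerD //.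
  rewrite horD horZ; apply: le_trans (enormD _ _) _; rewrite lerD2l enormZ ger0_norm //.
  by rewrite ler_piMl ?enorm_ge0.
by apply: sumr_ge0 => *; rewrite addr_ge0 ?enorm_ge0.
Qed.

Lemma line_le T s : is_line T -> 0 <= s <= 1 ->
  enorm (hor (line_pt T s)) <= cyl_radius A / 2.
Proof.
move=> lT s01; rewrite /cyl_radius mulrC mulKf ?pnatr_eq0 //.
by apply: sup_upper_bound; [exact: has_sup_line_radii|apply/line_radiiP; exists T, s].
Qed.

Lemma line_neq0 T : is_line T -> exists i, i \in T.
Proof.
move=> lT; apply/finset.set0Pn/eqP => T0; have [w w0 w1] := exists_horizontal.
have TT y : flat T y by move=> i; rewrite T0 inE.
have := line_ptE lT (TT w); rewrite w1 => Ew.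
have := line_ptE lT (TT 0); rewrite hgt0 => E0.
by move/eqP: w0; rewrite Ew -E0.
Qed.

(** A stratum line lies in some hyperplane, so at height 1 it avoids the axis: the point of the axis
    there is [p0], which is on no hyperplane. *)
Lemma cyl_radius_gt0 : 0 < cyl_radius A.
Proof.
have [w w0 _] := exists_horizontal.
have [||T _ lT] := @exists_line finset.set0 0 w _ _ w0; try by move=> i; rewrite inE.
suff : 0 < cyl_radius A / 2 by rewrite pmulr_lgt0 // invr_gt0.
apply: lt_le_trans (@line_le T 1 lT _); last by rewrite ler01 lexx.
rewrite enorm_gt0 //; apply/eqP => h0; have [i iT] := line_neq0 lT.
have := flat_line_pt lT 1 iT.
rewrite (_ : line_pt T 1 = @p0 R n); first by move/eqP; rewrite (negbTE (p0C i)).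
by apply: vec_inj; rewrite ?h0 ?hgt_line_pt // /p0 ?hor_vec ?hgt_vec.
Qed.

(** If the hyperplanes through [y] met only in [y], then [y] would be a vertex. Vertices are not on
    F, and a vertex at height between 0 and 1 lies on a stratum line, hence within R/2 of the
    axis. *)
Lemma line_through y : hgt y = 0 \/ (0 <= hgt y <= 1 /\ cyl_radius A / 2 < enorm (hor y)) ->
  exists2 T : {set 'I_N}, through y \subset T & is_line T.
Proof.
move=> Hy; have Fy := @flat_through y.
have [[w [w0 Sw]]|H] := pselect (exists w, w != 0 /\ dirs (through y) w).
  exact: exists_line Fy Sw w0.
have S0 w : dirs (through y) w -> w = 0.
  by move=> Sw; apply/eqP; apply: contrapT => /negP w0; apply: H; exists w.
exfalso; case: Hy => [y0|[y01 yR]].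
  have : flat (through y) = [set y].
    apply/seteqP; split=> [x Sx|_ ->//]; apply/eqP; rewrite -subr_eq0; apply/eqP.
    exact/S0/flat_dirs.
  by move/gen0; rewrite y0 eqxx.
have [T [z [u [Ty u0 Tzu]]]] := line_through_point Fy S0.
have lT := is_lineP u0 Tzu.
have := line_le lT y01; rewrite -(line_ptE lT Ty) => /(lt_le_trans yR).
by rewrite ltxx.
Qed.

Lemma line_in_hyp i : exists2 T : {set 'I_N}, i \in T & is_line T.
Proof.
have [x Hx] : exists x, dot (a i) x = b i.
  exists ((b i / dot (a i) (a i)) *: a i); rewrite dotZr divfK // gt_eqF //.
  exact: dot_gt0.
have [w w0 aw] : exists2 w, w != 0 & dot (a i) w = 0.
  (* A direction orthogonal to [a i], of shape [(h 1, - a' . 1)] with [h] the height of the normal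
     and [a'] its horizontal part. If it is zero, the normal is horizontal and the vertical
     direction serves. *)
  pose w := vec (hgt (a i) *: (const_mx 1 : 'rV[R]_n)) (- dot (hor (a i)) (const_mx 1)).
  have [w0|] := eqVneq w 0; last first.
    exists w => //; rewrite dot_hor hor_vec hgt_vec dotZr; ring.
  exists (vec 0 1).
    by apply/eqP => /(congr1 (@hgt R n)); rewrite hgt_vec hgt0 => /eqP; rewrite oner_eq0.
  have := congr1 (@hor R n) w0; rewrite hor_vec hor0 => /rowP /(_ (Ordinal n0)).
  by rewrite !mxE mulr1 dot_hor hor_vec hgt_vec dot0r add0r mulr1.
have [||T iT lT] := @exists_line [set i]%SET x w _ _ w0.
- by move=> j; rewrite inE => /eqP ->.
- by move=> j; rewrite inE => /eqP ->.
by exists T => //; apply: (fintype.subsetP iT); rewrite inE.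
Qed.

(** The hyperplane contains a stratum line, which meets every height, so it is not parallel to F. *)
Lemma hor_normal_neq0 i : hor (a i) != 0.
Proof.
have [T iT lT] := line_in_hyp i.
apply: contra_neq (a0 i) => h0; apply: vec_inj; rewrite ?h0 ?hor0 // hgt0.
have := dirs_line lT iT; rewrite dot_hor h0 dot0l add0r.
by have [_ -> _] := line_parP lT; rewrite mulr1.
Qed.

End Flats.

(** The arrangement as seen in adapted coordinates, with equations chosen: F has become height zero
    and p has become [p0]. *)
Record in_position (R : realType) (n N : nat) (A : set (set 'rV[R]_n.+1))
    (a : 'I_N -> 'rV[R]_n.+1) (b : 'I_N -> R) : Prop := InPosition {
  pos_dim : (0 < n)%N;
  pos_normal : forall i, a i != 0;
  pos_ess : forall w, (forall i, dot (a i) w = 0) -> w = 0;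
  pos_point : forall S x, flat a b S = [set x] -> hgt x != 0;
  pos_line : forall S z u, u != 0 -> flat a b S = line z u -> hgt u != 0;
  pos_range : A = [set hyp a b i | i in [set: 'I_N]];
  pos_base : forall i, dot (a i) (@p0 R n) != b i }.

(** * A smooth field tangent to the hyperplanes and to the rim of the cylinder *)

Section StratifiedField.
Variables (R : realType) (n N : nat) (A : set (set 'rV[R]_n.+1)).
Variables (a : 'I_N -> 'rV[R]_n.+1) (b : 'I_N -> R).
Hypothesis G : in_position A a b.
Local Notation E := 'rV[R]_n.+1.
Local Notation alpha := (alpha a b).
Local Notation is_line := (is_line a b).
Local Notation line_par := (line_par a b).
Local Notation line_pt := (line_pt a b).
Local Notation through := (through a b).
Local Notation R0 := (cyl_radius A).
Implicit Types (x y w u z : E) (T : {set 'I_N}).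

Let n0 := pos_dim G.
Let a0 := pos_normal G.
Let ess := pos_ess G.
Let gen0 := pos_point G.
Let gen1 := pos_line G.
Let HA := pos_range G.
Let p0C := pos_base G.

Lemma position_radius_gt0 : 0 < R0.
Proof. exact: (cyl_radius_gt0 ess gen1 HA n0 p0C). Qed.

Lemma position_line_le T s : is_line T -> 0 <= s <= 1 -> enorm (hor (line_pt T s)) <= R0 / 2.
Proof. exact: (line_le ess gen1 HA n0). Qed.

Lemma position_line_through y : hgt y = 0 \/ (0 <= hgt y <= 1 /\ R0 / 2 < enorm (hor y)) ->
  exists2 T : {set 'I_N}, through y \subset T & is_line T.
Proof. exact: (line_through ess gen0 gen1 HA n0). Qed.

Lemma position_line_in_hyp i : exists2 T : {set 'I_N}, i \in T & is_line T.
Proof. exact: (line_in_hyp a0 ess gen1 n0). Qed.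

Lemma position_hor_normal_neq0 i : hor (a i) != 0.
Proof. exact: (hor_normal_neq0 a0 ess gen1 n0). Qed.

Lemma alphaB i x y : alpha i x - alpha i y = dot (a i) (x - y).
Proof. by rewrite /alpha opprB addrA subrK dotBr. Qed.

Lemma line_weight_off T i y : i \notin T ->
  \prod_(j | j \notin T) alpha j y ^+ 2 =
  alpha i y * (alpha i y * \prod_(j | (j \notin T) && (j != i)) alpha j y ^+ 2).
Proof. by move=> iT; rewrite (bigD1 i) //= expr2 mulrA. Qed.

(* The weight of a line vanishes on every hyperplane not indexed by it, so at y only the lines
   contained in all the hyperplanes through y contribute to the sums below. *)
Definition line_weight T y : R := \prod_(i | i \notin T) alpha i y ^+ 2.
Definition mass y : R := \sum_(T | `[< is_line T >]) line_weight T y.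
Definition upward y : E := \sum_(T | `[< is_line T >]) line_weight T y *: (line_par T).2.
Definition outward y : E :=
  \sum_(T | `[< is_line T >]) line_weight T y *: (y - line_pt T (hgt y)).

Definition out_dot y : R := dot (hor y) (hor (outward y)).
Definition up_dot y : R := dot (hor y) (hor (upward y)).
Definition rim y : R := R0 ^+ 2 - dot (hor y) (hor y).
(** On the rim this is the quotient [up_dot / out_dot], which cancels the radial component. Adding
    [rim^2] to the denominator keeps it smooth inside, where [out_dot] may vanish; the radial
    component that remains is a multiple of [rim]. *)
Definition corr y : R := up_dot y * out_dot y / (out_dot y ^+ 2 + rim y ^+ 2).
Definition denom y : R := mass y * (out_dot y ^+ 2 + rim y ^+ 2).
Definition strat_field y : E := (mass y)^-1 *: (upward y - corr y *: outward y).

(** The quotient of [dot (a i) (upward y)] by [alpha i y], written without division: if the line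
    does not lie in the hyperplane, its weight contains the square of [alpha i y], and otherwise the
    term is zero. *)
Definition upward_coef i y : R :=
  \sum_(T | `[< is_line T >]) (if i \in T then 0 else
    alpha i y * \prod_(j | (j \notin T) && (j != i)) alpha j y ^+ 2 * dot (a i) (line_par T).2).
Definition outward_coef i y : R := \sum_(T | `[< is_line T >])
  (if i \in T then line_weight T y else
   alpha i y * \prod_(j | (j \notin T) && (j != i)) alpha j y ^+ 2 *
     dot (a i) (y - line_pt T (hgt y))).
Definition field_coef i y : R := (mass y)^-1 * (upward_coef i y - corr y * outward_coef i y).

Lemma dot_upward i y : dot (a i) (upward y) = upward_coef i y * alpha i y.
Proof.
rewrite dot_sumr mulr_suml; apply: eq_bigr => T /asboolP lT.
rewrite dotZr; case: ifPn => iT; first by rewrite (dirs_line lT) // mulr0 mul0r.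
by rewrite /line_weight (line_weight_off _ iT); ring.
Qed.

Lemma dot_outward i y : dot (a i) (outward y) = outward_coef i y * alpha i y.
Proof.
rewrite dot_sumr mulr_suml; apply: eq_bigr => T /asboolP lT.
rewrite dotZr; case: ifPn => iT; last by rewrite /line_weight (line_weight_off _ iT); ring.
by rewrite -alphaB [X in _ - X](_ : _ = 0) ?subr0 // alphaE (flat_line_pt lT _ iT) subrr.
Qed.

Lemma dot_strat_field i y : dot (a i) (strat_field y) = field_coef i y * alpha i y.
Proof. by rewrite dotZr dotBr dotZr dot_upward dot_outward /field_coef; ring. Qed.

Lemma hgt_sum (I : Type) (r : seq I) (P : pred I) (F : I -> E) :
  hgt (\sum_(i <- r | P i) F i) = \sum_(i <- r | P i) hgt (F i).
Proof. by elim/big_rec2: _ => [|i x y _ <-]; rewrite ?hgt0 // hgtD. Qed.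

Lemma hor_sum (I : Type) (r : seq I) (P : pred I) (F : I -> E) :
  hor (\sum_(i <- r | P i) F i) = \sum_(i <- r | P i) hor (F i).
Proof. by elim/big_rec2: _ => [|i x y _ <-]; rewrite ?hor0 // horD. Qed.

Lemma hgt_upward y : hgt (upward y) = mass y.
Proof.
rewrite hgt_sum; apply: eq_bigr => T /asboolP lT.
by have [_ u1 _] := line_parP lT; rewrite hgtZ u1 mulr1.
Qed.

Lemma hgt_outward y : hgt (outward y) = 0.
Proof.
rewrite hgt_sum big1 // => T /asboolP lT.
by rewrite hgtZ hgtB hgt_line_pt // subrr mulr0.
Qed.

Lemma denom_neq0 y : denom y != 0 -> mass y != 0 /\ out_dot y ^+ 2 + rim y ^+ 2 != 0.
Proof. by rewrite mulf_eq0 negb_or => /andP. Qed.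

Lemma hgt_strat_field y : denom y != 0 -> hgt (strat_field y) = 1.
Proof.
move=> /denom_neq0[m0 _].
by rewrite hgtZ hgtB hgtZ hgt_upward hgt_outward mulr0 subr0 mulVf.
Qed.

Lemma dot_hor_strat_field y : denom y != 0 -> dot (hor y) (hor (strat_field y)) =
  (mass y)^-1 * up_dot y / (out_dot y ^+ 2 + rim y ^+ 2) * rim y * rim y.
Proof.
move=> /denom_neq0[m0 c0]; rewrite horZ horB horZ dotZr dotBr dotZr.
by rewrite -/(up_dot y) -/(out_dot y) /corr; field; rewrite m0 c0.
Qed.

Lemma line_weight_ge0 T y : 0 <= line_weight T y.
Proof. by apply: prodr_ge0 => i _; exact: sqr_ge0. Qed.

Lemma line_weight_gt0 T y : through y \subset T -> 0 < line_weight T y.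
Proof.
move=> /fintype.subsetP yT; apply: prodr_gt0 => i iT; rewrite exprn_even_gt0 //=.
by apply: contra iT => ai0; apply: yT; rewrite inE.
Qed.

Lemma mass_gt0 y T : is_line T -> through y \subset T -> 0 < mass y.
Proof.
move=> lT yT; rewrite /mass (bigD1 T) /=; last exact/asboolP.
rewrite ltr_pwDl ?line_weight_gt0 //.
by apply: sumr_ge0 => *; exact: line_weight_ge0.
Qed.

(** Every stratum line is within R/2 of the axis while [y] is at distance R, so each displacement
    has a positive radial component; at least one weight is positive. *)
Lemma out_dot_gt0 y : enorm (hor y) = R0 -> 0 <= hgt y <= 1 -> 0 < out_dot y.
Proof.
move=> yR y01; have R00 := position_radius_gt0.
have [|T yT lT] := @position_line_through y.
  by right; split=> //; rewrite yR ltr_pdivrMr // ltr_pMr // ltr1n.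
rewrite /out_dot hor_sum dot_sumr.
have P T' : is_line T' -> 0 < dot (hor y) (hor (y - line_pt T' (hgt y))).
  move=> lT'; rewrite horB dotBr -enorm_sqr yR subr_gt0.
  apply: le_lt_trans (dot_cauchy_le _ _) _; rewrite yR.
  have H := position_line_le lT' y01; nra.
rewrite (bigD1 T) /=; last exact/asboolP.
rewrite ltr_pwDl //; first by rewrite horZ dotZr mulr_gt0 ?line_weight_gt0 ?P.
apply: sumr_ge0 => T' /andP[/asboolP lT' _].
by rewrite horZ dotZr mulr_ge0 ?line_weight_ge0 // ltW // P.
Qed.

Lemma denom_cyl y : Cyl A y -> denom y != 0.
Proof.
move=> [yR y01]; have R00 := position_radius_gt0; apply: mulf_neq0.
  have [|T yT lT] := @position_line_through y; last by rewrite gt_eqF // (mass_gt0 lT yT).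
  by right; split=> //; rewrite yR ltr_pdivrMr // ltr_pMr // ltr1n.
have := out_dot_gt0 yR y01 => d0.
by rewrite gt_eqF // ltr_pwDl ?exprn_gt0 ?sqr_ge0.
Qed.

Lemma denom_cyl0 y : Cyl_0 A y -> denom y != 0.
Proof.
move=> [yR y0]; apply: mulf_neq0.
  have [|T yT lT] := @position_line_through y; first by left.
  by rewrite gt_eqF // (mass_gt0 lT yT).
have [yE|yN] := eqVneq (enorm (hor y)) R0.
  have := @out_dot_gt0 y yE; rewrite y0 lexx ler01 => /(_ isT) d0.
  by rewrite gt_eqF // ltr_pwDl ?exprn_gt0 ?sqr_ge0.
rewrite gt_eqF // ltr_wpDl ?sqr_ge0 // exprn_gt0 // /rim -enorm_sqr subr_gt0.
by rewrite ltr_sqr ?nnegrE ?enorm_ge0 ?(ltW position_radius_gt0) // lt_neqAle yN.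
Qed.

Section Smoothness.
Variables (k : nat) (U : set E).
Hypothesis oU : open U.

Lemma Ck_alpha i : Ck k U (alpha i).
Proof.
apply: Ck_add => //; last exact: Ck_cst.
by apply: Ck_dot => //; [exact: Ck_cst|exact: Ck_id].
Qed.

Lemma Ck_line_weight T : Ck k U (line_weight T).
Proof. by apply: Ck_prodI => // i _; apply: Ck_exp => //; exact: Ck_alpha. Qed.

Lemma Ck_mass : Ck k U mass.
Proof. by apply: Ck_sumI => // T _; exact: Ck_line_weight. Qed.

Lemma Ck_line_pt T : Ck k U (fun y => line_pt T (hgt y)).
Proof.
apply: Ck_add => //; first exact: Ck_cst.
by apply: Ck_scale => //; [apply: Ck_hgt => //; exact: Ck_id|exact: Ck_cst].
Qed.

Lemma Ck_upward : Ck k U upward.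
Proof.
by apply: Ck_sumI => // T _; apply: Ck_scale => //; [exact: Ck_line_weight|exact: Ck_cst].
Qed.

Lemma Ck_disp T : Ck k U (fun y => y - line_pt T (hgt y)).
Proof.
by apply: Ck_add => //; [exact: Ck_id|apply: Ck_opp => //; exact: Ck_line_pt].
Qed.

Lemma Ck_outward : Ck k U outward.
Proof.
by apply: Ck_sumI => // T _; apply: Ck_scale => //; [exact: Ck_line_weight|exact: Ck_disp].
Qed.

Lemma Ck_hor_id : Ck k U (@hor R n).
Proof. by apply: Ck_hor => //; exact: Ck_id. Qed.

Lemma Ck_out_dot : Ck k U out_dot.
Proof.
by apply: Ck_dot => //; [exact: Ck_hor_id|apply: Ck_hor => //; exact: Ck_outward].
Qed.

Lemma Ck_up_dot : Ck k U up_dot.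
Proof.
by apply: Ck_dot => //; [exact: Ck_hor_id|apply: Ck_hor => //; exact: Ck_upward].
Qed.

Lemma Ck_rim : Ck k U rim.
Proof.
apply: Ck_add => //; first exact: Ck_cst.
by apply: Ck_opp => //; apply: Ck_dot => //; exact: Ck_hor_id.
Qed.

Lemma Ck_rim_dot : Ck k U (fun y => out_dot y ^+ 2 + rim y ^+ 2).
Proof.
apply: Ck_add => //; apply: Ck_exp => //; [exact: Ck_out_dot|exact: Ck_rim].
Qed.

Lemma Ck_denom : Ck k U denom.
Proof. by apply: Ck_mul => //; [exact: Ck_mass|exact: Ck_rim_dot]. Qed.

Hypothesis U0 : forall y, U y -> denom y != 0.

Lemma Ck_mass_inv : Ck k U (fun y => (mass y)^-1).
Proof. by apply: Ck_invf => //; [move=> y /U0 /denom_neq0[]|exact: Ck_mass]. Qed.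

Lemma Ck_rim_dot_inv : Ck k U (fun y => (out_dot y ^+ 2 + rim y ^+ 2)^-1).
Proof. by apply: Ck_invf => //; [move=> y /U0 /denom_neq0[]|exact: Ck_rim_dot]. Qed.

Lemma Ck_corr : Ck k U corr.
Proof.
apply: Ck_mul => //; last exact: Ck_rim_dot_inv.
by apply: Ck_mul => //; [exact: Ck_up_dot|exact: Ck_out_dot].
Qed.

Lemma Ck_strat_field : Ck k U strat_field.
Proof.
apply: Ck_scale => //; first exact: Ck_mass_inv.
apply: Ck_add => //; first exact: Ck_upward.
apply: Ck_opp => //; apply: Ck_scale => //; [exact: Ck_corr|exact: Ck_outward].
Qed.

Lemma Ck_rest T i : Ck k U
  (fun y => alpha i y * \prod_(j | (j \notin T) && (j != i)) alpha j y ^+ 2).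
Proof.
apply: Ck_mul => //; first exact: Ck_alpha.
by apply: Ck_prodI => // j _; apply: Ck_exp => //; exact: Ck_alpha.
Qed.

Lemma Ck_field_coef i : Ck k U (field_coef i).
Proof.
apply: Ck_mul => //; first exact: Ck_mass_inv.
apply: Ck_add => //.
  apply: Ck_sumI => // T _; case: (i \in T); first exact: Ck_cst.
  by apply: Ck_mul => //; [exact: Ck_rest|exact: Ck_cst].
apply: Ck_opp => //; apply: Ck_mul => //; first exact: Ck_corr.
apply: Ck_sumI => // T _; case: (i \in T); first exact: Ck_line_weight.
apply: Ck_mul => //; first exact: Ck_rest.
by apply: Ck_dot => //; [exact: Ck_cst|exact: Ck_disp].
Qed.
End Smoothness.

Lemma open_denom : open [set y | denom y != 0].
Proof.
have C : continuous denom by apply/continuous_Ck0/Ck_denom; exact: openT.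
rewrite (_ : mkset _ = denom @^-1` [set x : R | x != 0]) //.
by apply: open_comp => [x _|]; [exact: C|exact: open_neq0].
Qed.

Lemma tangent_field_exists : exists V, tangent_field A V.
Proof.
exists strat_field; split.
- exists [set y | denom y != 0]; split=> [|y|k]; first exact: open_denom.
    exact: denom_cyl.
  by apply: Ck_strat_field => //; exact: open_denom.
- move=> y Cy; have D := denom_cyl Cy; rewrite hgt_strat_field //; split=> //.
  rewrite dot_hor_strat_field // /rim -enorm_sqr; have [-> _] := Cy.
  by rewrite subrr mulr0.
- move=> H y; rewrite {1}HA => -[i _ <-] Cy /= Hy.
  by rewrite /hyp /= dotDr dot_strat_field alphaE Hy subrr mulr0 addr0.
Qed.

End StratifiedField.

(** * Flows with vertical component 1 *)

Section DeriveRows.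
Variable R : realType.
Implicit Types n : nat.

Lemma is_derive_row n (y : R -> 'rV[R]_n) (dy : 'rV[R]_n) (t : R) :
  (forall j, is_derive t (1 : R) (fun s => y s 0 j) (dy 0 j)) -> is_derive t (1 : R) y dy.
Proof.
move=> H; have Dj j : is_derive t (1 : R) (fun s => y s 0 j *: (delta_mx 0 j : 'rV[R]_n)) (dy 0 j *: delta_mx 0 j).
  have D := is_diff_fun_scale (is_diff_real (H j)) (is_diff_cst (delta_mx 0 j : 'rV[R]_n) t).
  apply: DeriveDef; first exact/derivable1_diffP/(@ex_diff _ _ _ _ _ _ _ D).
  rewrite deriveE; last exact: (@ex_diff _ _ _ _ _ _ _ D).
  by rewrite (@diff_val _ _ _ _ _ _ _ D) /= scaler0 add0r [X in X *: _](mul1r _).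
have := is_derive_sum Dj; rewrite -row_sum_delta.
rewrite (_ : \sum_(i < n) _ = y) //; apply/funext => s.
by rewrite fct_sumE [RHS]row_sum_delta.
Qed.

Lemma is_derive_dot n (x y : R -> 'rV[R]_n) dx dy t :
  is_derive t (1 : R) x dx -> is_derive t (1 : R) y dy ->
  is_derive t (1 : R) (fun s => dot (x s) (y s)) (dot dx (y t) + dot (x t) dy).
Proof.
move=> Dx Dy.
have Dj j : is_derive t (1 : R) (fun s => x s 0 j * y s 0 j) (dx 0 j * y t 0 j + x t 0 j * dy 0 j).
  apply: (is_derive_eq (is_deriveM (is_derive_coord j Dx) (is_derive_coord j Dy))).
  by rewrite /GRing.scale /=; ring.
have := is_derive_sum Dj; rewrite big_split /=.
by rewrite (_ : \sum_(i < n) _ = (fun s => dot (x s) (y s))) //; apply/funext => s; rewrite fct_sumE.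
Qed.

Lemma is_derive_hor n (y : R -> 'rV[R]_n.+1) dy t :
  is_derive t (1 : R) y dy -> is_derive t (1 : R) (fun s => hor (y s)) (hor dy).
Proof.
move=> D; apply: is_derive_row => j; rewrite mxE.
rewrite (_ : (fun s => _) = (fun s => y s 0 (lift ord_max j))); first exact: is_derive_coord.
by apply/funext => s; rewrite mxE.
Qed.

Lemma is_derive_dotl n (a : 'rV[R]_n) (y : R -> 'rV[R]_n) dy t :
  is_derive t (1 : R) y dy -> is_derive t (1 : R) (fun s => dot a (y s)) (dot a dy).
Proof.
move=> D; apply: (is_derive_eq (is_derive_dot (is_derive_cst a t (1 : R)) D)).
by rewrite dot0l add0r.
Qed.

End DeriveRows.

Section VerticalFlow.
Variables (R : realType) (n : nat) (f : 'rV[R]_n.+1 -> 'rV[R]_n).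
Local Notation E := 'rV[R]_n.+1.
Hypothesis Cf : forall k, Ck k setT f.
Variable M : R.
Hypothesis fM : forall y, `|f y| <= M.

Definition vertical_field (y : E) : E := vec (f y) 1.

Lemma Ck_vertical_field k : Ck k setT vertical_field.
Proof. by apply: Ck_vec; [exact: openT|exact: Cf|apply: Ck_cst; exact: openT]. Qed.

Lemma vertical_field_bounded y : `|vertical_field y| <= n%:R * M + 1.
Proof.
apply: le_trans (norm_le_enorm _) _.
have M0 : 0 <= M by apply: le_trans (normr_ge0 _) (fM 0).
have nM : 0 <= n%:R * M by rewrite mulr_ge0.
rewrite -ler_sqr ?nnegrE ?addr_ge0 ?enorm_ge0 //.
rewrite enorm_hor hor_vec hgt_vec.
have H : enorm (f y) <= n%:R * M.
  by apply: le_trans (enorm_le_norm _) _; rewrite ler_wpM2l.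
have := enorm_ge0 (f y); nra.
Qed.

Definition vflow : R -> E -> E := flow vertical_field.

Let fx := findim_rV R n.+1.

Lemma Ck_vflow (X : normedModType R) k (U : set X) (g : X -> E) (h : X -> R) : open U ->
  Ck k U g -> Ck k U h -> Ck k U (fun x => vflow (h x) (g x)).
Proof.
move=> oU Cg Ch.
apply: (Ck_comp (findim_prod fx (findim_R R)) oU (V := setT) (f := fun x => (g x, h x))
  (g := fun z : E * R => vflow z.2 z.1)) => //; first exact: Ck_pair.
exact: (Ck_flow fx Ck_vertical_field vertical_field_bounded).
Qed.

Lemma is_derive_vflow t x : is_derive t (1 : R) (fun s => vflow s x) (vertical_field (vflow t x)).
Proof. exact: (is_derive_flow fx Ck_vertical_field vertical_field_bounded). Qed.

Lemma vflow0 x : vflow 0 x = x.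
Proof. exact: (flow0 fx Ck_vertical_field vertical_field_bounded). Qed.

Lemma vflowD s t x : vflow (s + t) x = vflow s (vflow t x).
Proof. exact: (flowD Ck_vertical_field vertical_field_bounded). Qed.

Lemma vflowK t x : vflow (- t) (vflow t x) = x.
Proof. by rewrite -vflowD addNr vflow0. Qed.

#[local] Opaque vflow.

Lemma hgt_vflow t x : hgt (vflow t x) = hgt x + t.
Proof.
pose g s := hgt (vflow s x) - s.
have Dg s : is_derive s (1 : R) g 0.
  have := is_deriveB (is_derive_coord ord_max (is_derive_vflow s x)) (is_derive_id s (1 : R)).
  by rewrite -/(hgt _) hgt_vec subrr.
have := @is_derive_0_is_cst _ g t 0 Dg; rewrite /g vflow0 subr0 => <-.
by rewrite subrK.
Qed.

Lemma is_derive_hor_sq t x : is_derive t (1 : R) (fun s => dot (hor (vflow s x)) (hor (vflow s x)))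
  (2 * dot (hor (vflow t x)) (f (vflow t x))).
Proof.
have D := is_derive_hor (is_derive_vflow t x); apply: (is_derive_eq (is_derive_dot D D)).
by rewrite hor_vec [dot (f _) _]dotC; ring.
Qed.

Lemma vflow_hor_sq t x : (forall y, dot (hor y) (f y) = 0) ->
  dot (hor (vflow t x)) (hor (vflow t x)) = dot (hor x) (hor x).
Proof.
move=> f0; pose g s := dot (hor (vflow s x)) (hor (vflow s x)).
have Dg s : is_derive s (1 : R) g 0.
  by apply: (is_derive_eq (is_derive_hor_sq s x)); rewrite f0 mulr0.
by have := @is_derive_0_is_cst _ g t 0 Dg; rewrite /g vflow0.
Qed.

Lemma continuous_vflow_path (Y : topologicalType) (g : E -> Y) x :
  continuous g -> continuous (fun s => g (vflow s x)).
Proof.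
move=> gc s; apply: (@continuous_comp _ _ _ (fun s => vflow s x) g); last exact: gc.
apply: differentiable_continuous; apply/derivable1_diffP.
exact: (@ex_derive _ _ _ _ _ _ _ (is_derive_vflow s x)).
Qed.

End VerticalFlow.

(** * The flow on the cylinder and the diffeomorphisms of the sphere *)

Section SphereFlow.
Variables (R : realType) (n : nat) (A : set (set 'rV[R]_n.+1)) (V : 'rV[R]_n.+1 -> 'rV[R]_n.+1).
Local Notation E := 'rV[R]_n.+1.
Local Notation R0 := (cyl_radius A).
Hypothesis R00 : 0 < R0.
Hypothesis TV : tangent_field A V.

(** A smooth nonnegative function whose zero set is the cylinder and whose sublevel set at [1/2] is
    bounded, as [cutoff_exists] requires. *)
Definition cyl_gauge (y : E) : R :=
  (dot (hor y) (hor y) - R0 ^+ 2) ^+ 2 + bump (hgt y - 1) + bump (- hgt y).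

Lemma Ck_hor_sq k : Ck k setT (fun y : E => dot (hor y) (hor y)).
Proof. by apply: Ck_dot; try (apply: Ck_hor; try apply: Ck_id); exact: openT. Qed.

Lemma Ck_bumpf k (g : E -> R) : Ck k setT g -> Ck k setT (fun y => bump (g y)).
Proof. by move=> Cg; apply: (Ck_comp (findim_R R) openT (V := setT)) => //; exact: Ck_bump. Qed.

Lemma Ck_hgt_id k : Ck k setT (@hgt R n).
Proof. by apply: Ck_hgt; [|apply: Ck_id]; exact: openT. Qed.

Lemma Ck_cyl_gauge k : Ck k setT cyl_gauge.
Proof.
apply: Ck_add; [exact: openT|apply: Ck_add|]; first exact: openT.
- apply: Ck_exp; first exact: openT.
  by apply: Ck_add; [exact: openT|exact: Ck_hor_sq|apply: Ck_cst; exact: openT].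
- apply: Ck_bumpf; apply: Ck_add; [exact: openT|exact: Ck_hgt_id|apply: Ck_cst; exact: openT].
- by apply: Ck_bumpf; apply: Ck_opp; [exact: openT|exact: Ck_hgt_id].
Qed.

Lemma cyl_gauge_ge0 y : 0 <= cyl_gauge y.
Proof. by rewrite !addr_ge0 ?sqr_ge0 ?bump_ge0. Qed.

Lemma norm_bound_of_sq (y : E) (c d : R) : dot (hor y) (hor y) <= c -> `|hgt y| <= d ->
  `|y| <= c + d ^+ 2 + 1.
Proof.
move=> H1 H2; apply: le_trans (norm_le_enorm _) _.
have E1 : enorm y ^+ 2 = dot (hor y) (hor y) + hgt y ^+ 2 by rewrite enorm_hor enorm_sqr.
have h2 : hgt y ^+ 2 <= d ^+ 2.
  by rewrite -[leLHS]real_normK ?num_real // ler_sqr ?nnegrE // (le_trans _ H2).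
have := enorm_ge0 y; have := sqr_ge0 (enorm y - 1); rewrite sqrrB expr1n mulr1 E1.
by rewrite -mulr_natr; lra.
Qed.

Lemma half_bump s : bump s <= 2^-1 -> s <= - (ln (2^-1 : R))^-1.
Proof. by apply: bump_bounded; rewrite ?invr_gt0 // invf_lt1 // ltr1n. Qed.

Lemma cyl_gauge_bounded : exists r : R, forall y, cyl_gauge y <= 2^-1 -> `|y| <= r.
Proof.
pose K := - (ln (2^-1 : R))^-1.
exists (R0 ^+ 2 + 1 + (`|K| + 1) ^+ 2 + 1) => y Gy.
have b1 := bump_ge0 (hgt y - 1); have b2 := bump_ge0 (- hgt y).
have q0 := sqr_ge0 (dot (hor y) (hor y) - R0 ^+ 2).
have h1 : hgt y - 1 <= K by apply: half_bump; move: Gy; rewrite /cyl_gauge; lra.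
have h2 : - hgt y <= K by apply: half_bump; move: Gy; rewrite /cyl_gauge; lra.
apply: norm_bound_of_sq.
  move: Gy; rewrite /cyl_gauge => Gy.
  set d := dot _ _ in q0 Gy *; nra.
have := ler_norm K; rewrite ler_norml; lra.
Qed.

Lemma cyl_gauge_le0 y : cyl_gauge y <= 0 -> Cyl A y.
Proof.
have b1 := bump_ge0 (hgt y - 1); have b2 := bump_ge0 (- hgt y).
have q0 := sqr_ge0 (dot (hor y) (hor y) - R0 ^+ 2).
rewrite /cyl_gauge => Gy.
have h1 : hgt y - 1 <= 0 by apply: bump_eq0; lra.
have h2 : - hgt y <= 0 by apply: bump_eq0; lra.
split; last by apply/andP; lra.
have : (dot (hor y) (hor y) - R0 ^+ 2) ^+ 2 = 0 by apply/eqP; rewrite eq_le q0 andbT; lra.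
move/eqP; rewrite sqrf_eq0 subr_eq0 => /eqP H.
by rewrite /enorm H sqrtr_sqr ger0_norm // ltW.
Qed.

Lemma cyl_gauge_cyl y : Cyl A y -> cyl_gauge y = 0.
Proof.
move=> [yR /andP[y0 y1]]; rewrite /cyl_gauge -enorm_sqr yR subrr expr0n add0r.
by rewrite !bump_le0 ?addr0 // ?subr_le0 ?oppr_le0.
Qed.

(** Subtracting the radial component changes nothing on the cylinder, and it makes every trajectory
    of the extension keep its distance to the axis, including those that leave the heights between 0
    and 1. *)
Lemma cylinder_extension : exists f : E -> 'rV[R]_n,
  [/\ forall k, Ck k setT f, exists M : R, forall y, `|f y| <= M,
      forall y, dot (hor y) (f y) = 0 & forall y, Cyl A y -> vec (f y) 1 = V y].
Proof.
have [[U [oU CU HU]] HV1 HV2] := TV.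
pose U' := U `&` [set y : E | dot (hor y) (hor y) != 0].
have oU' : open U'.
  apply: openI => //.
  rewrite (_ : mkset _ = (fun y : E => dot (hor y) (hor y)) @^-1` [set x : R | x != 0]) //.
  apply: open_comp => [x _|]; last exact: open_neq0.
  exact: (continuous_Ck0 (Ck_hor_sq 0)).
have [r Gr] := cyl_gauge_bounded.
have [|chi [Cchi chi_ge0 chi1 [c /andP[c0 c2] [chi0 cU]]]] :=
    cutoff_exists (findim_rV R n.+1) Ck_cyl_gauge cyl_gauge_ge0 Gr oU'.
  move=> y /cyl_gauge_le0 Cy; split; first exact: CU.
  by case: Cy => yR _; rewrite /= -enorm_sqr yR expf_neq0 // gt_eqF.
pose W (y : E) := hor (V y) - (dot (hor y) (hor (V y)) / dot (hor y) (hor y)) *: hor y.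
have CW k : Ck k U' W.
  have CV : Ck k U' (fun y => hor (V y)).
    by apply: Ck_hor => //; apply: Ck_sub (HU k) => y [].
  have Ch : Ck k U' (@hor R n) by apply: Ck_hor => //; exact: Ck_id.
  apply: Ck_add => //; apply: Ck_opp => //; apply: Ck_scale => //.
  apply: Ck_mul => //; first exact: Ck_dot.
  by apply: Ck_invf => //; [move=> y []|exact: Ck_dot].
have [CF BF] := cutoff_field (findim_rV R n.+1) (continuous_Ck0 (Ck_cyl_gauge 0)) Cchi Gr oU' chi0 cU c2 CW.
exists (fun y => chi y *: W y); split=> //.
- move=> y; rewrite dotZr /W dotBr dotZr.
  have [h0|h0] := eqVneq (dot (hor y) (hor y)) 0; last by rewrite divfK // subrr mulr0.
  by rewrite (dot_eq0 h0) !dot0l mul0r mul0r subrr mulr0.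
- move=> y Cy; have [h1 h2] := HV1 y Cy.
  rewrite chi1 ?cyl_gauge_cyl // scale1r /W h2 mul0r scale0r subr0.
  by rewrite -h1 vec_eta.
Qed.

Lemma sphere_flow_exists : exists eta etai, is_flow A V eta etai.
Proof.
have [f [Cf [M fM] f0 fV]] := cylinder_extension.
pose psi := vflow f.
have Cpsi X k U g h := @Ck_vflow R n f Cf M fM X k U g h.
have hpsi := hgt_vflow Cf fM.
have psiN t x : enorm (hor (psi t x)) = enorm (hor x).
  by rewrite /enorm /psi (vflow_hor_sq Cf fM).
have eN (x : 'rV[R]_n) t : usphere x -> enorm (hor (vec (R0 *: x) t)) = R0.
  by move=> x1; rewrite hor_vec enormZ x1 mulr1 ger0_norm // ltW.
pose eta t (x : 'rV[R]_n) := R0^-1 *: hor (psi t (vec (R0 *: x) 0)).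
pose etai t (x : 'rV[R]_n) := R0^-1 *: hor (psi (- t) (vec (R0 *: x) t)).
have RV (x : 'rV[R]_n) : R0 *: (R0^-1 *: x) = x by rewrite scalerA divff ?scale1r // gt_eqF.
have pE t x : usphere x -> vec (R0 *: eta t x) t = psi t (vec (R0 *: x) 0).
  by move=> x1; apply: vec_inj; rewrite ?hor_vec ?RV // hgt_vec hpsi hgt_vec add0r.
have pEi t x : usphere x -> vec (R0 *: etai t x) 0 = psi (- t) (vec (R0 *: x) t).
  by move=> x1; apply: vec_inj; rewrite ?hor_vec ?RV // hgt_vec hpsi hgt_vec subrr.
have sE t x : usphere x -> usphere (eta t x).
  move=> x1; rewrite /usphere /= enormZ psiN eN // ger0_norm ?invr_ge0 ?(ltW R00) //.
  by rewrite mulVf // gt_eqF.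
have sEi t x : usphere x -> usphere (etai t x).
  move=> x1; rewrite /usphere /= enormZ psiN eN // ger0_norm ?invr_ge0 ?(ltW R00) //.
  by rewrite mulVf // gt_eqF.
have etaK t x : usphere x -> etai t (eta t x) = x.
  move=> x1; rewrite /etai pE // /psi (vflowK Cf fM) hor_vec.
  by rewrite scalerA mulVf ?scale1r // gt_eqF.
have etaiK t x : usphere x -> eta t (etai t x) = x.
  move=> x1; rewrite /eta pEi // /psi -{1}(opprK t) (vflowK Cf fM) hor_vec.
  by rewrite scalerA mulVf ?scale1r // gt_eqF.
have Csc (X : normedModType R) k (g : X -> 'rV[R]_n) c : Ck k setT g -> Ck k setT (fun x => c *: g x).
  by move=> Cg; apply: Ck_cscale => //; exact: openT.
have Ceta (X : normedModType R) k (g : X -> 'rV[R]_n) h : Ck k setT g -> Ck k setT h ->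
    Ck k setT (fun x => eta (h x) (g x)).
  move=> Cg Ch; apply/Csc/Ck_hor; first exact: openT.
  apply: Cpsi => //; first exact: openT.
  by apply: Ck_vec; [exact: openT|exact: Csc|apply: Ck_cst; exact: openT].
have Cetai (X : normedModType R) k (g : X -> 'rV[R]_n) h : Ck k setT g -> Ck k setT h ->
    Ck k setT (fun x => etai (h x) (g x)).
  move=> Cg Ch; apply/Csc/Ck_hor; first exact: openT.
  apply: Cpsi => //; first exact: openT.
    by apply: Ck_vec => //; [exact: openT|exact: Csc].
  by apply: Ck_opp => //; exact: openT.
exists eta, etai; split.
- exists setT; split=> // [|k]; first exact: openT.
  by apply: Ceta; [apply: Ck_fst|apply: Ck_snd]; exact: openT.
- exists setT; split=> // [|k]; first exact: openT.
  by apply: Cetai; [apply: Ck_fst|apply: Ck_snd]; exact: openT.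
- move=> t _; split.
  + exists setT; split=> // [|k]; first exact: openT.
    by apply: Ceta; [apply: Ck_id|apply: Ck_cst]; exact: openT.
  + exists setT; split=> // [|k]; first exact: openT.
    by apply: Cetai; [apply: Ck_id|apply: Ck_cst]; exact: openT.
  + by move=> x x1; split; [exact: sE|exact: etaK].
  + by move=> x x1; split; [exact: sEi|exact: etaiK].
- move=> x x1; rewrite /eta /psi (vflow0 Cf fM) hor_vec.
  by rewrite scalerA mulVf ?scale1r // gt_eqF.
- move=> x t x1 t01.
  have D := is_derive_vflow Cf fM t (vec (R0 *: x) 0).
  rewrite (_ : (fun s => vec _ s) = (fun s => psi s (vec (R0 *: x) 0))); last first.
    by apply/funext => s; rewrite pE.
  apply: (is_derive_eq D); rewrite pE // -/(psi t _) /vertical_field fV //.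
  by split; rewrite ?psiN ?eN // hpsi hgt_vec add0r.
Qed.

End SphereFlow.

(** * The product structure of the arrangement near F *)

Section Trivialization.
Variables (R : realType) (n N : nat) (A : set (set 'rV[R]_n.+1)).
Variables (a : 'I_N -> 'rV[R]_n.+1) (b : 'I_N -> R).
Hypothesis G : in_position A a b.
Local Notation E := 'rV[R]_n.+1.
Local Notation R0 := (cyl_radius A).
Local Notation denom := (denom A a b).
Local Notation rim := (rim A).
Local Notation strat_field := (strat_field A a b).

Definition pill_gauge (e : R) (y : E) : R :=
  bump (dot (hor y) (hor y) - R0 ^+ 2) + bump (hgt y - e) + bump (- e - hgt y).

Lemma Ck_pill_gauge e k : Ck k setT (pill_gauge e).
Proof.
apply: Ck_add; [exact: openT|apply: Ck_add|]; first exact: openT.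
- by apply: Ck_bumpf; apply: Ck_add; [exact: openT|exact: Ck_hor_sq|apply: Ck_cst; exact: openT].
- by apply: Ck_bumpf; apply: Ck_add; [exact: openT|exact: Ck_hgt_id|apply: Ck_cst; exact: openT].
- apply: Ck_bumpf; apply: Ck_add; [exact: openT|apply: Ck_cst; exact: openT|].
  by apply: Ck_opp; [exact: openT|exact: Ck_hgt_id].
Qed.

Lemma pill_gauge_ge0 e y : 0 <= pill_gauge e y.
Proof. by rewrite !addr_ge0 ?bump_ge0. Qed.

Lemma pill_gauge_bounded e : exists r : R, forall y, pill_gauge e y <= 2^-1 -> `|y| <= r.
Proof.
pose K := - (ln (2^-1 : R))^-1.
exists (R0 ^+ 2 + K + (`|K| + `|e|) ^+ 2 + 1) => y Gy.
have b1 := bump_ge0 (hgt y - e); have b2 := bump_ge0 (- e - hgt y).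
have b3 := bump_ge0 (dot (hor y) (hor y) - R0 ^+ 2).
have h1 : hgt y - e <= K by apply: half_bump; move: Gy; rewrite /pill_gauge; lra.
have h2 : - e - hgt y <= K by apply: half_bump; move: Gy; rewrite /pill_gauge; lra.
have h3 : dot (hor y) (hor y) - R0 ^+ 2 <= K by apply: half_bump; move: Gy; rewrite /pill_gauge; lra.
apply: norm_bound_of_sq; first lra.
have := ler_norm K; have := ler_norm e; have := ler_norm (- e); rewrite normrN ler_norml.
lra.
Qed.

Lemma hor_sq_le (y : E) : (dot (hor y) (hor y) - R0 ^+ 2 <= 0) = (enorm (hor y) <= R0).
Proof.
by rewrite subr_le0 -enorm_sqr ler_sqr ?nnegrE ?enorm_ge0 ?(ltW (position_radius_gt0 G)).
Qed.

Lemma pill_gauge_le0 e y : pill_gauge e y <= 0 -> Cyl_eps A e y.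
Proof.
have b1 := bump_ge0 (hgt y - e); have b2 := bump_ge0 (- e - hgt y).
have b3 := bump_ge0 (dot (hor y) (hor y) - R0 ^+ 2).
rewrite /pill_gauge => Gy.
have h1 : hgt y - e <= 0 by apply: bump_eq0; lra.
have h2 : - e - hgt y <= 0 by apply: bump_eq0; lra.
split; last by rewrite ler_norml; lra.
by rewrite -hor_sq_le; apply: bump_eq0; lra.
Qed.

Lemma pill_gauge_eq0 e y : Cyl_eps A e y -> pill_gauge e y = 0.
Proof.
move=> [yR]; rewrite ler_norml => /andP[h1 h2]; rewrite /pill_gauge.
by rewrite !bump_le0 ?addr0 //; [lra|lra|rewrite hor_sq_le].
Qed.

Lemma bump_le s : 0 <= s -> bump s <= s :> R.
Proof.
rewrite le_eqVlt => /predU1P[<-|s0]; first by rewrite bump_le0.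
(* The inequality is [exp(1/s) >= 1/s] after inversion. *)
rewrite /bump /poly_bump s0 hornerC mul1r expRN -[leRHS]invrK.
rewrite lef_pV2 ?posrE ?expR_gt0 ?invr_gt0 //.
by apply: le_trans (expR_ge1Dx _); rewrite lerDr.
Qed.

(** The bad set of [denom] is closed and misses the compact base, so it misses a sublevel set of the
    gauge of the base. That gauge is at most the absolute height within the cylinder, since
    [bump s <= s]. *)
Lemma denom_pill : exists2 e0 : R, 0 < e0 & forall e y, e <= e0 -> Cyl_eps A e y -> denom y != 0.
Proof.
have [r Gr] := pill_gauge_bounded 0.
have [|chi [_ _ _ [c /andP[c0 c2] [_ cU]]]] :=
    cutoff_exists (findim_rV R n.+1) (Ck_pill_gauge 0) (pill_gauge_ge0 0) Gr (@open_denom _ _ _ A a b).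
  move=> y /pill_gauge_le0[yR]; rewrite normr_le0 => /eqP y0.
  exact: (denom_cyl0 G).
exists c => // e y ec [yR]; rewrite ler_norml => /andP[h1 h2]; apply: cU.
rewrite /pill_gauge subr0 oppr0 sub0r (@bump_le0 _ (dot _ _ - _)) ?hor_sq_le // add0r.
have [y0|/ltW y0] := leP 0 (hgt y).
  by rewrite (@bump_le0 _ (- hgt y)) ?oppr_le0 // addr0; apply: le_trans (bump_le y0) _; lra.
by rewrite (@bump_le0 _ (hgt y)) // add0r; apply: le_trans (bump_le _) _; lra.
Qed.

Section Stratified.
Variables (e : R) (f : E -> 'rV[R]_n) (kr : E -> R) (ka : 'I_N -> E -> R).
Hypothesis Cf : forall k, Ck k setT f.
Variable M : R.
Hypothesis fM : forall y, `|f y| <= M.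
Hypothesis Ckr : continuous kr.
Hypothesis Cka : forall i, continuous (ka i).
Hypothesis fr : forall y, dot (hor y) (f y) = kr y * rim y.
Hypothesis fa : forall i y, Cyl_eps A e y -> dot (a i) (vec (f y) 1) = ka i y * alpha a b i y.
Local Notation psi := (vflow f).

Lemma sg_rim_vflow t x : Num.sg (rim (psi t x)) = Num.sg (rim x).
Proof.
rewrite -{2}(vflow0 Cf fM x).
apply: (@linear_ode_sign _ (fun s => rim (psi s x)) (fun s => - 2 * kr (psi s x)) (- `|t|) `|t|).
- move=> s _; have D := is_derive_hor_sq Cf fM s x.
  apply: (is_derive_eq (is_deriveB (is_derive_cst (R0 ^+ 2) s (1 : R)) D)).
  by rewrite fr; ring.
- apply: continuous_subspaceT => s; apply: cvgMr.
  exact: (@continuous_vflow_path _ _ _ Cf _ fM _ kr x Ckr s).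
- by rewrite lerNl -normrN !ler_norm // normrN ler_norm.
- by rewrite oppr_le0 normr_ge0.
Qed.

Lemma hor_vflow_le t x : enorm (hor x) <= R0 -> enorm (hor (psi t x)) <= R0.
Proof.
rewrite -!hor_sq_le !subr_le0 -![_ <= R0 ^+ 2]subr_ge0 -!/(rim _) => H.
by rewrite -sgr_ge0 sg_rim_vflow sgr_ge0.
Qed.

Lemma vflow_pill s x : Cyl_eps A e x -> `|hgt x + s| <= e -> Cyl_eps A e (psi s x).
Proof. by move=> [xR _] H; split; [exact: hor_vflow_le|rewrite (hgt_vflow Cf fM)]. Qed.

Lemma sg_alpha_vflow i s x : Cyl_eps A e x -> `|hgt x + s| <= e ->
  Num.sg (alpha a b i (psi s x)) = Num.sg (alpha a b i x).
Proof.
move=> Cx Hs; have [_ x0] := Cx; rewrite -{2}(vflow0 Cf fM x).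
apply: (@linear_ode_sign _ (fun s => alpha a b i (psi s x)) (fun s => ka i (psi s x))
  (- e - hgt x) (e - hgt x)).
- move=> t tb; have D := is_derive_dotl (a i) (is_derive_vflow Cf fM t x).
  apply: (is_derive_eq (is_deriveB D (is_derive_cst (b i) t (1 : R)))).
  rewrite subr0 -/(vertical_field f _) fa //; apply: vflow_pill => //.
  by rewrite ler_norml; lra.
- by apply: continuous_subspaceT; exact: continuous_vflow_path.
- by move: Hs; rewrite ler_norml; lra.
- by move: x0; rewrite ler_norml; lra.
Qed.

(** The field has vertical component 1, so flowing for time [- hgt x] lands on height zero. It
    preserves the sign of [rim], hence the solid cylinder, and within it the signs of the
    [alpha i]. *)
Definition straighten (x : E) : E * R := (psi (- hgt x) x, hgt x).
Definition unstraighten (z : E * R) : E := psi z.2 z.1.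

Lemma straighten_trivialization : 0 < e -> trivialization A e straighten unstraighten.
Proof.
move=> e0; have hp := hgt_vflow Cf fM.
have C0 x : Cyl_0 A x -> Cyl_eps A e x.
  by move=> [xR x0]; split=> //; rewrite x0 normr0 ltW.
have sK x : unstraighten (straighten x) = x.
  by rewrite /unstraighten /= -{1}(opprK (hgt x)) (vflowK Cf fM).
have uK (z : E * R) : hgt z.1 = 0 -> straighten (unstraighten z) = z.
  by move=> z0; rewrite /straighten /unstraighten hp z0 add0r (vflowK Cf fM) -surjective_pairing.
have sS x : Cyl_eps A e x -> Cyl_0 A (straighten x).1 /\ - e <= (straighten x).2 <= e.
  move=> [xR]; rewrite ler_norml => xe; split=> //; split; first exact: hor_vflow_le.
  by rewrite hp subrr.
have uS (z : E * R) : Cyl_0 A z.1 -> - e <= z.2 <= e -> Cyl_eps A e (unstraighten z).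
  move=> Cz ze; apply: vflow_pill; first exact: C0.
  by case: Cz => _ ->; rewrite add0r ler_norml.
have aE H : A H -> exists i, H = hyp a b i.
  by rewrite {1}(pos_range G) => -[i _ <-]; exists i.
have sg0 (x : R) : (Num.sg x == 0) = (x == 0) by rewrite sgr_eq0.
split; first split.
- exists setT; split=> // [|k]; first exact: openT.
  apply: Ck_pair; [exact: openT| |exact: Ck_hgt_id].
  apply: (Ck_vflow Cf fM); [exact: openT|apply: Ck_id; exact: openT|].
  by apply: Ck_opp; [exact: openT|exact: Ck_hgt_id].
- exists setT; split=> // [|k]; first exact: openT.
  by apply: (Ck_vflow Cf fM); [exact: openT|apply: Ck_fst; exact: openT|apply: Ck_snd; exact: openT].
- by move=> x Cx; split=> //; exact: sS.
- by move=> z [Cz ze]; split; [exact: uS|apply: uK; case: Cz].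
- move=> H /aE[i ->]; apply/seteqP; split=> [_ [x [Cx Hx] <-]|z [[Cz Hz] ze]].
    have [h1 h2] := sS x Cx; split=> //; split=> //.
    have := sg_alpha_vflow i Cx (_ : `|hgt x + - hgt x| <= e).
    rewrite subrr normr0 (ltW e0) => /(_ isT) S.
    apply/eqP; rewrite -alpha_eq0 -sg0 S sg0 alpha_eq0; exact/eqP.
  exists (unstraighten z); last by apply: uK; case: Cz.
  split; first exact: uS.
  have := sg_alpha_vflow i (C0 _ Cz) (_ : `|hgt z.1 + z.2| <= e).
  have [_ z0] := Cz; rewrite z0 add0r ler_norml => /(_ ze) S.
  apply/eqP; rewrite -alpha_eq0 -sg0 S sg0 alpha_eq0; exact/eqP.
- by move=> x [_ x0]; rewrite /straighten x0 oppr0 (vflow0 Cf fM).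
Qed.

End Stratified.

Lemma trivialization_exists : exists e0 : R, 0 < e0 /\ forall e : R, 0 < e <= e0 ->
  exists Phi Psi, trivialization A e Phi Psi.
Proof.
have [e0 e00 U0] := denom_pill.
exists e0; split=> // e /andP[ep ee0].
have oU := @open_denom _ _ _ A a b.
have [r Gr] := pill_gauge_bounded e.
have Gc := continuous_Ck0 (Ck_pill_gauge e 0).
have [|chi [Cchi _ chi1 [c /andP[c0 c2] [chi0 cU]]]] :=
    cutoff_exists (findim_rV R n.+1) (Ck_pill_gauge e) (pill_gauge_ge0 e) Gr oU.
  by move=> y /pill_gauge_le0; exact: U0.
have CF (Y : normedModType R) (W : E -> Y) := @cutoff_field R _ (findim_rV R n.+1) Y _ _ _ _ _ W Gc Cchi Gr oU chi0 cU c2.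
(* The radial identity is required at all points, including those where [denom] vanishes and its
   formula breaks down; the cutoff is zero there. *)
have UP y : denom y = 0 -> chi y = 0.
  move=> d0; apply: chi0; rewrite leNgt; apply/negP => /ltW /cU /=.
  by rewrite d0 eqxx.
have DD y (Dy : [set y | denom y != 0] y) : denom y != 0 by [].
have [Cf [M fM]] := CF _ (fun y => hor (strat_field y))
  (fun k => Ck_hor oU (@Ck_strat_field _ _ _ _ _ _ k _ oU DD)).
pose kr y := chi y *: ((mass a b y)^-1 * up_dot a b y / (out_dot a b y ^+ 2 + rim y ^+ 2) * rim y).
have [Ckr _] : (forall k, Ck k setT kr) /\ exists M : R, forall x, `|kr x| <= M.
  apply: CF => k; apply: Ck_mul => //; last exact: Ck_rim.
  apply: Ck_mul => //; last exact: (Ck_rim_dot_inv _ oU DD).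
  by apply: Ck_mul => //; [exact: (Ck_mass_inv _ oU DD)|exact: Ck_up_dot].
pose ka i y := chi y *: field_coef A a b i y.
have [Cka0 _] : (forall i k, Ck k setT (ka i)) /\ True.
  by split=> // i; apply: (CF _ (field_coef A a b i) _).1 => k; exact: (Ck_field_coef _ oU DD).
exists (straighten (fun y => chi y *: hor (strat_field y))), (unstraighten (fun y => chi y *: hor (strat_field y))).
apply: (straighten_trivialization Cf fM (kr := kr) (ka := ka)) => //.
- exact: continuous_Ck0.
- by move=> i; exact: continuous_Ck0.
- move=> y; rewrite dotZr /kr; have [/UP ->|dy] := eqVneq (denom y) 0.
    by rewrite mul0r scale0r mul0r.
  by rewrite dot_hor_strat_field // /GRing.scale /= !mulrA.
- move=> i y Cy; have dy := U0 _ _ ee0 Cy.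
  rewrite /ka chi1 ?pill_gauge_eq0 // !scale1r -dot_strat_field -(hgt_strat_field dy).
  by rewrite vec_eta.
Qed.

End Trivialization.

(** * Signs along trajectories *)

Section Trajectories.
Variables (R : realType) (n N : nat) (A : set (set 'rV[R]_n.+1)).
Variables (a : 'I_N -> 'rV[R]_n.+1) (b : 'I_N -> R).
Hypothesis G : in_position A a b.
Local Notation E := 'rV[R]_n.+1.
Local Notation R0 := (cyl_radius A).
Local Notation alpha := (alpha a b).
Let R00 : 0 < R0 := position_radius_gt0 G.

(* A hyperplane comes within R/2 of the axis at every height, since it contains a line. *)
Lemma hyp_level i s : 0 <= s <= 1 -> `|b i - hgt (a i) * s| <= enorm (hor (a i)) * (R0 / 2).
Proof.
move=> s01; have [T iT lT] := position_line_in_hyp G i.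
have := flat_line_pt lT s iT; rewrite dot_hor hgt_line_pt // => <-.
rewrite addrK; apply: le_trans (dot_cauchy _ _) _; rewrite ler_wpM2l ?enorm_ge0 //.
exact: (position_line_le G).
Qed.

(** The distance within the cylinder to the trace of a hyperplane is controlled by [|alpha i|]. At
    each height the hyperplane passes within R/2 of the axis, so it cuts the sphere of radius R at
    an angle bounded away from tangency. *)
Lemma foot_point i y : Cyl A y ->
  enorm (hor (a i)) * (R0 / 2) <= `|alpha i y| \/
  exists y', [/\ Cyl A y', alpha i y' = 0, hgt y' = hgt y &
    enorm (hor (y - y')) <= 5 / enorm (hor (a i)) * `|alpha i y|].
Proof.
move=> [yR y01]; set a' := hor (a i); set L := enorm a'.
have L0 : 0 < L by apply: enorm_gt0; exact: (position_hor_normal_neq0 G).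
have Ln : L != 0 by rewrite gt_eqF.
set be := b i - hgt (a i) * hgt y; set c := dot a' (hor y).
have al : alpha i y = c - be by rewrite alphaE dot_hor /be /c; ring.
have hb : `|be| <= L * (R0 / 2) := hyp_level i y01.
have cL : `|c| <= L * R0 by rewrite -yR; exact: dot_cauchy.
pose z : 'rV[R]_n := hor y - (c / L ^+ 2) *: a'.
have zz : dot z z = R0 ^+ 2 - c ^+ 2 / L ^+ 2.
  rewrite /z !(dotBl, dotBr, dotZl, dotZr) -!enorm_sqr yR [dot (hor y) a']dotC -/c -/L.
  by field.
have az : dot a' z = 0 by rewrite /z dotBr dotZr -enorm_sqr -/c -/L; field.
have zE : hor y = z + (c / L ^+ 2) *: a' by rewrite subrK.
(* If [hor y] is parallel to the normal, then [|c| = L R], and [y] is far from the hyperplane, whose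
   offset is at most [L R / 2]. *)
clearbody z; have [z0|z0] := eqVneq z 0.
  left; rewrite al; move: zz; rewrite z0 dot0r => zz.
  have cE : `|c| = L * R0.
    apply/eqP; rewrite -(@eqrXn2 _ 2) ?(mulr_ge0 (ltW L0) (ltW R00)) //.
    rewrite real_normK ?num_real // exprMn -subr_eq0; apply/eqP.
    have -> : c ^+ 2 = L ^+ 2 * (c ^+ 2 / L ^+ 2) by field.
    by rewrite -mulrBr -opprB -zz oppr0 mulr0.
  have := lerB_dist c be; rewrite cE; lra.
right; set r := enorm z; have r0 : 0 < r := enorm_gt0 z0.
have rn : r != 0 by rewrite gt_eqF.
(* The length of the component orthogonal to the normal for a point of the sphere of radius R on the
   hyperplane; [y'] keeps the direction of [z] and takes this length. *)
pose q := Num.sqrt (R0 ^+ 2 - be ^+ 2 / L ^+ 2).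
have be2 : be ^+ 2 / L ^+ 2 <= (R0 / 2) ^+ 2.
  rewrite ler_pdivrMr ?exprn_gt0 // -[leLHS]real_normK ?num_real // mulrC -exprMn.
  by rewrite ler_sqr ?nnegrE // (mulr_ge0 (ltW L0)) // divr_ge0 // ltW.
have q2 : q ^+ 2 = R0 ^+ 2 - be ^+ 2 / L ^+ 2.
  by rewrite sqr_sqrtr //; move: be2; rewrite expr_div_n; have := sqr_ge0 R0; lra.
have qR : R0 / 2 <= q.
  rewrite -ler_sqr ?nnegrE ?sqrtr_ge0 ?divr_ge0 ?(ltW R00) // q2.
  by move: be2; rewrite expr_div_n; have := sqr_ge0 R0; lra.
pose y' := vec ((be / L ^+ 2) *: a' + (q / r) *: z) (hgt y).
exists y'; rewrite hgt_vec; split=> //.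
- split; last by rewrite hgt_vec.
  apply/eqP; rewrite hor_vec -(@eqrXn2 _ 2) ?enorm_ge0 ?(ltW R00) // enorm_sqr.
  rewrite !(dotDl, dotDr, dotZl, dotZr) [dot z a']dotC az -!enorm_sqr -/L -/r.
  have -> : R0 ^+ 2 = q ^+ 2 + be ^+ 2 / L ^+ 2 by rewrite q2 subrK.
  by apply/eqP; move: (q) => q'; field; rewrite Ln rn.
- rewrite alphaE dot_hor hor_vec hgt_vec dotDr !dotZr az -/a' -enorm_sqr -/L.
  by rewrite mulr0 addr0 divfK ?expf_neq0 // /be; ring.
rewrite horB hor_vec al.
have -> : hor y - ((be / L ^+ 2) *: a' + (q / r) *: z) =
    ((c - be) / L ^+ 2) *: a' + (1 - q / r) *: z.
  rewrite zE; move: (c) (be) (q) => c' be' q'; rewrite mulrBl; apply/rowP => j; rewrite !mxE; ring.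
apply: le_trans (enormD _ _) _; rewrite !enormZ -/L -/r normrM normfV.
rewrite (ger0_norm (sqr_ge0 L)) -{2}(ger0_norm (ltW r0)) -normrM mulrBl mul1r divfK //.
have rq : 0 < r + q by apply: ltr_wpDr => //; exact: sqrtr_ge0.
have rq2 : R0 / 2 <= r + q by rewrite (le_trans qR) // lerDr ltW.
have D : (r - q) * (r + q) = (be - c) * (be + c) / L ^+ 2.
  have -> : (r - q) * (r + q) = r ^+ 2 - q ^+ 2 by ring.
  by rewrite q2 enorm_sqr zz; field.
(* From [(r - q)(r + q) = (be - c)(be + c) / L^2] with [r + q >= R/2] and [|be + c| <= 3LR/2]; the
   normal component contributes the remaining unit of the constant 5. *)
have B : `|r - q| <= 4 / L * `|c - be|.
  rewrite -(ler_pM2r rq) -{1}(ger0_norm (ltW rq)) -normrM D normrM normfV normrM.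
  rewrite (ger0_norm (sqr_ge0 L)) [`|be - c|]distrC ler_pdivrMr ?exprn_gt0 //.
  have -> : 4 / L * `|c - be| * (r + q) * L ^+ 2 = `|c - be| * (4 * (r + q) * L) by field.
  rewrite ler_wpM2l //; apply: le_trans (ler_normD _ _) _.
  have : L * (R0 / 2) <= (r + q) * L by rewrite mulrC ler_wpM2r // ltW.
  have := mulr_gt0 L0 R00; move: hb cL; move: R0 => R1; lra.
have -> : 5 / L * `|c - be| = `|c - be| / L ^+ 2 * L + 4 / L * `|c - be| by field.
by rewrite lerD2l.
Qed.

Variable V : E -> E.
Hypothesis TV : tangent_field A V.

(** The component of [V] along the normal is Lipschitz and vanishes on the trace of the hyperplane,
    so it is bounded by the distance to the foot point; where there is none, [|alpha i|] is bounded
    below and boundedness of [V] is enough. *)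
Lemma tangent_bound i : exists K : R, forall y, Cyl A y -> `|dot (a i) (V y)| <= K * `|alpha i y|.
Proof.
have [f [Cf [M fM] _ fV]] := cylinder_extension R00 TV.
have [Lf Lf0 HL] := lip_ball (R0 ^+ 2 + 1 + 1) (findim_rV R n.+1) (findim_rV R n) (Cf 1%N).
have bd y : Cyl A y -> `|y| <= R0 ^+ 2 + 1 + 1.
  move=> [yR /andP[y0 y1]].
  have := @norm_bound_of_sq R n y (R0 ^+ 2) 1; rewrite expr1n; apply.
    by rewrite -enorm_sqr yR.
  by rewrite ger0_norm.
set L := enorm (hor (a i)).
have L0 : 0 < L by apply: enorm_gt0; exact: (position_hor_normal_neq0 G).
pose K1 := enorm (a i) * (n%:R * M + 1) / (L * (R0 / 2)).
pose K2 := L * (n%:R * (Lf * (5 / L))).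
have LR : 0 < L * (R0 / 2) by rewrite mulr_gt0 // divr_gt0.
have K20 : 0 <= K2 by rewrite (mulr_ge0 (ltW L0)) // mulr_ge0 // mulr_ge0 // divr_ge0 // ltW.
have M0 : 0 <= M by apply: le_trans (normr_ge0 _) (fM 0).
have K10 : 0 <= K1 by rewrite divr_ge0 ?(ltW LR) // mulr_ge0 ?enorm_ge0 // addr_ge0 // mulr_ge0.
exists (K1 + K2) => y Cy; have [far|[y' [Cy' ay' hy' dy']]] := foot_point i Cy.
  apply: (@le_trans _ _ (K1 * `|alpha i y|)); last by rewrite ler_wpM2r // lerDl.
  apply: (@le_trans _ _ (K1 * (L * (R0 / 2)))); last exact: ler_wpM2l.
  rewrite divfK ?gt_eqF //; apply: le_trans (dot_cauchy _ _) _.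
  rewrite ler_wpM2l ?enorm_ge0 // -fV // -ler_sqr ?nnegrE ?enorm_ge0 ?addr_ge0 ?mulr_ge0 //.
  rewrite enorm_hor hor_vec hgt_vec.
  have := enorm_le_norm (f y); have := fM y; have := enorm_ge0 (f y).
  move=> h1 h2 h3; have : enorm (f y) <= n%:R * M by apply: le_trans h3 _; rewrite ler_wpM2l.
  by nra.
have T0 : dot (a i) (V y') = 0.
  have [_ _ HT] := TV.
  have Hi : A (hyp a b i) by rewrite {1}(pos_range G); exists i.
  have y'i : hyp a b i y' by apply/eqP; rewrite -alpha_eq0 ay'.
  have := HT _ _ Hi Cy' y'i; rewrite /hyp /= dotDr y'i.
  by move=> /eqP; rewrite -subr_eq0 addrAC subrr add0r => /eqP.
have -> : dot (a i) (V y) = dot (hor (a i)) (f y - f y').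
  rewrite -[LHS]subr0 -T0 -dotBr -fV // -(fV y') // vecB subrr dot_hor hor_vec hgt_vec mulr0 addr0 //.
apply: (@le_trans _ _ (K2 * `|alpha i y|)); last by rewrite ler_wpM2r // lerDr.
apply: le_trans (dot_cauchy _ _) _; rewrite -mulrA ler_wpM2l ?enorm_ge0 //.
apply: le_trans (enorm_le_norm _) _; rewrite -mulrA ler_wpM2l //.
apply: le_trans (HL _ _ (bd _ Cy) (bd _ Cy')) _; rewrite -mulrA ler_wpM2l //.
apply: le_trans (norm_le_enorm _) _; apply: le_trans dy'.
rewrite -ler_sqr ?nnegrE ?enorm_ge0 // enorm_hor hgtB hy' subrr expr0n /= addr0 //.
Qed.

Variables eta etai : R -> 'rV[R]_n -> 'rV[R]_n.
Hypothesis FE : is_flow A V eta etai.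

(** By [tangent_bound] and Gronwall, a zero of [alpha i] anywhere on a trajectory makes it vanish on
    all of it. *)
Lemma sg_trajectory i x s t : usphere x -> 0 <= s <= 1 -> 0 <= t <= 1 ->
  Num.sg (alpha i (vec (R0 *: eta s x) s)) = Num.sg (alpha i (vec (R0 *: eta t x) t)).
Proof.
move=> x1; have [_ _ FD _ FV] := FE.
pose y t := vec (R0 *: eta t x) t.
have Cy (r : R) : 0 <= r <= 1 -> Cyl A (y r).
  move=> r01; have [_ _ H _] := FD r r01; have [e1 _] := H x x1.
  by split; rewrite ?hor_vec ?hgt_vec // enormZ e1 mulr1 ger0_norm // ltW.
have Dy (r : R) : 0 <= r <= 1 -> is_derive r (1 : R) (fun t => alpha i (y t)) (dot (a i) (V (y r))).
  move=> r01; have D := is_derive_dotl (a i) (FV x r x1 r01).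
  by apply: (is_derive_eq (is_deriveB D (is_derive_cst (b i) r (1 : R)))); rewrite subr0.
have [K HK] := tangent_bound i.
move=> s01 t01; apply: (sg_constant (u := fun t => alpha i (y t)) _ _ s01 t01).
  apply: derivable_within_continuous => r; rewrite in_itv /= => r01.
  exact: (@ex_derive _ _ _ _ _ _ _ (Dy r r01)).
move=> c c01 uc; apply: (gronwall_zero Dy _ c01 uc) => r r01.
exact/HK/Cy.
Qed.

End Trajectories.

(** * The pieces of the disk *)

Section SmoothOn.
Variable R : realType.
Implicit Types X Y Z : normedModType R.

Lemma smooth_on1 X Y Z (S : set X) (f : X -> Y) (h : X -> Z) : smooth_on S f ->
  (forall U, open U -> (forall k, Ck k U f) -> forall k, Ck k U h) -> smooth_on S h.
Proof. by move=> [U [oU SU CU]] H; exists U; split=> //; exact: H. Qed.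

Lemma smooth_on2 X Y Y' Z (S : set X) (f : X -> Y) (g : X -> Y') (h : X -> Z) :
  smooth_on S f -> smooth_on S g ->
  (forall U, open U -> (forall k, Ck k U f) -> (forall k, Ck k U g) -> forall k, Ck k U h) ->
  smooth_on S h.
Proof.
move=> [U [oU SU CU]] [U' [oU' SU' CU']] H; exists (U `&` U'); split; first exact: openI.
  by move=> x Sx; split; [exact: SU|exact: SU'].
apply: H => [|k|k]; first exact: openI.
  by apply: Ck_sub (CU k) => x [].
by apply: Ck_sub (CU' k) => x [].
Qed.

Lemma smooth_on_Ck X Y (S : set X) (f : X -> Y) : (forall k, Ck k setT f) -> smooth_on S f.
Proof. by move=> C; exists setT; split=> //; exact: openT. Qed.

Lemma smooth_on_cont X Y (S : set X) (f : X -> Y) x : smooth_on S f -> S x -> {for x, continuous f}.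
Proof. by move=> [U [_ SU CU]] Sx; apply: Ck_cont (CU 0%N) _; exact: SU. Qed.

Lemma smooth_on_comp X Y Z (S : set X) (S' : set Y) (f : X -> Y) (g : Y -> Z) : findim Y ->
  smooth_on S f -> smooth_on S' g -> (forall x, S x -> S' (f x)) -> smooth_on S (fun x => g (f x)).
Proof.
move=> fY [U [oU SU CU]] [U' [oU' SU' CU']] SS.
have oW : open (U `&` f @^-1` U').
  rewrite openE => x [Ux U'x]; apply: filterI; first exact: open_nbhs_nbhs.
  by apply: (Ck_cont (CU 0%N) Ux); exact: open_nbhs_nbhs.
exists (U `&` f @^-1` U'); split=> // [x Sx|k].
  by split; [exact: SU|apply: SU'; exact: SS].
apply: (Ck_comp (V := U') fY oW) => //; first by move=> x [].
by apply: Ck_sub (CU k) => x [].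
Qed.

Lemma smooth_on_cst X Y (S : set X) (c : Y) : smooth_on S (fun=> c).
Proof. by apply: smooth_on_Ck => k; apply: Ck_cst; exact: openT. Qed.

Lemma smooth_on_pair X Y Y' (S : set X) (f : X -> Y) (g : X -> Y') :
  smooth_on S f -> smooth_on S g -> smooth_on S (fun x => (f x, g x)).
Proof. by move=> Hf Hg; apply: (smooth_on2 Hf Hg) => U oU Cf Cg k; exact: Ck_pair. Qed.

Lemma smooth_on_add X Y (S : set X) (f g : X -> Y) :
  smooth_on S f -> smooth_on S g -> smooth_on S (fun x => f x + g x).
Proof. by move=> Hf Hg; apply: (smooth_on2 Hf Hg) => U oU Cf Cg k; exact: Ck_add. Qed.

Lemma smooth_on_scale X Y (S : set X) (f : X -> R) (g : X -> Y) :
  smooth_on S f -> smooth_on S g -> smooth_on S (fun x => f x *: g x).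
Proof. by move=> Hf Hg; apply: (smooth_on2 Hf Hg) => U oU Cf Cg k; exact: Ck_scale. Qed.

Lemma smooth_on_mul X (S : set X) (f g : X -> R) :
  smooth_on S f -> smooth_on S g -> smooth_on S (fun x => f x * g x).
Proof. exact: smooth_on_scale. Qed.

Lemma smooth_on_opp X Y (S : set X) (f : X -> Y) :
  smooth_on S f -> smooth_on S (fun x => - f x).
Proof. by move=> Hf; apply: (smooth_on1 Hf) => U oU Cf k; exact: Ck_opp. Qed.

Lemma smooth_on_inv X (S : set X) (f : X -> R) : smooth_on S f ->
  (forall x, S x -> f x != 0) -> smooth_on S (fun x => (f x)^-1).
Proof.
move=> Hf f0; apply: (smooth_on_comp _ Hf (S' := [set x | x != 0]) (g := @GRing.inv R)) => //.
by exists [set x | x != 0]; split; [exact: open_neq0|by []|exact: Ck_inv].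
Qed.

Lemma smooth_on_enorm X n (S : set X) (f : X -> 'rV[R]_n) : smooth_on S f ->
  (forall x, S x -> f x != 0) -> smooth_on S (fun x => enorm (f x)).
Proof.
move=> Hf f0; apply: (smooth_on_comp _ Hf (S' := [set x | x != 0]) (g := @enorm R n)) => //.
have oU : open [set x : 'rV[R]_n | x != 0].
  rewrite (_ : mkset _ = @enorm R n @^-1` [set x : R | 0 < x]); last first.
    by apply/seteqP; split=> x /=; [exact: enorm_gt0|exact: enorm_neq0].
  by apply: open_comp => [x _|]; [exact: continuous_enorm|exact: open_gt].
by exists [set x | x != 0]; split=> // k; apply: Ck_enorm => //; exact: Ck_id.
Qed.

Lemma smooth_on_vec X n (S : set X) (f : X -> 'rV[R]_n) (g : X -> R) :
  smooth_on S f -> smooth_on S g -> smooth_on S (fun x => vec (f x) (g x)).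
Proof. by move=> Hf Hg; apply: (smooth_on2 Hf Hg) => U oU Cf Cg k; exact: Ck_vec. Qed.

Lemma smooth_on_cos X (S : set X) (f : X -> R) : smooth_on S f -> smooth_on S (fun x => cos (f x)).
Proof.
move=> Hf; apply: (smooth_on_comp _ Hf (S' := setT) (g := @cos R)) => //.
by apply: smooth_on_Ck => k; exact: (Ck_cos_sin k openT).1.
Qed.

Lemma smooth_on_sin X (S : set X) (f : X -> R) : smooth_on S f -> smooth_on S (fun x => sin (f x)).
Proof.
move=> Hf; apply: (smooth_on_comp _ Hf (S' := setT) (g := @sin R)) => //.
by apply: smooth_on_Ck => k; exact: (Ck_cos_sin k openT).2.
Qed.

Lemma smooth_on_asin X (S : set X) (f : X -> R) : smooth_on S f ->
  (forall x, S x -> -1 < f x < 1) -> smooth_on S (fun x => asin (f x)).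
Proof.
move=> Hf f1; apply: (@smooth_on_comp _ _ _ S [set x : R | -1 < x < 1] f (@asin R)) => //.
by exists [set x | -1 < x < 1]; split; [exact: open_unit_interval|by []|exact: Ck_asin].
Qed.

Lemma smooth_on_fst X Y (S : set (X * Y)) : smooth_on S fst.
Proof. by apply: smooth_on_Ck => k; apply: Ck_fst; exact: openT. Qed.

Lemma smooth_on_snd X Y (S : set (X * Y)) : smooth_on S snd.
Proof. by apply: smooth_on_Ck => k; apply: Ck_snd; exact: openT. Qed.

Lemma smooth_on_id X (S : set X) : smooth_on S id.
Proof. by apply: smooth_on_Ck => k; apply: Ck_id; exact: openT. Qed.

End SmoothOn.

(** * Complexified hyperplanes in terms of tangent vectors *)

Section ComplexPoints.
Variables (R : realType) (n : nat).
Local Notation E := 'rV[R]_n.+1.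
Implicit Types a x w : E.

(** All affine functions constant on a hyperplane are multiples of one, so its complexification,
    defined by all real equations, is cut out by a single complex equation. *)
Lemma hyp_normal_unique a b a' b' : a != 0 ->
  [set x : E | dot a x = b] `<=` [set x | dot a' x = b'] ->
  exists c : R, a' = c *: a /\ b' = c * b.
Proof.
move=> a0 H; have D := dot_gt0 a0; have Dn : dot a a != 0 by rewrite gt_eqF.
pose x0 := (b / dot a a) *: a.
have x0H : dot a x0 = b by rewrite dotZr divfK.
have H0 w : dot a w = 0 -> dot a' w = 0.
  move=> aw; have h1 := H _ x0H; have : [set x | dot a x = b] (x0 + w) by rewrite /= dotDr x0H aw addr0.
  by move/H; rewrite /= dotDr h1 => /eqP; rewrite -subr_eq0 addrAC subrr add0r => /eqP.
pose c := dot a' a / dot a a; pose w := a' - c *: a.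
have aw : dot a w = 0 by rewrite dotBr dotZr divfK // dotC subrr.
have ww : w = 0.
  by apply: dot_eq0; rewrite {1}/w dotBl dotZl aw mulr0 subr0; exact: H0.
have E1 : a' = c *: a by apply/eqP; rewrite -subr_eq0; apply/eqP.
by exists c; split=> //; rewrite -x0H -dotZl -E1; symmetry; exact: H.
Qed.

Lemma cplx_hyp a b (z : E * E) : a != 0 ->
  cplx [set x | dot a x = b] z <-> dot a z.1 = b /\ dot a z.2 = 0.
Proof.
move=> a0; have S a' : \sum_j (a' 0 j)%:C%C * Defs.cpoint z 0 j = (dot a' z.1 +i* dot a' z.2)%C :> R[i].
  rewrite /dot (eq_bigr (fun j => ((a' 0 j * z.1 0 j) +i* (a' 0 j * z.2 0 j))%C)); last first.
    by move=> j _; rewrite mxE; simpc.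
  by elim/big_ind3: _ => // x1 x2 x3 y1 y2 y3 -> ->; simpc.
split=> [H|[h1 h2] a' b' H].
  by have := H a b (fun x => id); rewrite S => -[].
have [c [-> ->]] := hyp_normal_unique a0 H.
by rewrite S !dotZl h1 h2 mulr0.
Qed.

Lemma dot_p0 x : dot (@p0 R n) x = hgt x.
Proof. by rewrite dot_hor /p0 hor_vec hgt_vec dot0l add0r mul1r. Qed.

Lemma p0_neq0 : @p0 R n != 0.
Proof.
by apply/eqP => /(congr1 (@hgt R n)); rewrite /p0 hgt_vec hgt0 => /eqP; rewrite oner_eq0.
Qed.

Lemma cplx_F0 (z : E * E) : cplx (@F0 R n) z <-> hgt z.1 = 0 /\ hgt z.2 = 0.
Proof.
rewrite (_ : @F0 R n = [set x | dot (@p0 R n) x = 0]); last first.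
  by apply/seteqP; split=> x /=; rewrite dot_p0.
rewrite -2!dot_p0; apply: cplx_hyp; exact: p0_neq0.
Qed.

Variables (N : nat) (A : set (set E)) (a : 'I_N -> E) (b : 'I_N -> R).
Hypothesis G : in_position A a b.

Lemma Mcompl_alpha x w : Mcompl A (x, w) <-> forall i, alpha a b i x = 0 -> dot (a i) w != 0.
Proof.
split=> [H i xi|H [D /= HD Hz]].
  apply/negP => /eqP wi; apply: H; exists (hyp a b i); first by rewrite {1}(pos_range G); exists i.
  apply/(cplx_hyp (b i) (x, w) (pos_normal G i)); split=> //=.
  by apply/eqP; rewrite -alpha_eq0 xi.
move: HD Hz; rewrite {1}(pos_range G) => -[i _ <-] /(cplx_hyp (b i) (x, w) (pos_normal G i))[/= xi wi].
have : dot (a i) w != 0 by apply: H; apply/eqP; rewrite alpha_eq0 xi.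
by rewrite wi eqxx.
Qed.

End ComplexPoints.

Section Radial.
Variables (R : realType) (n : nat).
Local Notation E' := 'rV[R]_n.
Implicit Types (f g : E' -> E') (x : E').

Lemma ext0 f : ext f 0 = 0.
Proof. by rewrite /ext enorm0 scale0r. Qed.

Lemma enorm_ext f x : (forall u, usphere u -> usphere (f u)) -> enorm (ext f x) = enorm x.
Proof.
move=> Hf; have [->|x0] := eqVneq x 0; first by rewrite ext0.
by rewrite enormZ Hf ?mulr1 ?ger0_norm ?enorm_ge0 //; exact: enorm_normalize.
Qed.

Lemma extZ f x k : 0 <= k -> ext f (k *: x) = k *: ext f x.
Proof.
rewrite le_eqVlt => /predU1P[<-|k0]; first by rewrite !scale0r ext0.
have E1 : (k * enorm x)^-1 *: (k *: x) = (enorm x)^-1 *: x.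
  by rewrite scalerA invfM mulrAC mulVf ?mul1r // gt_eqF.
by rewrite /ext enormZ (ger0_norm (ltW k0)) E1 scalerA.
Qed.

Lemma extK f g x : (forall u, usphere u -> usphere (f u)) ->
  (forall u, usphere u -> g (f u) = u) -> ext g (ext f x) = x.
Proof.
move=> Hf gf; have [->|x0] := eqVneq x 0; first by rewrite !ext0.
have u1 := enorm_normalize x0.
have xn : enorm x != 0 by rewrite gt_eqF // enorm_gt0.
rewrite /ext -/(ext f x) enorm_ext // scalerA mulVf // scale1r gf //.
by rewrite scalerA mulfV // scale1r.
Qed.

End Radial.

(** * Antipodal involutions carried by the flow *)

Section Antipode.
Variables (R : realType) (n N : nat) (A : set (set 'rV[R]_n.+1)).
Variables (a : 'I_N -> 'rV[R]_n.+1) (b : 'I_N -> R).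
Hypothesis G : in_position A a b.
Local Notation E := 'rV[R]_n.+1.
Local Notation E' := 'rV[R]_n.
Local Notation R0 := (cyl_radius A).
Local Notation alpha := (alpha a b).
Let R00 : 0 < R0 := position_radius_gt0 G.
Variable V : E -> E.
Hypothesis TV : tangent_field A V.
Variables eta etai : R -> E' -> E'.
Hypothesis FE : is_flow A V eta etai.
Implicit Types (x u : E') (v : E) (t : R).

(* The antipodal involution at height t, transported to the bottom sphere. *)
Definition antipode t x : E' := ext (etai t) (- ext (eta t) x).

Lemma eta_sphere t u : 0 <= t <= 1 -> usphere u -> usphere (eta t u).
Proof. by move=> t01 u1; have [_ _ D _ _] := FE; have [_ _ H _] := D t t01; have [] := H u u1. Qed.

Lemma etai_sphere t u : 0 <= t <= 1 -> usphere u -> usphere (etai t u).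
Proof. by move=> t01 u1; have [_ _ D _ _] := FE; have [_ _ _ H] := D t t01; have [] := H u u1. Qed.

Lemma etaK t u : 0 <= t <= 1 -> usphere u -> etai t (eta t u) = u.
Proof. by move=> t01 u1; have [_ _ D _ _] := FE; have [_ _ H _] := D t t01; have [] := H u u1. Qed.

Lemma etaiK t u : 0 <= t <= 1 -> usphere u -> eta t (etai t u) = u.
Proof. by move=> t01 u1; have [_ _ D _ _] := FE; have [_ _ _ H] := D t t01; have [] := H u u1. Qed.

Lemma enorm_ext_eta t x : 0 <= t <= 1 -> enorm (ext (eta t) x) = enorm x.
Proof. by move=> t01; apply: enorm_ext => u; exact: eta_sphere. Qed.

Lemma enorm_antipode t x : 0 <= t <= 1 -> enorm (antipode t x) = enorm x.
Proof.
move=> t01; rewrite enorm_ext => [|u]; last exact: etai_sphere.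
by rewrite enormN enorm_ext_eta.
Qed.

Lemma ext_eta_antipode t x : 0 <= t <= 1 -> ext (eta t) (antipode t x) = - ext (eta t) x.
Proof. by move=> t01; apply: extK => u; [exact: etai_sphere|exact: etaiK]. Qed.

Lemma antipodeK t x : 0 <= t <= 1 -> antipode t (antipode t x) = x.
Proof.
move=> t01; rewrite {1}/antipode ext_eta_antipode // opprK.
by apply: extK => u; [exact: eta_sphere|exact: etaK].
Qed.

Lemma antipodeZ t x k : 0 <= k -> antipode t (k *: x) = k *: antipode t x.
Proof. by move=> k0; rewrite /antipode extZ // -scalerN extZ. Qed.

Lemma antipode0 x : antipode 0 x = - x.
Proof.
have [_ _ _ H _] := FE.
have i01 : 0 <= (0 : R) <= 1 by rewrite lexx ler01.
have [->|x0] := eqVneq x 0; first by rewrite oppr0 /antipode ext0 oppr0 ext0.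
have xn : enorm x != 0 by rewrite gt_eqF // enorm_gt0.
have e0 y : y != 0 -> ext (eta 0) y = y.
  move=> y0; rewrite /ext H; last exact: enorm_normalize.
  by rewrite scalerA mulfV ?scale1r // gt_eqF // enorm_gt0.
have Nx0 : - x != 0 by rewrite oppr_eq0.
rewrite /antipode e0 //; rewrite -{1}(e0 _ Nx0).
by apply: extK => u; [exact: eta_sphere|exact: etaK].
Qed.

Lemma antipode_neq t x : 0 <= t <= 1 -> x != 0 -> antipode t x != x.
Proof.
move=> t01 x0; apply/eqP => E0; have := ext_eta_antipode x t01; rewrite E0 => /eqP.
rewrite -subr_eq0 opprK -mulr2n -scaler_nat scaler_eq0 pnatr_eq0 /= => /eqP e0.
by have := enorm_ext_eta x t01; rewrite e0 enorm0 => /esym/enorm_eq0 /eqP; rewrite (negbTE x0).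
Qed.

Lemma Imap_antipode x : Imap eta etai x = antipode 1 x.
Proof. by []. Qed.

Lemma smooth_on_antipode (X : normedModType R) (S : set X) (h : X -> R) (g : X -> E') :
  smooth_on S g -> smooth_on S h -> (forall z, S z -> g z != 0) -> (forall z, S z -> 0 <= h z <= 1) ->
  smooth_on S (fun z => antipode (h z) (g z)).
Proof.
move=> Sg Sh g0 h01; have [Ce Cei _ _ _] := FE.
have Sext (f : R -> E' -> E') (g' : X -> E') : smooth_on (@usphere R n `*` @unit_interval R) (fun z => f z.2 z.1) ->
    smooth_on S g' -> (forall z, S z -> g' z != 0) -> smooth_on S (fun z => ext (f (h z)) (g' z)).
  move=> Cf Sg' g'0; have Se := smooth_on_enorm Sg' g'0.
  apply: smooth_on_scale => //.
  apply: (@smooth_on_comp _ _ _ _ S _ (fun z => ((enorm (g' z))^-1 *: g' z, h z)) (fun z => f z.2 z.1) _ _ Cf).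
    apply: smooth_on_pair => //; apply: smooth_on_scale => //; apply: smooth_on_inv => // z Sz.
    by rewrite gt_eqF // enorm_gt0 // g'0.
  by move=> z Sz; split; [apply: enorm_normalize; exact: g'0|exact: h01].
apply: (Sext _ (fun z => - ext (eta (h z)) (g z))) => //.
  by apply: smooth_on_opp; apply: Sext.
move=> z Sz; rewrite oppr_eq0; apply: enorm_neq0.
by rewrite enorm_ext_eta; [apply: enorm_gt0; exact: g0|exact: h01].
Qed.

End Antipode.

(** * Norm and latitude as polar coordinates *)

Section Angles.
Variables (R : realType) (n : nat) (A : set (set 'rV[R]_n.+1)).
Local Notation E := 'rV[R]_n.+1.
Local Notation R0 := (cyl_radius A).
Hypothesis R00 : 0 < R0.
Local Notation th := (theta0 A).

Lemma theta0_gt0 : 0 < th.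
Proof. by rewrite -(@atan0 R) lt_atan // invr_gt0. Qed.

Lemma theta0_lt : th < pi / 2.
Proof. exact: atan_ltpi2. Qed.

Lemma small_angle (phi : R) : - th <= phi <= th -> - (pi / 2) < phi < pi / 2.
Proof. by have := theta0_lt; lra. Qed.

Lemma cos_small (phi : R) : - th <= phi <= th -> 0 < cos phi.
Proof. by move=> /small_angle; exact: cos_gt0_pihalf. Qed.

Lemma sin_theta0_gt0 : 0 < sin th.
Proof. by apply: sin_gt0_pihalf; rewrite theta0_gt0 theta0_lt. Qed.

Lemma cos_theta0 : cos th = R0 * sin th.
Proof.
have c0 : 0 < cos th by apply: cos_small; have := theta0_gt0; lra.
have := atanK (R0^-1); rewrite -/th /tan => H.
by rewrite -(divfK (lt0r_neq0 c0) (sin th)) H mulrA mulfV ?mul1r // gt_eqF.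
Qed.

Lemma sin_lt1 (phi : R) : - (pi / 2) < phi < pi / 2 -> -1 < sin phi < 1.
Proof.
move=> /cos_gt0_pihalf c0; have := cos2Dsin2 phi.
by have := exprn_gt0 2 c0; nra.
Qed.

Lemma hgt_ratio (v : E) : -1 <= hgt v / enorm v <= 1.
Proof.
have [->|v0] := eqVneq v 0; first by rewrite hgt0 mul0r lerN10 ler01.
have e0 := enorm_gt0 v0; have := hgt_le_enorm v; rewrite ler_norml => /andP[h1 h2].
by rewrite ler_pdivrMr // ler_pdivlMr // mul1r mulN1r h1 h2.
Qed.

Lemma sin_latitude (v : E) : v != 0 -> enorm v * sin (latitude v) = hgt v.
Proof.
move=> v0; rewrite asinK ?in_itv /= ?hgt_ratio // mulrC divfK // gt_eqF //.
exact: enorm_gt0.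
Qed.

Lemma cos_latitude_ge0 (v : E) : 0 <= cos (latitude v).
Proof. by apply: cos_ge0_pihalf; rewrite asin_geNpi2 ?asin_lepi2 ?hgt_ratio. Qed.

Lemma hor_latitude (v : E) : v != 0 -> enorm (hor v) = enorm v * cos (latitude v).
Proof.
move=> v0; have v1 := ltW (enorm_gt0 v0); have c0 := cos_latitude_ge0 v.
apply/eqP; rewrite -(@eqrXn2 _ 2) ?enorm_ge0 ?(mulr_ge0 v1 c0) //; apply/eqP.
have := enorm_hor v; rewrite -(sin_latitude v0) => H.
have := cos2Dsin2 (latitude v); move: H.
set c := cos _; set s := sin _; set r := enorm v; set k := enorm (hor v).
move=> H1 H2; have -> : k ^+ 2 = r ^+ 2 - (r * s) ^+ 2 by rewrite H1 addrK.
by have -> : r ^+ 2 - (r * s) ^+ 2 = r ^+ 2 * (1 - s ^+ 2) by [ring]; rewrite -H2 addrK exprMn.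
Qed.

Lemma latitude_vec (x : 'rV[R]_n) (h r phi : R) : - (pi / 2) < phi < pi / 2 -> 0 < r ->
  enorm x = r * cos phi -> h = r * sin phi -> enorm (vec x h) = r /\ latitude (vec x h) = phi.
Proof.
move=> phi1 r0 xE hE; have phi2 : - (pi / 2) <= phi <= pi / 2 by lra.
have E1 : enorm (vec x h) = r.
  apply/eqP; rewrite -(@eqrXn2 _ 2) ?enorm_ge0 ?(ltW r0) // enorm_hor hor_vec hgt_vec xE hE.
  by rewrite !exprMn -mulrDr cos2Dsin2 mulr1.
split=> //; rewrite /latitude E1 hgt_vec hE mulrAC mulfV ?gt_eqF // mul1r sinK //.
Qed.

End Angles.

Lemma convex_sign (R : realFieldType) (y p c d : R) : y != 0 -> 0 <= c -> 0 <= d -> c + d = 1 ->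
  c * p + d * y = 0 -> y * p <= 0.
Proof.
move=> y0 c0 d0 cd H; rewrite leNgt; apply/negP => yp.
have y2 : 0 < y ^+ 2 by rewrite exprn_even_gt0.
have : c * (y * p) + d * y ^+ 2 = 0 by rewrite expr2 mulrCA [d * _]mulrCA -mulrDr H mulr0.
have h1 : 0 <= c * (y * p) by rewrite mulr_ge0 // ltW.
have h2 : 0 <= d * y ^+ 2 by rewrite mulr_ge0 // ltW.
move=> H2; have /eqP : c * (y * p) = 0 by lra.
have /eqP : d * y ^+ 2 = 0 by lra.
rewrite mulf_eq0 (gt_eqF y2) orbF => /eqP d00; rewrite mulf_eq0 (gt_eqF yp) orbF => /eqP c00.
by move: cd; rewrite c00 d00 addr0 => /eqP; rewrite eq_sym oner_eq0.
Qed.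

(** * The four pieces lie in the complement *)

Section Pieces.
Variables (R : realType) (n N : nat) (A : set (set 'rV[R]_n.+1)).
Variables (a : 'I_N -> 'rV[R]_n.+1) (b : 'I_N -> R).
Hypothesis G : in_position A a b.
Local Notation E := 'rV[R]_n.+1.
Local Notation E' := 'rV[R]_n.
Local Notation R0 := (cyl_radius A).
Local Notation alpha := (alpha a b).
Local Notation th := (theta0 A).
Let R00 : 0 < R0 := position_radius_gt0 G.
Let th0 : 0 < th := theta0_gt0 R00.
Let thn : th != 0 := lt0r_neq0 th0.
Variable V : E -> E.
Hypothesis TV : tangent_field A V.
Variables eta etai : R -> E' -> E'.
Hypothesis FE : is_flow A V eta etai.
Local Notation J := (antipode eta etai).
Local Notation gamma := (gamma A eta etai).
Implicit Types (x u : E') (v : E) (t : R).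

Lemma gammaE x t : gamma x t =
  vec (cos ((2 * t - 1) * th) *: - J t x) (enorm x * sin ((2 * t - 1) * th)).
Proof. by []. Qed.

Lemma gamma_angle t : 0 <= t <= 1 -> - th <= (2 * t - 1) * th <= th.
Proof. by move=> t01; move: th th0 => s s0; nra. Qed.

Lemma gamma_polar x t : x != 0 -> 0 <= t <= 1 ->
  enorm (gamma x t) = enorm x /\ latitude (gamma x t) = (2 * t - 1) * th.
Proof.
move=> x0 t01; have an := gamma_angle t01; rewrite gammaE.
apply: latitude_vec => //; first exact: small_angle an.
  exact: enorm_gt0.
rewrite enormZ enormN (enorm_antipode FE) // ger0_norm ?(mulrC (enorm x)) //.
exact/ltW/(cos_small an).
Qed.

(** The latitude of [gamma x t] is [(2t - 1) theta0], which recovers [t]; dividing the horizontal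
    part by the cosine leaves [- J t x], and [J t] is an involution. *)
Definition ungamma v : E' * R :=
  let t := (1 + latitude v / th) / 2 in (J t (- ((cos (latitude v))^-1 *: hor v)), t).

Lemma gammaK x t : x != 0 -> 0 <= t <= 1 -> ungamma (gamma x t) = (x, t).
Proof.
move=> x0 t01; have [_ L] := gamma_polar x0 t01.
have c0 := cos_small (gamma_angle t01).
rewrite /ungamma L mulfK //; have -> : (1 + (2 * t - 1)) / 2 = t by field.
by rewrite gammaE hor_vec scalerA mulVf ?gt_eqF // scale1r opprK (antipodeK FE).
Qed.

Lemma latitude_time v : - th <= latitude v <= th -> 0 <= (1 + latitude v / th) / 2 <= 1.
Proof.
move=> L; have : -1 <= latitude v / th <= 1.
  by rewrite ler_pdivlMr // ler_pdivrMr // mulN1r mul1r.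
by lra.
Qed.

Lemma ungammaK v : v != 0 -> - th <= latitude v <= th ->
  gamma (ungamma v).1 (ungamma v).2 = v /\ enorm (ungamma v).1 = enorm v.
Proof.
move=> v0 L; have t01 := latitude_time L; have c0 := cos_small L.
have e1 : enorm (ungamma v).1 = enorm v.
  rewrite (enorm_antipode FE) // enormN enormZ hor_latitude //.
  rewrite ger0_norm ?invr_ge0 ?(ltW c0) // mulrC mulfK // gt_eqF //.
split=> //; rewrite gammaE e1 /ungamma /= (antipodeK FE) // opprK.
have -> : (2 * ((1 + latitude v / th) / 2) - 1) * th = latitude v by field.
by rewrite scalerA mulfV ?gt_eqF // scale1r sin_latitude // vec_eta.
Qed.

Lemma Tshell_neq0 x : Tshell x -> x != 0.
Proof. by move=> /andP[x1 _]; apply: enorm_neq0; apply: lt_le_trans x1; rewrite invr_gt0. Qed.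

Lemma shell_neq0 v : 2^-1 <= enorm v <= 1 -> v != 0.
Proof. by move=> /andP[x1 _]; apply: enorm_neq0; apply: lt_le_trans x1; rewrite invr_gt0. Qed.

Lemma gamma_A4 x t : Tshell x -> 0 <= t <= 1 -> A4 A (gamma x t).
Proof.
move=> Tx t01; have [E1 E2] := gamma_polar (Tshell_neq0 Tx) t01.
by split; rewrite ?E1 ?E2 //; exact: gamma_angle.
Qed.

Lemma ungamma_Tshell v : A4 A v -> Tshell (ungamma v).1 /\ 0 <= (ungamma v).2 <= 1.
Proof.
move=> [v1 L]; have [_ e1] := ungammaK (shell_neq0 v1) L.
by split; [rewrite /Tshell /= e1|exact: latitude_time].
Qed.

Lemma smooth_on_latitude : smooth_on (A4 A) (@latitude R n).
Proof.
have Ce : smooth_on (A4 A) (@enorm R n.+1).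
  by apply: smooth_on_enorm => [|v [/shell_neq0]//]; exact: smooth_on_id.
apply: smooth_on_asin.
  apply: smooth_on_mul; last first.
    by apply: smooth_on_inv => // v [/shell_neq0 v0 _]; rewrite gt_eqF // enorm_gt0.
  by apply: smooth_on_Ck => k; exact: Ck_hgt_id.
move=> v [/shell_neq0 v0 L]; have := sin_lt1 (small_angle L).
by rewrite /latitude asinK // in_itv /= hgt_ratio.
Qed.

Lemma gamma_diffeo : diffeo_between (@Tshell R n `*` @unit_interval R) (A4 A)
  (fun z => gamma z.1 z.2) ungamma.
Proof.
set S := _ `*` _.
have S0 z : S z -> z.1 != 0 by move=> [/Tshell_neq0].
have Ca : smooth_on S (fun z : E' * R => (2 * z.2 - 1) * th).
  apply: smooth_on_mul; last exact: smooth_on_cst.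
  apply: smooth_on_add; last exact: smooth_on_cst.
  by apply: smooth_on_mul; [exact: smooth_on_cst|exact: smooth_on_snd].
split.
- apply: smooth_on_vec.
    apply: smooth_on_scale; first exact: smooth_on_cos.
    apply: smooth_on_opp; apply: (smooth_on_antipode FE) => //.
    + exact: smooth_on_fst.
    + exact: smooth_on_snd.
    + by move=> z [].
  apply: smooth_on_mul; last exact: smooth_on_sin.
  by apply: smooth_on_enorm; [exact: smooth_on_fst|exact: S0].
- have Ct : smooth_on (A4 A) (fun v : E => (1 + latitude v / th) / 2).
    apply: smooth_on_mul; last exact: smooth_on_cst.
    apply: smooth_on_add; first exact: smooth_on_cst.
    by apply: smooth_on_mul; [exact: smooth_on_latitude|exact: smooth_on_cst].
  apply: smooth_on_pair => //; apply: (smooth_on_antipode FE) => //.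
  + apply: smooth_on_opp; apply: smooth_on_scale.
      apply: smooth_on_inv; first exact/smooth_on_cos/smooth_on_latitude.
      by move=> v [_ L]; rewrite (gt_eqF (cos_small L)).
    by apply: smooth_on_Ck => k; apply: Ck_hor; [|apply: Ck_id]; exact: openT.
  + move=> v [/shell_neq0 v0 L]; have c0 := cos_small L.
    apply: enorm_neq0; rewrite enormN enormZ hor_latitude // mulr_gt0 //.
      by rewrite ger0_norm ?invr_ge0 ?invr_gt0 // ltW.
    by rewrite mulr_gt0 // enorm_gt0.
  + by move=> v [_ L]; exact: latitude_time.
- move=> z [Tx t01]; split; first exact: gamma_A4.
  by rewrite gammaK //; [case: z {Tx t01}|exact: Tshell_neq0].
- move=> v A4v; have [h1 h2] := ungamma_Tshell A4v; split=> //.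
  by case: A4v => v1 L; have [] := ungammaK (shell_neq0 v1) L.
Qed.

Definition bottom u : E := vec (R0 *: u) 0.

Lemma alpha_bottom_pos i u : usphere u ->
  0 < alpha i (@p0 R n) * alpha i (bottom u) \/ 0 < alpha i (@p0 R n) * alpha i (bottom (J 1 u)).
Proof.
move=> u1; have I0 : 0 <= (0 : R) <= 1 by rewrite lexx ler01.
have I1 : 0 <= (1 : R) <= 1 by rewrite ler01 lexx.
have J1 : usphere (J 1 u) by rewrite /usphere /= (enorm_antipode FE).
have e0 y : usphere y -> eta 0 y = y by have [_ _ _ + _] := FE; apply.
have ee y : usphere y -> ext (eta 1) y = eta 1 y.
  by move=> y1; rewrite /ext y1 invr1 !scale1r.
have S y : usphere y -> Num.sg (alpha i (bottom y)) = Num.sg (alpha i (vec (R0 *: eta 1 y) 1)).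
  by move=> y1; rewrite -(sg_trajectory G TV FE i y1 I0 I1) e0.
have EJ : eta 1 (J 1 u) = - eta 1 u by rewrite -ee // (ext_eta_antipode FE) // ee.
set x := alpha i (@p0 R n); have x0 : x != 0 by rewrite alpha_eq0 (pos_base G).
set p := alpha i (vec (R0 *: eta 1 u) 1); set q := alpha i (vec (R0 *: eta 1 (J 1 u)) 1).
have pq : p + q = 2 * x.
  rewrite /p /q /x !alphaE EJ addrACA -dotDr vecD scalerN subrr !dot_hor /p0 !hor_vec !hgt_vec.
  by rewrite !dot0r; ring.
have sgp y z w : Num.sg y = Num.sg z -> 0 < w * z -> 0 < w * y :> R.
  by move=> yz; rewrite -(sgr_gt0 (w * y)) sgrM yz -sgrM sgr_gt0.
have x2 : 0 < x ^+ 2 by rewrite exprn_even_gt0.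
have : 0 < x * p + x * q by rewrite -mulrDr pq mulrCA -expr2 mulr_gt0.
have [xp _|xp xq] := ltP 0 (x * p); first by left; apply: sgp xp; exact: S.
by right; apply: (sgp _ q); [exact: S|lra].
Qed.

(** This is the reason for [tan theta0 = 1/R]: the line through [p0] with direction [gamma x 0]
    meets F on the sphere of radius R, at the bottom point of [x / |x|]. *)
Lemma xi_gamma0 x : Tshell x ->
  xi (gamma x 0) = (2 * enorm x - 1) *: bottom ((enorm x)^-1 *: x) + (2 - 2 * enorm x) *: @p0 R n.
Proof.
move=> Tx; have x0 := Tshell_neq0 Tx; have e0 := enorm_gt0 x0.
have I0 : 0 <= (0 : R) <= 1 by rewrite lexx ler01.
have [E1 _] := gamma_polar x0 I0; have s0 := sin_theta0_gt0 R00.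
rewrite /xi E1 gammaE hgt_vec hor_vec mulr0 sub0r mulN1r cosN sinN (antipode0 FE) opprK (cos_theta0 R00).
rewrite /bottom /p0 !vecZ vecD !scaler0 addr0 mulr0 add0r mulr1; congr vec.
by rewrite !scalerA; congr (_ *: _); field; rewrite !gt_eqF.
Qed.

Lemma xi_gamma1 x : Tshell x ->
  xi (gamma x 1) = (2 * enorm x - 1) *: bottom (J 1 ((enorm x)^-1 *: x)) + (2 - 2 * enorm x) *: @p0 R n.
Proof.
move=> Tx; have x0 := Tshell_neq0 Tx; have e0 := enorm_gt0 x0.
have I1 : 0 <= (1 : R) <= 1 by rewrite ler01 lexx.
have [E1 _] := gamma_polar x0 I1; have s0 := sin_theta0_gt0 R00.
rewrite /xi E1 gammaE hgt_vec hor_vec mulr1 (_ : 2 - 1 = 1); last by ring.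
rewrite mul1r (cos_theta0 R00) antipodeZ ?invr_ge0 ?(ltW e0) //.
rewrite /bottom /p0 !vecZ vecD !scaler0 addr0 mulr0 add0r mulr1; congr vec.
by rewrite scalerN scaleNr scalerA -scalerN opprK scalerA !scalerA; congr (_ *: _); field; rewrite !gt_eqF.
Qed.

Lemma base4E x t : Tshell x -> let u := (enorm x)^-1 *: x in
  base4 A eta etai x t =
    (2 * enorm x - 1) *: ((1 - t) *: bottom u + t *: bottom (J 1 u)) + (2 - 2 * enorm x) *: @p0 R n.
Proof.
move=> Tx u; rewrite /base4 xi_gamma0 // xi_gamma1 // -/u.
move: (bottom u) (bottom (J 1 u)) (@p0 R n) => p q y.
by apply/rowP => j; rewrite !mxE; ring.
Qed.

Lemma vec4E x : x != 0 -> let u := (enorm x)^-1 *: x in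
  vec4 eta etai x = (enorm x / R0) *: (bottom u - bottom (J 1 u)).
Proof.
move=> x0 u; have e0 := enorm_gt0 x0.
rewrite /vec4 Imap_antipode /bottom vecB subrr vecZ mulr0; congr vec.
rewrite -scalerBr scalerA divfK ?gt_eqF //.
rewrite /u antipodeZ ?invr_ge0 ?(ltW e0) // -scalerBr scalerA mulfV ?scale1r //.
by rewrite gt_eqF.
Qed.

Lemma gamma0E x : x != 0 -> gamma x 0 = (enorm x * sin th) *: (bottom ((enorm x)^-1 *: x) - @p0 R n).
Proof.
move=> x0; have e0 := enorm_gt0 x0; rewrite gammaE mulr0 sub0r mulN1r cosN sinN (antipode0 FE) opprK (cos_theta0 R00).
rewrite /bottom /p0 vecB vecZ subr0 sub0r mulrN1 mulrN; congr vec.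
by rewrite !scalerA; congr (_ *: _); field; rewrite gt_eqF.
Qed.

Lemma gamma1E x : x != 0 ->
  gamma x 1 = - (enorm x * sin th) *: (bottom (J 1 ((enorm x)^-1 *: x)) - @p0 R n).
Proof.
move=> x0; have e0 := enorm_gt0 x0; rewrite gammaE mulr1 (_ : 2 - 1 = 1); last by ring.
rewrite mul1r (cos_theta0 R00) antipodeZ ?invr_ge0 ?(ltW e0) //.
rewrite /bottom /p0 vecB vecZ subr0 sub0r mulrN1 opprK; congr vec.
by rewrite scalerN scaleNr !scalerA; congr (- (_ *: _)); field; rewrite gt_eqF.
Qed.

Lemma alpha_affine i (x y : E) c d : c + d = 1 -> alpha i (c *: x + d *: y) = c * alpha i x + d * alpha i y.
Proof.
by move=> cd; rewrite !alphaE dotDr !dotZr -[b i in LHS]mul1r -cd; ring.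
Qed.

Lemma Mcompl_piece4 x t : Tshell x -> 0 <= t <= 1 -> Mcompl A (sigma4gamma A eta etai x t).
Proof.
move=> Tx /andP[t0 t1]; have x0 := Tshell_neq0 Tx; have e0 := enorm_gt0 x0.
have /andP[r1 r2] := Tx.
have u1 := enorm_normalize x0; apply/(Mcompl_alpha G) => i.
have xn : alpha i (@p0 R n) != 0 by rewrite alpha_eq0 (pos_base G).
rewrite base4E // vec4E //.
set u := _ *: x; rewrite alpha_affine; last by ring.
rewrite alpha_affine; last by ring.
rewrite dotZr dotBr => H0; move: H0.
have := alpha_bottom_pos i u1; rewrite -/u.
have -> : dot (a i) (bottom u) - dot (a i) (bottom (J 1 u)) = alpha i (bottom u) - alpha i (bottom (J 1 u)).
  by rewrite !alphaE; ring.
move: (alpha i (@p0 R n)) xn (alpha i (bottom u)) (alpha i (bottom (J 1 u))) => y yn p q pq H.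
rewrite mulf_neq0 //; first by rewrite mulf_neq0 ?invr_eq0 ?gt_eqF.
rewrite subr_eq0; apply/eqP => pq1; move: H pq; rewrite -pq1 -mulrDl subrK mul1r => H pq.
have {pq} yp : 0 < y * p by case: pq.
have f1 : 2 * enorm x - 1 + (2 - 2 * enorm x) = 1 by ring.
have f2 : 0 <= 2 * enorm x - 1 by lra.
have f3 : 0 <= 2 - 2 * enorm x by lra.
by have := convex_sign yn f2 f3 f1 H; rewrite leNgt yp.
Qed.

Lemma vec4_neq0 x : x != 0 -> vec4 eta etai x != 0.
Proof.
move=> x0; apply/eqP => /(congr1 (@hor R n)); rewrite hor_vec hor0 Imap_antipode => /eqP.
have I1 : 0 <= (1 : R) <= 1 by rewrite ler01 lexx.
by rewrite subr_eq0 eq_sym (negbTE (antipode_neq FE I1 x0)).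
Qed.

Lemma hgt_base4 x t : Tshell x -> hgt (base4 A eta etai x t) = 2 - 2 * enorm x.
Proof.
move=> Tx; rewrite base4E // /bottom /p0 !(hgtD, hgtZ, hgt_vec).
by rewrite !mulr0 addr0 mulr0 add0r mulr1.
Qed.

Lemma latitude_hgt v : latitude v != 0 -> hgt v != 0.
Proof. 
have asin0 : asin 0 = 0 :> R.
  by rewrite -{1}(@sin0 R) sinK // in_itv /= oppr_le0 divr_ge0 ?pi_ge0.
by apply: contra_neq; rewrite /latitude => ->; rewrite mul0r.
Qed.

Lemma A23_hgt v : A2 A v \/ A3 A v -> 2^-1 <= enorm v <= 1 /\ hgt v != 0.
Proof.
move=> [[v1 L]|[v1 L]]; split=> //; apply: latitude_hgt.
  by rewrite gt_eqF // (lt_le_trans th0).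
by rewrite lt_eqF // (le_lt_trans L) // oppr_lt0.
Qed.

Lemma xiE v : hgt v != 0 -> xi v = @p0 R n - ((2 * enorm v - 1) / hgt v) *: v.
Proof.
move=> v0; apply: vec_inj; rewrite /xi /p0 !(horB, hgtB, horZ, hgtZ, hor_vec, hgt_vec).
  by rewrite sub0r scaleNr.
by rewrite divfK //; ring.
Qed.

Lemma alpha_xi i v : hgt v != 0 -> alpha i (xi v) = alpha i (@p0 R n) - (2 * enorm v - 1) / hgt v * dot (a i) v.
Proof. by move=> v0; rewrite xiE // !alphaE dotBr dotZr; ring. Qed.

(** The base point lies on the line through [p0] with direction [v]. If [v] is tangent to a
    hyperplane, [alpha i] is constant on that line, equal to its nonzero value at [p0]. *)
Lemma Mcompl_piece23 v : hgt v != 0 -> Mcompl A (sigma23 v).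
Proof.
move=> v0; apply/(Mcompl_alpha G) => i; rewrite alpha_xi // => H; apply/eqP => v00; move: H.
by rewrite v00 mulr0 subr0 => /eqP; rewrite alpha_eq0; apply/negP; exact: (pos_base G).
Qed.

Lemma Mcompl_p0 w : Mcompl A (@p0 R n, w).
Proof.
by apply/(Mcompl_alpha G) => i /eqP; rewrite alpha_eq0 (negbTE (pos_base G i)).
Qed.

Lemma xi_inner v : enorm v = 2^-1 -> xi v = @p0 R n.
Proof.
move=> v1; rewrite /xi v1 divff ?pnatr_eq0 // subrr mul0r oppr0 scale0r /p0.
by congr vec; ring.
Qed.

(** For [t = 0] the base point is a convex combination of [p0] and [U = bottom u]. If it is on the
    hyperplane, [alpha i] at [U] is not of the sign at [p0], so at the partner [U'] it is. Both
    vectors are positive multiples of differences, [U - p0] and [U - U'], pointing away from points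
    of that sign. The case [t = 1] exchanges the roles of [U] and [U'] and reverses the first
    difference. *)
Lemma same_side_seam i x (t : R) : Tshell x -> t = 0 \/ t = 1 ->
  alpha i (xi (gamma x t)) = 0 -> 0 < dot (a i) (gamma x t) * dot (a i) (vec4 eta etai x).
Proof.
move=> Tx t01; have x0 := Tshell_neq0 Tx; have e0 := enorm_gt0 x0.
have /andP[r1 r2] := Tx.
have u1 := enorm_normalize x0; have s0 := sin_theta0_gt0 R00.
have xn : alpha i (@p0 R n) != 0 by rewrite alpha_eq0 (pos_base G).
have := alpha_bottom_pos i u1; rewrite vec4E // dotZr dotBr.
set u := _ *: x.
have -> : dot (a i) (bottom u) - dot (a i) (bottom (J 1 u)) = alpha i (bottom u) - alpha i (bottom (J 1 u)).
  by rewrite !alphaE; ring.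
have k0 : 0 < enorm x * sin th by rewrite mulr_gt0.
have k1 : 0 < enorm x / R0 by rewrite divr_gt0.
have f1 : 2 * enorm x - 1 + (2 - 2 * enorm x) = 1 by ring.
have f2 : 0 <= 2 * enorm x - 1 by lra.
have f3 : 0 <= 2 - 2 * enorm x by lra.
have dB w : dot (a i) (w - @p0 R n) = alpha i w - alpha i (@p0 R n) by rewrite alphaB.
case: t01 => ->.
  rewrite xi_gamma0 // gamma0E // -/u dotZr dB alpha_affine //.
  move: (2 * enorm x - 1) (2 - 2 * enorm x) (enorm x * sin th) (enorm x / R0) f1 f2 f3 k0 k1.
  move: (alpha i (@p0 R n)) xn (alpha i (bottom u)) (alpha i (bottom (J 1 u))) => y yn p q.
  move=> c d k l cd c0 d0 k0 l0 pq H.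
  have y2 : 0 < y ^+ 2 by rewrite exprn_even_gt0.
  have yp : y * p <= 0 := convex_sign yn c0 d0 cd H.
  have yq : 0 < y * q by case: pq => // ; rewrite ltNge yp.
  (* Each factor is multiplied by [y], the value at [p0], so that only signs relative to it matter;
     dividing by [y^2] compensates. *)
  rewrite (_ : _ * _ = (k * l) * ((y * p - y ^+ 2) * (y * p - y * q) / y ^+ 2)); last first.
    by field.
  apply: mulr_gt0; first exact: mulr_gt0.
  by apply: divr_gt0 => //; rewrite nmulr_rgt0; lra.
rewrite xi_gamma1 // gamma1E // -/u dotZr dB alpha_affine //.
move: (2 * enorm x - 1) (2 - 2 * enorm x) (enorm x * sin th) (enorm x / R0) f1 f2 f3 k0 k1.
move: (alpha i (@p0 R n)) xn (alpha i (bottom u)) (alpha i (bottom (J 1 u))) => y yn p q.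
move=> c d k l cd c0 d0 k0 l0 pq H.
have y2 : 0 < y ^+ 2 by rewrite exprn_even_gt0.
have yq : y * q <= 0 := convex_sign yn c0 d0 cd H.
have yp : 0 < y * p by case: pq => // ; rewrite [0 < y * q]ltNge yq.
rewrite (_ : _ * _ = (k * l) * ((y ^+ 2 - y * q) * (y * p - y * q) / y ^+ 2)); last first.
  by field.
apply: mulr_gt0; first exact: mulr_gt0.
by apply: divr_gt0 => //; apply: mulr_gt0; lra.
Qed.

Lemma rotate_dot_neq0 i v w rho : 0 <= rho <= pi / 2 ->
  0 < dot (a i) v * dot (a i) w -> dot (a i) (rotate rho v w) != 0.
Proof.
move=> /andP[r0 r1] vw; rewrite dotDr !dotZr.
have c0 : 0 <= cos rho by apply: cos_ge0_pihalf; rewrite r1 andbT; have := pi_ge0 R; lra.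
have s0 : 0 <= sin rho by apply: sin_ge0_pi; rewrite r0 /=; have := pi_ge0 R; lra.
have := cos2Dsin2 rho; move: (cos rho) (sin rho) c0 s0 (dot (a i) v) (dot (a i) w) vw.
move=> c s c0 s0 p q pq cs; apply/eqP => H.
have H2 : p * (c * p + s * q) = 0 by rewrite H mulr0.
have p2 : 0 < p ^+ 2.
  by rewrite exprn_even_gt0 //=; apply/eqP => p0; move: pq; rewrite p0 mul0r ltxx.
have h1 : 0 <= c * p ^+ 2 by rewrite mulr_ge0 // ltW.
have h2 : 0 <= s * (p * q) by rewrite mulr_ge0 // ltW.
have h3 : c * p ^+ 2 + s * (p * q) = 0 by rewrite -H2; ring.
have cz : c = 0 by apply/eqP; rewrite -(mulIr_eq0 _ (mulIf (lt0r_neq0 p2))); apply/eqP; lra.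
have sz : s = 0 by apply/eqP; rewrite -(mulIr_eq0 _ (mulIf (lt0r_neq0 pq))); apply/eqP; lra.
by move: cs; rewrite cz sz !expr0n addr0 => /eqP; rewrite eq_sym oner_eq0.
Qed.

Lemma seam_time x t : Tshell x -> 0 <= t <= 1 -> A2 A (gamma x t) \/ A3 A (gamma x t) -> t = 0 \/ t = 1.
Proof.
move=> Tx t01; have [_ L] := gamma_polar (Tshell_neq0 Tx) t01.
move=> [[_]|[_]]; rewrite L => H; [right|left].
  by have := th0; move: H; move: th => s; nra.
by have := th0; move: H; move: th => s; nra.
Qed.

Lemma base4_end x t : t = 0 \/ t = 1 -> base4 A eta etai x t = xi (gamma x t).
Proof.
by move=> [] ->; rewrite /base4; [rewrite subr0 scale1r scale0r addr0|rewrite subrr scale0r scale1r add0r].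
Qed.

Lemma Mcompl_seam x t rho : Tshell x -> t = 0 \/ t = 1 -> 0 <= rho <= pi / 2 ->
  Mcompl A (xi (gamma x t), rotate rho (gamma x t) (vec4 eta etai x)).
Proof.
move=> Tx t01 r01; apply/(Mcompl_alpha G) => i H; apply: rotate_dot_neq0 => //.
exact: same_side_seam.
Qed.

Theorem pieces_are_valid : pieces_valid A eta etai.
Proof.
split; first by exists ungamma; exact: gamma_diffeo.
split; first split.
- by move=> v _; exact: Mcompl_p0.
- by move=> v /A23_hgt[_ v0]; exact: Mcompl_piece23.
- move=> x t Tx t01; split; first exact: Mcompl_piece4.
  move=> x1; split.
    by apply/cplx_F0; rewrite /= hgt_base4 // x1 hgt_vec; split=> //; ring.
  by move=> [_ /eqP]; rewrite (negbTE (vec4_neq0 (Tshell_neq0 Tx))).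
split.
  move=> v v1 /A23_hgt[v2 _]; rewrite /sigma1 /sigma23 xi_inner //.
  by apply/eqP; rewrite eq_le [_ <= 2^-1]v1; case/andP: v2 => ->.
move=> x t Tx t01 /= H; have te := seam_time Tx t01 H; split.
- exact: base4_end.
- move=> H0; rewrite {1}(pos_range G) => -[i _ <-] Hi a' b' Eab.
  have S : [set y | dot (a i) y = b i] `<=` [set y | dot a' y = b'] by rewrite -Eab.
  have [c [Ea Eb]] := hyp_normal_unique (pos_normal G i) S.
  have al0 : alpha i (xi (gamma x t)) = 0 by apply/eqP; rewrite alpha_eq0; exact/eqP.
  have pos := same_side_seam Tx te al0.
  (* The factor [c] relating the two equations is nonzero, for otherwise the second equation would
     hold everywhere, in particular at [p0]. *)
  rewrite Ea !dotZl mulrACA mulr_gt0 // -expr2 exprn_even_gt0 //=; apply/eqP => c0.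
  have : hyp a b i (@p0 R n) by rewrite Eab /= Ea Eb c0 scale0r dot0l mul0r.
  by move/eqP; rewrite (negbTE (pos_base G i)).
- by move=> rho r01; exact: Mcompl_seam.
Qed.

End Pieces.

(** * A nowhere zero homotopy along the seam *)

Section Pasting.
Variables (R : realType) (n N : nat) (A : set (set 'rV[R]_n.+1)).
Variables (a : 'I_N -> 'rV[R]_n.+1) (b : 'I_N -> R).
Hypothesis G : in_position A a b.
Local Notation E := 'rV[R]_n.+1.
Local Notation E' := 'rV[R]_n.
Local Notation R0 := (cyl_radius A).
Local Notation th := (theta0 A).
Let R00 : 0 < R0 := position_radius_gt0 G.
Let th0 : 0 < th := theta0_gt0 R00.
Variable V : E -> E.
Hypothesis TV : tangent_field A V.
Variables eta etai : R -> E' -> E'.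
Hypothesis FE : is_flow A V eta etai.
Local Notation J := (antipode eta etai).
Local Notation gamma := (gamma A eta etai).
Local Notation vec4 := (vec4 eta etai).
Implicit Types (x u : E') (v : E) (t rho : R).

(** Runs from [- J 1/2 x], the horizontal part of [gamma x 1/2], to [x - J 1 x], that of [vec4 x]:
    the time of the involution moves from [1/2] to 1 while [x] is faded in. *)
Definition shifted_antipode x rho : E' := sin rho *: x - J (2^-1 + rho / pi) x.

(* The plain rotation vanishes at [t = 1/2] for some [rho]; there it is replaced by
   [shifted_antipode], whose two terms have different norms before [rho = pi / 2]. *)
Definition seam_homotopy x t rho : E :=
  rotate rho (gamma x t) (vec4 x) + (1 - `|2 * t - 1|) *:
    vec (shifted_antipode x rho - hor (rotate rho (gamma x 2^-1) (vec4 x))) 0.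

Lemma rotate0 v w : rotate 0 v w = v :> E.
Proof. by rewrite /rotate cos0 sin0 scale1r scale0r addr0. Qed.

Lemma rotate_pihalf v w : rotate (pi / 2) v w = w :> E.
Proof. by rewrite /rotate cos_pihalf sin_pihalf scale1r scale0r add0r. Qed.

Lemma quarter_cos rho : quarter rho -> cos rho = 0 -> rho = pi / 2.
Proof.
move=> /andP[r0 r1] c0; apply/eqP; rewrite eq_le r1 /= leNgt; apply/negP => r2.
have : 0 < cos rho by apply: cos_gt0_pihalf; rewrite r2 andbT; have := pi_gt0 R; lra.
by rewrite c0 ltxx.
Qed.

Lemma quarter_time rho : quarter rho -> 0 <= 2^-1 + rho / pi <= 1.
Proof.
move=> /andP[r0 r1]; have p0 := pi_gt0 R.
have : 0 <= rho / pi by rewrite divr_ge0 // ltW.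
have : rho / pi <= 2^-1 by rewrite ler_pdivrMr // mulrC.
by lra.
Qed.

Lemma gamma_mid x : gamma x 2^-1 = vec (- J 2^-1 x) 0.
Proof.
rewrite gammaE (_ : 2 * 2^-1 - 1 = 0); last by rewrite divff ?pnatr_eq0 // subrr.
by rewrite mul0r cos0 sin0 mulr0 scale1r.
Qed.

Lemma seam_homotopy_cont (z : E' * R * R) : Tshell z.1.1 -> 0 <= z.1.2 <= 1 -> quarter z.2 ->
  {for z, continuous (fun z => seam_homotopy z.1.1 z.1.2 z.2)}.
Proof.
move=> Tz tz qz.
pose S := [set z : E' * R * R | [/\ Tshell z.1.1, 0 <= z.1.2 <= 1 & quarter z.2]].
have Sz : S z by [].
have half01 : 0 <= (2^-1 : R) <= 1 by lra.
have C1 : smooth_on S (fun z : E' * R * R => z.1).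
  by exact: smooth_on_fst.
have C11 : smooth_on S (fun z : E' * R * R => z.1.1).
  by apply: (smooth_on_comp _ C1 (S' := setT) (g := fst)) => //; exact: smooth_on_fst.
have C12 : smooth_on S (fun z : E' * R * R => z.1.2).
  by apply: (smooth_on_comp _ C1 (S' := setT) (g := snd)) => //; exact: smooth_on_snd.
have C2 : smooth_on S (fun z : E' * R * R => z.2) by exact: smooth_on_snd.
have S0 y : S y -> y.1.1 != 0 by move=> [/Tshell_neq0].
have [CG _ _ _] := gamma_diffeo G FE.
have Cgam (g : E' * R * R -> R) : smooth_on S g -> (forall y, S y -> 0 <= g y <= 1) ->
    smooth_on S (fun z => gamma z.1.1 (g z)).
  move=> Cg g01; apply: (smooth_on_comp _ (smooth_on_pair C11 Cg) CG) => y Sy.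
  by split; [case: Sy|exact: g01].
have CJ (g : E' * R * R -> R) : smooth_on S g -> (forall y, S y -> 0 <= g y <= 1) ->
    smooth_on S (fun z => J (g z) z.1.1).
  by move=> Cg g01; apply: (smooth_on_antipode FE).
have Cv : smooth_on S (fun z => vec4 z.1.1).
  apply: smooth_on_vec; last exact: smooth_on_cst.
  apply: smooth_on_add => //; apply: smooth_on_opp.
  by apply: (CJ (fun=> 1)); [exact: smooth_on_cst|move=> y _; rewrite ler01 lexx].
have Ccos := smooth_on_cos C2; have Csin := smooth_on_sin C2.
have Crot (g : E' * R * R -> E) : smooth_on S g -> smooth_on S (fun z => rotate z.2 (g z) (vec4 z.1.1)).
  by move=> Cg; apply: smooth_on_add; apply: smooth_on_scale.
have CY : smooth_on S (fun z : E' * R * R =>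
    vec (shifted_antipode z.1.1 z.2 - hor (rotate z.2 (gamma z.1.1 2^-1) (vec4 z.1.1))) 0).
  apply: smooth_on_vec; last exact: smooth_on_cst.
  apply: smooth_on_add.
    apply: smooth_on_add; first exact: smooth_on_scale.
    apply: smooth_on_opp; apply: CJ => [|y [_ _]]; last exact: quarter_time.
    apply: smooth_on_add; first exact: smooth_on_cst.
    by apply: smooth_on_mul => //; exact: smooth_on_cst.
  apply: smooth_on_opp.
  have CR : smooth_on S (fun z => rotate z.2 (gamma z.1.1 2^-1) (vec4 z.1.1)).
    by apply: Crot; apply: (Cgam (fun=> 2^-1)) => //; exact: smooth_on_cst.
  by apply: (smooth_on1 CR) => U oU C k; exact: Ck_hor.
apply: cvgD; first by apply: (smooth_on_cont _ Sz); apply: Crot; apply: Cgam => // y [].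
apply: cvgZ; last exact: (smooth_on_cont CY Sz).
apply: cvgB; first exact: cvg_cst.
apply: cvg_norm; apply: (smooth_on_cont (f := fun z : E' * R * R => 2 * z.1.2 - 1) _ Sz).
apply: smooth_on_add; last exact: smooth_on_cst.
by apply: smooth_on_mul => //; exact: smooth_on_cst.
Qed.

Lemma seam_homotopy0 x t : seam_homotopy x t 0 = gamma x t.
Proof.
rewrite /seam_homotopy !rotate0 gamma_mid hor_vec /shifted_antipode sin0 scale0r sub0r mul0r addr0.
rewrite subrr (_ : vec 0 0 = 0) ?scaler0 ?addr0 //.
by apply: vec_inj; rewrite ?hor_vec ?hor0 // hgt_vec hgt0.
Qed.

Lemma seam_homotopy1 x t : seam_homotopy x t (pi / 2) = vec4 x.
Proof.
have pn : pi != 0 :> R by rewrite gt_eqF // pi_gt0.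
rewrite /seam_homotopy !rotate_pihalf /shifted_antipode sin_pihalf scale1r.
rewrite (_ : 2^-1 + pi / 2 / pi = 1); last by rewrite mulrAC divff // mul1r; lra.
rewrite hor_vec subrr (_ : vec 0 0 = 0) ?scaler0 ?addr0 //.
by apply: vec_inj; rewrite ?hor_vec ?hor0 // hgt_vec hgt0.
Qed.

Lemma seam_homotopy_end x t rho : t = 0 \/ t = 1 ->
  seam_homotopy x t rho = rotate rho (gamma x t) (vec4 x).
Proof.
move=> t01; rewrite /seam_homotopy (_ : `|2 * t - 1| = 1) ?subrr ?scale0r ?addr0 //.
case: t01 => ->; first by rewrite mulr0 sub0r normrN1.
by rewrite mulr1 (_ : 2 - 1 = 1) ?normr1 //; ring.
Qed.

(** The height is [cos rho |x| sin((2t - 1) theta0)], which vanishes only for [rho = pi/2], where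
    the value is [vec4 x], or for [t = 1/2]. There the two terms of [shifted_antipode] have norms
    [sin rho |x|] and [|x|], equal only for [rho = pi/2]. *)
Lemma seam_homotopy_neq0 x t rho : Tshell x -> 0 <= t <= 1 -> quarter rho ->
  seam_homotopy x t rho != 0.
Proof.
move=> Tx t01 qr; have x0 := Tshell_neq0 Tx; have e0 := enorm_gt0 x0.
apply/eqP => H; have := congr1 (@hgt R n) H.
rewrite hgtD hgtZ hgt_vec mulr0 addr0 hgtD !hgtZ gammaE !hgt_vec mulr0 addr0 hgt0.
move=> /eqP; rewrite mulf_eq0 => /orP[/eqP c0|].
  move: H; rewrite (quarter_cos qr c0) seam_homotopy1 => /eqP.
  by rewrite (negbTE (vec4_neq0 FE x0)).
rewrite mulf_eq0 (gt_eqF e0) /= => /eqP s0.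
have an := small_angle (gamma_angle G t01).
have z0 : (2 * t - 1) * th = 0.
  rewrite -[LHS]sinK ?in_itv /=; last lra.
  by rewrite s0 -[in LHS](@sin0 R) sinK // in_itv /= oppr_le0 divr_ge0 ?pi_ge0.
have th2 : t = 2^-1.
  move/eqP: z0; rewrite mulf_eq0 (gt_eqF th0) orbF subr_eq0 => /eqP t1.
  by lra.
have := congr1 (@hor R n) H; rewrite /seam_homotopy th2 divff ?pnatr_eq0 // subrr normr0 subr0 scale1r.
rewrite horD hor_vec [hor _ + _]addrC subrK hor0 /shifted_antipode => /eqP.
rewrite subr_eq0 => /eqP K0; have := congr1 (@enorm R n) K0.
rewrite (enorm_antipode FE) ?quarter_time // enormZ => /eqP.
rewrite -{2}[enorm x]mul1r -subr_eq0 -mulrBl mulf_eq0 (gt_eqF e0) orbF subr_eq0 => /eqP s1.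
have c0 : cos rho = 0.
  have := cos2Dsin2 rho; rewrite -[sin rho ^+ 2]real_normK ?num_real // s1 expr1n => cs.
  by apply/eqP; rewrite -sqrf_eq0; apply/eqP; lra.
move: H; rewrite (quarter_cos qr c0) seam_homotopy1 => /eqP.
by rewrite (negbTE (vec4_neq0 FE x0)).
Qed.

Theorem pasting_exists : exists h, pasting A eta etai h.
Proof.
exists seam_homotopy; split.
  apply: continuous_in_subspaceT => z /[!inE] -[[Tz tz _] qz].
  exact: seam_homotopy_cont.
move=> x t [Tx t01 _]; split.
- exact: seam_homotopy0.
- exact: seam_homotopy1.
- by move=> te rho _; exact: seam_homotopy_end.
- by move=> _ rho qr; exact: seam_homotopy_neq0.
Qed.

End Pasting.

(** * The glued disk *)

Section Within.
Variables X Y Z : topologicalType.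

Lemma within_eq (A : set X) (f g : X -> Y) : (forall x, A x -> f x = g x) ->
  {within A, continuous g} -> {within A, continuous f}.
Proof. by move=> fg; apply: subspace_eq_continuous => x /[!inE] Ax; apply/esym; exact: fg. Qed.

Lemma within_pointwise (A : set X) (f : X -> Y) : (forall x, A x -> {for x, continuous f}) ->
  {within A, continuous f}.
Proof. by move=> H; apply: continuous_in_subspaceT => x /[!inE] /H. Qed.

Lemma within_comp (A : set X) (B : set Y) (k : X -> Y) (H : Y -> Z) :
  (forall x, A x -> {for x, continuous k}) -> (forall x, A x -> B (k x)) ->
  {within B, continuous H} -> {within A, continuous (fun x => H (k x))}.
Proof.
move=> kc kB /subspace_continuousP Hc; apply/subspace_continuousP => x Ax.
have K : k y @[y --> within A (nbhs x)] --> within B (nbhs (k x)).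
  move=> P HP; apply: (@filterS _ (nbhs x) _ _ _ _ (kc x Ax _ HP)) => y Hy Ay.
  exact: Hy (kB _ Ay).
exact: cvg_comp K (Hc _ (kB _ Ax)).
Qed.

Lemma for_pair (x : X) (f : X -> Y) (g : X -> Z) :
  {for x, continuous f} -> {for x, continuous g} -> {for x, continuous (fun z => (f z, g z))}.
Proof. by move=> cf cg; exact: cvg_pair cf cg. Qed.

End Within.

Lemma within_pair (X : topologicalType) (Y Z : topologicalType) (A : set X) (f : X -> Y) (g : X -> Z) :
  {within A, continuous f} -> {within A, continuous g} -> {within A, continuous (fun x => (f x, g x))}.
Proof. by move=> cf cg x; apply: cvg_pair; [exact: cf|exact: cg]. Qed.

Section Gluing.
Variables (R : realType) (n N : nat) (A : set (set 'rV[R]_n.+1)).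
Variables (a : 'I_N -> 'rV[R]_n.+1) (b : 'I_N -> R).
Hypothesis G : in_position A a b.
Local Notation E := 'rV[R]_n.+1.
Local Notation E' := 'rV[R]_n.
Local Notation R0 := (cyl_radius A).
Local Notation th := (theta0 A).
Let R00 : 0 < R0 := position_radius_gt0 G.
Let th0 : 0 < th := theta0_gt0 R00.
Variable V : E -> E.
Hypothesis TV : tangent_field A V.
Variables eta etai : R -> E' -> E'.
Hypothesis FE : is_flow A V eta etai.
Local Notation J := (antipode eta etai).
Local Notation gamma := (gamma A eta etai).
Local Notation vec4 := (vec4 eta etai).
Local Notation base4 := (base4 A eta etai).
Local Notation ungamma := (ungamma A eta etai).
Variable h : E' -> R -> R -> E.
Hypothesis Ph : pasting A eta etai h.
Implicit Types (x u : E') (v : E) (t rho : R).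

Definition gauge4 x t : R := Num.max (2 * (1 - enorm x)) `|2 * t - 1|.
Definition inner_pt x : E' := ((2 * enorm x - 1) / enorm x) *: x.
Definition seam_pt x t : E' := ((1 + (enorm x - 1) / gauge4 x t) / enorm x) *: x.
Definition seam_tm x t : R := 2^-1 + (t - 2^-1) / gauge4 x t.
Definition inner4 x t : E * E := sigma4gamma A eta etai (inner_pt x) (2 * t - 2^-1).
Definition outer4 x t : E * E :=
  (base4 (seam_pt x t) (seam_tm x t), h (seam_pt x t) (seam_tm x t) (pi * (1 - gauge4 x t))).
Definition cap x t : E * E := if gauge4 x t <= 2^-1 then inner4 x t else outer4 x t.

Definition glue v : E * E :=
  if enorm v <= 2^-1 then sigma1 v
  else if th <= `|latitude v| then sigma23 v
  else cap (ungamma v).1 (ungamma v).2.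

Lemma gauge4_le1 x t : Tshell x -> 0 <= t <= 1 -> gauge4 x t <= 1.
Proof. by move=> /andP[r1 r2] t01; rewrite ge_max ler_norml; apply/andP; split; lra. Qed.

Lemma inner_ptP x t : Tshell x -> 0 <= t <= 1 -> gauge4 x t <= 2^-1 ->
  Tshell (inner_pt x) /\ 0 <= 2 * t - 2^-1 <= 1.
Proof.
move=> Tx t01; rewrite ge_max ler_norml => /andP[h1 h2].
have e0 := enorm_gt0 (Tshell_neq0 Tx); have /andP[r1 r2] := Tx.
split; last by lra.
rewrite /Tshell /= /inner_pt enormZ ger0_norm ?divfK ?gt_eqF //; first by lra.
by rewrite divr_ge0 ?(ltW e0) //; lra.
Qed.

(** The parameter point [(|x'|, t)] is projected radially from [(1, 1/2)] to the seam: the argument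
    that attains the maximum in [gauge4] decides between [|x'| = 1/2] and the two ends of [t]. *)
Lemma seam_ptP x t : Tshell x -> 0 <= t <= 1 -> 2^-1 <= gauge4 x t ->
  seam (seam_pt x t) (seam_tm x t) /\ quarter (pi * (1 - gauge4 x t)).
Proof.
move=> Tx t01 g2; have g1 := gauge4_le1 Tx t01.
have e0 := enorm_gt0 (Tshell_neq0 Tx); have /andP[r1 r2] := Tx.
have p0 := pi_gt0 R.
have g0 : 0 < gauge4 x t by lra.
have ga : 2 * (1 - enorm x) <= gauge4 x t by rewrite le_max lexx.
have gb : `|2 * t - 1| <= gauge4 x t by rewrite le_max lexx orbT.
have k1 : -(2^-1) <= (enorm x - 1) / gauge4 x t <= 0.
  by rewrite ler_pdivlMr // ler_pdivrMr // mul0r; lra.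
have en : enorm (seam_pt x t) = 1 + (enorm x - 1) / gauge4 x t.
  rewrite /seam_pt enormZ ger0_norm ?divfK ?gt_eqF //.
  by rewrite divr_ge0 ?(ltW e0) //; lra.
split; last by apply/andP; split; nra.
split.
- by rewrite /Tshell /= en; lra.
- have : -(2^-1) <= (t - 2^-1) / gauge4 x t <= 2^-1.
    by rewrite ler_pdivlMr // ler_pdivrMr //; move: gb; rewrite ler_norml; lra.
  by rewrite /unit_interval /= /seam_tm; lra.
have gn : gauge4 x t != 0 by rewrite gt_eqF.
have [gE|gE] : gauge4 x t = 2 * (1 - enorm x) \/ gauge4 x t = `|2 * t - 1|.
  by rewrite /gauge4 maxEle; case: ifP; [right|left].
  apply: Or31; rewrite en gE; move: gn; rewrite gE => gn.
  have -> : enorm x - 1 = - 2^-1 * (2 * (1 - enorm x)) by field.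
  by rewrite mulfK //; lra.
have [t2|t2] := leP 0 (2 * t - 1).
  apply: Or33; rewrite /seam_tm gE ger0_norm //; move: gn; rewrite gE ger0_norm // => gn.
  have -> : t - 2^-1 = 2^-1 * (2 * t - 1) by field.
  by rewrite mulfK //; lra.
apply: Or32; rewrite /seam_tm gE ltr0_norm //; move: gn; rewrite gE ltr0_norm // => gn.
have -> : t - 2^-1 = - 2^-1 * - (2 * t - 1) by field.
by rewrite mulfK //; lra.
Qed.

Lemma inner_outer x t : Tshell x -> 0 <= t <= 1 -> gauge4 x t = 2^-1 -> inner4 x t = outer4 x t.
Proof.
move=> Tx t01 g2; have [|S qr] := seam_ptP Tx t01; first by rewrite g2.
have e0 := enorm_gt0 (Tshell_neq0 Tx).
have E1 : seam_pt x t = inner_pt x.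
  by rewrite /seam_pt g2 invrK /inner_pt; congr ((_ / _) *: _); ring.
have E2 : seam_tm x t = 2 * t - 2^-1 by rewrite /seam_tm g2 invrK; field.
have [_ /(_ _ _ S)[_ h1 _ _]] := Ph.
rewrite /inner4 /outer4 /sigma4gamma; rewrite E1 E2 in h1 *.
by rewrite g2 (_ : pi * (1 - 2^-1) = pi / 2) ?h1 //; congr (_ * _); field.
Qed.

Lemma cap_outer x t : Tshell x -> 0 <= t <= 1 -> 2^-1 <= gauge4 x t -> cap x t = outer4 x t.
Proof.
move=> Tx t01 g2; rewrite /cap; case: ifP => // g3; apply: inner_outer => //.
by apply/eqP; rewrite eq_le g2 g3.
Qed.

Lemma outer_rim x t : Tshell x -> 0 <= t <= 1 -> gauge4 x t = 1 -> outer4 x t = (base4 x t, gamma x t).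
Proof.
move=> Tx t01 g1; have [|S qr] := seam_ptP Tx t01; first by rewrite g1; lra.
have e0 := enorm_gt0 (Tshell_neq0 Tx).
have E1 : seam_pt x t = x.
  by rewrite /seam_pt g1 divr1 addrC subrK divff ?scale1r // gt_eqF.
have E2 : seam_tm x t = t by rewrite /seam_tm g1 divr1 addrC subrK.
have [_ /(_ _ _ S)[h1 _ _ _]] := Ph.
rewrite /outer4; rewrite E1 E2 in h1 *.
by rewrite g1 subrr mulr0 h1.
Qed.

Lemma cap_rim x t : Tshell x -> 0 <= t <= 1 -> gauge4 x t = 1 -> cap x t = (base4 x t, gamma x t).
Proof. by move=> Tx t01 g1; rewrite cap_outer ?outer_rim // g1; lra. Qed.

Lemma base4_inner x t : enorm x = 2^-1 -> base4 x t = @p0 R n.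
Proof.
move=> x1; have Tx : Tshell x by rewrite /Tshell /= x1; lra.
rewrite (base4E G FE) // x1 divff ?pnatr_eq0 // subrr scale0r add0r.
by rewrite (_ : 2 - 1 = 1) ?scale1r //; ring.
Qed.

Lemma glue_inner v : enorm v <= 2^-1 -> glue v = sigma1 v.
Proof. by move=> v1; rewrite /glue v1. Qed.

Lemma polar_norm v : (th <= `|latitude v|) = (th <= latitude v) || (latitude v <= - th).
Proof. by rewrite real_ler_normr ?num_real // [th <= - _]lerNr. Qed.

Lemma glue_polar v : A2 A v \/ A3 A v -> glue v = sigma23 v.
Proof.
move=> H; rewrite /glue; case: ifP => [v1|_].
  have [/andP[v2 _] _] := A23_hgt G H.
  by rewrite /sigma23 xi_inner //; apply/eqP; rewrite eq_le v1 v2.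
by rewrite polar_norm; case: H => -[_ ->] //; rewrite orbT.
Qed.

(** On the overlaps with the other pieces the gauge is one, where the collar starts at [gamma x t]
    over the base point of [sigma_4], so all branches agree. *)
Lemma glue_cap v : A4 A v -> glue v = cap (ungamma v).1 (ungamma v).2.
Proof.
move=> A4v; have [Tx t01] := ungamma_Tshell G FE A4v; have [v1 L] := A4v.
have v0 := shell_neq0 v1; have [gK eK] := ungammaK G FE v0 L.
rewrite /glue; case: ifP => [v2|_].
  have ve : enorm v = 2^-1 by apply/eqP; rewrite eq_le v2; case/andP: v1 => ->.
  rewrite cap_rim // ?gK ?base4_inner ?eK //.
  apply/eqP; rewrite eq_le gauge4_le1 //= le_max eK ve; apply/orP; left; lra.
case: ifP => // L2; rewrite cap_rim // ?gK.
  rewrite /sigma23 base4_end ?gK //; apply: (seam_time G FE Tx t01); rewrite gK.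
  by move: L2; rewrite polar_norm => /orP[]; [left|right].
apply/eqP; rewrite eq_le gauge4_le1 //= le_max; apply/orP; right.
rewrite /= (_ : 2 * ((1 + latitude v / th) / 2) - 1 = latitude v / th); last first.
  by rewrite mulrC divfK ?pnatr_eq0 // addrC addKr.
by rewrite normrM normfV (gtr0_norm th0) ler_pdivlMr // mul1r.
Qed.

Lemma glue_gamma x t : Tshell x -> 0 <= t <= 1 -> glue (gamma x t) = cap x t.
Proof.
move=> Tx t01; rewrite glue_cap; last exact: (gamma_A4 G FE).
by rewrite (gammaK G FE) //; exact: Tshell_neq0.
Qed.

Lemma glued_glue : glued A eta etai h glue.
Proof.
split=> [v|v|x t Tx t01]; [exact: glue_inner|exact: glue_polar|].
move=> r g; split=> g2; rewrite glue_gamma //; first by rewrite /cap [gauge4 _ _ <= _]g2.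
by rewrite cap_outer.
Qed.

End Gluing.

Section GluedDisk.
Variables (R : realType) (n N : nat) (A : set (set 'rV[R]_n.+1)).
Variables (a : 'I_N -> 'rV[R]_n.+1) (b : 'I_N -> R).
Hypothesis G : in_position A a b.
Local Notation E := 'rV[R]_n.+1.
Local Notation E' := 'rV[R]_n.
Local Notation R0 := (cyl_radius A).
Local Notation th := (theta0 A).
Let R00 : 0 < R0 := position_radius_gt0 G.
Let th0 : 0 < th := theta0_gt0 R00.
Variable V : E -> E.
Hypothesis TV : tangent_field A V.
Variables eta etai : R -> E' -> E'.
Hypothesis FE : is_flow A V eta etai.
Local Notation J := (antipode eta etai).
Local Notation gamma := (gamma A eta etai).
Local Notation vec4 := (vec4 eta etai).
Local Notation base4 := (base4 A eta etai).
Local Notation ungamma := (ungamma A eta etai).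
Variable h : E' -> R -> R -> E.
Hypothesis Ph : pasting A eta etai h.
Local Notation cap := (cap A eta etai h).
Local Notation glue := (glue A eta etai h).
Implicit Types (x u : E') (v : E) (t rho : R).

Lemma disk_cover v : disk v -> [\/ A1 v, A2 A v \/ A3 A v | A4 A v].
Proof.
move=> v1; have [v2|/ltW v2] := leP (enorm v) 2^-1; first exact: Or31.
have [|] := boolP (th <= `|latitude v|).
  by rewrite polar_norm => /orP[H|H]; apply: Or32; [left|right]; split; rewrite ?v2.
rewrite polar_norm negb_or -!ltNge => /andP[/ltW h1 /ltW h2].
by apply: Or33; split; rewrite ?v2 // h1 h2.
Qed.

Lemma seam_valid x t rho : seam x t -> quarter rho ->
  Mcompl A (base4 x t, h x t rho) /\ h x t rho != 0.
Proof.
move=> S qr; have [Tx t01 te] := S; have [_ /(_ _ _ S)[_ _ h1 h2]] := Ph.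
have ends : t = 0 \/ t = 1 -> Mcompl A (base4 x t, h x t rho) /\ h x t rho != 0.
  move=> te'; rewrite h1 // base4_end //; split; first exact: (Mcompl_seam G TV FE).
  (* At the two ends every pasting is the plain rotation, hence agrees with [seam_homotopy], which
     is known not to vanish. *)
  by rewrite -(seam_homotopy_end A eta etai x rho te'); exact: (seam_homotopy_neq0 G FE).
case: te => [x1|t0|t1]; [|by apply: ends; left|by apply: ends; right].
by rewrite (base4_inner G FE) //; split; [exact: (Mcompl_p0 G)|exact: h2].
Qed.

Lemma cap_valid x t : Tshell x -> 0 <= t <= 1 -> Mcompl A (cap x t) /\ (cap x t).2 != 0.
Proof.
move=> Tx t01; have [g2|/ltW g2] := leP (gauge4 x t) 2^-1.
  have [Ti ti] := inner_ptP Tx t01 g2; rewrite /cap g2; split; first exact: (Mcompl_piece4 G TV FE).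
  by apply: (vec4_neq0 FE); exact: Tshell_neq0.
rewrite (cap_outer Ph) //; have [S qr] := seam_ptP Tx t01 g2.
exact: seam_valid.
Qed.

Lemma glue_valid v : disk v -> Mcompl A (glue v) /\ (v != 0 -> (glue v).2 != 0).
Proof.
move=> /disk_cover[v1|v1|v1].
- by rewrite glue_inner //; split=> //; exact: (Mcompl_p0 G).
- rewrite (glue_polar G) //; split=> //; have [_ v0] := A23_hgt G v1; exact: (Mcompl_piece23 G).
- rewrite (glue_cap G FE Ph) //; have [Tx t01] := ungamma_Tshell G FE v1.
  by have [h1 h2] := cap_valid Tx t01.
Qed.

Lemma glue0 : glue 0 = (@p0 R n, 0).
Proof. by rewrite glue_inner // enorm0 invr_ge0. Qed.

Lemma glue_real v : disk v -> (glue v).2 = 0 -> v = 0.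
Proof.
move=> /glue_valid[_ H] v0; apply/eqP; apply: contrapT => /negP /H.
by rewrite v0 eqxx.
Qed.

(** Over the rim of the disk the base point must lie where a trivialization gives information. On
    the polar caps the cotangent of the latitude is at most R in absolute value; on [A4] the base
    point is on the segment joining two bottom points. *)
Lemma glue_Cyl_0 v : bdisk v -> Cyl_0 A (glue v).1.
Proof.
move=> v1; have dv : disk v by rewrite /disk /= v1.
case: (disk_cover dv) => [v2|v2|v2].
- by move: v2; rewrite /A1 /= v1 => v2; exfalso; lra.
- rewrite (glue_polar G) //; have [_ h0] := A23_hgt G v2; rewrite /sigma23 /xi v1.
  split; rewrite ?hor_vec ?hgt_vec; last by ring.
  rewrite (_ : 2 * 1 - 1 = 1); last by ring.
  have v0 : v != 0 by apply: enorm_neq0; rewrite v1.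
  rewrite enormZ normrN mul1r normfV hor_latitude // v1 mul1r.
  rewrite ler_pdivrMl ?normr_gt0 // mulrC -(sin_latitude v0) v1 mul1r.
  have s0 := sin_theta0_gt0 R00; have ct := cos_theta0 R00.
  have c0 := cos_latitude_ge0 v.
  have st : sin th <= `|sin (latitude v)|.
    have lb := hgt_ratio v; have t2 := theta0_lt A; have t0 : 0 < th := th0.
    have inI (s : R) : - (pi / 2) <= s <= pi / 2 -> s \in `[-(pi / 2), pi / 2] by rewrite in_itv.
    have thI : th \in `[-(pi / 2), pi / 2] by apply: inI; lra.
    have lI : latitude v \in `[-(pi / 2), pi / 2] by apply: inI; rewrite asin_geNpi2 // asin_lepi2.
    have lNI : - latitude v \in `[-(pi / 2), pi / 2] by move: lI; rewrite !in_itv /=; lra.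
    rewrite real_ler_normr ?num_real // -sinN; apply/orP.
    case: v2 => -[_ L]; [left|right]; rewrite leNgt ltr_sin // -leNgt //; lra.
  rewrite -ler_sqr ?nnegrE ?(mulr_ge0 (ltW R00)) // exprMn real_normK ?num_real //.
  have h1 := cos2Dsin2 (latitude v); have h2 := cos2Dsin2 th.
  have h3 : sin th ^+ 2 <= sin (latitude v) ^+ 2.
    by rewrite -[leRHS]real_normK ?num_real // ler_sqr ?nnegrE // ltW.
  move: h2; rewrite ct exprMn => h2.
  have h4 : 0 <= R0 ^+ 2 * (sin (latitude v) ^+ 2 - sin th ^+ 2).
    by rewrite mulr_ge0 ?sqr_ge0 // subr_ge0.
  lra.
rewrite (glue_cap G FE Ph) //; have [Tx t01] := ungamma_Tshell G FE v2.
have [v2' L] := v2; have [_ e1] := ungammaK G FE (shell_neq0 v2') L.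
move: e1 Tx t01; rewrite v1; set x := (ungamma v).1; set t := (ungamma v).2 => x1 Tx t01.
have [y [s [y1 Ty s01 ->]]] : exists y s, [/\ enorm y = 1, Tshell y, 0 <= s <= 1 & (cap x t).1 = base4 y s].
  have [g2|/ltW g2] := leP (gauge4 x t) 2^-1.
    have [Ti ti] := inner_ptP Tx t01 g2; rewrite /cap g2; exists (inner_pt x), (2 * t - 2^-1).
    by split=> //; rewrite /inner_pt x1 (_ : (2 * 1 - 1) / 1 = 1 :> R) ?scale1r //; field.
  have [[Ts s01 _] _] := seam_ptP Tx t01 g2; rewrite (cap_outer Ph) //; exists (seam_pt x t), (seam_tm x t).
  by split=> //; rewrite /seam_pt x1 subrr mul0r addr0 divr1 scale1r.
split; last by rewrite (hgt_base4 G FE) // y1; ring.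
rewrite (base4E G FE) // y1 invr1 scale1r mulr1 subrr scale0r addr0.
rewrite (_ : 2 - 1 = 1) ?scale1r; last by ring.
rewrite horD !horZ !hor_vec; apply: le_trans (enormD _ _) _.
have J1 : enorm (J 1 y) = 1 by rewrite (enorm_antipode FE) // ler01 lexx.
have /andP[s0 s1] := s01; rewrite [enorm ((1 - s) *: _)]enormZ [enorm (s *: _)]enormZ ![enorm (R0 *: _)]enormZ.
rewrite J1 y1 !mulr1 (ger0_norm (ltW R00)).
by rewrite !ger0_norm ?subr_ge0 // -mulrDl subrK mul1r.
Qed.

Lemma near_glue0 : \forall v \near (0 : E), glue v = (@p0 R n, v).
Proof.
have : \forall v \near (0 : E), enorm v < 2^-1 by apply: near_enorm_lt; rewrite invr_gt0.
by apply: filterS => v /ltW v1; rewrite glue_inner.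
Qed.

Lemma smooth_on_xi : smooth_on [set v : E | v != 0 /\ hgt v != 0] (@xi R n).
Proof.
have Ce : smooth_on [set v : E | v != 0 /\ hgt v != 0] (@enorm R n.+1).
  by apply: smooth_on_enorm => [|v []//]; exact: smooth_on_id.
have Ch : smooth_on [set v : E | v != 0 /\ hgt v != 0] (@hgt R n).
  by apply: smooth_on_Ck => k; exact: Ck_hgt_id.
have C2 (c : R) : smooth_on [set v : E | v != 0 /\ hgt v != 0] (fun v => c * enorm v).
  by apply: smooth_on_mul => //; exact: smooth_on_cst.
apply: smooth_on_vec.
  apply: smooth_on_scale.
    apply: smooth_on_opp; apply: smooth_on_mul; last by apply: smooth_on_inv => // v [].
    by apply: smooth_on_add => //; exact: smooth_on_cst.
  by apply: smooth_on_Ck => k; apply: Ck_hor; [|apply: Ck_id]; exact: openT.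
by apply: smooth_on_add; [exact: smooth_on_cst|exact: smooth_on_opp].
Qed.

Let S := @Tshell R n `*` @unit_interval R.

Lemma smooth_on_base4 : smooth_on S (fun z => base4 z.1 z.2).
Proof.
have [CG _ _ _] := gamma_diffeo G FE.
have Ce (c : R) : c = 0 \/ c = 1 -> smooth_on S (fun z : E' * R => xi (gamma z.1 c)).
  move=> c01; have c1 : 0 <= c <= 1 by case: c01 => ->; rewrite ?lexx ?ler01.
  apply: (smooth_on_comp _ _ smooth_on_xi).
    apply: (smooth_on_comp _ (smooth_on_pair (@smooth_on_fst _ _ _ S) (smooth_on_cst S c)) CG).
    by move=> z [Tz _].
  move=> z [Tz _]; have z0 := Tshell_neq0 Tz; have e0 := enorm_gt0 z0.
  have [E1 _] := gamma_polar G FE z0 c1; split; first by apply: enorm_neq0; rewrite E1.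
  rewrite gammaE hgt_vec mulf_neq0 ?(gt_eqF e0) //; have s0 := sin_theta0_gt0 R00.
  case: c01 => ->; first by rewrite mulr0 sub0r mulN1r sinN oppr_eq0 gt_eqF.
  by rewrite mulr1 (_ : 2 - 1 = 1) ?mul1r ?gt_eqF //; ring.
have Ct : smooth_on S (fun z : E' * R => z.2) by exact: smooth_on_snd.
apply: smooth_on_add; apply: smooth_on_scale => //; try by apply: Ce; [left|right].
- by apply: smooth_on_add; [exact: smooth_on_cst|exact: smooth_on_opp].
- by apply: Ce; left.
- by apply: Ce; right.
Qed.

Lemma smooth_on_vec4 : smooth_on (@Tshell R n) vec4.
Proof.
apply: smooth_on_vec; last exact: smooth_on_cst.
apply: smooth_on_add; first exact: smooth_on_id.
apply: smooth_on_opp; apply: (smooth_on_antipode FE (h := fun=> 1)).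
- exact: smooth_on_id.
- exact: smooth_on_cst.
- exact: Tshell_neq0.
- by move=> z _; rewrite ler01 lexx.
Qed.

Lemma continuous_gauge4 : continuous (fun z : E' * R => gauge4 z.1 z.2).
Proof.
move=> z; apply: (@continuous_max _ _ (fun z : E' * R => 2 * (1 - enorm z.1)) (fun z : E' * R => `|2 * z.2 - 1|)).
  apply: cvgM; first exact: cvg_cst.
  apply: cvgB; first exact: cvg_cst.
  by apply: (@continuous_comp _ _ _ fst (@enorm R n)); [exact: cvg_fst|exact: continuous_enorm].
apply: cvg_norm; apply: cvgB; last exact: cvg_cst.
by apply: cvgM; [exact: cvg_cst|exact: cvg_snd].
Qed.

Lemma closed_Tshell : closed (@Tshell R n).
Proof.
rewrite (_ : Tshell (R := R) (n := n) = @enorm R n @^-1` [set` `[2^-1, 1]]); last first.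
  by apply/seteqP; split=> x /=; rewrite in_itv.
by apply: closed_comp => [x _|]; [exact: continuous_enorm|exact: interval_closed].
Qed.

Lemma closed_S : closed S.
Proof.
rewrite (_ : S = fst @^-1` (@Tshell R n) `&` snd @^-1` (@unit_interval R)); last first.
  by apply/seteqP; split=> z [].
apply: closedI.
  by apply: closed_comp => [x _|]; [exact: cvg_fst|exact: closed_Tshell].
apply: closed_comp => [x _|]; first exact: cvg_snd.
rewrite (_ : unit_interval (R := R) = [set` `[0, 1]]); first exact: interval_closed.
by apply/seteqP; split=> x /=; rewrite in_itv.
Qed.

Lemma cap_cont : {within S, continuous (fun z => cap z.1 z.2)}.
Proof.
pose S1 := S `&` [set z | gauge4 z.1 z.2 <= 2^-1].
pose S2 := S `&` [set z | 2^-1 <= gauge4 z.1 z.2].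
have -> : S = S1 `|` S2.
  apply/seteqP; split=> [z Sz|z [[]|[]] //].
  by have [z2|/ltW z2] := leP (gauge4 z.1 z.2) 2^-1; [left|right]; split.
have gc := continuous_gauge4.
have cl (D : set R) : closed D -> closed (S `&` [set z | D (gauge4 z.1 z.2)]).
  move=> cD; apply: closedI; first exact: closed_S.
  by apply: (@closed_comp _ _ (fun z : E' * R => gauge4 z.1 z.2)) => // z _; exact: gc.
have C1 (P : set (E' * R)) : smooth_on P (fun z : E' * R => z.1) by exact: smooth_on_fst.
have Ct (P : set (E' * R)) : smooth_on P (fun z : E' * R => z.2) by exact: smooth_on_snd.
apply: withinU_continuous.
- by apply: (cl [set x | x <= 2^-1]); exact: closed_le.
- by apply: (cl [set x | 2^-1 <= x]); exact: closed_ge.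
- apply: (@within_eq _ _ _ _ (fun z => inner4 A eta etai z.1 z.2)) => [z [_ z2]|].
    by rewrite /cap; move: z2 => /= ->.
  have Ce : smooth_on S1 (fun z : E' * R => enorm z.1).
    by apply: smooth_on_enorm => // z [[/Tshell_neq0]].
  have Ci : smooth_on S1 (fun z : E' * R => inner_pt z.1).
    apply: smooth_on_scale => //; apply: smooth_on_mul.
      apply: smooth_on_add; last exact: smooth_on_cst.
      by apply: smooth_on_mul => //; exact: smooth_on_cst.
    apply: smooth_on_inv => // z [[/Tshell_neq0 /enorm_gt0 e0 _] _].
    by rewrite gt_eqF.
  have Cs : smooth_on S1 (fun z : E' * R => 2 * z.2 - 2^-1).
    apply: smooth_on_add; last exact: smooth_on_cst.
    by apply: smooth_on_mul => //; exact: smooth_on_cst.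
  have HS z : S1 z -> S (inner_pt z.1, 2 * z.2 - 2^-1).
    by move=> [[Tz tz] z2]; have [] := inner_ptP Tz tz z2.
  apply: within_pair; apply: within_pointwise => z Sz.
    apply: (smooth_on_cont _ Sz).
    exact: (smooth_on_comp _ (smooth_on_pair Ci Cs) smooth_on_base4).
  apply: (smooth_on_cont _ Sz).
  by apply: (smooth_on_comp _ Ci smooth_on_vec4) => y /HS[].
- apply: (@within_eq _ _ _ _ (fun z => outer4 A eta etai h z.1 z.2)) => [z [[Tz tz] z2]|].
    by rewrite (cap_outer Ph).
  have g0 z : S2 z -> gauge4 z.1 z.2 != 0 by move=> [_ /= z2]; rewrite gt_eqF //; lra.
  have cp z : S2 z -> {for z, continuous (fun z : E' * R => seam_pt z.1 z.2)}.
    move=> Sz; apply: cvgZ; last exact: cvg_fst.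
    have ec : {for z, continuous (fun z : E' * R => enorm z.1)}.
      by apply: (@continuous_comp _ _ _ fst (@enorm R n)); [exact: cvg_fst|exact: continuous_enorm].
    apply: cvgM; last first.
      by apply: cvgV => //; case: Sz => -[/Tshell_neq0 /enorm_gt0 e0 _] _; rewrite gt_eqF.
    apply: cvgD; first exact: cvg_cst.
    apply: cvgM; last by apply: cvgV; [exact: g0|exact: gc].
    by apply: cvgB => //; exact: cvg_cst.
  have ct z : S2 z -> {for z, continuous (fun z : E' * R => seam_tm z.1 z.2)}.
    move=> Sz; apply: cvgD; first exact: cvg_cst.
    apply: cvgM; last by apply: cvgV; [exact: g0|exact: gc].
    by apply: cvgB; [exact: cvg_snd|exact: cvg_cst].
  have HS z : S2 z -> seam (seam_pt z.1 z.2) (seam_tm z.1 z.2) /\ quarter (pi * (1 - gauge4 z.1 z.2)).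
    by move=> [[Tz tz] z2]; exact: seam_ptP.
  apply: within_pair.
    apply: within_pointwise => z Sz.
    apply: (@continuous_comp _ _ _ (fun z : E' * R => (seam_pt z.1 z.2, seam_tm z.1 z.2)) (fun y => base4 y.1 y.2)).
      by apply: for_pair; [exact: cp|exact: ct].
    by apply: (smooth_on_cont smooth_on_base4); have [[]] := HS z Sz.
  have [hc _] := Ph.
  apply: (within_comp (k := fun z : E' * R => (seam_pt z.1 z.2, seam_tm z.1 z.2, pi * (1 - gauge4 z.1 z.2))) _ _ hc) => z Sz.
    apply: for_pair; first by apply: for_pair; [exact: cp|exact: ct].
    apply: cvgM; first exact: cvg_cst.
    by apply: cvgB; [exact: cvg_cst|exact: gc].
  exact: HS.
Qed.

(** Rewrites conditions on the latitude as inequalities between continuous functions, so that the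
    pieces of the disk are seen to be closed. *)
Lemma latitude_ge v (s : R) : v != 0 -> - (pi / 2) <= s <= pi / 2 ->
  (s <= latitude v) = (enorm v * sin s <= hgt v).
Proof.
move=> v0 s1; rewrite -(sin_latitude v0) ler_pM2l ?enorm_gt0 // !leNgt ltr_sin //.
by rewrite in_itv /= asin_geNpi2 ?asin_lepi2 ?hgt_ratio.
Qed.

Lemma latitude_le v (s : R) : v != 0 -> - (pi / 2) <= s <= pi / 2 ->
  (latitude v <= s) = (hgt v <= enorm v * sin s).
Proof.
move=> v0 s1; rewrite -(sin_latitude v0) ler_pM2l ?enorm_gt0 // !leNgt ltr_sin //.
by rewrite in_itv /= asin_geNpi2 ?asin_lepi2 ?hgt_ratio.
Qed.

Lemma closed_shell : closed [set v : E | 2^-1 <= enorm v <= 1].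
Proof.
rewrite (_ : mkset _ = @enorm R n.+1 @^-1` [set` `[2^-1, 1]]); last first.
  by apply/seteqP; split=> x /=; rewrite in_itv.
by apply: closed_comp => [x _|]; [exact: continuous_enorm|exact: interval_closed].
Qed.

Lemma continuous_cone (c : R) : continuous (fun v : E => hgt v - enorm v * c).
Proof.
move=> v; apply: (@continuous_comp _ _ _ (fun v : E => (hgt v, enorm v)) (fun z : R * R => z.1 - z.2 * c)).
  by apply: for_pair; [exact: continuous_hgt|exact: continuous_enorm].
apply: cvgB; first exact: cvg_fst.
by apply: cvgM; [exact: cvg_snd|exact: cvg_cst].
Qed.

Lemma closed_cone (c : R) : closed [set v : E | hgt v <= enorm v * c].
Proof.
rewrite (_ : mkset _ = (fun v : E => hgt v - enorm v * c) @^-1` [set x | x <= 0]); last first.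
  by apply/seteqP; split=> x /=; rewrite subr_le0.
apply: closed_comp => [x _|]; last exact: closed_le.
exact: continuous_cone.
Qed.

Lemma closed_cone' (c : R) : closed [set v : E | enorm v * c <= hgt v].
Proof.
rewrite (_ : mkset _ = (fun v : E => hgt v - enorm v * c) @^-1` [set x | 0 <= x]); last first.
  by apply/seteqP; split=> x /=; rewrite subr_ge0.
apply: closed_comp => [x _|]; last exact: closed_ge.
exact: continuous_cone.
Qed.

Lemma closed_A1 : closed (@A1 R n).
Proof.
by apply: (@closed_comp _ _ (@enorm R n.+1) [set x | x <= 2^-1]) => [x _|]; [exact: continuous_enorm|exact: closed_le].
Qed.

Let thI : - (pi / 2) <= th <= pi / 2.
Proof. by have := theta0_lt A; have t0 : 0 < th := th0; lra. Qed.

Let NthI : - (pi / 2) <= - th <= pi / 2.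
Proof. by have := theta0_lt A; have t0 : 0 < th := th0; lra. Qed.

Lemma closed_A23 : closed [set v | A2 A v \/ A3 A v].
Proof.
rewrite (_ : mkset _ = ([set v : E | 2^-1 <= enorm v <= 1] `&` [set v | enorm v * sin th <= hgt v]) `|`
  ([set v : E | 2^-1 <= enorm v <= 1] `&` [set v | hgt v <= enorm v * sin (- th)])).
  by apply: closedU; apply: closedI; try exact: closed_shell; [exact: closed_cone'|exact: closed_cone].
apply/seteqP; split=> v [] [v1 L]; [left|right|left|right]; split=> //; have v0 := shell_neq0 v1.
- by rewrite /= -latitude_ge.
- by rewrite /= -latitude_le.
- by rewrite latitude_ge.
- by rewrite latitude_le.
Qed.

Lemma closed_A4 : closed (A4 A).
Proof.
rewrite (_ : A4 A = [set v : E | 2^-1 <= enorm v <= 1] `&`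
  ([set v | enorm v * sin (- th) <= hgt v] `&` [set v | hgt v <= enorm v * sin th])).
  apply: closedI; first exact: closed_shell.
  by apply: closedI; [exact: closed_cone'|exact: closed_cone].
apply/seteqP; split=> v [v1].
  move=> /andP[L1 L2]; have v0 := shell_neq0 v1; split=> //; split; first by rewrite /= -latitude_ge.
  by rewrite /= -latitude_le.
by move=> [/= L1 L2]; have v0 := shell_neq0 v1; split=> //; rewrite latitude_ge // latitude_le // L1 L2.
Qed.

Lemma glue_cont : {within @disk R n, continuous glue}.
Proof.
have : {within (@A1 R n `|` [set v | A2 A v \/ A3 A v]) `|` A4 A, continuous glue}.
  apply: withinU_continuous.
  - by apply: closedU; [exact: closed_A1|exact: closed_A23].
  - exact: closed_A4.
  - apply: withinU_continuous; [exact: closed_A1|exact: closed_A23| |].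
      apply: (@within_eq _ _ _ _ (@sigma1 R n)) => [v|]; first exact: glue_inner.
      by apply: within_pointwise => v _; apply: for_pair; [exact: (@cst_continuous _ _ _ v)|exact: cvg_id].
    apply: (@within_eq _ _ _ _ (@sigma23 R n)) => [v|]; first exact: (glue_polar G).
    apply: within_pointwise => v /(A23_hgt G)[v1 v0]; apply: for_pair; last exact: cvg_id.
    by apply: (smooth_on_cont smooth_on_xi); split=> //; exact: shell_neq0.
  - apply: (@within_eq _ _ _ _ (fun v => cap (ungamma v).1 (ungamma v).2)) => [v|]; first exact: (glue_cap G FE Ph).
    have [_ CU _ _] := gamma_diffeo G FE.
    apply: (within_comp (k := ungamma) _ _ cap_cont) => v Av; first exact: (smooth_on_cont CU).
    exact: (ungamma_Tshell G FE).
by apply: continuous_subspaceW => v /disk_cover[v1|v1|v1]; [left; left|left; right|right].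
Qed.

End GluedDisk.

(** * The pushed disk *)

Section DiskCriterion.
Variables (R : realType) (n : nat).
Local Notation E := 'rV[R]_n.+1.
Implicit Types (A : set (set E)) (C F : set E) (sigma : E -> E * E).

Lemma near_vertical_is_diff sigma (p : E) (k : R) : (\forall v \near (0 : E), sigma v = (p, k *: v)) ->
  \forall v \near (0 : E), is_diff v sigma (fun u => (0, k *: u)).
Proof.
move=> /near_join H; near=> v.
have D : is_diff v (fun v : E => (p, k *: v)) (fun u => (0, k *: u)).
  apply: is_diff_pair; apply: is_diffZ; exact: is_diff_id.
have [Dv Ev] := D.
rewrite -Ev; apply: near_eq_is_diff => //.
have Hv : \forall y \near v, sigma y = (p, k *: y) by near: v; exact: H.
by apply: filterS Hv => y ->.
Unshelve. all: by end_near. Qed.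

(** Near 0 the disk consists of multiples of imaginary vectors at [p], so its differential at 0
    covers the imaginary directions while [C] covers the real ones. *)
Lemma meets_only_at_vertical C (p : E) sigma (k : R) : k != 0 -> C p ->
  (\forall v \near (0 : E), sigma v = (p, k *: v)) ->
  (forall v, disk v -> realpts C (sigma v) -> v = 0) -> meets_only_at C p sigma.
Proof.
move=> k0 Cp H R0; have s0 : sigma 0 = (p, 0) by rewrite (nbhs_singleton H) scaler0.
have d0 : disk (0 : E) by rewrite /disk /= enorm0.
split=> //.
  apply/seteqP; split=> [z [[v dv <-] rv]|_ ->].
    by rewrite (R0 v dv rv) s0.
  by split; [exists 0|split].
move=> v dv rv; rewrite (R0 v dv rv).
have D : is_diff 0 sigma (fun u => (0, k *: u)) := nbhs_singleton (near_vertical_is_diff H).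
split; first exact: (@ex_diff _ _ _ _ _ _ _ D).
move=> z; exists (k^-1 *: z.2), z.1; rewrite (@diff_val _ _ _ _ _ _ _ D) /=.
by rewrite pairDE scalerA divff // scale1r add0r addr0; case: z.
Qed.

Lemma chamber_eq A C C' x : chamber A C -> chamber A C' -> C x -> C' x -> C = C'.
Proof.
move=> [y _ ->] [z _ ->] yx zx.
by rewrite (same_connected_component yx) (same_connected_component zx).
Qed.

(** The only real point of the disk over such a chamber would be [p], and chambers sharing a point
    coincide. *)
Lemma avoids_others_vertical A F C (p : E) sigma : chamber A C -> C p -> sigma 0 = (p, 0) ->
  (forall v C', chamber_off A F C' -> disk v -> realpts C' (sigma v) -> v = 0) ->
  avoids_others A F C sigma.
Proof.
move=> hC Cp s0 R0 C' hC' neq; apply/seteqP; split=> // z [[v dv <-] rv].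
apply: neq; have v0 := R0 v C' hC' dv rv; have [hc' _] := hC'.
apply: (chamber_eq hc' hC (x := p)) => //.
by case: rv; rewrite v0 s0.
Qed.

End DiskCriterion.

(** * Differentials read off from one-sided rays *)

Section OneSided.
Variable R : realType.

(** At the rim the properties of [Pr1] are available only on rays entering the cylinder; for a
    differentiable map one such ray determines the derivative in its direction. *)
Lemma diff_ray n m (f : 'rV[R]_n -> 'rV[R]_m) x w c (k d : R) : differentiable f x -> 0 < d ->
  (forall s, 0 < s < d -> dot c (f (x + s *: w)) = dot c (f x) + s * k) -> dot c ('d f x w) = k.
Proof.
move=> df d0 H; set C := enorm c * (m%:R * `|w|).
have C0 : 0 <= C by rewrite mulr_ge0 ?enorm_ge0 // mulr_ge0.
apply/eqP; rewrite -subr_eq0 -normr_le0; apply/ler_addgt0Pl => e e0; rewrite addr0.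
have e1 : 0 < e / (C + 1) by rewrite divr_gt0 // ltr_wpDl.
have Hs : \forall s \near 0^'+, `|f (s *: w + x) - f x - 'd f x (s *: w)| <= e / (C + 1) * `|s *: w|.
  have sc : s *: w @[s --> (0 : R)] --> (0 : 'rV[R]_n).
    by rewrite -[X in _ --> X](scale0r w); apply: cvgZr_tmp; exact: cvg_id.
  exact: (cvg_at_right_filter sc) _ (differentiable_eps df e1).
have [s [s0 sd Es]] : exists s, [/\ 0 < s, s < d &
    `|f (s *: w + x) - f x - 'd f x (s *: w)| <= e / (C + 1) * `|s *: w|].
  have : \forall s \near 0^'+, [/\ 0 < s, s < d &
      `|f (s *: w + x) - f x - 'd f x (s *: w)| <= e / (C + 1) * `|s *: w|].
    near=> s; split; near: s => //; [exact: nbhs_right_gt|exact: nbhs_right_lt].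
  by move=> /filter_ex.
have := dot_cauchy c (f (s *: w + x) - f x - 'd f x (s *: w)).
rewrite !dotBr addrC [s *: w + x]addrC H ?s0 ?sd // linearZ dotZr.
have -> : - (s * dot c ('d f x w)) + (dot c (f x) + s * k - dot c (f x)) = - (s * (dot c ('d f x w) - k)) by ring.
rewrite normrN normrM (gtr0_norm s0) => /le_trans.
have : enorm c * enorm (f (x + s *: w) - f x - s *: 'd f x w) <= s * (C * (e / (C + 1))).
  apply: (@le_trans _ _ (enorm c * (m%:R * (e / (C + 1) * `|s *: w|)))).
    rewrite ler_wpM2l ?enorm_ge0 //; apply: le_trans (enorm_le_norm _) _; rewrite ler_wpM2l //.
    by move: Es; rewrite linearZ [s *: w + x]addrC.
  by rewrite normrZ (gtr0_norm s0) /C le_eqVlt; apply/orP; left; apply/eqP; ring.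
move=> h1 /(_ _ h1); rewrite ler_pM2l // => /le_trans; apply.
by rewrite mulrCA ler_piMr ?(ltW e0) // ler_pdivrMr ?mul1r ?lerDl // ltr_wpDl.
Unshelve. all: by end_near. Qed.

Lemma continuous_for_sum (T : topologicalType) (W : normedModType R) (z : T) (I : Type) (r : seq I)
    (F : I -> T -> W) : (forall j, {for z, continuous (F j)}) ->
  {for z, continuous (fun y => \sum_(j <- r) F j y)}.
Proof.
move=> HF; elim: r => [|j r IH].
  rewrite (_ : (fun y => _) = cst 0); first exact: cst_continuous.
  by apply/funext => y; rewrite big_nil.
rewrite (_ : (fun y => _) = (fun y => F j y + \sum_(i <- r) F i y)); first exact: cvgD (HF j) IH.
by apply/funext => y; rewrite big_cons.
Qed.

Lemma continuous_diff n m (U : set 'rV[R]_n) (f : 'rV[R]_n -> 'rV[R]_m) (z : 'rV[R]_n * 'rV[R]_n) :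
  Ck 1 U f -> U z.1 -> {for z, continuous (fun z => 'd f (z.1) (z.2))}.
Proof.
move=> [_ Cf] Uz.
rewrite (_ : (fun z => 'd f (z.1) (z.2)) = (fun z => \sum_j z.2 0 j *: 'd f (z.1) (delta_mx 0 j))); last first.
  apply/funext => y; rewrite [in LHS](row_sum_delta y.2) linear_sum.
  by apply: eq_bigr => j _; rewrite linearZ.
apply: continuous_for_sum => j; apply: cvgZ.
  by apply: (@continuous_comp _ _ _ snd (fun w : 'rV[R]_n => w 0 j)); [exact: cvg_snd|exact: coord_continuous].
apply: (@continuous_comp _ _ _ fst (fun y => 'd f y 'e_j)); first exact: cvg_fst.
exact: (Cf 'e_j).
Qed.

End OneSided.

Section PushedDisk.
Variables (R : realType) (n N : nat) (A : set (set 'rV[R]_n.+1)).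
Variables (a : 'I_N -> 'rV[R]_n.+1) (b : 'I_N -> R).
Hypothesis G : in_position A a b.
Local Notation E := 'rV[R]_n.+1.
Local Notation E' := 'rV[R]_n.
Local Notation R0 := (cyl_radius A).
Local Notation alpha := (alpha a b).
Let R00 : 0 < R0 := position_radius_gt0 G.
Variables (eps : R) (Phi : E -> E * R) (Psi : E * R -> E).
Hypothesis eps0 : 0 < eps.
Hypothesis TP : trivialization A eps Phi Psi.
Local Notation D := (fun x w => 'd (Pr1 Phi) x w).
Implicit Types (x w z v : E).

Lemma Cyl_0_eps x : Cyl_0 A x -> Cyl_eps A eps x.
Proof. by move=> [xR x0]; split=> //; rewrite x0 normr0 ltW. Qed.

Lemma smooth_on_Pr1 : smooth_on (Cyl_eps A eps) (Pr1 Phi).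
Proof.
have [[CP _ _ _] _ _] := TP.
by apply: (smooth_on_comp _ CP (S' := setT) (g := fst)) => //; exact: smooth_on_fst.
Qed.

Lemma diff_Pr1 x : Cyl_0 A x -> differentiable (Pr1 Phi) x.
Proof.
move=> Cx; have [U [_ SU CU]] := smooth_on_Pr1.
by apply: Ck_diff (CU 1%N) _; apply: SU; exact: Cyl_0_eps.
Qed.

Lemma Pr1_id x : Cyl_0 A x -> Pr1 Phi x = x.
Proof. by move=> Cx; have [_ _ H] := TP; rewrite /Pr1 H. Qed.

Lemma Pr1_Cyl_0 x : Cyl_eps A eps x -> Cyl_0 A (Pr1 Phi x).
Proof. by move=> Cx; have [[_ _ H _] _ _] := TP; have [[]] := H x Cx. Qed.

Lemma Pr1_hyp i x : Cyl_eps A eps x -> alpha i x = 0 -> alpha i (Pr1 Phi x) = 0.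
Proof.
move=> Cx xi; have [_ H _] := TP.
have Hi : A (hyp a b i) by rewrite {1}(pos_range G); exists i.
have : (Phi @` (Cyl_eps A eps `&` hyp a b i)) (Phi x).
  by exists x => //; split=> //; apply/eqP; rewrite -alpha_eq0 xi.
by rewrite (H _ Hi) => -[[_ h] _]; apply/eqP; rewrite alpha_eq0; exact/eqP.
Qed.

(* Every direction becomes inward after adding a multiple of a direction towards a
   point well inside the base of the cylinder. *)
Lemma inward x z w : Cyl_0 A x -> hgt z = 0 -> enorm (hor z) <= R0 / 2 ->
  exists K d : R, 0 < d /\ forall s, 0 < s < d ->
    Cyl_eps A eps (x + s *: (w + K *: (z - x))) /\ Cyl_0 A (x + s *: (z - x)).
Proof.
(* [K] is so large that [w / K] has horizontal length at most R/2, hence [z + w / K] is still within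
   R of the axis and the segment towards it stays inside by convexity. *)
move=> [xR x0] z0 zR; pose K := 2 * enorm (hor w) / R0 + 1.
have K0 : 0 < K by rewrite ltr_wpDl // divr_ge0 ?(ltW R00) // mulr_ge0 ?enorm_ge0.
have wK : enorm (hor w) / K <= R0 / 2.
  rewrite ler_pdivrMr // /K mulrDr mulr1 mulrA.
  have -> : R0 / 2 * (2 * enorm (hor w)) / R0 = enorm (hor w) by field; rewrite gt_eqF.
  by rewrite lerDl divr_ge0 ?(ltW R00).
have cvx y (t : R) : enorm (hor y) <= R0 -> 0 <= t <= 1 -> enorm (hor (x + t *: (y - x))) <= R0.
  move=> yR /andP[t0 t1].
  have -> : x + t *: (y - x) = (1 - t) *: x + t *: y by apply/rowP => j; rewrite !mxE; ring.
  rewrite horD !horZ; apply: le_trans (enormD _ _) _; rewrite !enormZ !ger0_norm ?subr_ge0 //.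
  have : (1 - t) * enorm (hor x) <= (1 - t) * R0 by rewrite ler_wpM2l // subr_ge0.
  have : t * enorm (hor y) <= t * R0 by rewrite ler_wpM2l.
  lra.
exists K, (Num.min (Num.min 1 K^-1) (eps / (`|hgt w| + 1))).
have w1 : 0 < `|hgt w| + 1 by rewrite ltr_wpDl.
split; first by rewrite !lt_min ltr01 invr_gt0 K0 divr_gt0.
move=> s /andP[s0]; rewrite !lt_min => /andP[/andP[s1 sK] se].
split; last first.
  split; last by rewrite hgtD hgtZ hgtB x0 z0 subrr mulr0 addr0.
  by apply: cvx; rewrite ?(ltW s0) ?(ltW s1) //; move: zR R00; move: R0 => r; lra.
split; last first.
  rewrite hgtD hgtZ hgtD hgtZ hgtB x0 z0 subrr mulr0 add0r addr0 normrM (gtr0_norm s0).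
  apply: (@le_trans _ _ (s * (`|hgt w| + 1))); first by rewrite ler_pM2l // lerDl.
  by rewrite -ler_pdivlMr // ltW.
have -> : s *: (w + K *: (z - x)) = (s * K) *: (z + K^-1 *: w - x).
  apply/rowP => j; rewrite !mxE; field; rewrite gt_eqF //.
apply: cvx; last first.
  by rewrite mulr_ge0 ?(ltW s0) ?(ltW K0) //= -ler_pdivlMr // mul1r ltW.
rewrite horD horZ; apply: le_trans (enormD _ _) _; rewrite enormZ normfV (gtr0_norm K0).
by rewrite mulrC; move: zR wK; move: R0 => r; lra.
Qed.

Lemma hgt_dPr1 x w : Cyl_0 A x -> hgt (D x w) = 0.
Proof.
move=> Cx; have [||K [d [d0 H]]] := @inward x 0 w Cx; rewrite ?hgt0 ?hor0 ?enorm0 ?divr_ge0 ?(ltW R00) //.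
have D1 : dot (@p0 R n) (D x (w + K *: (0 - x))) = 0.
  apply: (diff_ray (diff_Pr1 Cx) d0) => s /H[Cs _]; rewrite mulr0 addr0 !dot_p0 (Pr1_id Cx).
  by have [_ ->] := Pr1_Cyl_0 Cs; case: Cx.
have D2 : dot (@p0 R n) (D x (0 - x)) = 0.
  apply: (diff_ray (diff_Pr1 Cx) d0) => s /H[_ Cs]; rewrite mulr0 addr0 !dot_p0 !Pr1_id //.
  by case: Cs => _ ->; case: Cx.
by move: D1; rewrite linearD linearZ dotDr dotZr D2 mulr0 addr0 dot_p0.
Qed.

Lemma dot_dPr1 i x w : Cyl_0 A x -> alpha i x = 0 -> dot (a i) (D x w) = dot (a i) w.
Proof.
move=> Cx xi.
(* The target [z] lies on both the hyperplane and F, within R/2 of the axis, so the inward direction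
   [z - x] is horizontal, tangent to the hyperplane and fixed by the differential. *)
have [T iT lT] := position_line_in_hyp G i.
pose z := line_pt a b T 0.
have z0 : hgt z = 0 by exact: hgt_line_pt.
have zR : enorm (hor z) <= R0 / 2 by apply: (position_line_le G lT); rewrite lexx ler01.
have zi : alpha i z = 0 by rewrite alphaE (flat_line_pt lT 0 iT) subrr.
have az : dot (a i) (z - x) = 0 by rewrite -(alphaB a b) zi xi subrr.
have Dz : D x (z - x) = z - x.
  have [K [d [d0 H]]] := inward 0 Cx z0 zR.
  have Dc c : dot c (D x (z - x)) = dot c (z - x).
    apply: (diff_ray (diff_Pr1 Cx) d0) => s /H[_ Cs]; rewrite !Pr1_id //.
    by rewrite [LHS]dotDr dotZr.
  by apply/eqP; rewrite -subr_eq0; apply/eqP/dot_eq0; rewrite dotBr Dc subrr.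
have ker y : dot (a i) y = 0 -> dot (a i) (D x y) = 0.
  move=> ay; have [K [d [d0 H]]] := inward y Cx z0 zR.
  have : dot (a i) (D x (y + K *: (z - x))) = 0.
    apply: (diff_ray (diff_Pr1 Cx) d0) => s /H[Cs _]; rewrite mulr0 addr0 (Pr1_id Cx).
    have al y' : alpha i y' = 0 -> dot (a i) y' = b i by move=> /eqP; rewrite subr_eq0 => /eqP.
    rewrite (al x) //; apply: al; apply: Pr1_hyp => //.
    by rewrite alphaE dotDr dotZr dotDr dotZr ay az mulr0 addr0 mulr0 addr0 -alphaE.
  by rewrite linearD linearZ dotDr dotZr Dz az mulr0 addr0.
have hor_fix y : hgt y = 0 -> D x y = y.
  move=> y0; have [K [d [d0 H]]] := inward y Cx z0 zR.
  have Dc c : dot c (D x (y + K *: (z - x))) = dot c (y + K *: (z - x)).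
    apply: (diff_ray (diff_Pr1 Cx) d0) => s /H[[Cs _] _]; rewrite !Pr1_id //; first by rewrite [LHS]dotDr [dot c (s *: _)]dotZr.
    split=> //; have [_ x0] := Cx.
    by rewrite hgtD hgtZ hgtD hgtZ hgtB x0 z0 y0 subrr mulr0 addr0 mulr0 addr0.
  have : D x (y + K *: (z - x)) = y + K *: (z - x).
    by apply/eqP; rewrite -subr_eq0; apply/eqP/dot_eq0; rewrite dotBr Dc subrr.
  by rewrite linearD linearZ Dz => /addIr.
(* A horizontal vector transverse to the hyperplane: every [w] is a multiple of [e], which the
   differential fixes, plus a vector of the kernel, which it preserves. *)
pose e := vec (hor (a i)) 0.
have ae : dot (a i) e != 0.
  rewrite dot_hor hor_vec hgt_vec mulr0 addr0 gt_eqF // dot_gt0 //.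
  exact: (position_hor_normal_neq0 G).
pose c := dot (a i) w / dot (a i) e.
have k0 : dot (a i) (w - c *: e) = 0 by rewrite dotBr dotZr divfK // subrr.
have := ker _ k0; rewrite linearB linearZ (hor_fix e) ?hgt_vec // dotBr dotZr divfK //.
by move/eqP; rewrite subr_eq0 => /eqP.
Qed.

Variable sigma : E -> E * E.
Hypothesis sigma_cont : {within @disk R n, continuous sigma}.
Hypothesis sigma_valid : forall v, disk v -> Mcompl A (sigma v).
Hypothesis sigma_real : forall v, disk v -> (sigma v).2 = 0 -> v = 0.
Hypothesis sigma_rim : forall v, bdisk v -> Cyl_0 A (sigma v).1.
Hypothesis sigma0 : \forall v \near (0 : E), sigma v = (@p0 R n, v).

(** Solves [|v| = (1 + 2 rho / pi) / 2] for [rho]. *)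
Definition collar_angle v : R := pi * (enorm v - 2^-1).
Definition collar v : E * E :=
  let z := sigma ((enorm v)^-1 *: v) in (z.1, rotate (collar_angle v) z.2 (D z.1 z.2)).
Definition push v : E * E := if enorm v <= 2^-1 then sigma (2 *: v) else collar v.

Lemma pushed_push : pushed sigma Phi push.
Proof.
split=> [v v1|v rho v1 /andP[r0 r1]]; first by rewrite /push v1.
have p0 := pi_gt0 R; set k := (1 + 2 * rho / pi) / 2.
have q0 : 0 <= rho / pi by rewrite divr_ge0 // ltW.
have kE : k = 2^-1 + rho / pi by rewrite /k -mulrA; lra.
have k0 : 0 < k by rewrite kE; lra.
have en : enorm (k *: v) = k by rewrite enormZ v1 mulr1 gtr0_norm.
have uE : (enorm (k *: v))^-1 *: (k *: v) = v by rewrite en scalerA mulVf ?scale1r // gt_eqF.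
have aE : collar_angle (k *: v) = rho.
  by rewrite /collar_angle en kE addrC addKr mulrC divfK // gt_eqF.
rewrite /push; case: ifP => [k1|_]; last by rewrite /collar uE aE; case: (sigma v).
have rho0 : rho = 0.
  have : rho / pi <= 0 by move: k1; rewrite en kE; lra.
  by rewrite ler_pdivrMr // mul0r => ?; apply/eqP; rewrite eq_le r0 andbT.
rewrite rho0 mul0r addr0 in kE; rewrite scalerA kE mulfV ?pnatr_eq0 // scale1r.
by rewrite rho0; case: (sigma v) => x w; rewrite rotate0.
Qed.

Lemma collar_disk v : 2^-1 <= enorm v <= 1 -> bdisk ((enorm v)^-1 *: v) /\ quarter (collar_angle v).
Proof.
move=> v1; split; first exact/enorm_normalize/shell_neq0.
by have p0 := pi_gt0 R; apply/andP; split; rewrite /collar_angle; nra.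
Qed.

Lemma bdisk_disk v : bdisk v -> disk v.
Proof. by rewrite /bdisk /disk /= => ->. Qed.

Lemma collar_valid v : 2^-1 <= enorm v <= 1 -> Mcompl A (collar v).
Proof.
move=> v1; have [u1 qa] := collar_disk v1; have Cx := sigma_rim u1.
have := sigma_valid (bdisk_disk u1); rewrite /collar.
case: (sigma _) Cx => x w /= Cx /(Mcompl_alpha G) H; apply/(Mcompl_alpha G) => i xi.
apply: rotate_dot_neq0 => //; rewrite dot_dPr1 // -expr2 exprn_even_gt0 //=.
exact: H.
Qed.

Lemma disk_double v : enorm v <= 2^-1 -> disk (2 *: v).
Proof. by move=> v1; rewrite /disk /= enormZ ger0_norm //; lra. Qed.

Lemma push_cases v : disk v -> (enorm v <= 2^-1 /\ push v = sigma (2 *: v)) \/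
  (2^-1 <= enorm v <= 1 /\ push v = collar v).
Proof.
move=> v1; rewrite /push; have [v2|/ltW v2] := leP (enorm v) 2^-1; [left|right] => //.
by rewrite v2.
Qed.

Lemma push_cont : {within @disk R n, continuous push}.
Proof.
have cS : closed [set v : E | 2^-1 <= enorm v <= 1] by exact: closed_shell.
have : {within @A1 R n `|` [set v : E | 2^-1 <= enorm v <= 1], continuous push}.
  apply: withinU_continuous => //; first exact: closed_A1.
    apply: (@within_eq _ _ _ _ (fun v => sigma (2 *: v))) => [v v1|].
      by rewrite /push; move: v1; rewrite /A1 /= => ->.
    apply: (within_comp (k := fun v : E => 2 *: v) _ _ sigma_cont) => v v1.
      exact: scaler_continuous.
    exact: disk_double.
  apply: (@within_eq _ _ _ _ collar) => [v v1|].
    rewrite /push; case: ifP => // v2; case/andP: (v1) => v3 _.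
    have ve : enorm v = 2^-1 by apply/eqP; rewrite eq_le v2 v3.
    rewrite /collar /collar_angle ve subrr mulr0 rotate0 invrK.
    by case: (sigma _).
  have [U [oU SU CU]] := smooth_on_Pr1.
  have Sk : smooth_on [set v : E | 2^-1 <= enorm v <= 1] (fun v => (enorm v)^-1 *: v).
    apply: smooth_on_scale; last exact: smooth_on_id.
    apply: smooth_on_inv => [|v /shell_neq0 /enorm_gt0 e0]; last by rewrite gt_eqF.
    by apply: smooth_on_enorm => [|v /shell_neq0 //]; exact: smooth_on_id.
  have kc v (v1 : [set v : E | 2^-1 <= enorm v <= 1] v) := smooth_on_cont Sk v1.
  have sc : {within [set v : E | 2^-1 <= enorm v <= 1], continuous (fun v => sigma ((enorm v)^-1 *: v))}.
    apply: (within_comp (k := fun v : E => (enorm v)^-1 *: v) kc _ sigma_cont) => v v1.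
    exact: bdisk_disk (collar_disk v1).1.
  have ac : continuous collar_angle.
    move=> v; apply: (@continuous_comp _ _ _ (@enorm R n.+1) (fun s : R => pi * (s - 2^-1))).
      exact: continuous_enorm.
    by apply: cvgM; [exact: cvg_cst|apply: cvgB; [exact: cvg_id|exact: cvg_cst]].
  have gc := within_pair (continuous_subspaceT ac : {within [set v : E | 2^-1 <= enorm v <= 1], continuous collar_angle}) sc.
  pose H (z : R * (E * E)) : E * E := (z.2.1, rotate z.1 z.2.2 (D z.2.1 z.2.2)).
  (* The differential of [Pr1] is jointly continuous over the open set [U] where [Pr1] is smooth,
     and the base points of the collar lie in [U]. *)
  have Hc (z : R * (E * E)) : U z.2.1 -> {for z, continuous H}.
    move=> Uz.
    have c2 : {for z, continuous (fun z : R * (E * E) => z.2)} by exact: cvg_snd.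
    have c1 : {for z, continuous (fun z : R * (E * E) => z.1)} by exact: cvg_fst.
    have c21 : {for z, continuous (fun z : R * (E * E) => z.2.1)}.
      by apply: (@continuous_comp _ _ _ (fun z : R * (E * E) => z.2) fst); [exact: c2|exact: cvg_fst].
    have c22 : {for z, continuous (fun z : R * (E * E) => z.2.2)}.
      by apply: (@continuous_comp _ _ _ (fun z : R * (E * E) => z.2) snd); [exact: c2|exact: cvg_snd].
    have cc : {for z, continuous (fun z : R * (E * E) => cos z.1)}.
      apply: (@continuous_comp _ _ _ (fun z : R * (E * E) => z.1) (@cos R)); first exact: c1.
      exact: continuous_cos.
    have cs : {for z, continuous (fun z : R * (E * E) => sin z.1)}.
      apply: (@continuous_comp _ _ _ (fun z : R * (E * E) => z.1) (@sin R)); first exact: c1.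
      exact: continuous_sin.
    have cd : {for z, continuous (fun z : R * (E * E) => D z.2.1 z.2.2)}.
      apply: (@continuous_comp _ _ _ (fun z : R * (E * E) => z.2) (fun y : E * E => D y.1 y.2)).
        exact: c2.
      exact: continuous_diff (CU 1%N) Uz.
    apply: for_pair; first exact: c21.
    apply: cvgD; first exact: (cvgZ cc c22).
    exact: (cvgZ cs cd).
  have HH := @within_continuous_comp _ _ _ _ _ H _ gc.
  apply: HH => _ /[!inE] -[v v1 <-]; apply: Hc; apply: SU; apply: Cyl_0_eps.
  apply: sigma_rim; exact: (collar_disk v1).1.
apply: continuous_subspaceW => v v1; have [v2|/ltW v2] := leP (enorm v) 2^-1; [left|right] => //.
by rewrite /= v2.
Qed.

Lemma near_push0 : \forall v \near (0 : E), push v = (@p0 R n, 2 *: v).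
Proof.
have H1 : \forall v \near (0 : E), sigma (2 *: v) = (@p0 R n, 2 *: v).
  have sc : 2 *: v @[v --> (0 : E)] --> (0 : E).
    by rewrite -[X in _ --> X](scaler0 _ 2); exact: scaler_continuous.
  exact: sc sigma0.
have H2 : \forall v \near (0 : E), enorm v < 2^-1 by apply: near_enorm_lt; rewrite invr_gt0.
by apply: filterS2 H1 H2 => v E1 v1; rewrite /push (ltW v1).
Qed.

Lemma push_lefschetz C : chamber_off A (@F0 R n) C -> C (@p0 R n) ->
  lefschetz_disk A (@F0 R n) C (@p0 R n) push.
Proof.
move=> hC Cp; have [hC1 _] := hC.
(* On the collar the base point lies on F, which the chambers in question avoid; on the inner disk
   only the center is real. *)
have real v C' : chamber_off A (@F0 R n) C' -> disk v -> realpts C' (push v) -> v = 0.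
  move=> [_ C'F] /push_cases[[v1 ->] [_ w0]|[v1 ->] [cx _]].
    have := sigma_real (disk_double v1) w0 => /eqP.
    by rewrite scaler_eq0 pnatr_eq0 /= => /eqP.
  have [u1 _] := collar_disk v1; have [_ h0] := sigma_rim u1.
  have : (C' `&` @F0 R n) (collar v).1 by split.
  by rewrite C'F.
split.
- split; first exact: push_cont.
  move=> _ [v v1 <-]; case: (push_cases v1) => -[v2 ->]; last exact: collar_valid.
  exact/sigma_valid/disk_double.
- by apply: filterS (near_vertical_is_diff near_push0) => v Dv; exact: (@ex_diff _ _ _ _ _ _ _ Dv).
- apply: (meets_only_at_vertical (k := 2)) => //; first exact: near_push0.
  by move=> v dv rv; exact: real hC dv rv.
- move=> _ [v v1 <-]; have v2 : 2^-1 <= enorm v <= 1 by rewrite v1 lexx andbT; lra.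
  have -> : push v = collar v by rewrite /push v1; case: ifP => //; rewrite leNgt invf_lt1 // ltr1n.
  split; first exact: collar_valid.
  have [u1 _] := collar_disk v2; have Cx := sigma_rim u1.
  apply/cplx_F0; rewrite /collar /collar_angle v1 (_ : pi * (1 - 2^-1) = pi / 2); last by congr (_ * _); lra.
  by rewrite rotate_pihalf /= hgt_dPr1 ?v1 //; case: Cx; rewrite v1.
- apply: avoids_others_vertical hC1 Cp _ _; first by rewrite (nbhs_singleton near_push0) scaler0.
  by move=> v C' hC' dv rv; exact: real hC' dv rv.
Qed.

End PushedDisk.

(** * Adapted charts *)

Section Chart.
Variables (R : realType) (n : nat).
Local Notation E := 'rV[R]_n.+1.
Variables (M : 'M[R]_n.+1) (b0 : E).
Hypothesis uM : M \in unitmx.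
Local Notation phi := (chart M b0).
Implicit Types (x y w a : E) (A : set (set E)) (H F C X : set E) (z : E * E).

Definition unchart y : E := (y - b0) *m invmx M.
(** Normals transform by the inverse transpose; points are row vectors acted on from the right. *)
Definition conormal a : E := a *m (invmx M)^T.

Lemma chartK x : unchart (phi x) = x.
Proof. by rewrite /unchart /chart addrK mulmxK. Qed.

Lemma unchartK y : phi (unchart y) = y.
Proof. by rewrite /unchart /chart mulmxKV // subrK. Qed.

Lemma chart_image X y : (phi @` X) y <-> X (unchart y).
Proof.
split=> [[x Xx <-]|Xy]; first by rewrite chartK.
by exists (unchart y) => //; exact: unchartK.
Qed.

Lemma chart_image_inj X X' : phi @` X = phi @` X' -> X = X'.
Proof.
move=> XX'; apply/seteqP; split=> x Xx.
  by have : (phi @` X') (phi x) by [rewrite -XX'; exists x]; rewrite chart_image chartK.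
by have : (phi @` X) (phi x) by [rewrite XX'; exists x]; rewrite chart_image chartK.
Qed.

Lemma dot_mulmx a y (K : 'M[R]_n.+1) : dot a (y *m K) = dot (a *m K^T) y.
Proof.
rewrite /dot (eq_bigr (fun j => \sum_i y 0 i * (a 0 j * K i j))); last first.
  by move=> j _; rewrite mxE mulr_sumr; apply: eq_bigr => i _; ring.
rewrite exchange_big; apply: eq_bigr => i _; rewrite mxE -mulr_sumr mulrC; congr (_ * _).
by apply: eq_bigr => j _; rewrite mxE.
Qed.

Lemma dot_conormal a y : dot (conormal a) y = dot a (y *m invmx M).
Proof. by rewrite dot_mulmx. Qed.

Lemma conormal_neq0 a : a != 0 -> conormal a != 0.
Proof.
apply: contra_neq => H; have := mulmxK (_ : (invmx M)^T \in unitmx) a.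
by rewrite unitmx_tr unitmx_inv => /(_ uM); rewrite -/(conormal a) H mul0mx.
Qed.

Lemma chart_hyp a c : phi @` [set x | dot a x = c] =
  [set y | dot (conormal a) y = c + dot (conormal a) b0].
Proof.
apply/seteqP; split=> y; rewrite chart_image /= /unchart -dot_conormal dotBr.
  by move=> <-; rewrite subrK.
by move=> ->; rewrite addrK.
Qed.

Lemma cplx_chart a c z : a != 0 ->
  cplx [set x | dot a x = c] (chart_inv M b0 z) <-> cplx (phi @` [set x | dot a x = c]) z.
Proof.
move=> a0; have a1 := conormal_neq0 a0.
rewrite chart_hyp; split.
  move=> /(cplx_hyp c _ a0)[/= h1 h2]; apply/(cplx_hyp _ z a1).
  by split; [rewrite -h1 -dot_conormal dotBr subrK|rewrite dot_conormal].
move=> /(cplx_hyp _ z a1)[/= h1 h2]; apply/(cplx_hyp c _ a0).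
by rewrite /chart_inv /= -!dot_conormal dotBr h1 addrK.
Qed.

Lemma Mcompl_chart A z : (forall H, A H -> hyperplane H) ->
  Mcompl [set phi @` H | H in A] z -> Mcompl A (chart_inv M b0 z).
Proof.
move=> hA Hz [H AH]; have [a [c [a0 HE]]] := hA _ AH; rewrite /= HE => /(cplx_chart _ _ a0) cz.
by apply: Hz; exists (phi @` H); [exists H|rewrite HE].
Qed.

Lemma continuous_unchart : continuous unchart.
Proof.
apply/continuous_Ck0; apply: Ck_row => [|j]; first exact: openT.
apply: (@Ck_ext _ _ _ _ _ (fun y => dot (row j (invmx M)^T) (y - b0))); first exact: openT.
  by move=> y _; rewrite /unchart [in RHS]mxE; apply: eq_bigr => i _; rewrite !mxE mulrC.
apply: Ck_dot; [exact: openT|apply: Ck_cst; exact: openT|].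
by apply: Ck_add; [exact: openT|apply: Ck_id; exact: openT|apply: Ck_cst; exact: openT].
Qed.

Lemma continuous_chart : continuous phi.
Proof.
apply/continuous_Ck0; apply: Ck_add; [exact: openT| |apply: Ck_cst; exact: openT].
apply: Ck_row => [|j]; first exact: openT.
apply: (@Ck_ext _ _ _ _ _ (fun y => dot (row j M^T) y)); first exact: openT.
  by move=> y _; rewrite [in RHS]mxE; apply: eq_bigr => i _; rewrite !mxE mulrC.
by apply: Ck_dot; [exact: openT|apply: Ck_cst; exact: openT|apply: Ck_id; exact: openT].
Qed.

Lemma complement_chart A y : complement [set phi @` H | H in A] y <-> complement A (unchart y).
Proof.
split=> Hy [H].
  by move=> AH Hx; apply: Hy; exists (phi @` H); [exists H|apply/chart_image].
by move=> [H' AH <-] /chart_image Hx; apply: Hy; exists H'.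
Qed.

Lemma chamber_chart A C : chamber A C -> chamber [set phi @` H | H in A] (phi @` C).
Proof.
move=> [x cx ->]; set B := [set _ | H in A]; exists (phi x).
  by apply/complement_chart; rewrite chartK.
have cB : complement B (phi x) by apply/complement_chart; rewrite chartK.
apply/seteqP; split.
  apply: connected_component_max.
  - by exists x => //; exact: connected_component_refl.
  - move=> _ [y Cy <-]; apply/complement_chart; rewrite chartK.
    exact: connected_component_sub Cy.
  - by apply: connected_continuous_connected; [exact: component_connected|exact/continuous_subspaceT/continuous_chart].
move=> y By; apply/chart_image.
suff : unchart @` connected_component (complement B) (phi x) `<=` connected_component (complement A) x.
  by apply; exists y.
apply: connected_component_max.
- by exists (phi x); [exact: connected_component_refl|exact: chartK].
- by move=> _ [w Bw <-]; apply/complement_chart; exact: connected_component_sub Bw.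
- by apply: connected_continuous_connected; [exact: component_connected|exact/continuous_subspaceT/continuous_unchart].
Qed.

Lemma chamber_off_chart A F C F' : phi @` F = F' -> chamber_off A F C ->
  chamber_off [set phi @` H | H in A] F' (phi @` C).
Proof.
move=> FF' [hC CF]; split; first exact: chamber_chart.
apply/seteqP; split=> // y []; rewrite -FF' => /chart_image Cy /chart_image Fy.
by have : (C `&` F) (unchart y) by []; rewrite CF.
Qed.

Lemma realpts_chart C z : realpts C (chart_inv M b0 z) <-> realpts (phi @` C) z.
Proof.
split=> [[Cz /= w0]|[/chart_image Cz w0]]; split=> //=; first exact/chart_image.
  by rewrite -[LHS](mulmxKV uM) w0 mul0mx.
by rewrite w0 mul0mx.
Qed.

Definition chart_inv_lin z : E * E := (z.1 *m invmx M, z.2 *m invmx M).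

Lemma chart_inv_linP : linear chart_inv_lin.
Proof.
move=> k [x1 x2] [y1 y2]; rewrite /chart_inv_lin /= pairZE pairDE /=.
by rewrite !mulmxDl -!scalemxAl.
Qed.

Lemma continuous_mulmx (K : 'M[R]_n.+1) : continuous (fun x : E => x *m K).
Proof.
apply/continuous_Ck0; apply: Ck_row => [|j]; first exact: openT.
apply: (@Ck_ext _ _ _ _ _ (fun y => dot (row j K^T) y)); first exact: openT.
  by move=> y _; rewrite [in RHS]mxE; apply: eq_bigr => i _; rewrite !mxE mulrC.
by apply: Ck_dot; [exact: openT|apply: Ck_cst; exact: openT|apply: Ck_id; exact: openT].
Qed.

Lemma continuous_chart_inv_lin : continuous chart_inv_lin.
Proof.
move=> z; apply: (for_pair (f := fun z : E * E => z.1 *m invmx M) (g := fun z : E * E => z.2 *m invmx M)).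
  by apply: (@continuous_comp _ _ _ fst (fun x : E => x *m invmx M)); [exact: cvg_fst|exact: continuous_mulmx].
by apply: (@continuous_comp _ _ _ snd (fun x : E => x *m invmx M)); [exact: cvg_snd|exact: continuous_mulmx].
Qed.

Lemma chart_invE z : chart_inv M b0 z = chart_inv_lin z - (b0 *m invmx M, 0).
Proof. by rewrite /chart_inv /chart_inv_lin mulmxBl; congr (_, _); rewrite /= subr0. Qed.

Lemma is_diff_chart_inv z : is_diff z (chart_inv M b0) chart_inv_lin.
Proof.
pose L : {linear (E * E)%type -> (E * E)%type} := HB.pack chart_inv_lin
  (GRing.isLinear.Build _ _ _ _ _ chart_inv_linP).
have D := is_diffB (is_diff_linear z (continuous_chart_inv_lin : continuous L)) (is_diff_cst (b0 *m invmx M, 0) z).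
have -> : chart_inv M b0 = L \- cst (b0 *m invmx M, 0).
  by apply/funext => y; rewrite chart_invE.
have <- : L \- \0 = chart_inv_lin by apply/funext => y /=; rewrite subr0.
exact: D.
Qed.

Lemma continuous_chart_inv : continuous (chart_inv M b0).
Proof. by move=> z; apply: differentiable_continuous; exact: (@ex_diff _ _ _ _ _ _ _ (is_diff_chart_inv z)). Qed.

Lemma lefschetz_chart A F F' C p p' tau : (forall H, A H -> hyperplane H) -> hyperplane F ->
  phi @` F = F' -> phi p = p' ->
  lefschetz_disk [set phi @` H | H in A] F' (phi @` C) p' tau ->
  lefschetz_disk A F C p (chart_inv M b0 \o tau).
Proof.
move=> hA [aF [cF [aF0 FE]]] FF' pp' [[tc tM] td [t0 tC ttr] tF tav].
have D v : differentiable tau v -> is_diff v (chart_inv M b0 \o tau) (chart_inv_lin \o 'd tau v).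
  by move=> /differentiableP dv; exact: is_diff_comp dv (is_diff_chart_inv _).
split.
- split; first by apply: (@within_continuous_comp _ _ _ _ _ (chart_inv M b0) _ tc) => z _; exact: continuous_chart_inv.
  by move=> _ [v v1 <-]; apply: Mcompl_chart => //; apply: tM; exists v.
- by apply: filterS td => v /D Dv; exact: (@ex_diff _ _ _ _ _ _ _ Dv).
- have s0 : (chart_inv M b0 \o tau) 0 = (p, 0).
    by rewrite /= t0 /chart_inv /= mul0mx -pp' -/(unchart _) chartK.
  split=> //.
    apply/seteqP; split=> [_ [[v v1 <-] /realpts_chart rv]|_ ->].
      have : ((tau @` disk (n:=n)) `&` realpts (phi @` C)) (tau v) by split=> //; exists v.
      by rewrite tC => tv; rewrite -s0 /= tv t0.
    split; first by exists 0 => //; rewrite /disk /= enorm0 ler01.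
    rewrite -s0; apply/realpts_chart; rewrite t0.
    have : ((tau @` disk (n:=n)) `&` realpts (phi @` C)) (p', 0) by rewrite tC.
    by case.
  move=> v v1 /realpts_chart rv; have [dv tv] := ttr v v1 rv; have Dv := D v dv.
  split; first exact: (@ex_diff _ _ _ _ _ _ _ Dv).
  move=> z; have [u [c E1]] := tv (z.1 *m M, z.2 *m M).
  exists u, (c *m invmx M); rewrite (@diff_val _ _ _ _ _ _ _ Dv) /=.
  have -> : 'd tau v u = (z.1 *m M - c, z.2 *m M).
    by apply: (addIr (c, 0)); rewrite -E1 pairDE subrK addr0.
  by rewrite /chart_inv_lin /= pairDE mulmxBl subrK addr0 !mulmxK //; case: z {E1}.
- move=> _ [v v1 <-]; have [h1 h2] : (Mcompl [set phi @` H | H in A] `&` cplx F') (tau v) by apply: tF; exists v.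
  split; first exact: Mcompl_chart.
  by rewrite FE; apply/cplx_chart => //; rewrite -FE FF'.
- move=> C' hC' neq; apply/seteqP; split=> // _ [[v v1 <-] /realpts_chart rv].
  have : ((tau @` disk (n:=n)) `&` realpts (phi @` C')) (tau v) by split=> //; exists v.
  have neq' : phi @` C' <> phi @` C by move=> /chart_image_inj.
  by rewrite (tav _ (chamber_off_chart FF' hC') neq').
Qed.

End Chart.

(** * From the hypotheses on the arrangement to adapted coordinates *)

Section Position.
Variables (R : realType) (n : nat).
Local Notation E := 'rV[R]_n.+1.
Implicit Types (A : set (set E)) (F C X : set E) (p x y w : E).

Lemma hyperplane_family A : arrangement A -> exists N (a : 'I_N -> E) (b : 'I_N -> R),
  (forall i, a i != 0) /\ A = [set hyp a b i | i in [set: 'I_N]].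
Proof.
move=> [/finite_setP[N /card_set_bijP[f [f1 f2 f3]]] hA].
have inv (i : 'I_N) : exists H, A H /\ f H = i.
  by have [H AH fH] := f3 i (ltn_ord i); exists H.
have [g Hg] := choice inv.
have ex i : exists ab : E * R, ab.1 != 0 /\ g i = [set x | dot ab.1 x = ab.2].
  by have [Ai _] := Hg i; have [a [b [a0 gE]]] := hA _ Ai; exists (a, b).
have [ab Hab] := choice ex.
exists N, (fun i => (ab i).1), (fun i => (ab i).2); split=> [i|]; first by have [] := Hab i.
apply/seteqP; split=> [H AH|_ [i _ <-]].
  have fN : (f H < N)%N by exact: f1.
  exists (Ordinal fN) => //; have [_ E1] := Hab (Ordinal fN); have [Ag fg] := Hg (Ordinal fN).
  by rewrite /hyp -E1; apply: f2; rewrite ?inE.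
by have [_ E1] := Hab i; rewrite /hyp -E1; have [] := Hg i.
Qed.

Lemma has_dim0P X : has_dim X 0 <-> exists x, X = [set x].
Proof.
split=> [[x [U [-> U0]]]|[x ->]].
  exists x; have -> : U = 0%VS by apply/eqP; rewrite -dimv_eq0 U0.
  apply/seteqP; split=> y /=; first by rewrite memv0 subr_eq0 => /eqP.
  by move=> ->; rewrite subrr mem0v.
exists x, 0%VS; split; last exact: dimv0.
apply/seteqP; split=> y /=; first by move=> ->; rewrite subrr mem0v.
by rewrite memv0 subr_eq0 => /eqP.
Qed.

Lemma position_chart A F C p (M : 'M[R]_n.+1) (b0 : E) : (0 < n)%N ->
  arrangement A -> essential A -> generic A F -> chamber_off A F C -> C p -> adapted F p M b0 ->
  exists N (a : 'I_N -> E) (b : 'I_N -> R), in_position [set chart M b0 @` H | H in A] a b.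
Proof.
move=> n0 hA eA gA hC Cp [uM FF' pp'].
have [N [a [b [a0 AE]]]] := hyperplane_family hA.
pose a' i := conormal M (a i); pose b' i := b i + dot (a' i) b0.
have hE i : chart M b0 @` hyp a b i = hyp a' b' i by rewrite /hyp (chart_hyp b0 uM).
have fE S y : flat a' b' S y <-> flat a b S (unchart M b0 y).
  have eqv i : dot (a' i) y = b' i <-> dot (a i) (unchart M b0 y) = b i.
    rewrite /unchart -dot_conormal dotBr -/(a' i) /b'.
    by split=> [->|<-]; rewrite ?addrK ?subrK.
  by split=> H i iS; apply/eqv; exact: H.
have F0P y : F0 y <-> F (unchart M b0 y) by rewrite -FF' chart_image.
have int S : intersection A (flat a b S).
  exists [set hyp a b i | i in [set i | i \in S]].
    by move=> _ [i _ <-]; rewrite AE; exists i.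
  apply/seteqP; split=> x Hx; first by move=> _ [i /= iS <-]; exact: Hx.
  by move=> i iS; apply: (Hx (hyp a b i)); exists i.
exists N, a', b'; split=> //.
- by move=> i; exact: conormal_neq0.
- move=> w aw; have [x0 [D DA xE]] := eA.
  have : [set x0] (x0 + w *m invmx M).
    rewrite xE => H DH; have := DA _ DH; rewrite AE => -[i _ Hi]; rewrite -Hi /hyp /= dotDr -dot_conormal aw addr0.
    have : [set x0] x0 by []; rewrite xE => /(_ H DH); rewrite -Hi; exact.
  move=> /= /eqP; rewrite -subr_eq0 addrAC subrr add0r => /eqP wN.
  by rewrite -(mulmxKV uM w) wN mul0mx.
- move=> S y Sy; apply/eqP => hy.
  have X0 : has_dim (flat a b S) 0.
    apply/has_dim0P; exists (unchart M b0 y); apply/seteqP; split=> x.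
      move=> Sx; have : flat a' b' S (chart M b0 x) by apply/fE; rewrite chartK.
      by rewrite Sy => /= <-; rewrite chartK.
    by move=> ->; apply/fE; rewrite Sy.
  (* A vertex has codimension [n+1], which exceeds [n], so genericity keeps it off F. *)
  have := gA _ _ (int S) X0; rewrite subn0 ltnn => FX.
  have : (F `&` flat a b S) (unchart M b0 y) by split; [exact/F0P|apply/fE; rewrite Sy].
  by rewrite FX.
- move=> S y u u0 Sy; apply/eqP => hu.
  have X1 : has_dim (flat a b S) 1.
    apply/has_dim1P; exists (unchart M b0 y), (u *m invmx M); split.
      by apply: contra_neq u0 => uN; rewrite -(mulmxKV uM u) uN mul0mx.
    have uE s : unchart M b0 (y + s *: u) = unchart M b0 y + s *: (u *m invmx M).
      by rewrite /unchart addrAC mulmxDl -scalemxAl.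
    apply/seteqP; split=> x.
      move=> Sx; have : flat a' b' S (chart M b0 x) by apply/fE; rewrite chartK.
      by rewrite Sy => -[s _ sx]; exists s => //; rewrite -uE sx chartK.
    by move=> [s _ <-]; rewrite -uE; apply/fE; rewrite Sy; exists s.
  (* F meets a one-dimensional stratum in a single point [x]; if the direction [u] were horizontal,
     [x] translated by [u] would be a second one. *)
  have := gA _ _ (int S) X1; rewrite subn1 /= leqnn subnn => /has_dim0P[x FX].
  have [Fx Sx] : (F `&` flat a b S) x by rewrite FX.
  have Sx' : flat a' b' S (chart M b0 x) by apply/fE; rewrite chartK.
  have hx : F0 (chart M b0 x) by apply/F0P; rewrite chartK.
  have : [set x] (unchart M b0 (chart M b0 x + u)).
    rewrite -FX; split; first by apply/F0P; rewrite /F0 /= hgtD hu addr0.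
    apply/fE; move: Sx'; rewrite Sy => -[s _ <-].
    by exists (s + 1) => //; rewrite scalerDl scale1r addrA.
  move=> /(congr1 (chart M b0)); rewrite unchartK // => /eqP.
  by rewrite -subr_eq0 addrAC subrr add0r; apply/negP.
- by rewrite AE; apply/seteqP; split=> [_ [_ [i _ <-] <-]|_ [i _ <-]]; [exists i|exists (hyp a b i)]; rewrite ?hE //; exists i.
- move=> i; apply/eqP => pi; have [[x cx CE] _] := hC.
  have : complement A p by move: Cp; rewrite CE; exact: connected_component_sub.
  apply; exists (hyp a b i); first by rewrite AE; exists i.
  have : hyp a' b' i (@p0 R n) by [].
  by rewrite -hE chart_image // -pp' chartK.
Qed.

Lemma adapted_exists F p : hyperplane F -> ~ F p -> exists (M : 'M[R]_n.+1) b, adapted F p M b.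
Proof.
move=> [a [c [a0 FE]]] Fp.
have kp : dot a p - c != 0 by rewrite subr_eq0; apply/eqP => H; apply: Fp; rewrite FE.
pose k := (dot a p - c)^-1.
have [j0 aj] : exists j, a 0 j != 0.
  apply: contrapT => H; move/eqP: a0; apply; apply/rowP => j; rewrite mxE.
  by apply/eqP; apply: contrapT => /negP aj; apply: H; exists j.
(* The last coordinate is the equation of F, scaled by [k] so that [p] has height 1; the others are
   the old coordinates except [j0], and the matrix is invertible because [a] has a nonzero entry at
   [j0]. *)
pose M : 'M[R]_n.+1 := \matrix_(i, j)
  (if unlift ord_max j is Some j' then (i == lift j0 j')%:R else k * a 0 i).
have Mh x : hgt (x *m M) = k * dot a x.
  rewrite /hgt mxE /dot mulr_sumr; apply: eq_bigr => i _; rewrite mxE unlift_none; ring.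
have Ml x j : (x *m M) 0 (lift ord_max j) = x 0 (lift j0 j).
  rewrite mxE (bigD1 (lift j0 j)) //= mxE liftK eqxx mulr1 big1 ?addr0 // => i ij.
  by rewrite mxE liftK (negbTE ij) mulr0.
have uM : M \in unitmx.
  rewrite -row_free_unit; apply: inj_row_free => x xM.
  have xl j : x 0 (lift j0 j) = 0 by rewrite -Ml xM mxE.
  have := Mh x; rewrite xM hgt0 /dot (bigD1 j0) //= big1 ?addr0 => [|i ij]; last first.
    by case: (unliftP j0 i) ij => [j ->|->]; rewrite ?xl ?mulr0 // eqxx.
  move=> /esym /eqP; rewrite !mulf_eq0 invr_eq0 (negbTE kp) (negbTE aj) /= => /eqP xj0.
  by apply/rowP => i; rewrite mxE; case: (unliftP j0 i) => [j ->|->].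
have hgtE x : hgt (chart M (@p0 R n - p *m M) x) = k * (dot a x - c).
  rewrite /chart hgtD hgtB !Mh /p0 hgt_vec.
  have : k * (dot a p - c) = 1 by rewrite mulVf.
  by rewrite !mulrBr => <-; ring.
exists M, (@p0 R n - p *m M); split=> //; last by rewrite /chart addrC subrK.
apply/seteqP; split=> y; rewrite (chart_image _ uM).
  by rewrite FE /= => H; rewrite /F0 /= -(unchartK (@p0 R n - p *m M) uM y) hgtE H subrr mulr0.
rewrite /F0 /= -{1}(unchartK (@p0 R n - p *m M) uM y) hgtE FE /= => /eqP.
by rewrite mulf_eq0 invr_eq0 (negbTE kp) /= subr_eq0 => /eqP.
Qed.

End Position.

(** * The case of dimension one *)

Section LineCase.
Variable R : realType.
Local Notation E := 'rV[R]_1.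
Implicit Types (A : set (set E)) (F C : set E) (p f v : E).

(** For [|v| <= 1/2] the point is [(p, v)]; beyond that the base point travels from [p] to [f] while
    the vector shrinks to zero, which it reaches exactly on the boundary, over [f]. *)
Definition segment_disk p f v : E * E :=
  (p + Num.max 0 (2 * enorm v - 1) *: (f - p), Num.min 1 (2 - 2 * enorm v) *: v).

Lemma dot_line_neq0 (a v : E) : a != 0 -> v != 0 -> dot a v != 0.
Proof.
move=> a0 v0; rewrite /dot big_ord1; apply: mulf_neq0.
  by apply: contra_neq a0 => H; apply/rowP => j; rewrite ord1 H mxE.
by apply: contra_neq v0 => H; apply/rowP => j; rewrite ord1 H mxE.
Qed.

Lemma segment_disk_cont p f : continuous (segment_disk p f).
Proof.
have ce := @continuous_enorm R 1.
have c2 : continuous (fun s : R => 2 * s).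
  by move=> s; apply: cvgM; [exact: cvg_cst|exact: cvg_id].
have h1 : continuous (fun s : R => Num.max 0 (2 * s - 1)).
  move=> s; apply: (@continuous_max _ _ (fun=> 0) (fun s : R => 2 * s - 1)); first exact: cst_continuous.
  by apply: cvgB; [exact: c2|exact: cvg_cst].
have h2 : continuous (fun s : R => Num.min 1 (2 - 2 * s)).
  move=> s; apply: (@continuous_min _ _ (fun=> 1) (fun s : R => 2 - 2 * s)); first exact: cst_continuous.
  by apply: cvgB; [exact: cvg_cst|exact: c2].
move=> v; apply: (for_pair (f := fun v : E => p + Num.max 0 (2 * enorm v - 1) *: (f - p))
    (g := fun v : E => Num.min 1 (2 - 2 * enorm v) *: v)).
  apply: (@continuous_comp _ _ _ (@enorm R 1) (fun s : R => p + Num.max 0 (2 * s - 1) *: (f - p))).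
    exact: ce.
  by apply: cvgD; [exact: cvg_cst|apply: cvgZ; [exact: h1|exact: cvg_cst]].
apply: (@continuous_comp _ _ _ (fun v : E => (enorm v, v)) (fun z : R * E => Num.min 1 (2 - 2 * z.1) *: z.2)).
  by apply: for_pair; [exact: ce|exact: cvg_id].
apply: cvgZ; last exact: cvg_snd.
by apply: (@continuous_comp _ _ _ fst (fun s : R => Num.min 1 (2 - 2 * s))); [exact: cvg_fst|exact: h2].
Qed.

Lemma segment_disk_rim p f v : enorm v = 1 -> segment_disk p f v = (f, 0).
Proof.
move=> v1; rewrite /segment_disk v1 mulr1 (_ : 2 - 1 = 1); last by ring.
by rewrite subrr (max_idPr ler01) (min_idPr ler01) scale1r scale0r addrC subrK.
Qed.

Lemma segment_disk_vec p f v : enorm v < 1 -> (segment_disk p f v).2 = 0 -> v = 0.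
Proof.
move=> v1 /eqP; rewrite scaler_eq0 => /orP[|/eqP //]; rewrite gt_eqF //.
by rewrite lt_min ltr01 /=; lra.
Qed.

Lemma near_segment_disk p f : \forall v \near (0 : E), segment_disk p f v = (p, 1 *: v).
Proof.
have : \forall v \near (0 : E), enorm v < 2^-1 by apply: near_enorm_lt; rewrite invr_gt0.
apply: filterS => v v1; rewrite /segment_disk.
have /max_idPl -> : 2 * enorm v - 1 <= 0 by lra.
have /min_idPl -> : 1 <= 2 - 2 * enorm v by lra.
by rewrite scale0r addr0.
Qed.

(** Hyperplanes of the line are points, and genericity makes F a point off the arrangement, so the
    real end point [(f, 0)] is allowed. Over the rest of the segment nonzero vectors suffice, since
    none is tangent to a point. *)
Lemma lefschetz_line A F C p : arrangement A -> hyperplane F -> generic A F ->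
  chamber_off A F C -> C p -> exists sigmaC, lefschetz_disk A F C p sigmaC.
Proof.
move=> [_ hA] [aF [cF [aF0 FE]]] gA hC Cp.
have [hC1 CF] := hC.
pose f : E := (cF / dot aF aF) *: aF.
have Ff : F f by rewrite FE /= dotZr divfK // gt_eqF // dot_gt0.
have FH H : A H -> F `&` H = set0.
  move=> AH; have [a [c [a0 HE]]] := hA _ AH.
  have X0 : has_dim H 0.
    apply/has_dim0P; exists ((c / dot a a) *: a).
    have ca : dot a ((c / dot a a) *: a) = c by rewrite dotZr divfK // gt_eqF // dot_gt0.
    rewrite HE; apply/seteqP; split=> x /= ; last by move=> ->.
    move=> xc; apply/eqP; rewrite -subr_eq0; apply: contrapT => /negP /(dot_line_neq0 a0).
    by rewrite dotBr xc ca subrr eqxx.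
  have iH : intersection A H.
    exists [set H]; first by move=> _ ->.
    by rewrite bigcap_set1.
  by have := gA _ _ iH X0.
have fA H : A H -> ~ H f by move=> /FH FH0 Hf; have : (F `&` H) f by []; rewrite FH0.
have pA H : A H -> ~ H p.
  move=> AH Hp; have [x cx CE] := hC1; have : complement A p.
    by move: Cp; rewrite CE; exact: connected_component_sub.
  by apply; exists H.
have valid v : disk v -> Mcompl A (segment_disk p f v).
  move=> v1 [H AH]; have [a [c [a0 HE]]] := hA _ AH; rewrite /= HE => /(cplx_hyp _ _ a0)[h1 h2].
  have [ve|vn] := eqVneq (enorm v) 1.
    by move: h1; rewrite segment_disk_rim //= => h1; apply: (fA H AH); rewrite HE.
  have vlt : enorm v < 1 by rewrite lt_neqAle vn.
  have [z0|/(dot_line_neq0 a0)] := eqVneq (segment_disk p f v).2 0; last by rewrite h2 eqxx.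
  have v0 := segment_disk_vec vlt z0.
  by move: h1; rewrite v0 (nbhs_singleton (near_segment_disk p f)) /= => h1; apply: (pA H AH); rewrite HE.
have real v C' : chamber_off A F C' -> disk v -> realpts C' (segment_disk p f v) -> v = 0.
  move=> [_ C'F] v1 [cv z0]; have [ve|vn] := eqVneq (enorm v) 1.
    by move: cv; rewrite segment_disk_rim //= => C'f; have : (C' `&` F) f by []; rewrite C'F.
  by apply: (segment_disk_vec _ z0); rewrite lt_neqAle vn.
exists (segment_disk p f); split.
- split; first exact/continuous_subspaceT/segment_disk_cont.
  by move=> _ [v v1 <-]; exact: valid.
- by apply: filterS (near_vertical_is_diff (near_segment_disk p f)) => v Dv; exact: (@ex_diff _ _ _ _ _ _ _ Dv).
- apply: (meets_only_at_vertical (k := 1)) => //; first exact: near_segment_disk.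
  by move=> v v1; exact: real.
- move=> _ [v v1 <-]; split; first by apply: valid; rewrite /disk /= v1.
  rewrite segment_disk_rim // FE; apply/(cplx_hyp _ (f, 0) aF0); split; last by rewrite /= dot0r.
  by move: Ff; rewrite FE.
- apply: avoids_others_vertical hC1 Cp _ _; first by rewrite (nbhs_singleton (near_segment_disk p f)) scaler0.
  by move=> v C' hC' v1; exact: real.
Qed.

End LineCase.

Lemma glued_lefschetz (R : realType) (n N : nat) (A : set (set 'rV[R]_n.+1))
    (a : 'I_N -> 'rV[R]_n.+1) (b : 'I_N -> R) (V : 'rV[R]_n.+1 -> 'rV[R]_n.+1)
    (eta etai : R -> 'rV[R]_n -> 'rV[R]_n) (h : 'rV[R]_n -> R -> R -> 'rV[R]_n.+1)
    (C : set 'rV[R]_n.+1) :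
  in_position A a b -> tangent_field A V -> is_flow A V eta etai -> pasting A eta etai h ->
  chamber_off A (@F0 R n) C -> C (@p0 R n) ->
  exists sigma,
    [/\ glued A eta etai h sigma,
        {within @disk R n, continuous sigma},
        sigma @` @disk R n `<=` Mcompl A,
        meets_only_at C (@p0 R n) sigma &
        avoids_others A (@F0 R n) C sigma] /\
    forall (eps : R) Phi Psi, 0 < eps -> trivialization A eps Phi Psi ->
    exists tau, pushed sigma Phi tau /\ lefschetz_disk A (@F0 R n) C (@p0 R n) tau.
Proof.
move=> G TV FE Ph hC Cp; have [hC1 _] := hC.
exists (glue A eta etai h).
have valid v : disk v -> Mcompl A (glue A eta etai h v) by move=> /(glue_valid G TV FE Ph)[].
have real v : disk v -> (glue A eta etai h v).2 = 0 -> v = 0 by exact: (glue_real G TV FE Ph).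
have vert : \forall v \near (0 : 'rV[R]_n.+1), glue A eta etai h v = (@p0 R n, 1 *: v).
  by apply: filterS (near_glue0 A eta etai h) => v ->; rewrite scale1r.
split; first split.
- exact: (glued_glue G FE Ph).
- exact: (glue_cont G FE Ph).
- by move=> _ [v v1 <-]; exact: valid.
- by apply: (meets_only_at_vertical (k := 1)) => // v v1 [_]; exact: real.
- apply: avoids_others_vertical hC1 Cp _ _; first exact: glue0.
  by move=> v C' _ v1 [_]; exact: real.
move=> eps Phi Psi e0 TP; exists (push Phi (glue A eta etai h)); split; first exact: pushed_push.
apply: (push_lefschetz G e0 TP) => //; first exact: (glue_cont G FE Ph).
  by move=> v; exact: (glue_Cyl_0 G FE Ph).
exact: near_glue0.
Qed.

(** In dimension at least two, existence of the disk is read off from the detailed construction,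
    which is therefore proved first. *)
Lemma conj_from_right (P Q : Prop) : (Q -> P) -> Q -> P /\ Q.
Proof. by move=> QP HQ; split=> //; exact: QP. Qed.

Theorem mainTheorem3 (R : realType) (n : nat)
    (A : set (set 'rV[R]_n.+1)) (F C : set 'rV[R]_n.+1) (p : 'rV[R]_n.+1) :
  arrangement A -> essential A -> hyperplane F -> generic A F ->
  chamber_off A F C -> C p ->
  (exists sigmaC, lefschetz_disk A F C p sigmaC) /\
  ((0 < n)%N ->
   (exists M b, adapted F p M b) /\
   forall M b, adapted F p M b ->
   let B := [set chart M b @` H | H in A] in
   let C0 := chart M b @` C in
   [/\ has_sup (line_radii B), 0 < cyl_radius B & exists V, tangent_field B V] /\
   forall V, tangent_field B V ->
   (exists eta etai, is_flow B V eta etai) /\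
   forall eta etai, is_flow B V eta etai ->
   pieces_valid B eta etai /\
   (exists h, pasting B eta etai h) /\
   (exists eps0 : R, 0 < eps0 /\ forall eps : R, 0 < eps <= eps0 ->
      exists Phi Psi, trivialization B eps Phi Psi) /\
   forall h, pasting B eta etai h ->
   exists sigma,
     [/\ glued B eta etai h sigma,
         {within @disk R n, continuous sigma},
         sigma @` @disk R n `<=` Mcompl B,
         meets_only_at C0 (@p0 R n) sigma &
         avoids_others B (@F0 R n) C0 sigma] /\
     forall (eps : R) Phi Psi, 0 < eps -> trivialization B eps Phi Psi ->
     exists tau, pushed sigma Phi tau /\
       lefschetz_disk A F C p (chart_inv M b \o tau)).
Proof.
move=> hA eA hF gA hC Cp; have [_ CF] := hC.
have Fp : ~ F p by move=> Fp; have : (C `&` F) p by []; rewrite CF.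
apply: conj_from_right; last first.
  move=> n0; split; first exact: adapted_exists.
  move=> M b ad B C0; have [uM FF' pp'] := ad.
  have [N [a [b' G]]] := position_chart n0 hA eA gA hC Cp ad.
  have hC0 : chamber_off B (@F0 R n) C0 := chamber_off_chart uM FF' hC.
  have Cp0 : C0 (@p0 R n) by exists p.
  split; first split.
  - exact: (has_sup_line_radii (pos_ess G) (pos_line G) (pos_range G) (pos_dim G)).
  - exact: (position_radius_gt0 G).
  - exact: (tangent_field_exists G).
  move=> V TV; split; first exact: (sphere_flow_exists (position_radius_gt0 G) TV).
  move=> eta etai FE; split; first exact: (pieces_are_valid G TV FE).
  split; first exact: (pasting_exists G FE).
  split; first exact: (trivialization_exists G).
  move=> h Ph; have [sigma [Hs Ht]] := glued_lefschetz G TV FE Ph hC0 Cp0.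
  exists sigma; split=> // eps Phi Psi e0 TP; have [tau [Pt Lt]] := Ht eps Phi Psi e0 TP.
  by exists tau; split=> //; apply: (lefschetz_chart uM _ hF FF' pp' Lt); case: hA.
(* In positive horizontal dimension each universal statement is applied to the object whose
   existence was just asserted. *)
case: n A F C p hA eA hF gA hC Cp {CF Fp} => [|n] A F C p hA _ hF gA hC Cp Q.
  exact: (lefschetz_line hA hF gA hC Cp).
have [[M [b ad]] /(_ M b ad) [[_ _ [V TV]] /(_ V TV) [[eta [etai FE]] /(_ eta etai FE)]]] := Q isT.
move=> [_ [[h Ph] [[e0 [e00 /(_ e0)]]]]]; rewrite e00 lexx => /(_ isT) [Phi [Psi TP]].
move=> /(_ h Ph) [sigma [_ /(_ e0 Phi Psi e00 TP)[tau [_ L]]]].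
by exists (chart_inv M b \o tau).
Qed.
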